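(* Let $X$ be a curve over $\mathbb{F}_q$ of genus $g$ with gonality $\operatorname{gon} X>1$, and let $e$ be the exponent of $\operatorname{Pic}^0 X$. Then \[ e \geqslant \max\left(\frac{\operatorname{gon} X}{2\left\lceil\log_q (2g+1)\right\rceil},\ \frac{g}{4(\operatorname{gon} X -1)\left\lceil\log_q(7g+1)\right\rceil}\right). \] Moreover, given an integer $m$, let $s=\lceil\operatorname{gon} X / m\rceil - 1$ and let $k$ be the largest prime less than $g/(m(\operatorname{gon} X -1))$. Then there are at least \[ N(m)=\max \left(q^{s/2}-2g,\ \lfloor q^{k/2}-7g\rfloor \right) \geqslant q^{\sqrt{g}/(4m)} - 7g \] elements of $\operatorname{Pic}^0 X$ of order larger than or equal to $m$.
   Context: A curve over $\mathbb{F}_q$ means a smooth, projective, geometrically integral, one-dimensional scheme over $\mathbb{F}_q$. $\operatorname{Pic}^0 X$ denotes the group of $\mathbb{F}_q$-rational degree-zero divisor classes on $X$ (the class group of the function field $\mathbb{F}_q(X)$). The gonality $\operatorname{gon} X$ is the minimal degree of a nonconstant rational function $X\to\mathbb{P}^1$ over $\mathbb{F}_q$.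
   Formalization: The integer m is taken nonzero, and the claim about N(m), with its lower bound, is asserted when a prime less than g/(m(gon X − 1)) exists; otherwise k is undefined (e.g. g = gon X = m = 2), and only the bound of at least q^{s/2} − 2g elements is asserted. *)

(* Defs.v *)
From HB Require Import structures.
From mathcomp Require Import all_boot all_order all_algebra.
From mathcomp Require Import freeg.
From mathcomp Require Import boolp classical_sets reals exp.

Set Implicit Arguments.
Unset Strict Implicit.
Unset Printing Implicit Defensive.

Import Order.TTheory GRing.Theory Num.Theory.

Local Open Scope classical_set_scope.
Local Open Scope ring_scope.
Local Open Scope quotient_scope.

(* A smooth projective geometrically integral curve X over Fq is represented  *)
(* by its function field K = Fq(X), a field with an embedding iota : Fq -> K: *)
(* - closed points of X are the places of K, i.e. the normalized discrete     *)
(*   valuations of K that are trivial on Fq;                                  *)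
(* - a nonconstant map f : X -> P^1 over Fq is an element f of K outside Fq,  *)
(*   and its degree is [K : Fq(f)].                                           *)
(* The Fq below is an arbitrary finite field, and q = #|Fq|.                  *)

(* The least element of P, or 0 if P is empty. *)
Definition least (P : set nat) : nat :=
  xget 0%N [set n | P n /\ (forall j, P j -> (n <= j)%N)].

Section Dimension.
Variable K : fieldType.

(* dim_k (V / W) = n, for a subfield k of K and k-subspaces W and V of K. *)
Definition has_dim (k W V : set K) (n : nat) : Prop :=
  exists b : 'I_n -> K,
    [/\ forall i, V (b i),
        forall y, V y -> exists c : 'I_n -> K,
          (forall i, k (c i)) /\ W (y - \sum_i c i * b i) &
        forall c : 'I_n -> K, (forall i, k (c i)) ->
          W (\sum_i c i * b i) -> forall i, c i = 0].

Definition dim (k W V : set K) : nat := xget 0%N [set n | has_dim k W V n].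

End Dimension.

Section FunctionField.
Variables (Fq : finFieldType) (K : fieldType) (iota : {rmorphism Fq -> K}).

Definition constants : set K := range iota.

(* The subfield Fq(x) of K. *)
Definition rational_in (x : K) : set K :=
  [set y | exists p r : {poly Fq},
     (map_poly iota r).[x] != 0 /\
     y = (map_poly iota p).[x] / (map_poly iota r).[x]].

(* For f transcendental over Fq, [K : Fq(f)] = n. *)
Definition has_degree (f : K) (n : nat) : Prop :=
  has_dim (rational_in f) [set 0] setT n.

(* As Fq is perfect, the second condition says that X is geometrically        *)
(* integral.                                                                  *)
Definition function_field : Prop :=
  (exists x : K, ~ algebraicOver iota x /\ exists n, has_degree x n) /\
  (forall y : K, algebraicOver iota y -> constants y).

Definition gonality : nat :=
  least [set n | exists f : K, ~ constants f /\ has_degree f n].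

(* The value of a valuation at 0, mathematically +oo, is set to 0, so that a  *)
(* valuation determines a unique record.                                      *)
Record place := Place {
  val_at :> K -> int;
  val_at0 : val_at 0 = 0;
  val_atM : forall x y, x != 0 -> y != 0 -> val_at (x * y) = val_at x + val_at y;
  val_atD : forall x y, x != 0 -> y != 0 -> x + y != 0 ->
    Num.min (val_at x) (val_at y) <= val_at (x + y);
  val_at_constant : forall a, a != 0 -> val_at (iota a) = 0;
  val_at_normalized : exists2 t, t != 0 & val_at t = 1
}.

HB.instance Definition _ := gen_eqMixin place.
HB.instance Definition _ := gen_choiceMixin place.

Definition valuation_ring (v : place) : set K := [set x | x = 0 \/ 0 <= v x].
Definition maximal_ideal (v : place) : set K := [set x | x = 0 \/ 0 < v x].

(* The degree over Fq of the residue field. *)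
Definition place_deg (v : place) : nat :=
  dim constants (maximal_ideal v) (valuation_ring v).

Definition divisor := {freeg place}.

(* freeg.deg would give every place the degree 1. *)
Definition div_deg (D : divisor) : int :=
  \sum_(v <- dom D) coeff v D * (place_deg v)%:Z.

Definition principal : pred divisor :=
  fun D => `[< exists2 f : K, f != 0 & forall v : place, coeff v D = v f >].

Definition riemann_roch_space (D : divisor) : set K :=
  [set f | f = 0 \/ forall v : place, 0 <= v f + coeff v D].

Definition ell (D : divisor) : nat :=
  dim constants [set 0] (riemann_roch_space D).

(* The maximum of deg D + 1 - l(D) over all divisors D. *)
Definition genus : nat :=
  xget 0%N [set g : nat |
    (forall D, div_deg D + 1 - (ell D)%:Z <= g%:Z) /\
    (exists D, div_deg D + 1 - (ell D)%:Z = g%:Z)].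

Lemma place1 (v : place) : v 1 = 0.
Proof.
have := val_atM v (oner_neq0 K) (oner_neq0 K).
by rewrite mulr1 => /eqP; rewrite -subr_eq0 opprD addNKr oppr_eq0 => /eqP.
Qed.

Lemma placeV (v : place) (f : K) : f != 0 -> v f^-1 = - v f.
Proof.
move=> f0; have fV0 : f^-1 != 0 by rewrite invr_eq0.
have := val_atM v f0 fV0; rewrite mulfV // place1 => /eqP.
by rewrite eq_sym addr_eq0 => /eqP ->; rewrite opprK.
Qed.

Lemma principal_zmod_closed : zmod_closed principal.
Proof.
split.
  by apply/asboolP; exists 1 => [|v]; rewrite ?oner_neq0 // coeff0 place1.
move=> D E /asboolP[f f0 Df] /asboolP[h h0 Eh].
apply/asboolP; exists (f / h) => [|v]; first by rewrite mulf_neq0 ?invr_eq0.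
by rewrite coeffB Df Eh val_atM ?invr_eq0 // placeV.
Qed.

HB.instance Definition _ :=
  GRing.isZmodClosed.Build divisor principal principal_zmod_closed.

Definition Pic : zmodType := 
  Quotient.quot (GRing.ZmodClosed.clone divisor principal _).

Definition divisor_class (D : divisor) : Pic := \pi_Pic D.

(* The elements of the subgroup of classes of divisors of degree 0 of Pic. *)
Definition Pic0 : set Pic :=
  [set c | exists2 D, div_deg D = 0 & c = divisor_class D].

End FunctionField.

Arguments Pic0 {Fq K} iota _.

Definition additive_order (G : zmodType) (c : G) : nat :=
  least [set n | (0 < n)%N /\ c *+ n = 0].

Definition exponent (G : zmodType) (A : set G) : nat :=
  least [set n | (0 < n)%N /\ forall c, A c -> c *+ n = 0].

(* The set A has at least x elements, for a real number x. *)
Definition at_least (R : realType) (T : eqType) (x : R) (A : set T) : Prop :=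
  exists s : seq T, [/\ uniq s, forall c, c \in s -> A c & x <= (size s)%:R].

Definition log (R : realType) (b x : R) : R := ln x / ln b.

Definition largest_prime_below (R : realType) (x : R) (k : nat) : Prop :=
  [/\ prime k, k%:R < x & forall p, prime p -> p%:R < x -> (p <= k)%N].

(* Submission.v *)
(* Two effective divisors of degree i < gon X are never linearly equivalent, and a
   relation n (D - D') ~ 0 gives a function of degree at most n i, so that n i >= gon X.
   This turns the effective divisors of degree s, of which there are about q^s / s by the
   Weil bound, into classes of order at least m as long as m s < gon X.

   For the bounds in terms of the genus, let f have minimal degree d = gon X and consider
   the points v of prime degree k whose residue field is generated by f(v).  If n (v - v') ~ 0
   with n > 0, the function h realizing the relation has degree n k, and for a suitable v'
   the field K is F(f, h).  The genus of a curve of bidegree (d, n k) in P^1 x P^1 is at most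
   (d - 1)(n k - 1), whence g <= (d - 1)(n k - 1).
   The number of the points v is again controlled by the Weil bound, and Bertrand's postulate
   provides the prime k. *)
From HB Require Import structures.
Require Import Defs.
From mathcomp Require Import all_boot all_order all_algebra.
From mathcomp Require Import all_field freeg.
From mathcomp Require Import boolp classical_sets reals exp.
From mathcomp Require Import zify ring lra.

Set Implicit Arguments.
Unset Strict Implicit.
Unset Printing Implicit Defensive.

(** * Bertrand's postulate *)

(** The Weil bound is proved from scratch, as |z| <= q^(1/2) for the roots z of the zeta function. A
    one-sided estimate N_k >= q^k - C q^(k/2) suffices: for suitable k the k-th powers of all roots
    have real part at least half their absolute value, so that no cancellation can hide a large
    root. Being one-sided, it is reached without a Galois closure: among the zeros of z^Q - z, for
    one function z, those are kept where a generator x of K over F(z) is fixed too. For the genus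
    bound, the powers of f are independent over F(h) only if f is unramified at the point: with pi
    the minimal polynomial of f(v), pi(f) must be a uniformizer. One such point v0 is enough, as all
    others are compared with it. It is found outside the zeros of the derivative of a separable
    equation over F(f), whose degree is at most 20 d g. The other delicate case is 0 < q^(s/2) - 2g
    < 1: one class is then still demanded, while the Weil bound in degree s alone does not give two
    effective divisors. Traces of three powers of the roots are compared there. *)

Notation cbin n := 'C(n.*2, n).

Lemma cbinS n : (cbin n.+1 * n.+1 = 2 * n.*2.+1 * cbin n)%N.
Proof.
have f0 k : (0 < k`!)%N by apply: fact_gt0.
have H k : (cbin k * (k`! * k`!) = k.*2`!)%N.
  have := @bin_fact k.*2 k; rewrite -addnn addnK; apply; exact: leq_addr.
apply/eqP; rewrite -(eqn_pmul2r (f0 n)) -(eqn_pmul2r (f0 n)) -(eqn_pmul2r (ltn0Sn n)); apply/eqP.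
have E : (cbin n.+1 * (n.+1 * n`! * (n.+1 * n`!)) = n.*2.+2 * (n.*2.+1 * (cbin n * (n`! * n`!))))%N.
  by rewrite H -!factS -doubleS H.
move: (cbin n.+1) (cbin n) (n`!) E; rewrite -muln2 => c a b E.
transitivity (c * (n.+1 * b * (n.+1 * b)))%N; first by clear E; nia.
by rewrite E; clear E; nia.
Qed.

Lemma cbin_ge n : (0 < n)%N -> (4 ^ n <= 2 * n * cbin n)%N.
Proof.
case: n => // n _; elim: n => [//|n IH].
have E := cbinS n.+1; rewrite expnS; move: IH E; rewrite -muln2.
by move: (4 ^ n.+1)%N (cbin n.+1) (cbin n.+2) => a b c; nia.
Qed.

Lemma cbin_le n : (2 * cbin n.+1 <= 4 ^ n.+1)%N.
Proof.
elim: n => [//|n IH]; have E := cbinS n.+1; rewrite expnS; move: IH E; rewrite -muln2.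
by move: (4 ^ n.+1)%N (cbin n.+1) (cbin n.+2) => a b c; nia.
Qed.

Lemma prod_primes_dvd (s : seq nat) N : uniq s -> all prime s -> all (fun p => p %| N)%N s ->
  (\prod_(p <- s) p %| N)%N.
Proof.
elim: s => [|p s IH] /=; first by rewrite big_nil dvd1n.
move=> /andP [ps us] /andP [pp sp] /andP [pN sN]; rewrite big_cons Gauss_dvd ?pN ?IH //.
elim: s sp ps {us sN IH} => [|r s IH] /=; first by rewrite big_nil coprimen1.
rewrite inE negb_or big_cons coprimeMr => /andP [rp sp] /andP [pr ps].
by rewrite IH // andbT prime_coprime // dvdn_prime2.
Qed.

Definition primorial n := (\prod_(p <- [seq p <- iota 0 n.+1 | prime p]) p)%N.

Lemma primorialS n : primorial n.+1 = ((if prime n.+1 then n.+1 else 1) * primorial n)%N.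
Proof.
rewrite /primorial -{1}[n.+2]addn1 iotaD add0n filter_cat big_cat /= mulnC.
by case: ifP => _; rewrite ?big_seq1 ?big_nil.
Qed.

Lemma primorial_split a b : (a <= b)%N ->
  primorial b = (\prod_(p <- [seq p <- iota a.+1 (b - a) | prime p]) p * primorial a)%N.
Proof.
move=> ab; rewrite /primorial -{1}(subnKC ab) -addSn iotaD add0n filter_cat big_cat /= mulnC.
by [].
Qed.

(** Erdős's induction. For odd n = 2m + 1 the primes from m + 2 to n all divide 'C(n, m), which is
    at most 4^m, and the induction hypothesis covers the primes up to m + 1. An even n > 2 adds no
    prime. *)
Lemma primorial_le n : (primorial n <= 4 ^ n)%N.
Proof.
elim/ltn_ind: n => n IH.
case: (leqP n 2) => [|n2].
  by case: n {IH} => [|[|[|n]]] //; rewrite /primorial /= ?big_nil ?big_seq1.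
have [n_odd|n_even] := boolP (odd n); last first.
  case: n n2 n_even IH => // n n2 n_even IH; rewrite primorialS.
  have -> : prime n.+1 = false.
    by apply/negP => pn; have [E|] := even_prime pn; [rewrite E in n2|rewrite (negPf n_even)].
  by rewrite mul1n; apply: leq_trans (IH n (ltnSn n)) _; rewrite leq_exp2l.
have [m nE] : exists m, n = m.*2.+1 by exists n./2; rewrite -{1}(odd_double_half n) n_odd.
have m0 : (0 < m)%N by lia.
have mn : (m.+1 <= n)%N by lia.
rewrite (primorial_split mn); have -> : (4 ^ n = 4 ^ m * 4 ^ m.+1)%N by rewrite -expnD nE; congr (4 ^ _)%N; lia.
apply: leq_mul; last by apply: IH; lia.
have bin_le : ('C(n, m) <= 4 ^ m)%N.
  have := cbin_le m; rewrite -[m.+1.*2]/(m.*2.+2) binS -nE.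
  have -> : 'C(n, m.+1) = 'C(n, m) by rewrite -bin_sub ?nE; [congr 'C(_, _); lia|lia].
  by rewrite expnS; move: 'C(n, m) (4 ^ m)%N; clear; lia.
apply: leq_trans bin_le; apply: dvdn_leq; first by rewrite bin_gt0; lia.
apply: prod_primes_dvd; first by rewrite filter_uniq // iota_uniq.
  by apply/allP => p; rewrite mem_filter => /andP [].
apply/allP => p; rewrite mem_filter mem_iota => /andP [pp /andP [p1 p2]].
have pn : (p <= n)%N by lia.
have mn' : (m <= n)%N by lia.
have E := bin_fact mn'.
have : (p %| n`!)%N by apply: dvdn_fact; rewrite pn prime_gt0.
rewrite -E !Euclid_dvdM //.
have nf k : (k < p)%N -> (p %| k`!)%N = false.
  by elim: k => [|k IHk] kp; [rewrite fact0 dvdn1; apply/eqP => p1'; rewrite p1' in pp|rewrite factS Euclid_dvdM // IHk ?gtnNdvd // ltnW].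
by rewrite !nf ?orbF //; lia.
Qed.

(** Legendre's formula for the three factorials, combined term by term because each difference is 0
    or 1. *)
Lemma logn_cbin p n : prime p ->
  logn p (cbin n) = (\sum_(1 <= k < n.*2.+1) (n.*2 %/ p ^ k - (n %/ p ^ k).*2))%N.
Proof.
move=> pp; have n2 : (n <= n.*2)%N by rewrite -addnn leq_addr.
have := congr1 (logn p) (bin_fact n2); rewrite -{2}addnn addnK !lognM ?muln_gt0 ?fact_gt0 ?bin_gt0 // !logn_fact //.
have -> : (\sum_(1 <= k < n.+1) n %/ p ^ k = \sum_(1 <= k < n.*2.+1) n %/ p ^ k)%N.
  rewrite [RHS](big_cat_nat (n := n.+1)) //= [X in (_ = _ + X)%N]big_nat_cond.
  rewrite [X in (_ = _ + X)%N]big1 ?addn0 // => k /andP [/andP [nk _] _].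
  by rewrite divn_small // (leq_trans nk) // ltnW // ltn_expl // prime_gt1.
rewrite -big_split /= => E.
apply/eqP; rewrite -(eqn_add2r (\sum_(1 <= k < n.*2.+1) (n %/ p ^ k + n %/ p ^ k))) E -big_split /=.
apply/eqP; apply: eq_bigr => k _; rewrite addnn subnK // -!mul2n.
by rewrite leq_divRL ?expn_gt0 ?prime_gt0 // -mulnA leq_mul2l leq_trunc_div.
Qed.

Lemma digit_le1 n d : (0 < d)%N -> (n.*2 %/ d - (n %/ d).*2 <= 1)%N.
Proof.
move=> d0; rewrite leq_subLR; have := ltn_pmod n d0; have := divn_eq n d.
move: (n %/ d)%N (n %% d)%N => a r E rd; rewrite -ltnS ltn_divLR // E; nia.
Qed.

Lemma expn_logn_cbin p n : prime p -> (0 < n)%N -> (p ^ logn p (cbin n) <= n.*2)%N.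
Proof.
move=> pp n0; have p1 := prime_gt1 pp; have n20 : (0 < n.*2)%N by rewrite double_gt0.
apply: leq_trans (_ : p ^ trunc_log p n.*2 <= _)%N; last exact: trunc_logP.
rewrite leq_exp2l // logn_cbin //.
have lt : (trunc_log p n.*2 < n.*2.+1)%N.
  by rewrite ltnS; apply: leq_trans (trunc_logP p1 n20); rewrite ltnW // ltn_expl.
rewrite (big_cat_nat (n := (trunc_log p n.*2).+1)) //= [X in (_ + X <= _)%N]big_nat_cond.
rewrite [X in (_ + X <= _)%N]big1 ?addn0 => [|k /andP [/andP [tk _] _]]; last first.
  rewrite divn_small ?sub0n //; apply: leq_trans (trunc_log_ltn _ p1) _.
  by rewrite leq_exp2l.
apply: (@leq_trans (\sum_(1 <= k < (trunc_log p n.*2).+1) 1)); last by rewrite sum_nat_const_nat subn1 muln1.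
by apply: leq_sum => k _; apply: digit_le1; rewrite expn_gt0 ltnW.
Qed.

(** For 2n/3 < p <= n the first term of the formula is 2 - 2 * 1, and the higher powers of p > 2
    exceed 2n. *)
Lemma logn_cbin_gap p n : prime p -> (2 < p)%N -> (n.*2 < 3 * p)%N -> (p <= n)%N -> logn p (cbin n) = 0.
Proof.
move=> pp p2 np pn; rewrite logn_cbin // big_nat_cond big1 // => k; rewrite andbT => /andP [k1 _].
have p0 := prime_gt0 pp; have [k2|k2] := leqP k 1.
  have -> : k = 1 by lia.
  rewrite expn1; have -> : (n %/ p = 1)%N.
    by apply/eqP; rewrite eqn_leq -ltnS ltn_divLR // leq_divRL //; lia.
  by apply/eqP; rewrite subn_eq0 -ltnS ltn_divLR //; lia.
have pk : (n.*2 < p ^ k)%N.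
  apply: leq_trans np _; apply: (@leq_trans (p ^ 2)); last by rewrite leq_exp2l // prime_gt1.
  by rewrite expnS expn1 leq_mul2r p2 orbT.
by rewrite divn_small.
Qed.

Lemma primes_small r : (size [seq p <- iota 0 r.+1 | prime p] <= r.-1)%N.
Proof.
case: r => [//|r]; rewrite -[r.+2]/(2 + r) iotaD filter_cat /= size_filter.
by apply: leq_trans (count_size _ _) _; rewrite size_iota.
Qed.

(** Without a prime in (n, 2n] every prime factor is at most 2n/3. Those up to r number at most r -
    1 and contribute at most 2n each; those above r occur once, so their product divides a
    primorial. *)
Lemma cbin_bound n r : (0 < n)%N -> (r ^ 2 <= n.*2 < r.+1 ^ 2)%N -> (1 < r)%N -> (2 < n)%N ->
  (forall p, prime p -> (n < p <= n.*2)%N -> False) ->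
  (cbin n <= n.*2 ^ r.-1 * 4 ^ (n.*2 %/ 3))%N.
Proof.
move=> n0 /andP [rn nr] r1 n2 noP; set N := cbin n.
have N0 : (0 < N)%N by rewrite bin_gt0 -addnn leq_addr.
have pN p : p \in primes N -> [/\ prime p, (p %| N)%N & (p <= n)%N].
  rewrite mem_primes => /and3P [pp _ dp]; split=> //; rewrite leqNgt; apply/negP => np.
  apply: (noP p pp); rewrite np /=; apply: leq_trans (expn_logn_cbin pp n0).
  by rewrite -{1}[p]expn1 leq_exp2l ?prime_gt1 // logn_gt0 mem_primes pp N0.
have -> : N = (\prod_(p <- primes N) p ^ logn p N)%N.
  by rewrite [LHS](prod_prime_decomp N0) prime_decompE big_map.
rewrite (bigID (fun p => p <= r)) /=; apply: leq_mul.
  rewrite -big_filter; apply: (@leq_trans (\prod_(p <- [seq p <- primes N | p <= r]) n.*2)).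
    rewrite big_seq [X in (_ <= X)%N]big_seq; apply: leq_prod => p; rewrite mem_filter => /andP [_ /pN [pp _ _]].
    exact: expn_logn_cbin.
  rewrite big_const_seq count_predT iter_muln_1; rewrite leq_exp2l; last by lia.
  apply: leq_trans (primes_small r); apply: uniq_leq_size; first by rewrite filter_uniq // primes_uniq.
  by move=> p; rewrite !mem_filter mem_iota add0n ltnS => /andP [-> /pN [-> _ _]].
apply: leq_trans (primorial_le (n.*2 %/ 3)); rewrite -big_filter /primorial.
apply: dvdn_leq; first by rewrite big_filter prodn_cond_gt0 // => p /prime_gt0.
set s := [seq p <- primes N | ~~ (p <= r)%N].
have logn1 p : p \in s -> logn p N = 1.
  rewrite mem_filter -ltnNge => /andP [rp pNN]; have [pp dp pn] := pN p pNN.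
  apply/eqP; rewrite eqn_leq logn_gt0 pNN andbT -ltnS -(ltn_exp2l _ _ (prime_gt1 pp)).
  apply: leq_ltn_trans (expn_logn_cbin pp n0) _; apply: leq_trans nr _.
  by rewrite leq_exp2r.
rewrite (eq_big_seq id) => [|p ps]; last by rewrite logn1 // expn1.
apply: prod_primes_dvd.
- by rewrite filter_uniq // primes_uniq.
- by apply/allP => p; rewrite mem_filter => /andP [_ /pN []].
apply/allP => p ps; have := ps; rewrite mem_filter -ltnNge => /andP [rp pNN].
have [pp dp pn] := pN p pNN.
have p3 : (p <= n.*2 %/ 3)%N.
  rewrite leq_divRL // leqNgt; apply/negP => H.
  have := logn1 p ps; rewrite logn_cbin_gap //; first by lia.
  by rewrite mulnC.
have pin : p \in [seq p <- iota 0 (n.*2 %/ 3).+1 | prime p] by rewrite mem_filter pp mem_iota add0n ltnS p3.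
by rewrite (big_rem p) //= dvdn_mulr.
Qed.

Lemma isqrt_exists n : exists r, (r ^ 2 <= n < r.+1 ^ 2)%N.
Proof.
elim: n => [|n [r /andP [r1 r2]]]; first by exists 0.
have [lt|ge] := ltnP n.+1 (r.+1 ^ 2); first by exists r; rewrite lt (leq_trans r1).
exists r.+1; rewrite ge /=; apply: leq_ltn_trans r2 _; rewrite ltn_exp2r //.
Qed.

(** The threshold makes r >= 36 and t = r/6 >= 6, the first value with 6t + 6 <= 2^t. Hence r + 1 <=
    2^t, and the cube of 4^D <= (2n)^r becomes impossible because 2n lies between r^2 and (r +
    1)^2. *)
Lemma bertrand_large n : (648 <= n)%N -> exists p, prime p && (n < p <= n.*2)%N.
Proof.
move=> n648; have [r /andP [r1 r2]] := isqrt_exists n.*2.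
have r36 : (36 <= r)%N.
  rewrite leqNgt; apply/negP => r36; have : (n.*2 < 36 ^ 2)%N.
    by apply: leq_trans r2 _; rewrite leq_exp2r.
  by move: n648; rewrite -[(36 ^ 2)%N]/(36 * 36)%N; lia.
have n0 : (0 < n)%N by lia.
case: (boolP (has (fun p => prime p && (n < p <= n.*2)%N) (iota 0 n.*2.+1))) => [/hasP [p _ Hp]|/hasPn noP].
  by exists p.
have {}noP p : prime p -> (n < p <= n.*2)%N -> False.
  move=> pp np; have := noP p; rewrite mem_iota add0n ltnS pp np => /(_ _)/negP; apply=> //.
  by case/andP: np.
have B := cbin_bound n0 (introT andP (conj r1 r2)) (leq_trans (isT : 1 < 36)%N r36) (leq_trans (isT : 2 < 648)%N n648) noP.
have L := cbin_ge n0.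
have rpos : (0 < r)%N by apply: leq_trans r36.
have M : (4 ^ n <= n.*2 ^ r * 4 ^ (n.*2 %/ 3))%N.
  apply: leq_trans L _; rewrite mul2n -[r in (_ ^ r)%N](prednK rpos) expnS -mulnA leq_mul2l B orbT //.
pose D := (n - n.*2 %/ 3)%N.
have dn : (n.*2 %/ 3 <= n)%N by rewrite -ltnS ltn_divLR //; lia.
have M2 : (4 ^ D <= n.*2 ^ r)%N.
  by move: M; rewrite -{1}(subnK dn) expnD leq_pmul2r // expn_gt0.
have D3 : (n <= 3 * D)%N by rewrite /D; have := leq_trunc_div n.*2 3; lia.
pose t := (r %/ 6)%N.
have t6 : (6 <= t)%N by rewrite leq_divRL.
have rt : (r.+1 <= 2 ^ t)%N.
  have lin k : (6 * (k + 6) + 6 <= 2 ^ (k + 6))%N.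
    by elim: k => [|k IH] //; rewrite addSn expnS; lia.
  apply: leq_trans (_ : 6 * t + 6 <= _)%N; first by have := ltn_ceil r (isT : 0 < 6)%N; rewrite -/t; lia.
  by have := lin (t - 6)%N; rewrite subnK.
have big1' : (2 ^ (r ^ 2) <= 4 ^ (3 * D))%N.
  rewrite -[4]/(2 ^ 2)%N -expnM leq_exp2l //; apply: leq_trans r1 _; rewrite -mul2n leq_mul2l D3 //.
have lt : (n.*2 ^ (3 * r) < r.+1 ^ (6 * r))%N.
  have -> : (6 * r = 2 * (3 * r))%N by rewrite mulnA.
  by rewrite [X in (_ < X)%N]expnM ltn_exp2r // muln_gt0.
have le1 : (r.+1 ^ (6 * r) <= 2 ^ (r ^ 2))%N.
  apply: leq_trans (_ : (2 ^ t) ^ (6 * r) <= _)%N; first by rewrite leq_exp2r // muln_gt0.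
  rewrite -expnM leq_exp2l // mulnA expnS expn1 leq_mul2r; apply/orP; right.
  by rewrite mulnC mulnC leq_trunc_div.
have le2 : (4 ^ (3 * D) <= n.*2 ^ (3 * r))%N.
  by rewrite [(3 * D)%N]mulnC [(3 * r)%N]mulnC !expnM leq_exp2r.
by have := leq_trans (leq_trans lt le1) (leq_trans big1' le2); rewrite ltnn.
Qed.

Lemma bertrand n : (1 < n)%N -> exists2 p, prime p & (n < p < n.*2)%N.
Proof.
move=> n1; have [p /andP [pp /andP [np pn]]] : exists p, prime p && (n < p <= n.*2)%N.
  have [le|gt] := leqP 648 n; first exact: bertrand_large.
  (* Each prime is less than twice its predecessor, and 1259 serves n up to 647. *)
  pose chain := [:: 3; 5; 7; 13; 23; 43; 83; 163; 317; 631; 1259].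
  have cp : all prime chain by vm_compute.
  have : has (fun p => n < p <= n.*2)%N chain.
    by rewrite /chain /=; lia.
  by case/hasP => p /(allP cp) pp H; exists p; rewrite pp.
exists p => //; rewrite np ltn_neqAle pn andbT; apply: contraTneq pp => ->.
by rewrite -muln2; apply/negP => /primeP [_ /(_ 2)]; rewrite dvdn_mull // => /(_ isT); lia.
Qed.

Import Order.TTheory GRing.Theory Num.Theory.
Local Open Scope classical_set_scope.
Local Open Scope ring_scope.

(** * Linear algebra over subfields *)

Section LinearAlgebra.
Variable K : fieldType.

Record subfield (k : set K) : Prop := Subfield {
  sf1 : k 1;
  sfB : forall x y, k x -> k y -> k (x - y);
  sfM : forall x y, k x -> k y -> k (x * y);
  sfV : forall x, k x -> k x^-1
}.

Record subspace (k V : set K) : Prop := Subspace {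
  ss0 : V 0;
  ssD : forall x y, V x -> V y -> V (x + y);
  ssZ : forall c x, k c -> V x -> V (c * x)
}.

(** Freeness and generation modulo [W] are the last two clauses of [has_dim], in swapped order.
    Working modulo a subspace means that no quotient space has to be formed. *)
Definition free_mod (k W : set K) n (b : 'I_n -> K) :=
  forall c : 'I_n -> K, (forall i, k (c i)) ->
    W (\sum_i c i * b i) -> forall i, c i = 0.

Definition span_mod (k W V : set K) n (b : 'I_n -> K) :=
  forall y, V y -> exists c : 'I_n -> K,
    (forall i, k (c i)) /\ W (y - \sum_i c i * b i).

Lemma sf0 k : subfield k -> k 0.
Proof. by move=> hk; rewrite -(subrr 1); apply: sfB => //; apply: sf1. Qed.

Lemma sfN k x : subfield k -> k x -> k (- x).
Proof. by move=> hk kx; rewrite -sub0r; apply: sfB => //; apply: sf0. Qed.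

Lemma sfD k x y : subfield k -> k x -> k y -> k (x + y).
Proof. by move=> hk kx ky; rewrite -[y]opprK; apply: sfB => //; apply: sfN. Qed.

Lemma sf_sum k (I : Type) (r : seq I) (P : pred I) (G : I -> K) : subfield k ->
  (forall i, P i -> k (G i)) -> k (\sum_(i <- r | P i) G i).
Proof.
move=> hk H; elim/big_ind: _ => //; first exact: sf0.
by move=> x y; apply: sfD.
Qed.

Lemma sfX k x n : subfield k -> k x -> k (x ^+ n).
Proof.
move=> hk kx; elim: n => [|n IH]; first by rewrite expr0; apply: sf1.
by rewrite exprS; apply: sfM.
Qed.

Lemma sf_div k x y : subfield k -> k x -> k y -> k (x / y).
Proof. by move=> hk kx ky; apply: sfM => //; apply: sfV. Qed.

Lemma ssN k V x : subfield k -> subspace k V -> V x -> V (- x).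
Proof.
by move=> hk hV Vx; rewrite -mulN1r; apply: (ssZ hV) => //; apply: (sfN hk); apply: sf1.
Qed.

Lemma ssB k V x y : subfield k -> subspace k V -> V x -> V y -> V (x - y).
Proof. by move=> hk hV Vx Vy; apply: (ssD hV) => //; apply: (ssN hk hV). Qed.

Lemma ss_sum k V (I : Type) (r : seq I) (P : pred I) (G : I -> K) :
  subspace k V -> (forall i, P i -> V (G i)) -> V (\sum_(i <- r | P i) G i).
Proof.
move=> hV H; elim/big_ind: _ => //; first exact: ss0 hV.
by move=> x y; apply: (ssD hV).
Qed.

Arguments ss_sum {k V I r P G}.
Arguments sf_sum {k I r P G}.

Lemma subspace0 k : subspace k [set 0].
Proof.
by split=> // [x y -> ->|c x _ ->] /=; rewrite ?addr0 ?mulr0.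
Qed.

Lemma subspaceT k : subspace k setT. Proof. by []. Qed.

Definition addsp (V W : set K) : set K :=
  [set x | exists v w, [/\ V v, W w & x = v + w]].

Lemma subspaceD k V W : subspace k V -> subspace k W -> subspace k (addsp V W).
Proof.
move=> hV hW; split.
- by exists 0, 0; split; rewrite ?addr0 //; [apply: (ss0 hV)|apply: (ss0 hW)].
- move=> x y [v [w [Vv Ww ->]]] [v' [w' [Vv' Ww' ->]]].
  exists (v + v'), (w + w'); split; last by rewrite addrACA.
    exact: (ssD hV).
  exact: (ssD hW).
- move=> c x kc [v [w [Vv Ww ->]]]; exists (c * v), (c * w).
  by split; [apply: (ssZ hV)|apply: (ssZ hW)|rewrite mulrDr].
Qed.

(** Gaussian elimination: a row [i0] with a nonzero first entry clears the first equation from the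
    other rows, and its own coefficient is recovered at the end. *)
Lemma homog_system k (hk : subfield k) n m (A : 'I_m -> 'I_n -> K) :
  (forall i j, k (A i j)) -> (n < m)%N ->
  exists c : 'I_m -> K, [/\ forall i, k (c i), exists i, c i != 0 &
    forall j, \sum_i c i * A i j = 0].
Proof.
elim: n m A => [|n IH] m A kA nm.
  exists (fun=> 1); split; [by move=> _; apply: sf1| |by case].
  by exists (Ordinal nm); rewrite oner_eq0.
case: m A kA nm => // m A kA nm.
have [/existsP [i0 Ai0]|/existsPn A0] := boolP [exists i, A i ord0 != 0]; last first.
  have [] := IH m.+1 (fun i j => A i (fintype.lift ord0 j)) _ (ltnW nm) => // c [kc c0 Hc].
  exists c; split=> // j; case: (unliftP ord0 j) => [j' ->|->]; first exact: Hc.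
  by rewrite big1 // => i _; move: (A0 i); rewrite negbK => /eqP->; rewrite mulr0.
pose B i j := A (fintype.lift i0 i) (fintype.lift ord0 j) -
  A (fintype.lift i0 i) ord0 / A i0 ord0 * A i0 (fintype.lift ord0 j).
have kB i j : k (B i j).
  by apply: sfB => //; apply: sfM => //; apply: sf_div.
have [c [kc [i1 ci1] Hc]] := IH m B kB nm.
pose c0 := - \sum_i c i * (A (fintype.lift i0 i) ord0 / A i0 ord0).
pose c' i := if unlift i0 i is Some i' then c i' else c0.
exists c'; split.
- move=> i; rewrite /c'; case: (unlift i0 i) => [a|]; first exact: kc.
  by apply: sfN => //; apply: sf_sum => // j _; apply: sfM => //; apply: sf_div.
- by exists (fintype.lift i0 i1); rewrite /c' liftK.
- move=> j; rewrite (bigD1_ord i0) //= {1}/c' unlift_none.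
  under eq_bigr => i _ do rewrite /c' liftK.
  case: (unliftP ord0 j) => [j' ->|->].
    have := Hc j'; rewrite /B.
    rewrite (eq_bigr (fun i => c i * A (fintype.lift i0 i) (fintype.lift ord0 j') -
      c i * (A (fintype.lift i0 i) ord0 / A i0 ord0) * A i0 (fintype.lift ord0 j'))); last first.
      by move=> i _; rewrite mulrBr !mulrA.
    rewrite sumrB -mulr_suml => /eqP; rewrite subr_eq0 => /eqP->.
    by rewrite /c0 mulNr addNr.
  rewrite /c0 mulNr mulr_suml (eq_bigr (fun i => c i * A (fintype.lift i0 i) ord0)) ?addNr //.
  by move=> i _; rewrite -mulrA divfK.
Qed.

Section Subfield.
Variables (k : set K) (hk : subfield k).

Lemma steinitz W V m n (b : 'I_n -> K) (c : 'I_m -> K) : subspace k W ->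
  span_mod k W V b -> (forall i, V (c i)) -> free_mod k W c -> (m <= n)%N.
Proof.
move=> hW sb Vc fc; rewrite leqNgt; apply/negP => nm.
have [A HA] := choice (fun i => sb _ (Vc i)).
have [e [ke [i ei] He]] := homog_system hk (fun i j => (HA i).1 j) nm.
have := fc e ke _ i; move=> H; move: ei; rewrite H ?eqxx //.
have -> : \sum_i e i * c i =
    \sum_i e i * (c i - \sum_j A i j * b j) + \sum_j (\sum_i e i * A i j) * b j.
  under [in RHS]eq_bigr => i' _ do rewrite mulrBr mulr_sumr.
  rewrite sumrB; under [X in _ + X]eq_bigr => i' _ do rewrite mulr_suml.
  rewrite exchange_big /=; under [X in _ - X]eq_bigr => i' _ do
    (under eq_bigr => j' _ do rewrite mulrA).
  by rewrite subrK.
apply: (ssD hW); last first.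
  rewrite big1; first exact: (ss0 hW).
  by move=> j _; rewrite He mul0r.
by apply: (ss_sum hW) => i' _; apply: (ssZ hW) => //; case: (HA i').
Qed.

Lemma has_dim_le W V n m : subspace k W -> has_dim k W V n -> forall c : 'I_m -> K,
  (forall i, V (c i)) -> free_mod k W c -> (m <= n)%N.
Proof. by move=> hW [b [_ sb _]] c Vc fc; apply: (steinitz hW sb Vc fc). Qed.

Lemma has_dim_uniq W V n m :
  subspace k W -> has_dim k W V n -> has_dim k W V m -> n = m.
Proof.
move=> hW Hn Hm; apply/eqP; rewrite eqn_leq.
have [b [Vb _ fb]] := Hn; have [c [Vc _ fc]] := Hm.
by rewrite (has_dim_le hW Hm Vb fb) (has_dim_le hW Hn Vc fc).
Qed.

Lemma dimE W V n : subspace k W -> has_dim k W V n -> Defs.dim k W V = n.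
Proof.
move=> hW Hn; rewrite /Defs.dim; case: xgetP => [m _ Hm|]; last by move/(_ n).
exact: (has_dim_uniq hW Hm Hn).
Qed.

Lemma free_has_dim W V n (b : 'I_n -> K) : subspace k W -> subspace k V ->
  (forall i, V (b i)) -> free_mod k W b ->
  (forall c : 'I_n.+1 -> K, (forall i, V (c i)) -> ~ free_mod k W c) ->
  has_dim k W V n.
Proof.
move=> hW hV Vb fb max; exists b; split=> // y Vy.
pose b' (i : 'I_n.+1) := if unlift ord0 i is Some j then b j else y.
have Vb' i : V (b' i) by rewrite /b'; case: (unlift ord0 i).
have /existsNP [c /not_implyP [kc /not_implyP [Wc /existsNP [i ci]]]] := max b' Vb'.
move: Wc; rewrite big_ord_recl /b' unlift_none.
under eq_bigr => j _ do rewrite liftK.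
move=> Wc; have c0 : c ord0 != 0.
  apply/eqP => c0; move: Wc; rewrite c0 mul0r add0r => Wc.
  apply: ci; case: (unliftP ord0 i) => [j ->|->] //.
  by have := fb (fun j => c (fintype.lift ord0 j)) (fun j => kc _) Wc j.
exists (fun j => - (c ord0)^-1 * c (fintype.lift ord0 j)); split.
  by move=> j; apply: (sfM hk) => //; apply: (sfN hk); apply: (sfV hk).
have -> : y - \sum_i0 - (c ord0)^-1 * c (fintype.lift ord0 i0) * b i0 =
    (c ord0)^-1 * (c ord0 * y + \sum_i0 c (fintype.lift ord0 i0) * b i0).
  rewrite mulrDr mulKf // mulr_sumr -sumrN; congr (_ + _).
  by apply: eq_bigr => j _; rewrite !mulNr opprK mulrA.
by apply: (ssZ hW) => //; apply: (sfV hk).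
Qed.

Lemma free0 W (b : 'I_0 -> K) : free_mod k W b. Proof. by move=> c _ _ []. Qed.

Lemma has_dim_bounded W V N : subspace k W -> subspace k V ->
  (forall n (c : 'I_n -> K), (forall i, V (c i)) -> free_mod k W c -> (n <= N)%N) ->
  exists2 n, (n <= N)%N & has_dim k W V n.
Proof.
move=> hW hV bnd.
pose P n := `[< exists c : 'I_n -> K, (forall i, V (c i)) /\ free_mod k W c >].
have P0 : exists n, P n.
  by exists 0%N; apply/asboolP; exists (fun=> 0); split=> [[]//|]; apply: free0.
have Pb n : P n -> (n <= N)%N by move=> /asboolP [c [Vc fc]]; apply: bnd Vc fc.
have [n /asboolP [b [Vb fb]] max] := ex_maxnP P0 Pb.
exists n; first exact: bnd Vb fb.
apply: free_has_dim Vb fb _ => // c Vc fc.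
suff : (n.+1 <= n)%N by rewrite ltnn.
by apply: max; apply/asboolP; exists c.
Qed.

Lemma has_dim_free_basis W V n (b : 'I_n -> K) : subspace k W -> subspace k V ->
  has_dim k W V n -> (forall i, V (b i)) -> free_mod k W b -> span_mod k W V b.
Proof.
move=> hW hV Hn Vb fb y Vy.
apply: contrapT => H.
pose b' (i : 'I_n.+1) := if unlift ord0 i is Some j then b j else y.
have Vb' i : V (b' i) by rewrite /b'; case: (unlift ord0 i).
suff fb' : free_mod k W b' by have := has_dim_le hW Hn Vb' fb'; rewrite ltnn.
move=> c kc; rewrite big_ord_recl /b' unlift_none.
under eq_bigr => j _ do rewrite liftK.
move=> Wc; have c0 : c ord0 = 0.
  apply/eqP; apply: contra_notT H => c0.
  exists (fun j => - (c ord0)^-1 * c (fintype.lift ord0 j)); split.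
    by move=> j; apply: (sfM hk) => //; apply: (sfN hk); apply: (sfV hk).
  have -> : y - \sum_i0 - (c ord0)^-1 * c (fintype.lift ord0 i0) * b i0 =
      (c ord0)^-1 * (c ord0 * y + \sum_i0 c (fintype.lift ord0 i0) * b i0).
    rewrite mulrDr mulKf // mulr_sumr -sumrN; congr (_ + _).
    by apply: eq_bigr => j _; rewrite !mulNr opprK mulrA.
  by apply: (ssZ hW) => //; apply: (sfV hk).
move: Wc; rewrite c0 mul0r add0r => Wc i.
case: (unliftP ord0 i) => [j ->|->] //.
by have := fb (fun j => c (fintype.lift ord0 j)) (fun j => kc _) Wc j.
Qed.

Definition catf n m (a : 'I_n -> K) (b : 'I_m -> K) (i : 'I_(n + m)) : K :=
  match split i with inl j => a j | inr j => b j end.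

Lemma catfl n m (a : 'I_n -> K) (b : 'I_m -> K) i : catf a b (lshift m i) = a i.
Proof.
by rewrite /catf; case: splitP => j /= E; [congr a; apply/val_inj|move: (ltn_ord i); rewrite E; lia].
Qed.

Lemma catfr n m (a : 'I_n -> K) (b : 'I_m -> K) i : catf a b (rshift n i) = b i.
Proof.
rewrite /catf; case: splitP => j /= E; first by move: (ltn_ord j); rewrite -E; lia.
by congr b; apply/val_inj => /=; lia.
Qed.

Lemma has_dimD W V U n m : subspace k W -> subspace k V -> subspace k U -> W `<=` V -> V `<=` U ->
  has_dim k W V n -> has_dim k V U m -> has_dim k W U (n + m).
Proof.
move=> hW hV hU WV VU [b [Vb sb fb]] [c [Uc sc fc]]; exists (catf b c); split.
- by move=> i; rewrite /catf; case: split => j //; apply: VU.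
- move=> y /sc [e [ke /sb [e' [ke' H]]]]; exists (catf e' e); split.
    by move=> i; rewrite /catf; case: split => j.
  rewrite big_split_ord /=.
  under eq_bigr => i _ do rewrite !catfl.
  under [X in _ - (_ + X)]eq_bigr => i _ do rewrite !catfr.
  by rewrite opprD addrA addrAC.
- move=> e ke; rewrite big_split_ord /=.
  under eq_bigr => i _ do rewrite !catfl.
  under [X in _ + X]eq_bigr => i _ do rewrite !catfr.
  move=> We; have e2 : forall i, e (rshift n i) = 0.
    apply: fc => //; apply: contrapT => H; apply: H.
    have := WV _ We.
    set x := \sum_i _; set y := \sum_i _ => Vxy.
    rewrite -[y](addKr x); apply: (ssD hV) => //.
    apply: (ssN hk hV); apply: (ss_sum hV) => i _.
    by apply: (ssZ hV).
  have e1 : forall i, e (lshift m i) = 0.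
    apply: fb => //; move: We.
    by rewrite [X in _ + X]big1 ?addr0 // => i _; rewrite e2 mul0r.
  move=> i; rewrite -(splitK i); case: (split i) => j /=; [exact: e1|exact: e2].
Qed.

Lemma has_dim_sub W V U n : subspace k W -> subspace k V -> subspace k U ->
  W `<=` V -> V `<=` U -> has_dim k W U n ->
  exists a b, [/\ has_dim k W V a, has_dim k V U b & (a + b)%N = n].
Proof.
move=> hW hV hU WV VU Hn.
have [a _ Ha] : exists2 a, (a <= n)%N & has_dim k W V a.
  by apply: has_dim_bounded => // m c Vc fc; apply: (has_dim_le hW Hn _ fc) => i; apply: VU.
have [b _ Hb] : exists2 b, (b <= n)%N & has_dim k V U b.
  apply: has_dim_bounded => // m c Vc fc; apply: (has_dim_le hW Hn Vc) => e ke We.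
  by apply: fc => //; apply: WV.
exists a, b; split=> //.
exact: (has_dim_uniq hW (has_dimD hW hV hU WV VU Ha Hb) Hn).
Qed.

Lemma has_dim_iso W V W' V' n t : t != 0 -> (forall x, W' (t * x) <-> W x) ->
  (forall x, V' (t * x) <-> V x) -> has_dim k W V n -> has_dim k W' V' n.
Proof.
move=> t0 HW HV [b [Vb sb fb]]; exists (fun i => t * b i).
have E c : \sum_i c i * (t * b i) = t * \sum_i c i * b i.
  by rewrite mulr_sumr; apply: eq_bigr => i _; rewrite mulrCA.
split; first by move=> i; apply/HV.
- move=> y V'y; have /sb [c [kc Wc]] : V (t^-1 * y) by apply/HV; rewrite mulVKf.
  exists c; split=> //; rewrite E -[y](mulVKf t0) -mulrBr; exact/HW.
- by move=> c kc; rewrite E => /HW; apply: fb.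
Qed.

(** Second isomorphism theorem: the inclusion of V in U identifies V / W with U / W' when V meets W'
    inside W and V + W' contains U. *)
Lemma has_dim_quot W V W' U n : has_dim k W V n -> subspace k V ->
  W `<=` W' -> V `<=` U -> V `&` W' `<=` W -> U `<=` addsp V W' -> subspace k W' ->
  has_dim k W' U n.
Proof.
move=> [b [Vb sb fb]] hV WW VU VW UVW hW'; exists b; split.
- by move=> i; apply: VU.
- move=> y /UVW [v [w [Vv Ww ->]]]; have [c [kc Wc]] := sb v Vv.
  by exists c; split=> //; rewrite addrAC; apply: (ssD hW') => //; apply: WW.
- move=> c kc Wc; apply: fb => //; apply: VW; split=> //.
  by apply: (ss_sum hV) => i _; apply: (ssZ hV).
Qed.

(** A basis of V / W is moved into V' by subtracting elements of W; inside V' being in W and being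
    in W' mean the same. *)
Lemma has_dim_restrict W V W' V' n : subspace k W -> subspace k W' ->
  has_dim k W V n -> V' `<=` V -> (forall x, V' x -> (W' x <-> W x)) ->
  subspace k V' -> V `<=` addsp V' W -> has_dim k W' V' n.
Proof.
move=> hW hW' [b [Vb sb fb]] VV W'W hV' VVW.
have [b' Hb'] := choice (fun i => VVW _ (Vb i)).
have {}Hb' i : V' (b' i) /\ W (b i - b' i).
  by have [w [Vb' Ww ->]] := Hb' i; rewrite addrAC subrr add0r.
have E c : (forall i, k (c i)) -> W (\sum_i c i * b i - \sum_i c i * b' i).
  move=> kc; rewrite -sumrB; apply: (ss_sum hW) => i _; rewrite -mulrBr.
  by apply: (ssZ hW) => //; case: (Hb' i).
have V'E c : (forall i, k (c i)) -> V' (\sum_i c i * b' i).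
  by move=> kc; apply: (ss_sum hV') => i _; apply: (ssZ hV') => //; case: (Hb' i).
exists b'; split.
- by move=> i; case: (Hb' i).
- move=> y Vy; have [c [kc Wc]] := sb y (VV _ Vy); exists c; split=> //.
  apply/W'W; first by apply: (ssB hk hV') => //; apply: V'E.
  rewrite -[X in W X](subrK (y - \sum_i c i * b i)); apply: (ssD hW) => //.
  by rewrite opprB addrC addrA subrK; apply: E.
- move=> c kc /W'W Wc; apply: fb => //.
  rewrite -[X in W X](subrK (\sum_i c i * b' i)); apply: (ssD hW); first exact: E.
  by apply: Wc; apply: V'E.
Qed.

(** The functional is a coordinate with respect to a basis of V / W, which has an element since the
    dimension is positive. *)
Lemma linear_functional W V n : subspace k W -> subspace k V -> W `<=` V ->
  has_dim k W V n -> (0 < n)%N -> exists F : K -> K,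
  [/\ forall y, V y -> k (F y),
      forall a x y, k a -> V x -> V y -> F (a * x + y) = a * F x + F y,
      forall y, W y -> F y = 0 & exists2 y, V y & F y != 0].
Proof.
move=> hW hV WV [b [Vb sb fb]] n0.
have /choice [c Hc] : forall y, exists c : 'I_n -> K,
    V y -> (forall i, k (c i)) /\ W (y - \sum_i c i * b i).
  move=> y; have [/sb [c Hc]|nV] := pselect (V y); first by exists c.
  by exists (fun=> 0).
have uniq_c y e : V y -> (forall i, k (e i)) -> W (y - \sum_i e i * b i) ->
    forall i, c y i = e i.
  move=> Vy ke We i; have [kc Wc] := Hc y Vy.
  apply/eqP; rewrite -subr_eq0; apply/eqP.
  apply: (fb (fun i => c y i - e i)) => [j|]; first exact: sfB.
  have -> : \sum_j (c y j - e j) * b j =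
      (y - \sum_j e j * b j) - (y - \sum_j c y j * b j).
    rewrite opprB [RHS]addrC addrA subrK -sumrB.
    by apply: eq_bigr => j _; rewrite mulrBl.
  exact: (ssB hk hW).
pose i0 := Ordinal n0; exists (fun y => c y i0); split.
- by move=> y Vy; apply: (Hc y Vy).1.
- move=> a x y ka Vx Vy; apply: (uniq_c _ (fun i => a * c x i + c y i)).
  + by apply: (ssD hV) => //; apply: (ssZ hV).
  + by move=> i; apply: sfD => //; [apply: sfM => //|]; [apply: (Hc x Vx).1|apply: (Hc y Vy).1].
  + have -> : a * x + y - \sum_i (a * c x i + c y i) * b i =
       a * (x - \sum_i c x i * b i) + (y - \sum_i c y i * b i).
      rewrite mulrBr mulr_sumr addrACA -opprD -big_split; congr (_ - _).
      by apply: eq_bigr => i _; rewrite /= mulrDl mulrA.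
    by apply: (ssD hW); [apply: (ssZ hW) => //; apply: (Hc x Vx).2|apply: (Hc y Vy).2].
- move=> y Wy; apply: (uniq_c _ (fun=> 0)) => [|_|]; [exact: WV|exact: sf0|].
  by rewrite big1 ?subr0 // => i _; rewrite mul0r.
- exists (b i0) => //.
  have -> : c (b i0) i0 = (i0 == i0)%:R; last by rewrite eqxx oner_eq0.
  apply: (uniq_c _ (fun i => (i == i0)%:R)) => // [i|].
    by case: (i == i0); [apply: sf1|apply: sf0].
  rewrite (bigD1 i0) //= ?eqxx mul1r big1 ?addr0 ?subrr; first exact: (ss0 hW).
  by move=> i /negPf->; rewrite mul0r.
Qed.

Lemma has_dim0 W V : W `<=` V -> V `<=` W -> has_dim k W V 0.
Proof.
move=> WV VW; exists (fun=> 0); split=> [[]//|y Vy|c _ _ []//].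
by exists (fun=> 0); split=> [[]//|]; rewrite big_ord0 subr0; apply: VW.
Qed.

Lemma has_dim_eq0 W V : W 0 -> subspace k W -> has_dim k W V 0 -> V `<=` W.
Proof.
move=> _ hW [b [_ sb _]] y /sb [c [_]]; by rewrite big_ord0 subr0.
Qed.

Lemma steinitz_fin (W V : set K) (T S : finType) (b : S -> K) (c : T -> K) : subspace k W ->
  (forall y, V y -> exists e : S -> K, (forall i, k (e i)) /\ W (y - \sum_i e i * b i)) ->
  (forall i, V (c i)) ->
  (forall e : T -> K, (forall i, k (e i)) -> W (\sum_i e i * c i) -> forall i, e i = 0) ->
  (#|T| <= #|S|)%N.
Proof.
move=> hW sb Vc fc.
refine (@steinitz W V #|T| #|S| (fun i => b (enum_val i)) (fun i => c (enum_val i)) hW _ _ _) => //.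
- move=> y /sb [e [ke We]]; exists (fun i => e (enum_val i)); split=> //.
  by rewrite -(big_enum_val (A := S) (fun i => e i * b i)).
- move=> e ke We i.
  have := fc (fun t => e (enum_rank t)) (fun t => ke _) _ (enum_val i).
  rewrite enum_valK; apply.
  rewrite (big_enum_val (A := T) (fun t => e (enum_rank t) * c t)).
  by under eq_bigr => j _ do rewrite enum_valK.
Qed.

Lemma has_dim_le_fin (W V : set K) n (T : finType) (c : T -> K) : subspace k W -> has_dim k W V n ->
  (forall i, V (c i)) ->
  (forall e : T -> K, (forall i, k (e i)) -> W (\sum_i e i * c i) -> forall i, e i = 0) ->
  (#|T| <= n)%N.
Proof.
move=> hW [b [_ sb _]] Vc fc; rewrite -[n]card_ord.
exact: (@steinitz_fin W V _ _ b c).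
Qed.

End Subfield.
End LinearAlgebra.
Arguments ss_sum {K k V I r P G}.
Arguments sf_sum {K k I r P G}.

(** * Polynomials in a function and the degree of K over F(f) *)

Section Eval.
Variables (Fq : finFieldType) (K : fieldType) (iota : {rmorphism Fq -> K}).

Definition ev (f : K) (p : {poly Fq}) : K := (map_poly iota p).[f].

Lemma evD f p r : ev f (p + r) = ev f p + ev f r.
Proof. by rewrite /ev rmorphD hornerD. Qed.
Lemma evN f p : ev f (- p) = - ev f p.
Proof. by rewrite /ev rmorphN hornerN. Qed.
Lemma evB f p r : ev f (p - r) = ev f p - ev f r.
Proof. by rewrite evD evN. Qed.
Lemma evM f p r : ev f (p * r) = ev f p * ev f r.
Proof. by rewrite /ev rmorphM hornerM. Qed.
Lemma evC f c : ev f c%:P = iota c.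
Proof. by rewrite /ev map_polyC hornerC. Qed.
Lemma ev0 f : ev f 0 = 0. Proof. by rewrite /ev rmorph0 horner0. Qed.
Lemma ev1 f : ev f 1 = 1. Proof. by rewrite evC rmorph1. Qed.
Lemma evX f : ev f 'X = f. Proof. by rewrite /ev map_polyX hornerX. Qed.
Lemma evXn f p n : ev f (p ^+ n) = ev f p ^+ n.
Proof. by rewrite /ev rmorphXn horner_exp. Qed.
Lemma ev_sum f (I : Type) (r : seq I) (P : pred I) G :
  ev f (\sum_(i <- r | P i) G i) = \sum_(i <- r | P i) ev f (G i).
Proof. by rewrite /ev rmorph_sum horner_sum. Qed.
Lemma ev_prod f (I : Type) (r : seq I) (P : pred I) G :
  ev f (\prod_(i <- r | P i) G i) = \prod_(i <- r | P i) ev f (G i).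
Proof. by rewrite /ev rmorph_prod horner_prod. Qed.

Lemma evE f (p : {poly Fq}) n : (size p <= n)%N -> ev f p = \sum_(i < n) iota p`_i * f ^+ i.
Proof.
move=> pn; rewrite /ev (@horner_coef_wide _ n) ?size_map_poly //.
by apply: eq_bigr => i _; rewrite coef_map.
Qed.

Notation cst := (constants iota).
Notation "'F(' f )" := (rational_in iota f) (at level 0, format "'F(' f )").

Lemma constant_iota a : cst (iota a). Proof. by exists a. Qed.

Lemma subfield_constants : subfield cst.
Proof.
split.
- by exists 1; rewrite ?rmorph1.
- by move=> _ _ [a _ <-] [b _ <-]; exists (a - b); rewrite ?rmorphB.
- by move=> _ _ [a _ <-] [b _ <-]; exists (a * b); rewrite ?rmorphM.
- by move=> _ [a _ <-]; exists a^-1; rewrite ?fmorphV.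
Qed.

Lemma subfield_rational f : subfield F(f).
Proof.
split.
- by exists 1, 1; rewrite -!/(ev _ _) ev1 oner_eq0 divr1.
- move=> _ _ [p [r [r0 ->]]] [p' [r' [r0' ->]]].
  exists (p * r' - p' * r), (r * r'); rewrite -!/(ev _ _) evB !evM mulf_neq0 //; split=> //.
  rewrite mulrBl -[in LHS](mulfK r0' (ev f p)) -[in RHS]mulf_div.
  by rewrite -!/(ev _ _); field; rewrite r0 r0'.
- move=> _ _ [p [r [r0 ->]]] [p' [r' [r0' ->]]].
  exists (p * p'), (r * r'); rewrite -!/(ev _ _) !evM mulf_neq0 //; split=> //.
  by rewrite mulf_div.
- move=> _ [p [r [r0 ->]]]; have [p0|p0] := eqVneq (map_poly iota p).[f] 0.
    by exists 0, 1; rewrite -!/(ev _ _) ev1 oner_eq0 ev0 divr1 /ev p0 mul0r invr0.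
  by exists r, p; rewrite invf_div.
Qed.

Lemma rational_ev f p : F(f) (ev f p).
Proof. by exists p, 1; rewrite -!/(ev _ _) ev1 oner_eq0 divr1. Qed.

Lemma rational_constant f a : F(f) (iota a).
Proof. by rewrite -(evC f); apply: rational_ev. Qed.

Lemma rational_gen f : F(f) f.
Proof. by rewrite -{2}(evX f); apply: rational_ev. Qed.

Lemma common_denominator f (I : finType) (c : I -> K) : (forall i, F(f) (c i)) ->
  exists D (P : I -> {poly Fq}), ev f D != 0 /\ forall i, ev f D * c i = ev f (P i).
Proof.
move=> /choice [p /choice [r Hr]].
exists (\prod_i r i), (fun i => p i * \prod_(j | j != i) r j); split.
  by rewrite ev_prod; apply/prodf_neq0 => i _; case: (Hr i).
move=> i; rewrite evM !ev_prod (bigD1 i) //=; case: (Hr i) => ri0 ->.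
by rewrite -!/(ev _ _) mulrAC mulrCA divff ?mulr1.
Qed.

Definition transc f := forall p, ev f p = 0 -> p = 0.

Lemma transc_neq0 f : transc f -> f != 0.
Proof.
move=> tf; apply/eqP => f0; have /tf/eqP : ev f 'X = 0 by rewrite evX.
by rewrite polyX_eq0.
Qed.

Lemma ev_neq0 f p : transc f -> p != 0 -> ev f p != 0.
Proof. by move=> tf; apply: contra_neq => /tf. Qed.

Lemma free_poly_rational f n (b : 'I_n -> K) : transc f ->
  (forall P : 'I_n -> {poly Fq}, \sum_i ev f (P i) * b i = 0 -> forall i, P i = 0) ->
  free_mod F(f) [set 0] b.
Proof.
move=> tf H c /common_denominator [D [P [D0 HP]]] /= c0 i.
have /H/(_ i) Pi : \sum_i ev f (P i) * b i = 0.
  under eq_bigr => j _ do rewrite -HP -mulrA.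
  by rewrite -mulr_sumr c0 mulr0.
by apply: (mulfI D0); rewrite HP Pi ev0 mulr0.
Qed.

Lemma free_rational_poly f (I : finType) (b : I -> K) : transc f ->
  (forall c : I -> K, (forall i, F(f) (c i)) -> \sum_i c i * b i = 0 -> forall i, c i = 0) ->
  forall P : I -> {poly Fq}, \sum_i ev f (P i) * b i = 0 -> forall i, P i = 0.
Proof.
by move=> tf H P HP i; apply/tf/(H (fun i => ev f (P i))) => // j; apply: rational_ev.
Qed.

Definition mulset (f : K) (V : set K) : set K := [set x | exists2 y, V y & x = f * y].

Lemma poly_split0 (p : {poly Fq}) : p = (p`_0)%:P + 'X * drop_poly 1 p.
Proof.
by apply/polyP => -[|i]; rewrite coefD coefC coefXM coef_drop_poly ?addr0 ?add0r ?addn1.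
Qed.

(** The tool behind every lower bound for [K : F(f)]. After denominators are cleared, the constant
    coefficients of a relation vanish because the remaining part lies in f V; division by f then
    lowers the degrees of the coefficients. *)
Lemma free_lift f (V : set K) n (b : 'I_n -> K) : transc f -> subspace cst V ->
  (forall x, V x -> V (f * x)) -> (forall i, V (b i)) ->
  free_mod cst (mulset f V) b -> free_mod F(f) [set 0] b.
Proof.
move=> tf hV fV Vb fb; apply: free_poly_rational => // P.
have Vp p x : V x -> V (ev f p * x).
  move=> Vx; elim/poly_ind: p => [|p c IH]; first by rewrite ev0 mul0r; apply: (ss0 hV).
  rewrite evD evM evX evC mulrDl -mulrA [X in V (X + _)]mulrCA; apply: (ssD hV).
    exact: fV.
  by apply: (ssZ hV) => //; apply: constant_iota.
have [N HN] : exists N, forall i, (size (P i) <= N)%N.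
  by exists (\max_i size (P i))%N => i; apply: leq_bigmax.
elim: N P HN => [|N IH] P HN HP i.
  by apply/eqP; rewrite -size_poly_eq0 -leqn0.
pose P' i := drop_poly 1 (P i).
have E : \sum_i ev f (P i) * b i =
    \sum_i iota (P i)`_0 * b i + f * \sum_i ev f (P' i) * b i.
  rewrite mulr_sumr -big_split; apply: eq_bigr => j _ /=.
  by rewrite {1}(poly_split0 (P j)) evD evC evM evX mulrDl mulrA.
have c0 : forall i, iota (P i)`_0 = 0.
  apply: fb => [j|]; first exact: constant_iota.
  exists (- \sum_i ev f (P' i) * b i).
    apply: (ssN subfield_constants hV); apply: (ss_sum hV) => j _; exact: Vp.
  by move: HP; rewrite E mulrN => /eqP; rewrite addr_eq0 => /eqP.
have : forall i, P' i = 0.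
  apply: IH => [j|]; first by rewrite size_drop_poly leq_subLR add1n.
  apply: (mulfI (transc_neq0 tf)); move: HP; rewrite mulr0 E big1 ?add0r // => j _.
  by rewrite c0 mul0r.
move=> P'0; rewrite (poly_split0 (P i)) -/(P' i) P'0 mulr0 addr0.
by move: (c0 i) => /eqP; rewrite fmorph_eq0 => /eqP->.
Qed.

Lemma free_powers f (I : finType) (b : I -> K) m : transc f ->
  (forall c : I -> K, (forall i, F(f) (c i)) -> \sum_i c i * b i = 0 -> forall i, c i = 0) ->
  forall e : I * 'I_m -> K, (forall t, cst (e t)) ->
   \sum_t e t * (b t.1 * f ^+ t.2) = 0 -> forall t, e t = 0.
Proof.
move=> tf fb e ce e0 [i j].
have /choice [a Ha] : forall t, exists a, iota a = e t.
  by move=> t; have [a _ <-] := ce t; exists a.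
move=> {ce}.
pose P i : {poly Fq} := \poly_(j < m) oapp (fun j' => a (i, j')) 0 (insub j).
have P0 : forall i, P i = 0.
  apply: (free_rational_poly tf fb); rewrite -[RHS]e0.
  transitivity (\sum_i \sum_j e (i, j) * (b i * f ^+ j)); last first.
    by rewrite pair_bigA; apply: eq_bigr => -[].
  apply: eq_bigr => i' _; rewrite (evE _ (size_poly _ _)) mulr_suml.
  by apply: eq_bigr => j' _; rewrite coef_poly ltn_ord valK /= Ha -mulrA [f ^+ _ * _]mulrC.
have := congr1 (fun p : {poly Fq} => p`_j) (P0 i).
by rewrite coef_poly ltn_ord valK coef0 /= => aij; rewrite -Ha aij rmorph0.
Qed.

Section Degree.
Hypothesis hK : function_field iota.

Lemma nonconstant_transc f : ~ cst f -> transc f.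
Proof.
move=> nf p p0; apply/eqP; apply: contra_notT nf => p_neq0.
by apply: hK.2; exists p => //; apply/rootP.
Qed.

Lemma not_algebraic_transc f : ~ algebraicOver iota f -> transc f.
Proof.
move=> nf p p0; apply/eqP; apply: contra_notT nf => p_neq0.
by exists p => //; apply/rootP.
Qed.

Lemma transc_nonconstant f : transc f -> ~ cst f.
Proof.
move=> tf [a _ fa]; have /tf/eqP : ev f ('X - a%:P) = 0 by rewrite evB evX evC fa subrr.
by rewrite polyXsubC_eq0.
Qed.

Section Growth.
Variables (n : nat) (x : K) (b : 'I_n -> K).

Let W m : set K := [set u | exists P : 'I_n -> {poly Fq},
  (forall l, (size (P l) <= m)%N) /\ u = \sum_l ev x (P l) * b l].

Let W_mul m C u (p : {poly Fq}) : W m u -> (size p <= C.+1)%N -> W (m + C) (ev x p * u).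
Proof.
move=> [P [sP ->]] sp; exists (fun l => p * P l); split.
  move=> l; apply: leq_trans (size_polyMleq _ _) _; have := sP l.
  by case: (size p) sp => [|s] /=; lia.
by rewrite mulr_sumr; apply: eq_bigr => l _; rewrite evM mulrA.
Qed.

Let W_sum m (I : finType) (u : I -> K) : (forall i, W m (u i)) -> W m (\sum_i u i).
Proof.
move=> /choice [P HP]; exists (fun l => \sum_i P i l); split.
  move=> l; apply: leq_trans (size_sum _ _ _) _; apply/bigmax_leqP => i _.
  by have [sP _] := HP i.
rewrite (eq_bigr _ (fun i _ => (HP i).2)) exchange_big /=; apply: eq_bigr => l _.
by rewrite ev_sum mulr_suml.
Qed.

Let W_free m (T : finType) (c : T -> K) : (forall t, W m (c t)) ->
  (forall e : T -> K, (forall i, cst (e i)) -> \sum_i e i * c i = 0 -> forall i, e i = 0) ->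
  (#|T| <= n * m)%N.
Proof.
move=> Wc fc; have -> : (n * m)%N = #|{: 'I_n * 'I_m}| by rewrite card_prod !card_ord.
refine (@steinitz_fin _ _ subfield_constants [set 0] (W m) T ('I_n * 'I_m)%type
  (fun t => x ^+ t.2 * b t.1) c (subspace0 _) _ Wc fc).
move=> u [P [sP ->]]; exists (fun t : 'I_n * 'I_m => iota (P t.1)`_t.2); split=> /=.
  by move=> t; apply: constant_iota.
apply/eqP; rewrite subr_eq0; apply/eqP.
transitivity (\sum_i \sum_(j < m) iota (P i)`_j * (x ^+ j * b i)); last first.
  by rewrite pair_bigA.
apply: eq_bigr => i _; rewrite (evE _ (sP i)) mulr_suml.
by apply: eq_bigr => j _; rewrite mulrA.
Qed.

(** Comparison of growth. Multiplication by [ev x D * f] raises degrees in x by at most C, so the m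
    (J + 1) independent elements u_i f^j fit, after scaling, into a space of dimension n (C' + J C).
    For large J this forces m <= n C. Thus one x of finite degree makes the degree of every
    transcendental f finite. *)
Lemma degree_bound f : span_mod F(x) [set 0] setT b -> transc x -> transc f ->
  exists N, forall m (u : 'I_m -> K), free_mod F(f) [set 0] u -> (m <= N)%N.
Proof.
move=> sb tx tf.
have [c Hc] := choice (fun i => sb (f * b i) I).
have [D [P [D0 HP]]] := @common_denominator x _ (fun t : 'I_n * 'I_n => c t.1 t.2) (fun t => (Hc t.1).1 t.2).
pose C := (size D + \max_t size (P t))%N.
have sP t : (size (P t) <= C.+1)%N by apply/leqW/(leq_trans _ (leq_addl _ _)); apply: (leq_bigmax (F := fun t => size (P t))).
have sD : (size D <= C.+1)%N by apply/leqW/leq_addr.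
have Wf m u : W m u -> W (m + C) (ev x D * f * u).
  move=> [Q [sQ ->]]; rewrite mulr_sumr; apply: W_sum => l.
  have -> : ev x D * f * (ev x (Q l) * b l) =
      \sum_i ev x (P (l, i)) * (ev x (Q l) * b i).
    have /eqP := (Hc l).2; rewrite subr_eq0 => /eqP E.
    rewrite mulrACA E mulr_sumr; apply: eq_bigr => i _.
    by rewrite -HP /=; ring.
  apply: W_sum => i; apply: W_mul => //; exists (fun i' => if i' == i then Q l else 0).
  split; first by move=> i'; case: ifP; rewrite ?size_poly0.
  rewrite (bigD1 i) //= eqxx big1 ?addr0 // => i' /negPf->.
  by rewrite ev0 mul0r.
exists (n * C)%N => m u fu.
have [c' Hc'] := choice (fun i => sb (u i) I).
have [D' [P' [D'0 HP']]] := @common_denominator x _ (fun t : 'I_m * 'I_n => c' t.1 t.2) (fun t => (Hc' t.1).1 t.2).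
pose C' := (\max_t size (P' t))%N.
have Wu i : W C' (ev x D' * u i).
  have /eqP := (Hc' i).2; rewrite subr_eq0 => /eqP ->; exists (fun l => P' (i, l)).
  by split=> [l|]; [apply: (leq_bigmax (F := fun t => size (P' t)))|rewrite mulr_sumr; apply: eq_bigr => l _; rewrite -HP' mulrA].
rewrite leqNgt; apply/negP => Cm.
pose J := (n * C + n * C' + 1)%N.
have Wj i j : (j <= J)%N -> W (C' + J * C) (ev x D' * ev x D ^+ J * (u i * f ^+ j)).
  move=> jJ; rewrite -(subnKC jJ).
  have -> : ev x D' * ev x D ^+ (j + (J - j)) * (u i * f ^+ j) =
     ev x D ^+ (J - j) * ((ev x D * f) ^+ j * (ev x D' * u i)).
    by rewrite exprD exprMn; ring.
  rewrite mulnDl addnA; elim: (J - j)%N => [|l IH].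
    rewrite expr0 mul1r mul0n addn0; elim: j {jJ} => [|j IH].
      by rewrite expr0 mul1r mul0n addn0.
    by rewrite exprS -mulrA mulSn addnCA addnC; apply: Wf.
  by rewrite exprS -mulrA mulSn addnCA addnC; apply: W_mul.
pose z := ev x D' * ev x D ^+ J.
have z0 : z != 0 by rewrite mulf_neq0 // expf_neq0.
have := @W_free (C' + J * C) _ (fun t : 'I_m * 'I_J.+1 => z * (u t.1 * f ^+ t.2)).
rewrite card_prod !card_ord => /(_ (fun t => Wj _ _ (ltn_ord t.2))).
have H : forall e : 'I_m * 'I_J.+1 -> K, (forall i, cst (e i)) ->
    \sum_i e i * (z * (u i.1 * f ^+ i.2)) = 0 -> forall i, e i = 0.
  move=> e ce e0; apply: (free_powers tf fu ce).
  apply: (mulfI z0); rewrite mulr0 -[in RHS]e0 mulr_sumr.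
  by apply: eq_bigr => i _; rewrite mulrCA.
move=> /(_ H); rewrite /J; nia.
Qed.
End Growth.

Lemma has_degree_exists f : transc f -> exists2 n, (0 < n)%N & has_degree iota f n.
Proof.
move=> tf; have [[x [/not_algebraic_transc tx [n [b [_ sb _]]]]] _] := hK.
have [N HN] := degree_bound sb tx tf.
have [m _ Hm] := has_dim_bounded (subfield_rational f) (subspace0 F(f)) (subspaceT F(f))
  (fun n c _ => @HN n c).
exists m => //; rewrite lt0n; apply/eqP => m0; move: Hm; rewrite m0 => Hm.
have /= E : [set 0] (1 : K) by apply: (has_dim_eq0 _ (subspace0 F(f)) Hm).
by move/eqP: E; rewrite oner_eq0.
Qed.

Definition fdeg f := Defs.dim F(f) [set 0] setT.

Lemma fdegE f n : has_degree iota f n -> fdeg f = n.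
Proof. exact: (dimE (subfield_rational f) (subspace0 F(f))). Qed.

Lemma has_fdeg f : transc f -> has_degree iota f (fdeg f).
Proof. by move=> /has_degree_exists [n _ H]; rewrite (fdegE H). Qed.

Lemma fdeg_gt0 f : transc f -> (0 < fdeg f)%N.
Proof. by move=> /has_degree_exists [n n0 H]; rewrite (fdegE H). Qed.

End Degree.
End Eval.

(** * Places and their residue fields *)

Section PlaceTheory.
Variables (Fq : finFieldType) (K : fieldType) (iota : {rmorphism Fq -> K}).
Notation cst := (constants iota).
Notation place := (place iota).
Notation "'F(' f )" := (rational_in iota f) (at level 0, format "'F(' f )").
Notation ev := (ev iota).
Implicit Types (v : place) (x y : K).

(* [vge v n x] means v(x) >= n, with v(0) = +oo. *)
Definition vge v (n : int) (x : K) : bool := (x == 0) || (n <= v x).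

Lemma vge0 v n : vge v n 0. Proof. by rewrite /vge eqxx. Qed.

Lemma vgeE v n x : x != 0 -> vge v n x = (n <= v x).
Proof. by rewrite /vge => /negPf->. Qed.

Lemma vgeW v m n x : n <= m -> vge v m x -> vge v n x.
Proof. by rewrite /vge => nm /orP [->//|H]; rewrite (le_trans nm H) orbT. Qed.

Lemma vgeD v n x y : vge v n x -> vge v n y -> vge v n (x + y).
Proof.
have [->|x0] := eqVneq x 0; first by rewrite add0r.
have [->|y0] := eqVneq y 0; first by rewrite addr0.
have [->|xy0] := eqVneq (x + y) 0; first by rewrite vge0.
rewrite !vgeE // => nx ny. by apply: le_trans (val_atD v x0 y0 xy0); rewrite le_min nx ny.
Qed.

Lemma placeN v x : v (- x) = v x.
Proof.
have [->|x0] := eqVneq x 0; first by rewrite oppr0.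
have N0 : (-1 : Fq) != 0 by rewrite oppr_eq0 oner_eq0.
have i0 : iota (-1) != 0 by rewrite fmorph_eq0.
rewrite -mulN1r -(rmorph1 iota) -rmorphN val_atM //.
by rewrite val_at_constant // add0r.
Qed.

Lemma vgeN v n x : vge v n (- x) = vge v n x.
Proof. by rewrite /vge oppr_eq0 placeN. Qed.

Lemma vgeB v n x y : vge v n x -> vge v n y -> vge v n (x - y).
Proof. by move=> nx ny; apply: vgeD; rewrite ?vgeN. Qed.

Lemma vgeM v m n x y : vge v m x -> vge v n y -> vge v (m + n) (x * y).
Proof.
have [->|x0] := eqVneq x 0; first by move=> *; rewrite mul0r vge0.
have [->|y0] := eqVneq y 0; first by move=> *; rewrite mulr0 vge0.
by rewrite !vgeE ?mulf_neq0 // val_atM // => *; apply: lerD.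
Qed.

Lemma vgeM0 v n x y : vge v n x -> vge v 0 y -> vge v n (x * y).
Proof. by move=> nx ny; rewrite -[n]addr0; apply: vgeM. Qed.

Lemma vge0M v n x y : vge v 0 x -> vge v n y -> vge v n (x * y).
Proof. by move=> nx ny; rewrite -[n]add0r; apply: vgeM. Qed.

Lemma vge_sum v n (I : Type) (r : seq I) (P : pred I) (G : I -> K) :
  (forall i, P i -> vge v n (G i)) -> vge v n (\sum_(i <- r | P i) G i).
Proof.
by move=> H; elim/big_ind: _ => //; [apply: vge0|move=> *; apply: vgeD].
Qed.

Lemma place_iota v a : v (iota a) = 0.
Proof.
have [->|/val_at_constant->//] := eqVneq a 0; by rewrite rmorph0 val_at0.
Qed.

Lemma vge_iota v a : vge v 0 (iota a).
Proof. by rewrite /vge place_iota lexx orbT. Qed.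

Lemma vge1 v : vge v 0 1. Proof. by rewrite -(rmorph1 iota) vge_iota. Qed.

Lemma vge_prod v (I : Type) (r : seq I) (P : pred I) (G : I -> K) :
  (forall i, P i -> vge v 0 (G i)) -> vge v 0 (\prod_(i <- r | P i) G i).
Proof.
by move=> H; elim/big_ind: _ => //; [apply: vge1|move=> *; apply: vgeM0].
Qed.

Lemma vgeX v n x m : vge v n x -> vge v (n * m%:Z) (x ^+ m).
Proof.
move=> nx; elim: m => [|m IH]; first by rewrite mulr0 expr0 vge1.
by rewrite exprS -[m.+1]add1n PoszD mulrDr mulr1; apply: vgeM.
Qed.

Lemma vge0X v x m : vge v 0 x -> vge v 0 (x ^+ m).
Proof. by move/(vgeX m); rewrite mul0r. Qed.

Lemma vge_cst v n c x : cst c -> vge v n x -> vge v n (c * x).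
Proof. by move=> [a _ <-] nx; apply: vge0M => //; apply: vge_iota. Qed.

Lemma vge_ev v f p : vge v 0 f -> vge v 0 (ev f p).
Proof.
move=> vf; rewrite (evE _ _ (leqnn _)); apply: vge_sum => i _.
by apply: vgeM0; [apply: vge_iota|apply: vge0X].
Qed.

Lemma subspace_vge v n : subspace cst [set x | vge v n x].
Proof. by split=> /= *; [apply: vge0|apply: vgeD|apply: vge_cst]. Qed.

Lemma placeX v x n : x != 0 -> v (x ^+ n) = v x * n%:Z.
Proof.
move=> x0; elim: n => [|n IH]; first by rewrite expr0 place1 mulr0.
by rewrite exprS val_atM ?expf_neq0 // IH -[n.+1]add1n PoszD mulrDr mulr1.
Qed.

Lemma place_div v x y : x != 0 -> y != 0 -> v (x / y) = v x - v y.
Proof. by move=> x0 y0; rewrite val_atM ?invr_eq0 // placeV. Qed.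

Lemma place_exprz v x (n : int) : x != 0 -> v (x ^ n) = v x * n.
Proof.
move=> x0; case: n => n; first exact: placeX.
by rewrite NegzE -invr_expz placeV ?expf_neq0 // placeX // mulrN.
Qed.

Lemma place_addl v x y : x != 0 -> vge v (v x + 1) y -> x + y != 0 /\ v (x + y) = v x.
Proof.
move=> x0 vy.
have xy : ~~ vge v (v x + 1) (x + y).
  apply/negP => H; have := vgeB H vy; rewrite addrK vgeE //.
  by move=> ?; lia.
have xy0 : x + y != 0 by apply: contraNneq xy => ->; apply: vge0.
split=> //; apply/le_anti; rewrite vgeE // -ltNge in xy.
rewrite -ltzD1 xy /= -vgeE //; apply: vgeD; first by rewrite vgeE.
by apply: vgeW vy; rewrite lerDl.
Qed.

Lemma place_uniformizer v : exists2 t, t != 0 & v t = 1.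
Proof. exact: val_at_normalized. Qed.

Lemma place_eq (v w : place) : (forall x, v x = w x) -> v = w.
Proof.
case: v w => [v a b c d e] [w a' b' c' d' e'] /= /funext vw.
by move: a b c d e a' b' c' d' e'; rewrite vw => *; congr Place; apply: Prop_irrelevance.
Qed.

Lemma valuation_ringE v x : valuation_ring v x <-> vge v 0 x.
Proof.
rewrite /valuation_ring /vge /=; split; first by case=> [->|->]; rewrite ?eqxx ?orbT.
by case/orP => [/eqP|]; [left|right].
Qed.

Lemma maximal_idealE v x : maximal_ideal v x <-> vge v 1 x.
Proof.
rewrite /maximal_ideal /vge /=; split; first by case=> [->|]; rewrite ?eqxx // -gtz0_ge1 => ->; rewrite orbT.
by case/orP => [/eqP|]; [left|rewrite -gtz0_ge1; right].
Qed.
End PlaceTheory.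

(** * Existence of a place where a given function vanishes *)

Section Existence.
Variables (Fq : finFieldType) (K : fieldType) (iota : {rmorphism Fq -> K}).
Hypothesis hK : function_field iota.
Notation cst := (constants iota).
Notation place := (place iota).
Notation ev := (ev iota).
Variable z : K.
Hypothesis tz : transc iota z.

(** The absence of z^-1 replaces a prime ideal containing z. It passes to unions of chains, so that
    Zorn's lemma applies, and a maximal such ring turns out to be a valuation ring. *)
Record goodring (R : set K) : Prop := Goodring {
  gr_iota : forall a, R (iota a);
  grB : forall x y, R x -> R y -> R (x - y);
  grM : forall x y, R x -> R y -> R (x * y);
  gr_z : R z;
  gr_zV : ~ R z^-1
}.

Let z0 : z != 0 := transc_neq0 tz.

Let goodring0 : goodring [set y | exists p, y = ev z p].
Proof.
split=> /=.
- by move=> a; exists a%:P; rewrite evC.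
- by move=> _ _ [p ->] [r ->]; exists (p - r); rewrite evB.
- by move=> _ _ [p ->] [r ->]; exists (p * r); rewrite evM.
- by exists 'X; rewrite evX.
- move=> [p Hp]; have /tz/eqP : ev z (p * 'X - 1) = 0.
    by rewrite evB evM evX ev1 -Hp mulVf // subrr.
  rewrite subr_eq0 => /eqP/(congr1 (fun p : {poly Fq} => p`_0)).
  by rewrite coefMX coef1 /= => /eqP; rewrite eq_sym oner_eq0.
Qed.

Let T := {R : set K | goodring R}.

Lemma maximal_goodring : exists O, goodring O /\
  forall R, goodring R -> O `<=` R -> R `<=` O.
Proof.
have [] := @ZL_preorder T (exist _ _ goodring0) (fun s t => `[< sval s `<=` sval t >]).
- by move=> t; apply/asboolP.
- by move=> r s t /asboolP rs /asboolP st; apply/asboolP; apply: subset_trans st.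
- move=> A tot; have [[t At]|A0] := pselect (exists t, A t); last first.
    by exists (exist _ _ goodring0) => s As; case: A0; exists s.
  have gU : goodring [set x | exists2 t, A t & sval t x].
    split=> /=.
    - by move=> a; exists t => //; apply: (gr_iota (svalP t) a).
    - move=> x y [s As sx] [r Ar ry].
      case: (tot s r As Ar) => /asboolP H.
        by exists r => //; apply: (grB (svalP r) (H _ sx) ry).
      by exists s => //; apply: (grB (svalP s) sx (H _ ry)).
    - move=> x y [s As sx] [r Ar ry].
      case: (tot s r As Ar) => /asboolP H.
        by exists r => //; apply: (grM (svalP r) (H _ sx) ry).
      by exists s => //; apply: (grM (svalP s) sx (H _ ry)).
    - by exists t => //; apply: (gr_z (svalP t)).
    - by move=> [s As]; apply: (gr_zV (svalP s)).
  by exists (exist _ _ gU) => s As; apply/asboolP => x sx; exists s.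
move=> [O gO] max; exists O; split=> // R gR OR.
by have /asboolP := max (exist _ _ gR) (asboolT OR).
Qed.

Section Valuation.
Variable O : set K.
Hypotheses (gO : goodring O) (maxO : forall R, goodring R -> O `<=` R -> R `<=` O).

Let O0 : O 0. Proof. by rewrite -(rmorph0 iota); apply: (gr_iota gO). Qed.
Let O1 : O 1. Proof. by rewrite -(rmorph1 iota); apply: (gr_iota gO). Qed.
Let ON x : O x -> O (- x). Proof. by move=> Ox; rewrite -sub0r; apply: (grB gO O0 Ox). Qed.
Let OB x y : O x -> O y -> O (x - y). Proof. exact: (grB gO). Qed.
Let OD x y : O x -> O y -> O (x + y).
Proof. by move=> Ox Oy; rewrite -[y]opprK; apply: OB => //; apply: ON. Qed.
Let OM x y : O x -> O y -> O (x * y). Proof. exact: (grM gO). Qed.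
Let OX x n : O x -> O (x ^+ n).
Proof. by move=> Ox; elim: n => [|n IH]; rewrite ?expr0 // exprS; apply: OM. Qed.
Let Osum (I : Type) (r : seq I) (P : pred I) (G : I -> K) :
  (forall i, P i -> O (G i)) -> O (\sum_(i <- r | P i) G i).
Proof. by move=> H; elim/big_ind: _. Qed.

Let Opoly (P : {poly K}) := forall i, O P`_i.

Let adjoin x : set K := [set y | exists2 P, Opoly P & y = P.[x]].

Let adjoin_zV x : ~ O x -> adjoin x z^-1.
Proof.
move=> nOx; apply: contrapT => nz.
have OC a : O a -> Opoly a%:P by move=> Oa i; rewrite coefC; case: ifP.
have gA : goodring (adjoin x).
  split=> //.
  - by move=> a; exists (iota a)%:P; rewrite ?hornerC //; apply: OC; apply: (gr_iota gO).
  - move=> _ _ [P HP ->] [R HR ->]; exists (P - R); rewrite ?hornerD ?hornerN //.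
    by move=> i; rewrite coefB; apply: OB.
  - move=> _ _ [P HP ->] [R HR ->]; exists (P * R); rewrite ?hornerM //.
    by move=> i; rewrite coefM; apply: Osum => j _; apply: OM.
  - by exists z%:P; rewrite ?hornerC //; apply: OC; apply: (gr_z gO).
apply: nOx; apply: (maxO gA) => [y Oy|]; first by exists y%:P; rewrite ?hornerC //; apply: OC.
exists 'X; rewrite ?hornerX // => i; rewrite coefX; by case: (i == 1)%N.
Qed.

(** Chevalley's descent. From z R(1/x) = 1 follows (1 - z R_0) x^n = z S(x) with deg S < n.
    Multiplying z P(x) = 1 by 1 - z R_0 and replacing the leading term by means of S gives a
    relation z Q(x) = 1 of smaller degree; multiplying avoids having to invert 1 - z R_0. *)
Let no_relations N : forall x P R, x != 0 -> Opoly P -> Opoly R ->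
  (size P + size R <= N)%N -> z * P.[x] = 1 -> z * R.[x^-1] = 1 -> False.
Proof.
elim: N => [|N IH] x P R x0 OP OR sPR zP zR.
  move: sPR; rewrite leqn0 addn_eq0 size_poly_eq0 => /andP [/eqP P0 _].
  by move: zP; rewrite P0 horner0 mulr0 => /esym/eqP; rewrite oner_eq0.
wlog sRP : x P R x0 OP OR sPR zP zR / (size R <= size P)%N.
  move=> H; have [|/ltnW] := leqP (size R) (size P); first exact: (H x P R).
  apply: (H x^-1 R P) => //; rewrite ?invr_eq0 ?invrK //; by rewrite addnC.
have P0 : P != 0.
  by apply: contra_eq_neq zP => ->; rewrite horner0 mulr0 eq_sym oner_eq0.
have sP0 : (0 < size P)%N by rewrite lt0n size_poly_eq0.
set n := (size P).-1.
have sPn : size P = n.+1 by rewrite prednK.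
have n0 : (0 < n)%N.
  rewrite lt0n; apply/eqP => n0; have := gr_zV gO; apply.
  have /size1_polyC Pc : (size P <= 1)%N by rewrite sPn n0.
  move: zP; rewrite Pc hornerC => zP.
  by rewrite -[z^-1]mulr1 -zP mulKf.
pose S := \poly_(i < n) R`_(n - i).
have ES : (1 - z * R`_0) * x ^+ n = z * S.[x].
  have E : x ^+ n * R.[x^-1] = R`_0 * x ^+ n + S.[x].
    rewrite (@horner_coef_wide _ n.+1 R); last by rewrite -sPn.
    rewrite big_ord_recl /= ?expr0 mulr1.
    rewrite mulrDr [x ^+ n * _]mulrC; congr (_ + _).
    rewrite horner_poly mulr_sumr (reindex_inj rev_ord_inj) /=.
    apply: eq_bigr => i _; have := ltn_ord i => ni.
    have -> : (bump 0 (n - i.+1) = n - i)%N by rewrite /bump; lia.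
    rewrite exprVn mulrCA -[X in x ^+ X * _](subnK (ltnW ni)) addnC exprD.
    by rewrite mulfK // expf_neq0.
  by rewrite mulrBl mul1r -[x ^+ n in LHS]mulr1 -{1}zR mulrCA E; ring.
pose Q := (R`_0)%:P + (1 - z * R`_0) *: take_poly n P + (z * P`_n) *: S.
apply: (IH x Q R) => //.
- move=> i; rewrite !coefD coefC !coefZ coef_take_poly coef_poly.
  have Oz := gr_z gO.
  by do ?[apply: OB|apply: OD|apply: OM|case: ifP => _].
- have : (size Q <= n)%N.
    rewrite (leq_trans (size_polyD _ _)) // geq_max; apply/andP; split.
      rewrite (leq_trans (size_polyD _ _)) // geq_max; apply/andP; split.
        by rewrite (leq_trans (size_polyC_leq1 _)).
      by rewrite (leq_trans (size_scale_leq _ _)) // size_take_poly.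
    by rewrite (leq_trans (size_scale_leq _ _)) // size_poly.
  by lia.
- have EP : P.[x] = (take_poly n P).[x] + P`_n * x ^+ n.
    rewrite -{1}(poly_take_drop n P) hornerD hornerM hornerXn; congr (_ + _ * _).
    have sd : (size (drop_poly n P) <= 1)%N by rewrite size_drop_poly sPn subSnn.
    by rewrite (size1_polyC sd) hornerC coef_drop_poly add0n.
  rewrite !hornerD hornerC !hornerZ; rewrite EP in zP.
  have -> : z * (R`_0 + (1 - z * R`_0) * (take_poly n P).[x] + z * P`_n * S.[x]) =
     z * R`_0 + (1 - z * R`_0) * (z * (take_poly n P).[x]) + z * P`_n * (z * S.[x]).
    by ring.
  rewrite -ES -[RHS](subrK (z * R`_0)) -[X in _ = X + _]mulr1 -[X in _ = _ * X + _]zP.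
  by ring.
Qed.

Lemma valring x : x != 0 -> O x \/ O x^-1.
Proof.
move=> x0; apply: contrapT => /not_orP [/adjoin_zV [P OP zP] /adjoin_zV [R OR zR]].
by apply: (@no_relations _ x P R x0 OP OR (leqnn _)); rewrite -?zP -?zR divff.
Qed.

Let m : set K := [set y | O y /\ (y = 0 \/ ~ O y^-1)].
Let m_z : m z. Proof. by split; [apply: gr_z gO|right; apply: gr_zV gO]. Qed.
Let mM x y : m x -> O y -> m (x * y).
Proof.
move=> [Ox Hx] Oy; split; first exact: OM.
have [->|xy0] := eqVneq (x * y) 0; first by left.
right => H; move: xy0; rewrite mulf_eq0 negb_or => /andP [x0 y0].
case: Hx => [x1|]; first by rewrite x1 eqxx in x0.
apply; have -> : x^-1 = y * (x * y)^-1 by rewrite invfM mulrCA mulfV // mulr1.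
exact: OM.
Qed.

Let mD x y : m x -> m y -> m (x + y).
Proof.
have [->|x0] := eqVneq x 0; first by rewrite add0r.
have [->|y0] := eqVneq y 0; first by rewrite addr0.
move=> mx my; have /valring [H|H] : x / y != 0 by rewrite mulf_neq0 // invr_eq0.
  have -> : x + y = y * (x / y + 1) by rewrite mulrDr mulr1 mulrC divfK.
  by apply: mM => //; apply: OD.
have -> : x + y = x * (1 + (x / y)^-1) by rewrite mulrDr mulr1 invf_div mulrC divfK.
by apply: mM => //; apply: OD.
Qed.

Let msum (I : Type) (r : seq I) (P : pred I) (G : I -> K) :
  (forall i, P i -> m (G i)) -> m (\sum_(i <- r | P i) G i).
Proof. by move=> H; elim/big_ind: _ => //; split=> //; left. Qed.

Let m_not_unit y : y != 0 -> O y -> O y^-1 -> ~ m y.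
Proof. by move=> y0 Oy OyV [_ [y1|//]]; rewrite y1 eqxx in y0. Qed.

Let mVO y : y != 0 -> ~ O y -> m y^-1.
Proof. by move=> y0 nOy; case: (valring y0) => // Oy; split=> //; right; rewrite invrK. Qed.

(** The u_i are independent modulo y O: in a constant relation the coefficient with the last nonzero
    index would be a nonzero constant inside the maximal ideal. By [free_lift] the length of the
    chain is bounded by the degree of y, which is what makes the valuation discrete. *)
Let chain N y (u : 'I_N -> K) : transc iota y -> O y -> (forall i, u i != 0) -> (forall i, O (u i)) ->
  (forall i, m (y / u i)) -> (forall i j : 'I_N, (i < j)%N -> m (u i / u j)) ->
  (N <= fdeg iota y)%N.
Proof.
move=> ty Oy u0 Ou yu uu.
have hO : subspace cst O.
  split=> //.
  by move=> c x [a _ <-] Ox; apply: OM => //; apply: (gr_iota gO).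
have fu : free_mod cst (mulset y O) u.
  move=> c cc [o Oo E] i; apply/eqP; apply: contraT => ci.
  have [j cj maxj] := @arg_maxnP _ i (fun j => c j != 0) (fun j : 'I_N => j : nat) ci.
  have [a _ aj] := cc j; have a0 : a != 0 by rewrite -(fmorph_eq0 iota) aj.
  have : m (c j).
    have -> : c j = y / u j * o + \sum_(i < N | i != j) (- c i) * (u i / u j).
      apply: (mulIf (u0 j)); rewrite mulrDl mulrAC divfK // -E mulr_suml.
      rewrite (bigD1 j) //= [X in _ = _ + X](eq_bigr (fun i => - (c i * u i))).
        by rewrite sumrN addrK.
      by move=> k _; rewrite -mulrA divfK // mulNr.
    apply: mD; first exact: mM.
    apply: msum => k kj; rewrite mulrC.
    have [->|ck] := eqVneq (c k) 0; first by rewrite oppr0 mulr0; split=> //; left.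
    apply: mM; last by have [b _ <-] := cc k; rewrite -rmorphN; apply: (gr_iota gO).
    apply: uu; rewrite ltn_neqAle; apply/andP; split; first by rewrite -val_eqE in kj.
    exact: maxj.
  move/m_not_unit => H; exfalso; apply: H => //; rewrite -aj; first exact: gr_iota gO _.
  by rewrite -fmorphV; apply: (gr_iota gO).
have fru := free_lift ty hO (fun x Ox => OM Oy Ox) Ou fu.
exact: (has_dim_le (subfield_rational iota y) (subspace0 _) (has_fdeg hK ty) (fun=> I) fru).
Qed.

(** Otherwise repeated choice starting at z yields an infinite sequence in which each term is the
    next one times an element of m, contrary to [chain]. *)
Let principal_m : exists2 t, t != 0 & m t /\ forall y, m y -> O (y / t).
Proof.
apply: contrapT => H.
have /choice [next Hn] : forall t, exists y, t != 0 -> m t -> y != 0 /\ m y /\ m (t / y).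
  move=> t; have [[t0 mt]|] := pselect (t != 0 /\ m t); last first.
    by move=> nt; exists 0 => t0 mt; case: nt.
  apply: contrapT => Ht; apply: H; exists t => //; split=> // y my.
  apply: contrapT => nO; apply: Ht; exists y => _ _.
  have y0 : y != 0 by apply: contra_notN nO => /eqP->; rewrite mul0r.
  by split=> //; split=> //; rewrite -invf_div; apply: mVO => //; rewrite mulf_neq0 // invr_eq0.
pose u i := iter i next z.
have Hu i : u i != 0 /\ m (u i).
  elim: i => [|i [a b]] /=; first by [].
  by have [a' [b' _]] := Hn _ a b.
have Huu i j : (i < j)%N -> m (u i / u j).
  move=> /subnK <-; elim: (j - i.+1)%N => [|l IH].
    by rewrite add0n; have [a b] := Hu i; have [_ [_]] := Hn _ a b.
  have [a b] := Hu (l + i.+1)%N; have [_ [_ c]] := Hn _ a b.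
  have -> : u i / u (l.+1 + i.+1)%N = (u (l + i.+1)%N / next (u (l + i.+1)%N)) * (u i / u (l + i.+1)%N).
    by rewrite [RHS]mulrC mulrA divfK.
  apply: (mM c).
  by have [] := IH.
have := @chain (fdeg iota z).+1 z (fun i => u i.+1) tz (gr_z gO) => Hc.
suff : (fdeg iota z < fdeg iota z)%N by rewrite ltnn.
apply: Hc => i.
- by have [] := Hu i.+1.
- by have [_ []] := Hu i.+1.
- exact: (Huu 0).
- by move=> j ij; apply: Huu.
Qed.

Lemma place_of_maximal : exists v : place, 0 < v z.
Proof.
have [t t0 [mt Ht]] := principal_m.
have [Ot tV] : O t /\ ~ O t^-1.
  by have [Ot [E|]] := mt; rewrite ?E ?eqxx in t0.
pose unit y := y != 0 /\ O y /\ O y^-1.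
have Hm x : x != 0 -> m x -> exists j : nat, unit (x / t ^+ j).
  move=> x0 mx; apply: contrapT => H.
  have mx' j : m (x / t ^+ j).
    elim: j => [|j IH]; first by rewrite expr0 divr1.
    have H1 : O (x / t ^+ j.+1) by rewrite exprSr invfM mulrA; apply: Ht.
    split=> //; right => H2; apply: H; exists j.+1; split=> //.
    by rewrite mulf_neq0 // invr_eq0 expf_neq0.
  have tx : transc iota x.
    apply: (nonconstant_transc hK) => -[a _ ax]; move: mx; apply: m_not_unit => //.
      by rewrite -ax; apply: (gr_iota gO).
    by rewrite -ax -fmorphV; apply: (gr_iota gO).
  (* If no power of t exhausts x, the powers of t with decreasing exponents form a chain of divisors
     of x that is longer than the degree of x. *)
  have := @chain (fdeg iota x).+1 x (fun i => t ^+ ((fdeg iota x).+1 - i)) tx => Hc.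
  suff : (fdeg iota x < fdeg iota x)%N by rewrite ltnn.
  apply: Hc; first by case: mx.
  - by move=> i; rewrite expf_neq0.
  - by move=> i; apply: OX.
  - by move=> i; apply: mx'.
  - move=> i j ij; rewrite -(subnKC (leq_sub2l (fdeg iota x).+1 (ltnW ij))) exprD.
    rewrite mulrAC divff ?mul1r ?expf_neq0 //.
    have := ltn_ord j => jN.
    have -> : (((fdeg iota x).+1 - i - ((fdeg iota x).+1 - j)) = (j - i.+1).+1)%N by lia.
    by rewrite exprS; apply: mM => //; apply: OX.
have unitM x y : unit x -> unit y -> unit (x * y).
  by move=> [x0 [a b]] [y0 [c d]]; split; [rewrite mulf_neq0|split; [apply: OM|rewrite invfM; apply: OM]].
have unitV x : unit x -> unit x^-1.
  by move=> [x0 [a b]]; split; [rewrite invr_eq0|rewrite invrK].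
have Hx x : x != 0 -> exists j : int, unit (x * t ^ (- j)).
  move=> x0; have [Ux|nU] := pselect (unit x); first by exists 0; rewrite oppr0 expr0z mulr1.
  case: (valring x0) => Ox.
    have [|j Hj] := Hm _ x0; last by exists j%:Z; rewrite -invr_expz.
    by split=> //; right => OxV; apply: nU.
  have [||j Hj] := Hm x^-1; first by rewrite invr_eq0.
    by split=> //; right => OxV; apply: nU; rewrite invrK in OxV; split.
  exists (- j%:Z); rewrite opprK.
  by have := unitV _ Hj; rewrite invfM !invrK.
have tzM (i j : int) : t ^ (i + j) = t ^ i * t ^ j by rewrite expfzDr.
have Otz (j : int) : 0 <= j -> O (t ^ j) by case: j => // j _; apply: OX.
have nOtz (j : int) : j < 0 -> ~ O (t ^ j).
  case: j => // j _ H; apply: tV.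
  have -> : t^-1 = t ^+ j * t ^ (Negz j).
    by change (t ^ Negz j) with ((t ^+ j.+1)^-1); rewrite exprSr invfM mulrA divff ?mul1r // expf_neq0.
  by apply: OM => //; apply: OX.
(* The value 0 at 0 is the convention of the record [place]. *)
pose val x : int := if x == 0 then 0 else xget 0 [set j | unit (x * t ^ (- j))].
have valP x : x != 0 -> unit (x * t ^ (- val x)).
  move=> x0; rewrite /val (negPf x0); case: xgetP => [j _ //|].
  by have [j Hj] := Hx _ x0; move/(_ j).
have val_ge x (n : int) : x != 0 -> O (x * t ^ (- n)) <-> n <= val x.
  move=> x0; have [y0 [Oy OyV]] := valP _ x0.
  have E : x * t ^ (- n) = x * t ^ (- val x) * t ^ (val x - n).
    by rewrite -mulrA -tzM; congr (_ * t ^ _); lia.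
  split=> [H|H]; last by rewrite E; apply: OM => //; apply: Otz; lia.
  rewrite leNgt; apply/negP => nv; apply: (nOtz (val x - n)); first by lia.
  have -> : t ^ (val x - n) = (x * t ^ (- val x))^-1 * (x * t ^ (- n)) by rewrite E mulKf.
  exact: OM.
have val_uniq x j : x != 0 -> unit (x * t ^ (- j)) -> val x = j.
  move=> x0 [y0 [Oy OyV]]; apply/le_anti/andP; split; last exact/val_ge.
  have /val_ge : (x^-1 != 0) by rewrite invr_eq0.
  move=> H; have := valP _ x0 => -[w0 [Ow OwV]].
  rewrite leNgt; apply/negP => jv; apply: (nOtz (j - val x)); first by lia.
  have -> : t ^ (j - val x) = (x * t ^ (- val x)) * (x * t ^ (- j))^-1.
    rewrite invfM mulrACA divff // mul1r -[t ^ (- j)]invr_expz invrK -tzM.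
    by congr (t ^ _); lia.
  exact: OM.
have v0 : val 0 = 0 by rewrite /val eqxx.
have vM x y : x != 0 -> y != 0 -> val (x * y) = val x + val y.
  move=> x0 y0; apply: val_uniq; first by rewrite mulf_neq0.
  by rewrite opprD tzM mulrACA; apply: unitM; apply: valP.
have vD x y : x != 0 -> y != 0 -> x + y != 0 -> Num.min (val x) (val y) <= val (x + y).
  move=> x0 y0 xy0; apply/val_ge => //; rewrite mulrDl.
  by apply: OD; apply/val_ge => //; rewrite ge_min lexx ?orbT.
have vc a : a != 0 -> val (iota a) = 0.
  move=> a0; apply: val_uniq; rewrite ?fmorph_eq0 // oppr0 expr0z mulr1.
  by split; [rewrite fmorph_eq0|split; [|rewrite -fmorphV]; apply: (gr_iota gO)].
have vt : exists2 t, t != 0 & val t = 1.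
  exists t => //; apply: val_uniq => //; rewrite -invr_expz expr1z divff //.
  by split; rewrite ?oner_eq0 // invr1.
exists (Place v0 vM vD vc vt) => /=.
rewrite gtz0_ge1; apply/val_ge => //.
by rewrite -invr_expz expr1z; apply: Ht.
Qed.
End Valuation.

Lemma place_exists : exists v : place, 0 < v z.
Proof.
by have [O [gO maxO]] := maximal_goodring; apply: place_of_maximal gO maxO.
Qed.
End Existence.

(** * Weak approximation and local dimensions *)

Section Approximation.
Variables (Fq : finFieldType) (K : fieldType) (iota : {rmorphism Fq -> K}).
Hypothesis hK : function_field iota.
Notation cst := (constants iota).
Notation place := (place iota).
Notation ev := (ev iota).
Notation "'F(' f )" := (rational_in iota f) (at level 0, format "'F(' f )").
Implicit Types (v w : place) (S : seq place).

(** If the ring of v lay inside that of w, writing y as a unit times t^(v y) would give w y = w t *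
    v y for all y; as both valuations are normalized, v = w. *)
Lemma place_not_sub v w : v != w -> exists y, [/\ y != 0, 0 <= v y & w y < 0].
Proof.
move=> vw; apply: contrapT => H.
have Hge y : y != 0 -> 0 <= v y -> 0 <= w y.
  by move=> y0 vy; rewrite leNgt; apply/negP => wy; apply: H; exists y.
have [t t0 vt] := place_uniformizer v.
have E y : y != 0 -> w y = w t * v y.
  move=> y0; pose u := y * t ^ (- v y).
  have tn0 j : t ^ j != 0 by rewrite expfz_neq0.
  have u0 : u != 0 by rewrite mulf_neq0.
  have vu : v u = 0 by rewrite val_atM // place_exprz // vt mul1r subrr.
  have wu1 : 0 <= w u by apply: Hge; rewrite ?vu.
  have wu2 : 0 <= w u^-1 by apply: Hge; rewrite ?invr_eq0 // placeV // vu.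
  rewrite placeV // in wu2.
  have : w u = 0 by lia.
  by rewrite val_atM // place_exprz // mulrN => /eqP; rewrite subr_eq0 => /eqP.
have wt : 0 <= w t by apply: Hge; rewrite ?vt.
have [s s0 ws] := place_uniformizer w.
have := E s s0; rewrite ws => ws1.
have b1 : 1 <= v s by rewrite leNgt; apply/negP => bs; (have : v s <= 0 by lia); nia.
have wt1 : w t = 1.
  have : w t != 0 by apply: contra_eq_neq ws1 => ->; rewrite mul0r.
  by move=> a0; (have : w t <= w t * v s by nia); lia.
case/eqP: vw; apply: place_eq => x.
have [->|x0] := eqVneq x 0; first by rewrite !val_at0.
by rewrite (E x x0) wt1 mul1r.
Qed.

Lemma place_separate v w : v != w -> exists y, [/\ y != 0, 0 < v y & w y < 0].
Proof.
move=> vw; have [y [y0 vy wy]] := place_not_sub vw.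
have [z [z0 wz vz]] : exists y, [/\ y != 0, 0 <= w y & v y < 0].
  by apply: place_not_sub; rewrite eq_sym.
exists (y / z); rewrite mulf_neq0 ?invr_eq0 // !place_div //.
by split=> //; lia.
Qed.

(** If z fails at the new place w, a power of a function y with a pole at w is added. The exponent
    [r] exceeds |w' z| for all w' in S, so z and y^r never have the same negative value and cannot
    cancel. *)
Lemma place_separate_seq v S : v \notin S ->
  exists z, [/\ z != 0, 0 < v z & forall w, w \in S -> w z < 0].
Proof.
elim: S => [_|w S IH].
  by have [t t0 vt] := place_uniformizer v; exists t; rewrite vt.
rewrite inE negb_or => /andP [vw /IH [z [z0 vz Sz]]].
have [wz|wz] := ltP (w z) 0.
  by exists z; split=> // w'; rewrite inE => /orP [/eqP->|/Sz].
have [y [y0 vy wy]] := place_separate vw.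
pose r := (\sum_(w' <- S) `|w' z|).+1%N.
have yr0 : y ^+ r != 0 by rewrite expf_neq0.
have vyr (u : place) : u (y ^+ r) = u y * r%:Z by rewrite placeX.
have vzyr : vge v 1 (z + y ^+ r).
  by apply: vgeD; rewrite vgeE // ?vyr /r; nia.
have Hw : z + y ^+ r != 0 /\ w (z + y ^+ r) = w (y ^+ r).
  rewrite addrC; apply: place_addl => //; rewrite vgeE // vyr /r; nia.
exists (z + y ^+ r); split; first by case: Hw.
  by move: vzyr; rewrite vgeE //; case: Hw.
move=> w'; rewrite inE => /orP [/eqP->|w'S].
  by rewrite Hw.2 vyr /r; nia.
have lt_r : (`|w' z| < r)%N.
  by rewrite /r ltnS (big_rem w') //= leq_addr.
have w'z := Sz _ w'S.
have [zy|yz|E] := ltgtP (w' z) (w' (y ^+ r)).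
- by rewrite (place_addl z0 _).2 // vgeE // lezD1.
- by rewrite addrC (place_addl yr0 _).2 // ?vgeE ?lezD1 //; lia.
- move: E; rewrite vyr => E; exfalso.
  move: (r) (w' y) (w' z) lt_r w'z E => R a b lt_r b0 E.
  (have a1 : a <= -1 by nia); have : b <= - R%:Z by nia.
  by lia.
Qed.

(** The function 1 / (1 + z^r) is close to 1 at a zero of z and close to 0 at a pole of z. *)
Lemma place_indicator v S (N : int) : v \notin S ->
  exists x, vge v N (x - 1) /\ forall w, w \in S -> vge w N x.
Proof.
move=> /place_separate_seq [z [z0 vz Sz]].
pose r := `|N|.+1.
have zr0 : z ^+ r != 0 by rewrite expf_neq0.
have vzr (u : place) : u (z ^+ r) = u z * r%:Z by rewrite placeX.
have [u0 vu] : 1 + z ^+ r != 0 /\ v (1 + z ^+ r) = v 1.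
  apply: place_addl; rewrite ?oner_eq0 // place1 vgeE // vzr; nia.
exists (1 + z ^+ r)^-1; split.
  have -> : (1 + z ^+ r)^-1 - 1 = - (z ^+ r / (1 + z ^+ r)).
    by field; rewrite u0.
  rewrite vgeN vgeE ?mulf_neq0 ?invr_eq0 // place_div // vu place1 vzr /r; nia.
move=> w /Sz wz; rewrite vgeE ?invr_eq0 // placeV //.
have [_] : z ^+ r + 1 != 0 /\ w (z ^+ r + 1) = w (z ^+ r).
  apply: place_addl; rewrite // vgeE ?oner_eq0 // place1 vzr /r; nia.
by rewrite addrC => ->; rewrite vzr /r; nia.
Qed.

Lemma vge_exists v x : exists n : nat, vge v (- n%:Z) x.
Proof. by exists `|v x|%N; rewrite /vge; apply/orP; right; lia. Qed.

Lemma vge_exists_seq S (T : Type) (r : seq T) (X : T -> K) :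
  exists n : nat, forall v t, v \in S -> List.In t r -> vge v (- n%:Z) (X t).
Proof.
elim: r => [|t r [n IH]]; first by exists 0%N.
have [m Hm] : exists m : nat, forall v, v \in S -> vge v (- m%:Z) (X t).
  elim: S {IH} => [|w S [m IH]]; first by exists 0%N.
  have [l Hl] := vge_exists w (X t); exists (maxn m l) => v; rewrite inE => /orP [/eqP->|/IH].
    by apply: vgeW Hl; lia.
  by apply: vgeW; lia.
exists (maxn n m) => v t' vS /= [<-|/(IH _ _ vS)]; last by apply: vgeW; lia.
by apply: vgeW (Hm v vS); lia.
Qed.

Lemma weak_approximation S (X : place -> K) (N : int) : uniq S ->
  exists x, forall v, v \in S -> vge v N (x - X v).
Proof.
move=> uS.
have [M HM] : exists M : nat, forall v w, v \in S -> w \in S -> vge v (- M%:Z) (X w).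
  have [M HM] := vge_exists_seq S S X; exists M => v w vS wS; apply: HM => //.
  by elim: (S) wS => //= a s IH; rewrite inE => /orP [/eqP->|/IH]; [left|right].
have /choice [e He] : forall v, exists x, v \in S ->
    vge v (N + M%:Z) (x - 1) /\ forall w, w \in rem v S -> vge w (N + M%:Z) x.
  move=> v; have vr : v \notin rem v S by rewrite mem_rem_uniqF.
  by have [x Hx] := place_indicator (N + M%:Z) vr; exists x.
exists (\sum_(w <- S) X w * e w) => v vS.
rewrite (big_rem v) //= addrAC -{2}[X v]mulr1 -mulrBr.
have EN : N = - M%:Z + (N + M%:Z) by lia.
apply: vgeD; first by rewrite EN; apply: vgeM; [apply: HM|case: (He v vS)].
rewrite big_seq; apply: vge_sum => w wS; rewrite EN.
have wS' := mem_rem wS; apply: vgeM; first exact: HM.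
apply: (He w wS').2; rewrite mem_rem_uniq // inE vS andbT.
by apply: contraTneq wS => ->; rewrite mem_rem_uniqF.
Qed.

(** A finite substitute for adeles: only the places of S are constrained, and by weak approximation
    an element of K can stand for any finite family of local elements. *)
Definition VS S (n : place -> int) : set K := [set x | forall v, v \in S -> vge v (n v) x].

Lemma subspace_VS S n : subspace cst (VS S n).
Proof.
split=> /=; first by move=> v _; apply: vge0.
  by move=> x y Hx Hy v vS; apply: vgeD; [apply: Hx|apply: Hy].
by move=> c x cc Hx v vS; apply: vge_cst => //; apply: Hx.
Qed.

Lemma uniformizer_transc v t : v t != 0 -> transc iota t.
Proof.
move=> vt; apply: (nonconstant_transc hK) => -[a _ at_].
by move: vt; rewrite -at_ place_iota eqxx.
Qed.

Lemma has_place_deg v : has_dim cst [set x | vge v 1 x] [set x | vge v 0 x] (place_deg v).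
Proof.
have -> : [set x | vge v 1 x] = maximal_ideal v.
  by apply/seteqP; split=> x /maximal_idealE.
have -> : [set x | vge v 0 x] = valuation_ring v.
  by apply/seteqP; split=> x /valuation_ringE.
have sO : subspace cst (valuation_ring v).
  have -> : valuation_ring v = [set x | vge v 0 x].
    by apply/seteqP; split=> x /valuation_ringE.
  exact: subspace_vge.
have sm : subspace cst (maximal_ideal v).
  have -> : maximal_ideal v = [set x | vge v 1 x].
    by apply/seteqP; split=> x /maximal_idealE.
  exact: subspace_vge.
have [t t0 vt] := place_uniformizer v.
have tt : transc iota t by apply: (@uniformizer_transc v); rewrite vt.
have [n _ Hn] : exists2 n, (n <= fdeg iota t)%N & has_dim cst (maximal_ideal v) (valuation_ring v) n.
  apply: (has_dim_bounded (subfield_constants iota)) => // n c Oc fc.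
  have fc' : free_mod F(t) [set 0] c.
    apply: (free_lift tt sO) Oc _ => [x /valuation_ringE Ox|].
      by apply/valuation_ringE; apply: vge0M => //; rewrite vgeE // vt.
    move=> e ce [y /valuation_ringE Oy E]; apply: fc => //.
    by apply/maximal_idealE; rewrite E -[1]addr0; apply: vgeM => //; rewrite vgeE // vt.
  exact: (has_dim_le (subfield_rational iota t) (subspace0 _) (has_fdeg hK tt) (fun=> I) fc').
by rewrite /place_deg (dimE (subfield_constants iota) sm Hn).
Qed.

Lemma place_deg_gt0 v : (0 < place_deg v)%N.
Proof.
rewrite lt0n; apply/eqP => d0; have := has_place_deg v; rewrite d0 => H.
have := has_dim_eq0 (vge0 v 1) (subspace_vge v 1) H (vge1 v).
by rewrite /= vgeE ?oner_eq0 // place1.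
Qed.

Lemma has_dim_local v (n : int) :
  has_dim cst [set x | vge v (n + 1) x] [set x | vge v n x] (place_deg v).
Proof.
have [t t0 vt] := place_uniformizer v.
have tn0 : t ^ n != 0 by rewrite expfz_neq0.
have E m x : vge v (n + m) (t ^ n * x) <-> vge v m x.
  rewrite /vge mulf_eq0 (negPf tn0) /=; have [//|x0] := eqVneq x 0.
  by rewrite val_atM // place_exprz // vt mul1r lerD2l.
apply: (has_dim_iso tn0 _ _ (has_place_deg v)) => x /=; first exact: E.
by rewrite -{1}[n]addr0; apply: E.
Qed.

(** Weak approximation replaces an element of the local quotient at v by one that is small at the
    other places of S. *)
Lemma has_dim_VS_step S v n : uniq S -> v \in S ->
  has_dim cst (VS S (fun w => n w + (w == v)%:Z)) (VS S n) (place_deg v).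
Proof.
move=> uS vS.
apply: (has_dim_restrict (subfield_constants iota) (subspace_vge v (n v + 1)) (subspace_VS _ _)
  (has_dim_local v (n v))).
- by move=> x; apply.
- move=> x Vx; split=> [/(_ v vS)|/= vx w wS]; first by rewrite /= eqxx.
  by case: eqVneq => [->//|_]; rewrite addr0; apply: Vx.
- exact: subspace_VS.
- move=> x /= vx.
  pose M := (\sum_(w <- S) `|n w| + 1)%N.
  have HM w : w \in S -> n w + 1 <= M%:Z.
    by move=> wS; rewrite /M (big_rem w) //=; lia.
  have [y Hy] := @weak_approximation S (fun w => if w == v then x else 0) M uS.
  exists y, (x - y); split; last by rewrite addrC subrK.
    move=> w wS; have := Hy w wS; case: eqVneq => [->|_] H; last first.
      by rewrite subr0 in H; apply: vgeW H; have := HM w wS; lia.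
    rewrite -[y](subrK x); apply: vgeD => //; apply: vgeW H; have := HM v vS; lia.
  rewrite /= -vgeN opprB; have := Hy v vS; rewrite eqxx; apply: vgeW; exact: HM.
Qed.

Lemma has_dim_VS S m n : uniq S -> (forall v, v \in S -> n v <= m v) ->
  has_dim cst (VS S m) (VS S n) (\sum_(v <- S) `|m v - n v| * place_deg v)%N.
Proof.
move=> uS; move: {2}(\sum_(v <- S) _)%N (leqnn (\sum_(v <- S) `|m v - n v|)%N) => N.
elim: N n => [|N IH] n sN nm.
  have E v : v \in S -> m v = n v.
    by move=> vS; move: sN; rewrite (big_rem v) //=; lia.
  rewrite big_seq big1 => [|v /E->]; last by rewrite subrr mul0n.
  by apply: has_dim0 => x Hx v vS; have := Hx v vS; rewrite (E v vS).
have [/hasP [v vS nv]|/hasPn H] := boolP (has (fun v => n v < m v) S); last first.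
  apply: IH => //; rewrite big_seq big1 // => v vS.
  by have := H v vS; have := nm v vS; lia.
pose n' w := n w + (w == v)%:Z.
have n'm w : w \in S -> n' w <= m w.
  by move=> /nm; rewrite /n'; case: eqVneq => [->|_]; lia.
have dv : `|m v - n v|%N = (`|m v - n' v|).+1 by rewrite /n' eqxx; lia.
have dw w : w \in rem v S -> `|m w - n w|%N = `|m w - n' w|%N.
  rewrite mem_rem_uniq // inE => /andP [/negPf wv _]; rewrite /n' wv; lia.
have E : (\sum_(w <- S) `|m w - n w| * place_deg w =
    \sum_(w <- S) `|m w - n' w| * place_deg w + place_deg v)%N.
  rewrite !(big_rem v vS) /= dv mulSn [in RHS]addnC addnA; congr (_ + _)%N.
  by apply: eq_big_seq => w /dw->.
rewrite E; apply: (has_dimD (subfield_constants iota)) (IH n' _ n'm) (has_dim_VS_step n uS vS).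
- exact: subspace_VS.
- exact: subspace_VS.
- exact: subspace_VS.
- by move=> x Hx w wS; apply: vgeW (Hx w wS); apply: n'm.
- by move=> x Hx w wS; apply: vgeW (Hx w wS); rewrite lerDl.
- move: sN; rewrite !(big_rem v vS) /= dv => sN.
  rewrite -ltnS; apply: leq_trans sN; rewrite ltnS leq_add2l.
  by rewrite big_seq [X in (_ <= X)%N]big_seq; apply: leq_sum => w /dw->.
Qed.

(** The left side is the dimension of O_S / f O_S, where O_S consists of the functions regular at S;
    a basis of this quotient stays free over F(f) by [free_lift]. *)
Lemma zeros_bound f S : transc iota f -> uniq S -> (forall v, v \in S -> 0 < v f) ->
  (\sum_(v <- S) `|v f| * place_deg v <= fdeg iota f)%N.
Proof.
move=> tf uS Sf; have f0 := transc_neq0 tf.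
have [b [Vb _ fb]] : has_dim cst (VS S (fun v => v f)) (VS S (fun=> 0))
    (\sum_(v <- S) `|v f| * place_deg v)%N.
  have := @has_dim_VS S (fun v => v f) (fun=> 0) uS (fun v vS => ltW (Sf v vS)).
  by under eq_bigr => v _ do rewrite subr0.
have fb' : free_mod F(f) [set 0] b.
  apply: (free_lift tf (subspace_VS _ _)) Vb _ => [x Vx v vS|c cc [y Vy E]].
    by apply: vge0M; [rewrite vgeE // ltW // Sf|apply: Vx].
  apply: fb => // v vS; rewrite E -[v f]addr0; apply: vgeM; last exact: Vy.
  by rewrite vgeE.
exact: (has_dim_le (subfield_rational iota f) (subspace0 _) (has_fdeg hK tf) (fun=> I) fb').
Qed.
End Approximation.

(** * Divisors *)

(** A duplicate-free list of maximal length is complete. *)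
Lemma finite_pred_enum (T : choiceType) (P : T -> Prop) N :
  (forall s : seq T, uniq s -> (forall x, x \in s -> P x) -> (size s <= N)%N) ->
  exists s : seq T, uniq s /\ forall x, x \in s <-> P x.
Proof.
move=> H; pose Q n := `[< exists s : seq T, [/\ uniq s, forall x, x \in s -> P x & size s = n] >].
have Q0 : exists n, Q n by exists 0%N; apply/asboolP; exists [::].
have Qb n : Q n -> (n <= N)%N by move=> /asboolP [s [us Ps <-]]; apply: H.
have [n /asboolP [s [us Ps sn]] max] := ex_maxnP Q0 Qb.
exists s; split=> // x; split; first exact: Ps.
move=> Px; apply: contrapT => /negP nx.
suff : (n.+1 <= n)%N by rewrite ltnn.
apply: max; apply/asboolP; exists (x :: s); split=> /=; rewrite ?nx ?us ?sn //.
by move=> y; rewrite inE => /orP [/eqP->|/Ps].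
Qed.

Lemma Posz_sum (I : Type) (r : seq I) (P : pred I) (F : I -> nat) :
  (\sum_(i <- r | P i) F i)%N%:Z = \sum_(i <- r | P i) (F i)%:Z.
Proof. by apply: (big_morph Posz) => // *; rewrite PoszD. Qed.

Section Divisors.
Variables (Fq : finFieldType) (K : fieldType) (iota : {rmorphism Fq -> K}).
Hypothesis hK : function_field iota.
Notation cst := (constants iota).
Notation place := (place iota).
Notation divisor := (divisor iota).
Notation ev := (ev iota).
Notation transc := (transc iota).
Notation fdeg := (fdeg iota).
Notation "'F(' f )" := (rational_in iota f) (at level 0, format "'F(' f )").
Implicit Types (v w : place) (S : seq place) (D E : divisor) (f h : K).

Let hF := subfield_constants iota.

Definition divf S (n : place -> int) : divisor := \sum_(v <- S) << n v *g v >>.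

Lemma coeff_divf S n v : uniq S -> coeff v (divf S n) = if v \in S then n v else 0.
Proof.
move=> uS; rewrite /divf raddf_sum /=; case: ifP => [vS|vS].
  rewrite (big_rem v) //= coeffU eqxx mulr1 big1_seq ?addr0 // => w /= wS.
  rewrite coeffU; case: eqVneq => [E|_]; last by rewrite mulr0.
  by move: wS; rewrite E mem_rem_uniqF.
rewrite big1_seq // => w /= wS; rewrite coeffU.
by case: eqVneq => [E|_]; [rewrite -E wS in vS|rewrite mulr0].
Qed.

Lemma divisor_eq D E : (forall v, coeff v D = coeff v E) -> D = E.
Proof. by move=> H; apply/eqP/freeg_eqP. Qed.

Lemma div_degE D S : uniq S -> (forall v, v \notin S -> coeff v D = 0) ->
  div_deg D = \sum_(v <- S) coeff v D * (place_deg v)%:Z.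
Proof.
move=> uS DS; rewrite /div_deg [RHS](bigID (mem (dom D))) /=.
rewrite [X in _ = _ + X]big1 ?addr0 => [|v /coeff_outdom->]; last by rewrite mul0r.
rewrite -[RHS]big_filter; apply: perm_big; apply: uniq_perm; rewrite ?uniq_dom ?filter_uniq //.
move=> v; rewrite mem_filter; case: (boolP (v \in dom D)) => //= vD.
by apply/esym; apply: contraTT vD => /DS; rewrite mem_dom => ->; rewrite eqxx.
Qed.

Lemma div_degD D E : div_deg (D + E) = div_deg D + div_deg E.
Proof.
pose S := undup (dom D ++ dom E).
have uS : uniq S by rewrite undup_uniq.
have HS v : v \notin S -> coeff v D = 0 /\ coeff v E = 0.
  by rewrite mem_undup mem_cat negb_or => /andP [a b]; rewrite !coeff_outdom.
rewrite (@div_degE (D + E) S) // => [|v /HS [a b]]; last by rewrite coeffD a b.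
rewrite (@div_degE D S) // => [|v /HS [a b]] //.
rewrite (@div_degE E S) // => [|v /HS [a b]] //.
by rewrite -big_split; apply: eq_bigr => v _; rewrite coeffD mulrDl.
Qed.

Lemma div_deg0 : div_deg (0 : divisor) = 0.
Proof. by rewrite /div_deg dom0 big_nil. Qed.

Lemma div_degN D : div_deg (- D) = - div_deg D.
Proof. by apply/eqP; rewrite -addr_eq0 -div_degD addNr div_deg0. Qed.

Lemma div_degB D E : div_deg (D - E) = div_deg D - div_deg E.
Proof. by rewrite div_degD div_degN. Qed.

Lemma div_deg_muln D n : div_deg (D *+ n) = div_deg D *+ n.
Proof. by elim: n => [|n IH]; rewrite ?mulr0n ?div_deg0 // !mulrS div_degD IH. Qed.

Lemma div_degU n v : div_deg (<< n *g v >> : divisor) = n * (place_deg v)%:Z.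
Proof.
rewrite (@div_degE _ [:: v]) // ?big_seq1 ?coeffU ?eqxx ?mulr1 // => w.
by rewrite inE coeffU eq_sym => /negPf->; rewrite mulr0.
Qed.

Lemma div_deg_divf S n : uniq S ->
  div_deg (divf S n) = \sum_(v <- S) n v * (place_deg v)%:Z.
Proof.
move=> uS; rewrite (div_degE uS) => [|v /negPf vS]; last by rewrite coeff_divf // vS.
by apply: eq_big_seq => v vS; rewrite coeff_divf // vS.
Qed.

Definition dle D E := forall v, coeff v D <= coeff v E.

Lemma eff_ge0 D v : dle 0 D -> 0 <= coeff v D.
Proof. by move/(_ v); rewrite coeff0. Qed.

Lemma dle_deg D E : dle D E -> div_deg D <= div_deg E.
Proof.
move=> DE; rewrite -subr_ge0 -div_degB /div_deg sumr_ge0 // => v _.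
by rewrite mulr_ge0 // coeffB subr_ge0.
Qed.

Definition posdiv D : divisor := divf (dom D) (fun v => Num.max 0 (coeff v D)).

Lemma coeff_posdiv D v : coeff v (posdiv D) = Num.max 0 (coeff v D).
Proof.
rewrite coeff_divf ?uniq_dom //; case: ifP => // /negbT /coeff_outdom->.
by rewrite maxxx.
Qed.

Notation L D := (riemann_roch_space D).

Lemma LspaceE D : L D = [set x | forall v, vge v (- coeff v D) x].
Proof.
apply/seteqP; split=> x /=.
  case=> [->|H] v; first exact: vge0.
  by apply/orP; right; have := H v; lia.
move=> H; have [->|x0] := eqVneq x 0; [by left|right=> v].
by have := H v; rewrite vgeE //; lia.
Qed.

Lemma subspace_L D : subspace cst (L D).
Proof.
rewrite LspaceE; split=> /=; first by move=> v; apply: vge0.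
  by move=> x y Hx Hy v; apply: vgeD; [apply: Hx|apply: Hy].
by move=> c x cc Hx v; apply: vge_cst => //; apply: Hx.
Qed.

Lemma L_sub D E : dle D E -> L D `<=` L E.
Proof. by rewrite !LspaceE => DE x Hx v; apply: vgeW (Hx v); rewrite lerN2. Qed.

Lemma constant_no_pole f : (forall v, vge v 0 f) -> cst f.
Proof.
move=> Hf; apply: contrapT => nf; have tf := nonconstant_transc hK nf.
have f0 := transc_neq0 tf.
have tfV : transc f^-1.
  apply: (nonconstant_transc hK) => -[a _ af]; apply: nf; exists a^-1 => //.
  by rewrite fmorphV af invrK.
have [v vf] := place_exists hK tfV.
by have := Hf v; rewrite vgeE //; rewrite placeV // in vf; lia.
Qed.

Lemma has_dim_L0 : has_dim cst [set 0] (L (0 : divisor)) 1.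
Proof.
exists (fun=> 1); split.
- by move=> _; rewrite LspaceE => v; rewrite coeff0 oppr0 vge1.
- move=> y; rewrite LspaceE => Hy; exists (fun=> y); split.
    by move=> _; apply: constant_no_pole => v; have := Hy v; rewrite coeff0 oppr0.
  by rewrite big_ord1 mulr1 /= subrr.
- by move=> c cc; rewrite big_ord1 mulr1 /= => c0 i; rewrite ord1.
Qed.

(** The quotient L(E) / L(D) embeds into the local quotient at the support of E - D. *)
Lemma rr_diff D E : dle D E -> exists2 m, has_dim cst (L D) (L E) m &
  m%:Z <= div_deg E - div_deg D.
Proof.
move=> DE; pose S := dom (E - D).
have uS : uniq S by apply: uniq_dom.
have HS v : v \notin S -> coeff v D = coeff v E.
  by move=> /coeff_outdom /eqP; rewrite coeffB subr_eq0 => /eqP.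
have Hn := @has_dim_VS _ _ _ hK S (fun v => - coeff v D) (fun v => - coeff v E) uS
  (fun v _ => ltac:(rewrite lerN2; apply: DE)).
set N := (\sum_(v <- S) _)%N in Hn.
have NE : N%:Z = div_deg E - div_deg D.
  rewrite -div_degB (div_degE uS) => [|v /HS Ev]; last by rewrite coeffB Ev subrr.
  rewrite /N Posz_sum; apply: eq_bigr => v _; rewrite PoszM coeffB; congr (_ * _).
  by have := DE v; lia.
have H : forall n (c : 'I_n -> K), (forall i, L E (c i)) -> free_mod cst (L D) c -> (n <= N)%N.
  move=> n c Ec fc; apply: (has_dim_le hF (subspace_VS _ _) Hn (c := c)).
    by move=> i v vS; have := Ec i; rewrite LspaceE; apply.
  move=> e ce Hs; apply: fc => //; rewrite LspaceE => v.
  case: (boolP (v \in S)) => [vS|/HS ->]; first exact: Hs.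
  have : L E (\sum_i e i * c i).
    by apply: (ss_sum (subspace_L E)) => i _; apply: (ssZ (subspace_L E)).
  by rewrite LspaceE; apply.
have [m mN Hm] := has_dim_bounded hF (subspace_L D) (subspace_L E) H.
by exists m => //; rewrite -NE lez_nat.
Qed.

Lemma L_sub0 D : [set 0] `<=` L D.
Proof. by move=> _ ->; apply: (ss0 (subspace_L D)). Qed.

Lemma has_ell D : has_dim cst [set 0] (L D) (ell D).
Proof.
have D0 : dle 0 (posdiv D) by move=> v; rewrite coeff0 coeff_posdiv le_max lexx.
have DD : dle D (posdiv D) by move=> v; rewrite coeff_posdiv le_max lexx orbT.
have [m Hm _] := rr_diff D0.
have H := has_dimD hF (subspace0 cst) (subspace_L _) (subspace_L _) (@L_sub0 _)
  (L_sub D0) has_dim_L0 Hm.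
have [a [b [Ha _ _]]] := has_dim_sub hF (subspace0 cst) (subspace_L D) (subspace_L _)
  (@L_sub0 _) (L_sub DD) H.
by rewrite /ell (dimE hF (subspace0 _) Ha).
Qed.

Lemma ellE D n : has_dim cst [set 0] (L D) n -> ell D = n.
Proof. by move=> Hn; apply: (dimE hF (subspace0 _) Hn). Qed.

Lemma ell0 : ell (0 : divisor) = 1%N. Proof. exact: ellE has_dim_L0. Qed.

Lemma has_dim_LL D E : dle D E -> exists2 m, has_dim cst (L D) (L E) m & ell E = (ell D + m)%N.
Proof.
move=> DE; have [m Hm _] := rr_diff DE; exists m => //; apply: ellE.
exact: (has_dimD hF (subspace0 cst) (subspace_L _) (subspace_L _) (@L_sub0 _)
  (L_sub DE) (has_ell D) Hm).
Qed.

Lemma ell_le D E : dle D E -> (ell D)%:Z <= (ell E)%:Z <= (ell D)%:Z + (div_deg E - div_deg D).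
Proof.
move=> DE; have [m Hm mb] := rr_diff DE.
have -> : ell E = (ell D + m)%N.
  apply: ellE; exact: (has_dimD hF (subspace0 cst) (subspace_L _) (subspace_L _) (@L_sub0 _)
  (L_sub DE) (has_ell D) Hm).
by rewrite PoszD lerDl lerD2l mb andbT.
Qed.

Lemma ell_eff D : dle 0 D -> (ell D)%:Z <= div_deg D + 1.
Proof. by move=> /ell_le /andP [_]; rewrite ell0 div_deg0 subr0 addrC. Qed.

Lemma free_le_ell D (T : finType) (c : T -> K) : (forall t, L D (c t)) ->
  (forall e : T -> K, (forall i, cst (e i)) -> \sum_i e i * c i = 0 -> forall i, e i = 0) ->
  (#|T| <= ell D)%N.
Proof. by move=> Lc fc; apply: (has_dim_le_fin hF (subspace0 _) (has_ell D) Lc fc). Qed.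

Lemma L_nonzero D : (0 < ell D)%N -> exists2 h, h != 0 & L D h.
Proof.
move=> l0; apply: contrapT => H.
have : has_dim cst [set 0] (L D) 0.
  apply: has_dim0 (@L_sub0 D) _ => x Lx; apply/eqP; apply: contra_notT H => x0.
  by exists x.
by move=> /ellE E; rewrite E in l0.
Qed.

Lemma zeros_enum f : transc f -> exists S, uniq S /\ forall v, v \in S <-> 0 < v f.
Proof.
move=> tf; apply: (@finite_pred_enum _ _ (fdeg f)) => S uS HS.
apply: leq_trans (zeros_bound hK tf uS HS).
rewrite -sum1_size big_seq [X in (_ <= X)%N]big_seq; apply: leq_sum => v /HS vf.
by rewrite muln_gt0 place_deg_gt0 // andbT absz_gt0 gt_eqF.
Qed.

Lemma transcV f : transc f -> transc f^-1.
Proof.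
move=> tf; apply: (nonconstant_transc hK) => -[a _ af].
apply: (transc_nonconstant tf); exists a^-1 => //.
by rewrite fmorphV af invrK.
Qed.

Lemma rationalV f : F(f^-1) = F(f).
Proof.
have H : forall f, F(f^-1) `<=` F(f).
  move=> {}f; have sf := subfield_rational iota f.
  have Hev p : F(f) (ev f^-1 p).
    rewrite (evE _ _ (leqnn _)); apply: sf_sum => // i _.
    apply: (sfM sf); first exact: rational_constant.
    by apply: (sfX _ sf); apply: (sfV sf); apply: rational_gen.
  by move=> _ [p [r [r0 ->]]]; apply: (sf_div sf); apply: Hev.
by apply/seteqP; split; [apply: H|rewrite -{1}[f]invrK; apply: H].
Qed.

Lemma fdegV f : fdeg f^-1 = fdeg f.
Proof. by rewrite /Submission.fdeg rationalV. Qed.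

Lemma zdiv_exists f : transc f -> exists D, (forall v, coeff v D = Num.max 0 (v f)) /\
  div_deg D <= (fdeg f)%:Z.
Proof.
move=> tf; have [S [uS HS]] := zeros_enum tf.
exists (divf S (fun v => v f)); split.
  move=> v; rewrite coeff_divf //; case: ifP => [/HS|/negbT nS]; first by lia.
  by rewrite max_l // leNgt; apply: contra nS => ?; apply/HS.
rewrite div_deg_divf //.
have := zeros_bound hK tf uS (fun v => (HS v).1); rewrite -lez_nat Posz_sum.
apply: le_trans; rewrite le_eqVlt; apply/orP; left; apply/eqP.
by apply: eq_big_seq => v /HS vf; rewrite PoszM gtz0_abs.
Qed.

Lemma L_exists n (u : 'I_n -> K) : exists2 D, dle 0 D & forall i, L D (u i).
Proof.
have H1 x : exists2 D, dle 0 D & L D x.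
  have [cx|/(nonconstant_transc hK) tx] := pselect (cst x).
    exists 0 => //; rewrite LspaceE => v; rewrite coeff0 oppr0.
    by have [a _ <-] := cx; apply: vge_iota.
  have [D [HD _]] := zdiv_exists (transcV tx).
  exists D; first by move=> v; rewrite coeff0 HD le_max lexx.
  rewrite LspaceE => v; rewrite HD; have x0 := transc_neq0 tx.
  by rewrite placeV // vgeE //; lia.
elim: n u => [|n IH] u; first by exists 0 => // -[].
have [D D0 HD] := IH (fun i => u (fintype.lift ord0 i)); have [E E0 HE] := H1 (u ord0).
exists (D + E) => [v|i]; first by rewrite coeffD coeff0 addr_ge0 // eff_ge0.
case: (unliftP ord0 i) => [j ->|->].
  by apply: L_sub (HD j) => v; rewrite coeffD lerDl eff_ge0.
by apply: L_sub HE => v; rewrite coeffD lerDr eff_ge0.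
Qed.

(** The first l + 1 powers of f times a basis of K over F(f) are independent over the constants; C
    accounts for the poles of the basis. *)
Lemma growth f : transc f -> exists2 C : divisor, dle 0 C &
  forall P : divisor, (forall v, coeff v P = Num.max 0 (- v f)) ->
  forall l : nat, (fdeg f * l.+1 <= ell (P *+ l + C)%R)%N.
Proof.
move=> tf; have [u [_ _ fu]] := has_fdeg hK tf.
have [C C0 HC] := L_exists u; exists C => // P HP l.
have f0 := transc_neq0 tf.
rewrite -[X in (X * _)%N]card_ord -[l.+1]card_ord -card_prod.
apply: (@free_le_ell _ _ (fun t : 'I_(fdeg f) * 'I_l.+1 => u t.1 * f ^+ t.2)).
  move=> [i j] /=; rewrite LspaceE => v; have := HC i; rewrite LspaceE => /(_ v).
  rewrite coeffD coeffMn HP opprD addrC => H; apply: vgeM => //.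
  rewrite vgeE ?expf_neq0 // placeX //.
  have := ltn_ord j; move: (v f) (nat_of_ord j) => a b bl; rewrite -mulr_natr natz; nia.
exact: free_powers tf fu.
Qed.

(** The inequality missing from [zdiv_exists] comes from the growth in l of deg f * (l + 1) <= ell
    (D *+ l + C) <= deg D * l + deg C + 1, applied to f^-1. *)
Lemma zdiv_deg f : transc f -> exists2 D, (forall v, coeff v D = Num.max 0 (v f)) &
  div_deg D = (fdeg f)%:Z.
Proof.
move=> tf; have [D [HD degD]] := zdiv_exists tf; exists D => //.
apply/eqP; rewrite eq_le degD /=.
have [C C0 HC] := growth (transcV tf).
have {}HC l : (fdeg f * l.+1 <= ell (D *+ l + C)%R)%N.
  by rewrite -fdegV; apply: HC => v; rewrite HD placeV ?opprK ?(transc_neq0 tf).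
have H l : (fdeg f)%:Z * l.+1%:Z <= div_deg D * l%:Z + div_deg C + 1.
  have : (ell (D *+ l + C)%R)%:Z <= div_deg (D *+ l + C) + 1.
    apply: ell_eff => v; rewrite coeff0 coeffD coeffMn HD addr_ge0 ?mulrn_wge0 ?le_max ?lexx //.
    exact: eff_ge0.
  rewrite div_degD div_deg_muln -mulr_natr natz; apply: le_trans.
  by rewrite -PoszM lez_nat.
rewrite leNgt; apply/negP => lt.
have C1 := dle_deg C0; rewrite div_deg0 in C1.
have H1 := H (`|div_deg C|.+2)%N.
move: (fdeg f) (div_deg D) (div_deg C) lt C1 H1 => a b c; clear; move=> lt c0.
have -> : (`|c|.+2)%:Z = c + 2 by lia.
have -> : (`|c|.+3)%:Z = c + 3 by lia.
by nia.
Qed.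

Lemma pdiv_exists f : f != 0 -> exists2 D, (forall v, coeff v D = v f) & div_deg D = 0.
Proof.
move=> f0; have [[a _ af]|/(nonconstant_transc hK) tf] := pselect (cst f).
  by exists 0; rewrite ?div_deg0 // => v; rewrite coeff0 -af place_iota.
have [D HD dD] := zdiv_deg tf; have [E HE dE] := zdiv_deg (transcV tf).
exists (D - E); last by rewrite div_degB dD dE fdegV subrr.
by move=> v; rewrite coeffB HD HE placeV //; lia.
Qed.

Definition pdiv f : divisor := xget 0 [set D : divisor | forall v, coeff v D = v f].

Lemma coeff_pdiv f v : f != 0 -> coeff v (pdiv f) = v f.
Proof.
move=> f0; rewrite /pdiv; case: xgetP => [D _ //|].
by have [D HD _] := pdiv_exists f0; move/(_ D).
Qed.

Lemma deg_pdiv f : f != 0 -> div_deg (pdiv f) = 0.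
Proof.
move=> f0; have [D HD <-] := pdiv_exists f0; congr div_deg.
by apply: divisor_eq => v; rewrite HD coeff_pdiv.
Qed.

Lemma ell_pdiv D h : h != 0 -> ell (D - pdiv h) = ell D.
Proof.
move=> h0; apply: ellE; apply: (has_dim_iso h0 _ _ (has_ell D)) => x /=.
  by split=> [/eqP|->]; rewrite ?mulr0 // mulf_eq0 (negPf h0) /= => /eqP.
rewrite !LspaceE; have [->|x0] := eqVneq x 0; first by rewrite mulr0; split=> _ v; apply: vge0.
split=> H v; have := H v; rewrite !vgeE ?mulf_neq0 // val_atM // coeffB coeff_pdiv //; lia.
Qed.

Lemma ell_deg_neg D : div_deg D < 0 -> ell D = 0%N.
Proof.
move=> dD; apply/eqP; rewrite -leqn0 leqNgt; apply/negP => /L_nonzero [h h0].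
rewrite LspaceE => Lh; have : dle 0 (D + pdiv h).
  move=> v; rewrite coeff0 coeffD coeff_pdiv //; have := Lh v; rewrite vgeE //; lia.
by move/dle_deg; rewrite div_deg0 div_degD deg_pdiv // addr0 leNgt dD.
Qed.

(** The quantity deg D - ell D increases with D and is bounded on the multiples l P of a pole
    divisor by [growth]. Every effective D lies, up to a principal divisor, below some l P. *)
Lemma riemann_bound : exists g : nat, forall D, div_deg D + 1 - (ell D)%:Z <= g%:Z.
Proof.
have [[f [/(@not_algebraic_transc _ _ iota) tf _]] _] := hK.
have [C C0 HC] := growth tf.
have [P HP dP] := zdiv_deg (transcV tf).
have HP' (v : place) : coeff v P = Num.max 0 (- v f) by rewrite HP placeV ?(transc_neq0 tf).
have {}HC := HC P HP'; rewrite fdegV in dP.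
have degC : 0 <= div_deg C by have := dle_deg C0; rewrite div_deg0.
have Hl l : div_deg P * l%:Z + 1 - (ell (P *+ l)%R)%:Z <= 1 + div_deg C.
  have Pl : dle (P *+ l) (P *+ l + C) by move=> v; rewrite coeffD lerDl eff_ge0.
  have /andP [_] := ell_le Pl; rewrite div_degD addrAC subrr add0r => H1.
  have := HC l; rewrite -lez_nat dP PoszM; nia.
have mono D E : dle D E -> div_deg D - (ell D)%:Z <= div_deg E - (ell E)%:Z.
  by move=> /ell_le /andP [_]; lia.
exists (`|div_deg C|.+1)%N => D.
suff : div_deg (posdiv D) - (ell (posdiv D))%:Z <= div_deg C.
  have DD : dle D (posdiv D) by move=> v; rewrite coeff_posdiv le_max lexx orbT.
  by have := mono _ _ DD; lia.
move: (posdiv D) => {}D.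
wlog D0 : D / dle 0 D.
  move=> H; have DD : dle D (posdiv D) by move=> v; rewrite coeff_posdiv le_max lexx orbT.
  have D0 : dle 0 (posdiv D) by move=> v; rewrite coeff0 coeff_posdiv le_max lexx.
  by have := mono _ _ DD; have := H _ D0; lia.
have fd0 := fdeg_gt0 hK tf.
have dD0 := dle_deg D0; rewrite div_deg0 in dD0.
pose l := (`|div_deg C| + `|div_deg D| + 1)%N.
have [h h0] : exists2 h, h != 0 & L (P *+ l - D) h.
  apply: L_nonzero; rewrite -ltz_nat.
  have PD : dle (P *+ l - D) (P *+ l).
    by move=> v; rewrite coeffB lerBlDr lerDl eff_ge0.
  have /andP [_] := ell_le PD; rewrite div_degB.
  have := Hl l; rewrite dP /l; nia.
rewrite LspaceE => Lh.
have HD : dle (D - pdiv h) (P *+ l).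
  move=> v; have := Lh v; rewrite vgeE // !coeffB coeff_pdiv //; lia.
have := mono _ _ HD; rewrite ell_pdiv // div_degB deg_pdiv // subr0 => /le_trans; apply.
by have := Hl l; rewrite div_deg_muln -mulr_natr natz; lia.
Qed.

Lemma genus_spec : (forall D, div_deg D + 1 - (ell D)%:Z <= (genus iota)%:Z) /\
  exists D, div_deg D + 1 - (ell D)%:Z = (genus iota)%:Z.
Proof.
rewrite /genus; case: xgetP => [g _ //|none]; exfalso.
have [N HN] := riemann_bound.
pose Q n := `[< exists D, div_deg D + 1 - (ell D)%:Z = n%:Z >].
have Q0 : exists n, Q n by exists 0%N; apply/asboolP; exists 0; rewrite ell0 div_deg0.
have Qb n : Q n -> (n <= N)%N by move=> /asboolP [D E]; rewrite -lez_nat -E.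
have [g /asboolP Hg max] := ex_maxnP Q0 Qb.
apply: (none g); split=> // D; have [neg|pos] := ltP (div_deg D + 1 - (ell D)%:Z) 0; first by lia.
rewrite -[X in X <= _]gez0_abs // lez_nat; apply: max; apply/asboolP; exists D.
by rewrite gez0_abs.
Qed.

Notation g := (genus iota).

Lemma riemann D : div_deg D + 1 - g%:Z <= (ell D)%:Z.
Proof. by have := genus_spec.1 D; lia. Qed.

(** A divisor of large degree lies above a translate, by a principal divisor, of some D0 at which
    the genus is attained, and deg - ell is monotone. *)
Lemma riemann_large : exists c : int, forall D, c <= div_deg D -> (ell D)%:Z = div_deg D + 1 - g%:Z.
Proof.
have [_ [D0 HD0]] := genus_spec.
exists (div_deg D0 + g%:Z) => D cD.
have [h h0] : exists2 h, h != 0 & L (D - D0) h.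
  apply: L_nonzero; rewrite -ltz_nat; have := riemann (D - D0); rewrite div_degB; lia.
rewrite LspaceE => Lh.
have HD : dle (D0 - pdiv h) D.
  by move=> v; have := Lh v; rewrite vgeE // !coeffB coeff_pdiv //; lia.
have /andP [_] := ell_le HD; rewrite ell_pdiv // div_degB deg_pdiv // subr0.
by have := riemann D; lia.
Qed.
End Divisors.

(** * The Riemann-Roch theorem *)

Section RiemannRoch.
Variables (Fq : finFieldType) (K : fieldType) (iota : {rmorphism Fq -> K}).
Hypothesis hK : function_field iota.
Notation cst := (constants iota).
Notation place := (place iota).
Notation divisor := (divisor iota).
Notation ev := (ev iota).
Notation transc := (transc iota).
Notation fdeg := (fdeg iota).
Notation "'F(' f )" := (rational_in iota f) (at level 0, format "'F(' f )").
Notation L D := (riemann_roch_space D).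
Notation g := (genus iota).
Implicit Types (v w : place) (S : seq place) (D E : divisor) (f h : K).

Let hF := subfield_constants iota.

Definition VD S D : set K := VS S (fun v => - coeff v D).

Let subspace_VD S D : subspace cst (VD S D). Proof. exact: subspace_VS. Qed.

Let L_VD S D : L D `<=` VD S D.
Proof. by rewrite LspaceE => x Hx v _; apply: Hx. Qed.

(** This is the dimension of A(D1) / (A(D) + L(D1)), with the adeles replaced by elements of K
    constrained at S. When Riemann's equality holds for D1 it is the index of speciality of D. *)
Lemma corank S D D1 : uniq S -> dle D D1 -> (forall v, v \notin S -> coeff v D = coeff v D1) ->
  exists2 N, has_dim cst (addsp (VD S D) (L D1)) (VD S D1) N &
    N%:Z = div_deg D1 - div_deg D - ((ell D1)%:Z - (ell D)%:Z).
Proof.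
move=> uS DD HS.
have [m Hm Em] := has_dim_LL hK DD.
have sub1 : VD S D `<=` addsp (VD S D) (L D1).
  by move=> x Hx; exists x, 0; split; rewrite ?addr0 //; apply: (ss0 (subspace_L D1)).
have VDD : VD S D `<=` VD S D1.
  by move=> x Hx v vS; apply: vgeW (Hx v vS); rewrite lerN2; apply: DD.
have sub2 : addsp (VD S D) (L D1) `<=` VD S D1.
  move=> _ [x [y [Hx Hy ->]]]; apply: (ssD (subspace_VD _ _)); first exact: VDD.
  exact: L_VD.
have hW : subspace cst (addsp (VD S D) (L D1)).
  by apply: subspaceD; [apply: subspace_VD|apply: subspace_L].
have H1 : has_dim cst (VD S D) (addsp (VD S D) (L D1)) m.
  apply: (has_dim_quot Hm (subspace_L D1)).
  - exact: L_VD.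
  - by move=> x Hx; exists 0, x; split; rewrite ?add0r //; apply: (ss0 (subspace_VD S D)).
  - move=> x []; rewrite !LspaceE => H1 H2 v.
    by case: (boolP (v \in S)) => [/H2//|/HS->]; apply: H1.
  - by move=> _ [x [y [Hx Hy ->]]]; exists y, x; rewrite addrC; split.
  - exact: subspace_VD.
have H2 := @has_dim_VS _ _ _ hK S (fun v => - coeff v D) (fun v => - coeff v D1) uS
  (fun v _ => ltac:(rewrite lerN2; apply: DD)).
have [a [N [Ha HN E]]] := has_dim_sub hF (subspace_VD S D) hW (subspace_VD S D1) sub1 sub2 H2.
exists N => //; have am := has_dim_uniq hF (subspace_VD S D) H1 Ha.
have : (a + N)%N%:Z = div_deg D1 - div_deg D.
  rewrite E -div_degB (div_degE (D := D1 - D) uS) => [|v /HS Ev]; last by rewrite coeffB Ev subrr.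
  rewrite Posz_sum; apply: eq_bigr => v _; rewrite PoszM coeffB; congr (_ * _).
  by have := DD v; lia.
by rewrite Em -am; lia.
Qed.

(* Serre duality in disguise: a linear functional on the adelic quotient of
   index i(D) can be multiplied by the elements of L(E). *)
Lemma index_le D E : div_deg D + 1 - g%:Z < (ell D)%:Z ->
  (ell E)%:Z <= (ell (D - E))%:Z - div_deg (D - E) - 1 + g%:Z.
Proof.
move=> iD; have [c Hc] := riemann_large hK.
have [v0 _] : exists v : place, True.
  have [[x [/not_algebraic_transc tx _]] _] := hK.
  by have [v _] := place_exists hK tx; exists v.
(* D1 and D1 - E become so large that Riemann's equality holds for both. Hence N is the index of D,
   positive by assumption, and s is the index of D - E. *)
pose n := (`|c| + `|div_deg D| + `|div_deg E|)%N.
pose D1 := D + << n%:Z *g v0 >>.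
have cD1 v : coeff v D1 = coeff v D + n%:Z * (v0 == v)%:R by rewrite coeffD coeffU.
have DD1 : dle D D1 by move=> v; rewrite cD1; case: (v0 == v); lia.
have degD1 : c <= div_deg D1 /\ c <= div_deg D1 - div_deg E.
  rewrite /D1 div_degD div_degU // /n; have := place_deg_gt0 hK v0; nia.
pose S := undup (v0 :: dom D ++ dom E).
have uS : uniq S by rewrite undup_uniq.
have HS v : v \notin S -> [/\ coeff v D = 0, coeff v E = 0 & v0 == v = false].
  rewrite mem_undup in_cons mem_cat => /norP [/negPf a /norP [b d]].
  by rewrite !coeff_outdom // eq_sym a.
rewrite leNgt; apply/negP => lt_sr.
have [N HN EN] := corank uS DD1 (fun v vS => ltac:(rewrite cD1; case: (HS v vS) => -> _ ->; lia)).
have DE1 : dle (D - E) (D1 - E) by move=> v; rewrite !coeffB lerD2r.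
have [s [a [Va sa fa]] Es] := corank uS DE1 (fun v vS =>
  ltac:(rewrite !coeffB cD1; case: (HS v vS) => -> -> ->; lia)).
have RD1 := Hc D1 degD1.1.
have RDE1 := Hc (D1 - E) ltac:(rewrite div_degB; apply: degD1.2).
have N0 : (0 < N)%N by rewrite -ltz_nat; lia.
have hW : subspace cst (addsp (VD S D) (L D1)).
  by apply: subspaceD; [apply: subspace_VD|apply: subspace_L].
have WV : addsp (VD S D) (L D1) `<=` VD S D1.
  move=> _ [x [y [Hx Hy ->]]]; apply: (ssD (subspace_VD _ _)); last exact: L_VD.
  by move=> v vS; apply: vgeW (Hx v vS); rewrite lerN2; apply: DD1.
have [F [cF linF F0 [y0 Vy0 Fy0]]] := linear_functional hF hW (subspace_VD S D1) WV HN N0.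
have FD x y : VD S D1 x -> VD S D1 y -> F (x + y) = F x + F y.
  by move=> Vx Vy; have := linF 1 x y (sf1 hF) Vx Vy; rewrite !mul1r.
have FZ e x : cst e -> VD S D1 x -> F (e * x) = e * F x.
  move=> ce Vx; have V0 := ss0 (subspace_VD S D1).
  by have := linF e x 0 ce Vx V0; rewrite !addr0 (F0 0) ?addr0 //; apply: (ss0 hW).
have Fsum (I : finType) (x : I -> K) : (forall i, VD S D1 (x i)) -> F (\sum_i x i) = \sum_i F (x i).
  move=> Vx; have : VD S D1 (\sum_i x i) /\ F (\sum_i x i) = \sum_i F (x i); last by case.
  elim/big_rec2: _ => [|i u u' _ [Vu Eu]].
    by split; [apply: (ss0 (subspace_VD S D1))|apply: F0; apply: (ss0 hW)].
  by split; [apply: (ssD (subspace_VD S D1))|rewrite FD // Eu].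
have VM h x : L E h -> VD S (D1 - E) x -> VD S D1 (h * x).
  rewrite LspaceE => Lh Vx v vS.
  have -> : - coeff v D1 = - coeff v E + - coeff v (D1 - E) by rewrite coeffB; lia.
  by apply: vgeM; [apply: Lh|apply: Vx].
have WM h x : L E h -> addsp (VD S (D - E)) (L (D1 - E)) x -> F (h * x) = 0.
  move=> Lh [x1 [x2 [V1 V2 ->]]]; rewrite mulrDr; apply: F0.
  move: Lh V2; rewrite !LspaceE => Lh V2; exists (h * x1), (h * x2); split=> //.
    move=> v vS; have -> : - coeff v D = - coeff v E + - coeff v (D - E) by rewrite coeffB; lia.
    by apply: vgeM; [apply: Lh|apply: V1].
  move=> v; have -> : - coeff v D1 = - coeff v E + - coeff v (D1 - E) by rewrite coeffB; lia.
  by apply: vgeM; [apply: Lh|apply: V2].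
have [b [Lb _ fb]] := has_ell hK E.
have rs : (s < ell E)%N by rewrite -ltz_nat; lia.
(* As ell E > s, some nonzero h in L(E) makes F (h * a_i) vanish for all s basis vectors a_i. *)
have [e [ce [j ej] He]] := homog_system hF (A := fun j i => F (b j * a i))
  (fun j i => cF _ (VM _ _ (Lb j) (Va i))) rs.
pose h := \sum_j e j * b j.
have Lh : L E h by apply: (ss_sum (subspace_L E)) => i _; apply: (ssZ (subspace_L E)).
have h0 : h != 0 by apply: contra_neq ej => h0; apply: fb.
have Fha i : F (h * a i) = 0.
  rewrite -[RHS](He i) /h mulr_suml Fsum => [|l].
    by apply: eq_bigr => l _; rewrite -mulrA FZ //; apply: VM.
  by rewrite -mulrA; apply: (ssZ (subspace_VD S D1)) => //; apply: VM.
have Fh x : VD S (D1 - E) x -> F (h * x) = 0.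
  move=> Vx; have [c' [cc' Wx]] := sa x Vx.
  have Vs : VD S (D1 - E) (\sum_i c' i * a i).
    by apply: (ss_sum (subspace_VD _ _)) => i _; apply: (ssZ (subspace_VD _ _)).
  rewrite -(subrK (\sum_i c' i * a i) x) mulrDr FD; [|apply: VM => //|exact: VM].
    rewrite (WM _ _ Lh Wx) add0r mulr_sumr Fsum => [|i]; last first.
      by rewrite mulrCA; apply: (ssZ (subspace_VD S D1)) => //; apply: VM.
    rewrite big1 // => i _; rewrite mulrCA FZ ?Fha ?mulr0 //; exact: VM.
  exact: (ssB hF (subspace_VD _ _)).
have Ev v : 0 <= coeff v E + v h.
  by move: Lh; rewrite LspaceE => /(_ v); rewrite vgeE //; lia.
(* G is the part of (h) + E inside S. Since F kills h * VD S (D1 - E), it kills VD S (D1 - G). As D1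
   - G is still large, this space and L(D1) together fill VD S D1, so F = 0. *)
pose G := divf S (fun v => coeff v E + v h).
have cG v : coeff v G = if v \in S then coeff v E + v h else 0 by rewrite coeff_divf.
have degG : div_deg G <= div_deg E.
  rewrite -[X in _ <= X]addr0 -(deg_pdiv hK h0) -div_degD; apply: dle_deg => v.
  by rewrite cG coeffD coeff_pdiv //; case: ifP.
have D2D1 : dle (D1 - G) D1.
  by move=> v; rewrite coeffB cG; case: ifP => _; rewrite ?subr0 // lerBlDr lerDl.
have [N2 HN2 EN2] := corank uS D2D1 (fun v vS =>
  ltac:(rewrite coeffB cG (negPf vS) subr0; reflexivity)).
have RD2 := Hc (D1 - G) ltac:(rewrite div_degB; move: degD1.2 degG; lia).
have N20 : N2 = 0%N by apply/eqP; rewrite -eqz_nat; apply/eqP; rewrite EN2; lia.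
rewrite N20 in HN2.
have hW2 : subspace cst (addsp (VD S (D1 - G)) (L D1)).
  by apply: subspaceD; [apply: subspace_VD|apply: subspace_L].
have [u [l [Vu Ll y0E]]] := has_dim_eq0 (ss0 hW2) hW2 HN2 Vy0.
have Vuh : VD S (D1 - E) (u / h).
  move=> v vS; have -> : - coeff v (D1 - E) = - coeff v (D1 - G) + v h^-1.
    by rewrite !coeffB cG vS placeV //; lia.
  by apply: vgeM; [apply: Vu|rewrite vgeE ?invr_eq0].
case/eqP: Fy0; rewrite y0E FD; last by apply: L_VD.
- rewrite (F0 l) ?addr0; first by have := Fh _ Vuh; rewrite mulrC divfK.
  by exists 0, l; split; rewrite ?add0r //; apply: (ss0 (subspace_VD S D)).
- by move=> v vS; apply: vgeW (Vu v vS); rewrite lerN2; apply: D2D1.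
Qed.

(** If D were special, [index_le] with E of degree above deg D, where ell (D - E) = 0, and Riemann's
    inequality for E would give deg D <= 2g - 2. *)
Theorem riemann_roch_large D : 2 * g%:Z - 1 <= div_deg D ->
  (ell D)%:Z = div_deg D + 1 - g%:Z.
Proof.
move=> dD; apply/le_anti; rewrite (riemann hK) andbT leNgt; apply/negP => iD.
have [v0 _] : exists v : place, True.
  have [[x [/not_algebraic_transc tx _]] _] := hK.
  by have [v _] := place_exists hK tx; exists v.
pose E : divisor := << (`|div_deg D| + 2 * g + 1)%N%:Z *g v0 >>.
have dE : div_deg D < div_deg E.
  by rewrite div_degU //; have := place_deg_gt0 hK v0; nia.
have E0 : ell (D - E) = 0%N by apply: (ell_deg_neg hK); rewrite div_degB; lia.
have := index_le E iD; rewrite E0 div_degB.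
by have := riemann hK E; lia.
Qed.
End RiemannRoch.

(** * Frobenius powers and conjugates over a finite field *)

Section FiniteField.
Variable F : finFieldType.
Let q := #|F|.

Lemma card_finField_pow : exists p e, [/\ prime p, p \in [pchar F], q = (p ^ e)%N & (0 < e)%N].
Proof.
have [p p_pr pF] := finPcharP F.
have E := card_pprimeChar pF; exists p, (logn p q); split=> //.
rewrite lt0n; apply/eqP => e0; have : (1 < q)%N by apply: finNzRing_gt1.
by rewrite /q E -/q e0 expn0.
Qed.

Variables (K : fieldType) (j : {rmorphism F -> K}).

Lemma card_pnat_pchar i : [pchar K].-nat (q ^ i)%N.
Proof.
have [p [e [p_pr pF -> _]]] := card_finField_pow; rewrite -expnM pnatX; apply/orP; left.
by rewrite pnatE //; apply: rmorph_pchar j _ pF.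
Qed.

Lemma exprD_card x y i : (x + y) ^+ (q ^ i) = x ^+ (q ^ i) + y ^+ (q ^ i) :> K.
Proof. exact/exprDn_pchar/card_pnat_pchar. Qed.

Lemma exprN_card x i : (- x) ^+ (q ^ i) = - x ^+ (q ^ i) :> K.
Proof. exact/exprNn_pchar/card_pnat_pchar. Qed.

Lemma exprB_card x y i : (x - y) ^+ (q ^ i) = x ^+ (q ^ i) - y ^+ (q ^ i) :> K.
Proof. by rewrite exprD_card exprN_card. Qed.

Lemma expr_card_iota a i : j a ^+ (q ^ i) = j a.
Proof.
rewrite -rmorphXn; congr (j _); elim: i => [|i IH]; first by rewrite expn0 expr1.
by rewrite expnSr exprM IH expf_card.
Qed.

Lemma horner_card (P : {poly F}) x i : (map_poly j P).[x ^+ (q ^ i)] = (map_poly j P).[x] ^+ (q ^ i).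
Proof.
elim/poly_ind: P => [|P c IH].
  by rewrite rmorph0 !horner0 expr0n expn_eq0 (gtn_eqF (ltnW (finNzRing_gt1 F))).
by rewrite rmorphD rmorphM /= map_polyX map_polyC !hornerMXaddC exprD_card exprMn IH expr_card_iota.
Qed.

Lemma expr_card_inj i : injective (fun x : K => x ^+ (q ^ i)).
Proof.
move=> x y /= /eqP; rewrite -subr_eq0 -exprB_card expf_eq0 => /andP [_].
by rewrite subr_eq0 => /eqP.
Qed.

Lemma conjugates_bound (P : {poly F}) x r :
  (forall i, (0 < i < r)%N -> x ^+ (q ^ i) != x) -> P != 0 -> (map_poly j P).[x] = 0 ->
  (r < size P)%N.
Proof.
move=> Hx P0 Px.
have := @max_poly_roots K (map_poly j P) [seq x ^+ (q ^ i) | i <- iota 0 r].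
rewrite size_map size_iota size_map_poly => -> //; first by rewrite map_poly_eq0.
  apply/allP => _ /mapP [i _ ->]; rewrite /root horner_card Px expr0n expn_eq0.
  by rewrite (gtn_eqF (ltnW (finNzRing_gt1 F))).
rewrite map_inj_in_uniq ?iota_uniq // => a b.
wlog ab : a b / (a <= b)%N.
  by move=> H; case/orP: (leq_total a b) => [|ab] *; [apply: H|apply/esym/H].
rewrite !mem_iota !add0n => /= ar br.
rewrite -(subnK ab) expnD exprM => /expr_card_inj /esym /eqP E.
apply/eqP; rewrite eq_sym subnK // eqn_leq ab andbT leqNgt; apply/negP => lt.
by move: E; apply/negP/Hx; rewrite subn_gt0 lt (leq_ltn_trans (leq_subr _ _) br).
Qed.
End FiniteField.

(** * Residue fields of places *)

Section ResidueField.
Variables (Fq : finFieldType) (K : fieldType) (iota : {rmorphism Fq -> K}).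
Notation cst := (constants iota).
Notation place := (place iota).

Definition resf (hK : function_field iota) (v : place) := 'rV[Fq]_(place_deg v).

Section Fix.
Variables (hK : function_field iota) (v : place).
Notation k := (resf hK v).

HB.instance Definition _ := GRing.Zmodule.on k.
HB.instance Definition _ := Finite.on k.

Let r := place_deg v.

Lemma residue_coords_exist : exists bc : ('I_r -> K) * (K -> k),
  [/\ forall i, vge v 0 (bc.1 i),
      forall y, vge v 0 y -> vge v 1 (y - \sum_i iota (bc.2 y ord0 i) * bc.1 i) &
      forall a : k, vge v 1 (\sum_i iota (a ord0 i) * bc.1 i) -> a = 0].
Proof.
have [b [Ob sb fb]] := has_place_deg hK v.
have /choice [c Hc] : forall y, exists a : k, vge v 0 y ->
   vge v 1 (y - \sum_i iota (a ord0 i) * b i).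
  move=> y; have [Oy|] := boolP (vge v 0 y); last by exists 0.
  have [c [cc Wc]] := sb y Oy.
  have /choice [a Ha] : forall i, exists a, iota a = c i by move=> i; have [a _] := cc i; exists a.
  exists (\row_i a i) => _; congr (vge v 1 (y - _)): Wc.
  by apply: eq_bigr => i _; rewrite mxE Ha.
exists (b, c); split=> //= a Ha; apply/rowP => i; rewrite mxE.
apply/eqP; rewrite -(fmorph_eq0 iota); apply/eqP.
by apply: (fb (fun i => iota (a ord0 i))) => // l; apply: constant_iota.
Qed.

Let bc := sval (cid residue_coords_exist).
Let lft (a : k) : K := \sum_i iota (a ord0 i) * bc.1 i.
Definition res : K -> k := bc.2.

Let Olft a : vge v 0 (lft a).
Proof.
have [H _ _] := svalP (cid residue_coords_exist).
by apply: vge_sum => i _; apply: vge0M; [apply: vge_iota|apply: H].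
Qed.

Let lft_res y : vge v 0 y -> vge v 1 (y - lft (res y)).
Proof. by have [_ H _] := svalP (cid residue_coords_exist); apply: H. Qed.

Let lftB a b : lft (a - b) = lft a - lft b.
Proof.
rewrite /lft -sumrB; apply: eq_bigr => i _.
by rewrite !mxE rmorphB mulrBl.
Qed.

Let lft_inj a b : vge v 1 (lft a - lft b) -> a = b.
Proof.
have [_ _ H] := svalP (cid residue_coords_exist).
by rewrite -lftB => /H/eqP; rewrite subr_eq0 => /eqP.
Qed.

Let res_uniq y a : vge v 0 y -> vge v 1 (y - lft a) -> res y = a.
Proof.
move=> Oy H; apply: lft_inj.
have -> : lft (res y) - lft a = (y - lft a) - (y - lft (res y)) by ring.
by apply: vgeB => //; apply: lft_res.
Qed.

Lemma resP y y' : vge v 0 y -> vge v 0 y' -> (res y == res y') = vge v 1 (y - y').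
Proof.
move=> Oy Oy'; apply/eqP/idP => [E|H].
  have -> : y - y' = (y - lft (res y)) - (y' - lft (res y)) by ring.
  by apply: vgeB; [|rewrite E]; apply: lft_res.
apply: res_uniq => //; have -> : y - lft (res y') = (y - y') + (y' - lft (res y')) by ring.
by apply: vgeD => //; apply: lft_res.
Qed.

Lemma res_surj a : exists2 y, vge v 0 y & res y = a.
Proof. by exists (lft a) => //; apply: res_uniq; rewrite ?subrr ?vge0. Qed.

Lemma resD x y : vge v 0 x -> vge v 0 y -> res (x + y) = res x + res y.
Proof.
move=> Ox Oy; apply: res_uniq; first exact: vgeD.
have -> : x + y - lft (res x + res y) = (x - lft (res x)) + (y - lft (res y)).
  have -> : lft (res x + res y) = lft (res x) + lft (res y).
    by rewrite -[in RHS](addrK (res y) (res x)) lftB subrK.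
  by ring.
by apply: vgeD; apply: lft_res.
Qed.

Lemma res0 : res 0 = 0.
Proof.
apply: res_uniq; rewrite ?vge0 // (_ : lft 0 = 0) ?subrr ?vge0 //.
by rewrite /lft big1 // => i _; rewrite mxE rmorph0 mul0r.
Qed.

Definition resmul (a b : k) : k := res (lft a * lft b).

Let resmulE x y : vge v 0 x -> vge v 0 y -> resmul (res x) (res y) = res (x * y).
Proof.
move=> Ox Oy; apply/eqP; rewrite resP; try exact: vgeM0.
have -> : lft (res x) * lft (res y) - x * y =
  - ((x - lft (res x)) * lft (res y) + x * (y - lft (res y))) by ring.
rewrite vgeN; apply: vgeD; [apply: vgeM0 => //|apply: vge0M => //]; exact: lft_res.
Qed.

Let resmulA : associative resmul.
Proof.
move=> a b c; have [x Ox <-] := res_surj a; have [y Oy <-] := res_surj b; have [z Oz <-] := res_surj c.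
by rewrite !resmulE ?mulrA //; apply: vgeM0.
Qed.

Let resmulC : commutative resmul.
Proof. by move=> a b; rewrite /resmul mulrC. Qed.

Let resmul1 : left_id (res 1) resmul.
Proof. by move=> a; have [x Ox <-] := res_surj a; rewrite resmulE ?vge1 ?mul1r. Qed.

Let resmulDl : left_distributive resmul +%R.
Proof.
move=> a b c; have [x Ox <-] := res_surj a; have [y Oy <-] := res_surj b; have [z Oz <-] := res_surj c.
by rewrite -resD // !resmulE ?vgeD // -resD ?mulrDl //; apply: vgeM0.
Qed.

Let res1_neq0 : res 1 != 0.
Proof. by rewrite -res0 resP ?vge1 ?vge0 // subr0 vgeE ?oner_eq0 // place1. Qed.

HB.instance Definition _ :=
  GRing.Zmodule_isComNzRing.Build k resmulA resmulC resmul1 resmulDl res1_neq0.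

Let resinv (a : k) : k := if a == 0 then 0 else res (lft a)^-1.

Let resmulV a : a != 0 -> resinv a * a = 1.
Proof.
move=> a0; rewrite /resinv (negPf a0); have [x Ox xa] := res_surj a.
have la : res (lft a) = a by apply: res_uniq; rewrite // subrr vge0.
have l0 : lft a != 0 by apply: contraNneq a0 => l0; rewrite -la l0 res0.
have vl : v (lft a) = 0.
  apply/eqP; rewrite eq_le -!vgeE // ?Olft andbT leNgt; apply: contra a0 => vl.
  by rewrite -la -res0 resP ?Olft ?vge0 // subr0 vgeE // -gtz0_ge1.
have OV : vge v 0 (lft a)^-1 by rewrite vgeE ?invr_eq0 // placeV // vl.
by rewrite -[X in _ * X]la; apply: etrans (resmulE OV (Olft a)) _; rewrite mulVf.
Qed.

Let resinv0 : resinv 0 = 0. Proof. by rewrite /resinv eqxx. Qed.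

HB.instance Definition _ := GRing.ComNzRing_isField.Build k resmulV resinv0.

Lemma resM x y : vge v 0 x -> vge v 0 y -> res (x * y) = res x * res y.
Proof. by move=> Ox Oy; rewrite -resmulE. Qed.

Lemma res_eq0 x : vge v 0 x -> (res x == 0) = vge v 1 x.
Proof. by move=> Ox; rewrite -res0 resP ?vge0 // subr0. Qed.

Lemma resX x n : vge v 0 x -> res (x ^+ n) = res x ^+ n.
Proof.
move=> Ox; elim: n => [|n IH]; first by rewrite !expr0.
by rewrite !exprS resM ?IH //; apply: vge0X.
Qed.

Lemma card_resf : #|{: k}| = (#|Fq| ^ place_deg v)%N.
Proof. by rewrite card_mx mul1n. Qed.

Definition res_iota (a : Fq) : k := res (iota a).

Lemma res_iota_zmod : zmod_morphism res_iota.
Proof.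
move=> a b; apply/eqP; rewrite eq_sym subr_eq -resD ?vge_iota // -rmorphD.
by rewrite subrK.
Qed.

Lemma res_iota_monoid : monoid_morphism res_iota.
Proof.
split; first by rewrite /res_iota rmorph1.
by move=> a b; rewrite /res_iota rmorphM resM ?vge_iota.
Qed.

HB.instance Definition _ := GRing.isZmodMorphism.Build Fq k res_iota res_iota_zmod.
HB.instance Definition _ := GRing.isMonoidMorphism.Build Fq k res_iota res_iota_monoid.

Lemma res_ev f p : vge v 0 f -> res (ev iota f p) = (map_poly res_iota p).[res f].
Proof.
move=> Of; elim/poly_ind: p => [|p c IH].
  by rewrite ev0 res0 rmorph0 horner0.
rewrite evD evM evX evC resD ?resM ?vge_ev ?vge_iota //; last first.
  by apply: vgeM0 => //; apply: vge_ev.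
by rewrite rmorphD rmorphM /= map_polyX map_polyC hornerMXaddC IH.
Qed.

Lemma vge_fermat y : vge v 0 y -> vge v 1 (y ^+ (#|Fq| ^ place_deg v) - y).
Proof.
move=> Oy; rewrite -resP //; last exact: vge0X.
by rewrite resX // -card_resf; apply/eqP; apply: expf_card.
Qed.

Lemma resf_fixed_card d : (0 < d)%N -> (forall a : k, a ^+ (#|Fq| ^ d) = a) -> (place_deg v <= d)%N.
Proof.
move=> d0 H.
have q1 : (1 < #|Fq|)%N by apply: finNzRing_gt1.
have Q1 : (1 < #|Fq| ^ d)%N by rewrite -(exp1n d) ltn_exp2r.
have sP : size ('X^(#|Fq| ^ d) - 'X : {poly k}) = (#|Fq| ^ d).+1.
  by rewrite size_polyDl ?size_polyXn // size_polyN size_polyX ltnS.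
have := @max_poly_roots k ('X^(#|Fq| ^ d) - 'X) (enum k).
rewrite -cardE card_resf sP ltnS leq_exp2l // => -> //; rewrite ?enum_uniq //.
  by rewrite -size_poly_eq0 sP.
by apply/allP => a _; rewrite /root !hornerE H subrr.
Qed.

(** Otherwise every element is a root of some X^(q^i) - X with 0 < i < deg v, but the sum of these
    degrees is less than q^(deg v). *)
Lemma resf_exists_generator : exists a : k, forall i, (0 < i < place_deg v)%N -> a ^+ (#|Fq| ^ i) != a.
Proof.
apply: contrapT => H.
have q1 : (1 < #|Fq|)%N by apply: finNzRing_gt1.
pose P : {poly k} := \prod_(i < place_deg v | (0 < i)%N) ('X^(#|Fq| ^ i) - 'X).
have sP1 (i : nat) : (0 < i)%N -> size ('X^(#|Fq| ^ i) - 'X : {poly k}) = (#|Fq| ^ i).+1.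
  move=> i0; have Q1 : (1 < #|Fq| ^ i)%N by rewrite -(exp1n i) ltn_exp2r.
  by rewrite size_polyDl ?size_polyXn // size_polyN size_polyX ltnS.
have P0 : P != 0.
  by apply/prodf_neq0 => i i0; rewrite -size_poly_eq0 sP1.
have sP : (size P <= #|Fq| ^ place_deg v)%N.
  rewrite size_prod => [|i i0]; last by rewrite -size_poly_eq0 sP1.
  rewrite (eq_bigr (fun i : 'I__ => (#|Fq| ^ i + 1)%N)); last by move=> i i0; rewrite sP1 // addn1.
  rewrite big_split /= sum1_card -addSn addnK.
  have : (\sum_(i < place_deg v) #|Fq| ^ i < #|Fq| ^ place_deg v)%N.
    elim: (place_deg v) => [|n IH]; first by rewrite big_ord0.
    rewrite big_ord_recr expnS /=; apply: (@leq_trans (#|Fq| ^ n + #|Fq| ^ n)%N).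
      by rewrite -addSn leq_add2r.
    by rewrite addnn -mul2n leq_mul2r q1 orbT.
  apply: leq_ltn_trans; rewrite [X in (_ <= X)%N](bigID (fun i : 'I__ => 0 < i)%N) /=.
  exact: leq_addr.
have := @max_poly_roots k P (enum k) P0.
rewrite -cardE card_resf => /(_ _ (enum_uniq _)) => H1.
suff : all (root P) (enum k) by move=> /H1 /leq_trans /(_ sP); rewrite ltnn.
apply/allP => a _; have /existsNP [i /not_implyP [/andP [i0 ir] /negP]] : ~ forall i, (0 < i < place_deg v)%N -> a ^+ (#|Fq| ^ i) != a.
  by move=> Ha; apply: H; exists a.
rewrite negbK => /eqP ai; rewrite /root horner_prod; apply/eqP.
by apply/eqP; rewrite prodf_seq_eq0; apply/hasP; exists (Ordinal ir); rewrite ?mem_index_enum //= i0 !hornerE ai subrr eqxx.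
Qed.
End Fix.

Variable hK : function_field iota.

Lemma frobenius_gcd (F : finFieldType) (x : F) (Q : nat) m n : (forall i, x ^+ (Q ^ (m * i)) = x) ->
  (forall i, x ^+ (Q ^ (n * i)) = x) -> (0 < m)%N -> x ^+ (Q ^ gcdn m n) = x.
Proof.
move=> Hm Hn m0; have [a b E _] := egcdnP n m0.
by rewrite -[in LHS](Hn b) -exprM -expnD [(n * b)%N]mulnC -E mulnC Hm.
Qed.

Lemma place_deg_dvdn (v : place) n : (0 < n)%N ->
  (forall y, vge v 0 y -> vge v 1 (y ^+ (#|Fq| ^ n) - y)) -> (place_deg v %| n)%N.
Proof.
move=> n0 H; have d0 := place_deg_gt0 hK v.
have Hn (a : resf hK v) i : a ^+ (#|Fq| ^ (n * i)) = a.
  have [y Oy <-] := res_surj a; elim: i => [|i IH]; first by rewrite muln0 expn0 expr1.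
  rewrite mulnS expnD exprM -resX //.
  have -> : res hK v (y ^+ (#|Fq| ^ n)) = res hK v y by apply/eqP; rewrite resP ?H //; apply: vge0X.
  exact: IH.
have Hd (a : resf hK v) i : a ^+ (#|Fq| ^ (place_deg v * i)) = a.
  elim: i => [|i IH]; first by rewrite muln0 expn0 expr1.
  by rewrite mulnS expnD exprM -(card_resf hK) expf_card IH.
have := @resf_fixed_card hK v (gcdn (place_deg v) n).
rewrite gcdn_gt0 d0 => /(_ isT (fun a => frobenius_gcd (Hd a) (Hn a) d0)) le.
apply/gcdn_idPl/eqP; rewrite eqn_leq le andbT.
exact: dvdn_leq (dvdn_gcdl _ _).
Qed.

Lemma vge_fermat_dvdn (v : place) n y : (place_deg v %| n)%N -> vge v 0 y -> vge v 1 (y ^+ (#|Fq| ^ n) - y).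
Proof.
move=> /dvdnP [m ->] Oy; rewrite -(resP hK) //; last exact: vge0X.
rewrite resX //; apply/eqP; elim: m => [|m IH]; first by rewrite mul0n expn0 expr1.
by rewrite mulSn expnD exprM -(card_resf hK) expf_card.
Qed.
End ResidueField.

(** * Counting effective divisors *)

Lemma size_partition (T U : eqType) (s : seq T) (t : seq U) (f : T -> U) : uniq t ->
  (forall x, x \in s -> f x \in t) -> size s = (\sum_(u <- t) count (fun x => f x == u) s)%N.
Proof.
move=> ut st; rewrite (eq_bigr (fun u => \sum_(x <- s) (f x == u))%N); last first.
  by move=> u _; rewrite -sum1_count big_mkcond; apply: eq_bigr => x _; case: (_ == _).
rewrite exchange_big /= -sum1_size; apply: eq_big_seq => x /st xt.
rewrite (eq_bigr (fun u => if f x == u then 1 else 0)%N); last by move=> u _; case: (_ == _).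
rewrite -big_mkcond sum1_count (eq_count (a2 := pred1 (f x))) ?count_uniq_mem ?xt //.
Qed.

Lemma card_cst_neq0 (F : finFieldType) : size [seq a <- enum F | a != 0] = (#|F| - 1)%N.
Proof.
rewrite size_filter.
rewrite cardE -[X in (X - _)%N](count_predC (fun a : F => a != 0)).
have -> : count (predC (fun a : F => a != 0)) (enum F) = count (pred1 0) (enum F).
  by apply: eq_count => a /=; rewrite negbK.
by rewrite count_uniq_mem ?enum_uniq // mem_enum addnK.
Qed.

Section Counting.
Variables (Fq : finFieldType) (K : fieldType) (iota : {rmorphism Fq -> K}).
Hypothesis hK : function_field iota.
Notation cst := (constants iota).
Notation place := (place iota).
Notation divisor := (divisor iota).
Notation ev := (ev iota).
Notation transc := (transc iota).
Notation fdeg := (fdeg iota).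
Notation "'F(' f )" := (rational_in iota f) (at level 0, format "'F(' f )").
Notation L D := (riemann_roch_space D).
Notation g := (genus iota).
Implicit Types (v w : place) (S : seq place) (D E : divisor) (f h : K).

Let hF := subfield_constants iota.
Notation q := #|Fq|.

Lemma card_gt1 : (1 < q)%N. Proof. exact: finNzRing_gt1. Qed.

Lemma transc_card_pow x Q : transc x -> (1 < Q)%N -> transc (x ^+ Q - x).
Proof.
move=> tx Q1; apply: (nonconstant_transc hK) => -[a _ ax].
have : ev x ('X^Q - 'X - a%:P) = 0 by rewrite !evB evXn evX evC ax subrr.
move/tx => /(congr1 (fun p : {poly Fq} => p`_Q)).
rewrite !coefB coefXn coefX coefC eqxx coef0 (gtn_eqF Q1) (gtn_eqF (ltnW Q1)) !subr0.
by move/eqP; rewrite oner_eq0.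
Qed.

(** A place of degree at most n is a pole of x or, as its degree divides n!, a zero of x^(q^(n!)) -
    x. *)
Lemma places_finite n : exists S, uniq S /\ forall v, v \in S <-> (place_deg v <= n)%N.
Proof.
have [[x [/not_algebraic_transc tx _]] _] := hK.
have Q1 : (1 < q ^ n`!)%N by rewrite -(exp1n n`!) ltn_exp2r ?fact_gt0 ?card_gt1.
have [S1 [_ HS1]] := zeros_enum hK (transc_card_pow tx Q1).
have [S2 [_ HS2]] := zeros_enum hK (transcV hK tx).
exists (undup [seq v <- S1 ++ S2 | (place_deg v <= n)%N]); split; first exact: undup_uniq.
move=> v; rewrite mem_undup mem_filter mem_cat; split=> [/andP []//|vn].
rewrite vn /=; apply/orP; have [xv|xv] := ltP (v x) 0.
  by right; apply/HS2; rewrite placeV ?(transc_neq0 tx) //; lia.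
left; apply/HS1; rewrite gtz0_ge1 -vgeE ?(transc_neq0 (transc_card_pow tx Q1)) //.
apply: (vge_fermat_dvdn hK); first by apply: dvdn_fact; rewrite vn (place_deg_gt0 hK).
by rewrite vgeE ?(transc_neq0 tx).
Qed.

Definition plist n : seq place := sval (cid (places_finite n)).
Lemma plist_uniq n : uniq (plist n).
Proof. by have [] := svalP (cid (places_finite n)). Qed.
Lemma mem_plist n v : (v \in plist n) = (place_deg v <= n)%N.
Proof. by have [_ /(_ v) H] := svalP (cid (places_finite n)); apply/idP/idP => /H. Qed.

(* The number of points of X over the extension of degree n of Fq. *)
Definition Npt n : nat := (\sum_(v <- plist n | place_deg v %| n) place_deg v)%N.

Lemma eff_coeff_le D v n : dle 0 D -> div_deg D = n%:Z -> coeff v D * (place_deg v)%:Z <= n%:Z.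
Proof.
move=> D0 <-; have -> : coeff v D * (place_deg v)%:Z = div_deg (<< coeff v D *g v >> : divisor) by rewrite div_degU.
apply: dle_deg => w; rewrite coeffU.
by case: eqVneq => [->|_]; rewrite ?mulr1 // mulr0 eff_ge0.
Qed.

Lemma eff_coeff_small D v n : dle 0 D -> div_deg D = n%:Z -> (n < place_deg v)%N -> coeff v D = 0.
Proof.
move=> D0 dD nv; have := eff_coeff_le v D0 dD; have := eff_ge0 v D0; nia.
Qed.

Lemma eff_degE D n : dle 0 D -> div_deg D = n%:Z ->
  n = (\sum_(v <- plist n) `|coeff v D| * place_deg v)%N.
Proof.
move=> D0 dD; apply/eqP; rewrite -eqz_nat -dD Posz_sum (@div_degE _ _ _ D (plist n)) ?plist_uniq //.
  by apply/eqP/eq_bigr => v _; rewrite PoszM gez0_abs ?eff_ge0.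
by move=> v; rewrite mem_plist -ltnNge; apply: eff_coeff_small.
Qed.

Lemma effective_finite n : exists s : seq divisor, uniq s /\
  forall D, D \in s <-> (dle 0 D /\ div_deg D = n%:Z).
Proof.
pose m := size (plist n).
pose code D : m.-tuple 'I_n.+1 := [tuple of [seq inord `|coeff v D| | v <- in_tuple (plist n)]].
apply: (@finite_pred_enum _ _ #|{: m.-tuple 'I_n.+1}|) => s us Hs.
rewrite -(size_map code) -(card_uniqP _) ?max_card // map_inj_in_uniq // => D E /Hs [D0 dD] /Hs [E0 dE].
move=> /(congr1 val) /= /eq_in_map H; apply: divisor_eq => v.
have [vn|nv] := leqP (place_deg v) n; last by rewrite (eff_coeff_small D0 dD nv) (eff_coeff_small E0 dE nv).
have := H v; rewrite mem_plist vn => /(_ isT) /(congr1 val) /=.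
have aux G : dle 0 G -> div_deg G = n%:Z -> (`|coeff v G| < n.+1)%N.
  move=> G0 dG; have := eff_coeff_le v G0 dG; have := eff_ge0 v G0.
  have := place_deg_gt0 hK v; nia.
rewrite !inordK ?aux //; have := eff_ge0 v D0; have := eff_ge0 v E0; lia.
Qed.

Definition elist n : seq divisor := sval (cid (effective_finite n)).
Lemma elist_uniq n : uniq (elist n).
Proof. by have [] := svalP (cid (effective_finite n)). Qed.
Lemma mem_elist n D : D \in elist n <-> (dle 0 D /\ div_deg D = n%:Z).
Proof. by have [_ H] := svalP (cid (effective_finite n)). Qed.

Definition Aeff n : nat := size (elist n).

Lemma Aeff0 : Aeff 0 = 1%N.
Proof.
rewrite /Aeff; have : perm_eq (elist 0) [:: 0].
  apply: uniq_perm; rewrite ?elist_uniq // => D; rewrite inE; apply/idP/eqP => [/mem_elist [D0 dD]|->].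
    by apply: divisor_eq => v; rewrite coeff0 (eff_coeff_small D0 dD) // (place_deg_gt0 hK).
  by apply/mem_elist; split; [|rewrite div_deg0].
by move/perm_size.
Qed.

Lemma count_ge v n i : count (fun D => i%:Z <= coeff v D) (elist n) =
  (if i * place_deg v <= n then Aeff (n - i * place_deg v) else 0)%N.
Proof.
case: leqP => [le|lt]; last first.
  rewrite -(count_pred0 (elist n)); apply: eq_in_count => D /mem_elist [D0 dD].
  apply/negbTE; rewrite -ltNge; have := eff_coeff_le v D0 dD; nia.
rewrite -size_filter /Aeff -[RHS](size_map (fun D => D + << i%:Z *g v >>)).
apply: perm_size; apply: uniq_perm.
- by rewrite filter_uniq ?elist_uniq.
- by rewrite map_inj_uniq ?elist_uniq //; apply: addIr.
move=> D; rewrite mem_filter; apply/andP/mapP => [[iD /mem_elist [D0 dD]]|[E /mem_elist [E0 dE] ->]].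
  exists (D - << i%:Z *g v >>); last by rewrite subrK.
  apply/mem_elist; split; last by rewrite div_degB dD div_degU // -subzn // PoszM.
  move=> w; rewrite coeff0 coeffB coeffU; case: eqVneq => [<-|_]; first by rewrite mulr1 subr_ge0.
  by rewrite mulr0 subr0 eff_ge0.
split; first by rewrite coeffD coeffU eqxx mulr1 lerDr eff_ge0.
apply/mem_elist; split; last by rewrite div_degD dE div_degU // -PoszM -PoszD subnK.
move=> w; rewrite coeff0 coeffD; apply: addr_ge0; first exact: eff_ge0.
by rewrite coeffU; case: eqVneq; rewrite ?mulr1 ?mulr0.
Qed.

Lemma sum_indicator_nat c n : (c <= n)%N -> (\sum_(1 <= i < n.+1) (i <= c))%N = c.
Proof.
move=> cn; rewrite (@big_cat_nat _ _ _ c.+1) //=.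
rewrite big_nat (eq_bigr (fun=> 1%N)); last by move=> i /andP [_]; rewrite ltnS => ->.
rewrite -big_nat sum_nat_const_nat muln1 subn1 /= [X in (_ + X)%N]big_nat big1 ?addn0 //.
by move=> i /andP [ci _]; rewrite leqNgt ci.
Qed.

Lemma sum_multiples (f : nat -> nat) d n : (0 < d)%N ->
  (\sum_(1 <= i < n.+1) (if i * d <= n then f (n - i * d) else 0) =
   \sum_(1 <= j < n.+1 | d %| j) f (n - j))%N.
Proof.
move=> d0; rewrite [RHS]big_mkcond /=.
rewrite (@eq_big_nat _ _ _ _ _ _ (fun i => \sum_(1 <= j < n.+1) if j == i * d then f (n - j) else 0)%N).
  rewrite exchange_big_nat /=; apply: eq_big_nat => j /andP [j0 jn].
  case: (boolP (d %| j)%N) => [/dvdnP [i ij]|dj].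
    have i0 : (0 < i)%N by move: j0; rewrite ij muln_gt0 => /andP [].
    have inn : (i < n.+1)%N by apply: leq_ltn_trans jn; rewrite ij leq_pmulr.
    rewrite (big_cat_nat _ (n := i)) //=; last exact: ltnW.
    rewrite [X in (_ + X)%N](@big_ltn _ _ _ i) // -ij eqxx.
    rewrite big_nat big1 ?add0n => [|l /andP [_ li]]; last first.
      by rewrite ij eqn_pmul2r // gtn_eqF.
    rewrite big_nat big1 ?addn0 // => l /andP [li _].
    by rewrite ij eqn_pmul2r // ltn_eqF.
  rewrite big1 // => i _; case: eqP => // ji; by rewrite ji dvdn_mull in dj.
move=> i /andP [i0 _]; case: leqP => [le|lt].
  have id0 : (0 < i * d)%N by rewrite muln_gt0 i0.
  rewrite (big_cat_nat _ (n := (i * d)%N)) //=; last exact: ltnW.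
  rewrite [X in (_ + X)%N](@big_ltn _ _ _ (i * d)%N) // eqxx.
  rewrite big_nat big1 ?add0n => [|l /andP [_ li]]; last by rewrite ltn_eqF.
  by rewrite big_nat big1 ?addn0 // => l /andP [li _]; rewrite gtn_eqF.
by rewrite big_nat big1 // => j /andP [_ jn]; rewrite ltn_eqF // (leq_ltn_trans _ lt).
Qed.

Lemma Npt_plist n j : (j <= n)%N -> (0 < j)%N -> Npt j = (\sum_(v <- plist n | place_deg v %| j) place_deg v)%N.
Proof.
move=> jn j0; rewrite /Npt -big_filter -[RHS]big_filter; apply: perm_big; apply: uniq_perm.
- by rewrite filter_uniq ?plist_uniq.
- by rewrite filter_uniq ?plist_uniq.
move=> v; rewrite !mem_filter !mem_plist; case: (boolP (place_deg v %| j)%N) => //= /(dvdn_leq j0) vj.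
by rewrite vj (leq_trans vj jn).
Qed.

(** The coefficients of X Z' = (sum_j N_j X^j) Z for the zeta series Z. The left side adds up the
    degrees of all D; the multiplicity of v in D is the number of i >= 1 with i v <= D, and these D
    correspond to the effective divisors of degree n - i deg v. *)
Lemma Aeff_recursion n : (n * Aeff n = \sum_(1 <= j < n.+1) Npt j * Aeff (n - j))%N.
Proof.
have -> : (n * Aeff n = \sum_(D <- elist n) \sum_(v <- plist n) `|coeff v D| * place_deg v)%N.
  rewrite (eq_big_seq (fun=> n)); last by move=> D /mem_elist [D0 dD]; rewrite -(eff_degE D0 dD).
  by rewrite big_const_seq count_predT iter_addn_0 mulnC.
rewrite exchange_big /=.
have -> : (\sum_(1 <= j < n.+1) Npt j * Aeff (n - j) =
    \sum_(v <- plist n) \sum_(1 <= j < n.+1 | place_deg v %| j) place_deg v * Aeff (n - j))%N.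
  rewrite (@eq_big_nat _ _ _ _ _ _ (fun j => \sum_(v <- plist n)
     if place_deg v %| j then place_deg v * Aeff (n - j) else 0)%N); last first.
    move=> j /andP [j0 jn]; rewrite (@Npt_plist n) // big_distrl /= big_mkcond /=.
    by apply: eq_bigr => v _; case: ifP.
  by rewrite exchange_big /=; apply: eq_bigr => v _; rewrite -big_mkcond.
apply: eq_big_seq => v; rewrite mem_plist => vn; have d0 := place_deg_gt0 hK v.
rewrite -big_distrr -big_distrl /= mulnC; congr (_ * _)%N.
rewrite -(sum_multiples Aeff n d0).
rewrite (@eq_big_nat _ _ _ _ _ _ (fun i => count (fun D => i%:Z <= coeff v D) (elist n))); last first.
  by move=> i _; rewrite count_ge.
have E D : D \in elist n -> `|coeff v D|%N = (\sum_(1 <= i < n.+1) (i%:Z <= coeff v D)%R)%N.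
  move=> /mem_elist [D0 dD]; have cv := eff_ge0 v D0.
  rewrite -[LHS](@sum_indicator_nat _ n).
    by apply: eq_bigr => i _; congr nat_of_bool; lia.
  by have := eff_coeff_le v D0 dD; nia.
rewrite (eq_big_seq _ E) exchange_big /=; apply: eq_bigr => i _.
by rewrite -sum1_count [RHS]big_mkcond /=; apply: eq_bigr => D _; case: (_ <= _).
Qed.

Lemma principalP D : principal D <-> exists2 h, h != 0 & D = pdiv iota h.
Proof.
split=> [/asboolP [h h0 Hh]|[h h0 ->]].
  by exists h => //; apply: divisor_eq => v; rewrite Hh (coeff_pdiv hK).
by apply/asboolP; exists h => // v; rewrite (coeff_pdiv hK).
Qed.

Lemma principal0 : principal (0 : divisor).
Proof.
apply/principalP; exists 1; rewrite ?oner_neq0 //; apply: divisor_eq => v.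
by rewrite coeff0 (coeff_pdiv hK) ?oner_neq0 // place1.
Qed.

Lemma principalB D E : principal D -> principal E -> principal (D - E).
Proof.
move=> /principalP [h h0 ->] /principalP [h' h0' ->]; apply/principalP; exists (h / h').
  by rewrite mulf_neq0 ?invr_eq0.
apply: divisor_eq => v; rewrite coeffB !(coeff_pdiv hK) ?mulf_neq0 ?invr_eq0 //.
by rewrite place_div.
Qed.

Lemma principalN D : principal D -> principal (- D).
Proof. by move=> pD; rewrite -sub0r; apply: principalB => //; apply: principal0. Qed.

Lemma principalD D E : principal D -> principal E -> principal (D + E).
Proof. by move=> pD pE; rewrite -[E]opprK; apply/principalB/principalN. Qed.

Lemma L_enum D : exists s : seq K, [/\ uniq s, size s = (q ^ ell D)%N & forall h, h \in s <-> L D h].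
Proof.
have [b [Lb sb fb]] := has_ell hK D.
pose c (a : {ffun 'I_(ell D) -> Fq}) := \sum_i iota (a i) * b i.
have Lc a : L D (c a).
  by apply: (ss_sum (subspace_L D)) => i _; apply: (ssZ (subspace_L D)) => //; apply: constant_iota.
exists [seq c a | a <- enum {: {ffun 'I_(ell D) -> Fq}}]; split.
- rewrite map_inj_uniq ?enum_uniq // => a a' /eqP; rewrite -subr_eq0 /c -sumrB => /eqP aa.
  apply/ffunP => i; apply: (fmorph_inj iota); apply/eqP; rewrite -subr_eq0; apply/eqP.
  apply: (fb (fun i => iota (a i) - iota (a' i))) => [l|].
    by rewrite -rmorphB; apply: constant_iota.
  by rewrite /= -[RHS]aa; apply: eq_bigr => l _; rewrite mulrBl.
- by rewrite size_map -cardE card_ffun card_ord.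
- move=> h; split=> [/mapP [a _ ->]//|/sb [e [ce /= /eqP]]].
  rewrite subr_eq0 => /eqP ->.
  have /boolp.choice [a Ha] : forall i, exists a, iota a = e i by move=> i; have [a _] := ce i; exists a.
  apply/mapP; exists [ffun i => a i]; first by rewrite mem_enum.
  by apply: eq_bigr => i _; rewrite ffunE Ha.
Qed.

(** The map from h to D + (h) sends the nonzero elements of L(D) onto the effective divisors
    equivalent to D; its fibers are the orbits of the q - 1 nonzero constants. *)
Lemma count_linear_system D n : div_deg D = n%:Z ->
  ((q - 1) * count (fun E => principal (E - D)%R) (elist n) + 1 = q ^ ell D)%N.
Proof.
move=> dD; have [s [us ss Hs]] := L_enum D.
pose s' := rem 0 s; have s0 : 0 \in s by apply/Hs/(ss0 (subspace_L D)).
have us' : uniq s' by rewrite rem_uniq.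
have Hs' h : h \in s' <-> h != 0 /\ L D h.
  by rewrite mem_rem_uniq // inE; split=> [/andP [-> /Hs]|[-> /Hs]].
have <- : (size s' + 1 = q ^ ell D)%N by rewrite size_rem // -ss addn1 prednK // lt0n size_eq0; apply: contraTneq s0 => ->.
congr (_ + 1)%N.
pose f h := D + pdiv iota h.
have fE h : h \in s' -> f h \in [seq E <- elist n | principal (E - D)].
  move=> /Hs' [h0 Lh]; rewrite mem_filter /f addrAC subrr add0r; apply/andP; split.
    by apply/principalP; exists h.
  apply/mem_elist; rewrite div_degD (deg_pdiv hK) // addr0; split=> // v.
  move: Lh; rewrite LspaceE => /(_ v); rewrite vgeE // coeff0 coeffD (coeff_pdiv hK) //; lia.
rewrite (size_partition (filter_uniq _ (elist_uniq n)) fE).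
rewrite (eq_big_seq (fun=> (q - 1)%N)).
  by rewrite big_const_seq count_predT iter_addn_0 size_filter mulnC.
move=> E; rewrite mem_filter => /andP [/principalP [h0 h00 Eh0] /mem_elist [E0 dE]].
have Lh0 : L D h0.
  rewrite LspaceE => v; rewrite vgeE // -(coeff_pdiv hK) // -Eh0 coeffB.
  by have := eff_ge0 v E0; lia.
rewrite -size_filter -(card_cst_neq0).
rewrite -[RHS](size_map (fun a => iota a * h0)); apply: perm_size; apply: uniq_perm.
- exact: filter_uniq.
- rewrite map_inj_in_uniq => [|a b _ _ /(mulIf h00) /fmorph_inj //].
  by apply: filter_uniq; apply: enum_uniq.
move=> h; rewrite mem_filter; apply/andP/mapP => [[/eqP fh /Hs' [hn0 Lh]]|[a]].
  have [a _ Ha] : cst (h / h0).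
    apply: (constant_no_pole hK) => v; rewrite vgeE ?mulf_neq0 ?invr_eq0 //.
    rewrite place_div // -!(coeff_pdiv hK) //.
    have : pdiv iota h = pdiv iota h0 by rewrite -Eh0 -fh /f addrAC subrr add0r.
    by move=> ->; rewrite subrr.
  exists a; last by rewrite Ha divfK.
  rewrite mem_filter mem_enum andbT; apply: contra_neq hn0 => a0.
  by move: Ha; rewrite a0 rmorph0 => /esym/eqP; rewrite mulf_eq0 invr_eq0 (negPf h00) orbF => /eqP.
rewrite mem_filter => /andP [a0 _] ->.
have ah : iota a * h0 != 0 by rewrite mulf_neq0 // fmorph_eq0.
split; last first.
  by apply/Hs'; split=> //; apply: (ssZ (subspace_L D)) => //; apply: constant_iota.
apply/eqP; rewrite /f -[RHS](subrK D) addrC Eh0; congr (_ + _).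
apply: divisor_eq => v; rewrite !(coeff_pdiv hK) // val_atM ?fmorph_eq0 //.
by rewrite val_at_constant // add0r.
Qed.

Section DegreeOne.
Variable B : divisor.
Hypothesis degB : div_deg B = 1.

(** By Riemann's inequality every class of degree 0 contains some E - g B with E effective of degree
    g, and there are finitely many such E. *)
Lemma degree_classes : exists C : seq divisor, [/\ uniq C, forall D, D \in C -> div_deg D = 0,
  forall D, div_deg D = 0 -> exists2 E, E \in C & principal (D - E) &
  forall D E, D \in C -> E \in C -> principal (D - E) -> D = E].
Proof.
pose s := [seq E - B *+ g | E <- elist g].
have sP D : div_deg D = 0 -> exists2 E, E \in s & principal (D - E).
  move=> dD; have [h h0] : exists2 h, h != 0 & L (D + B *+ g) h.
    apply: L_nonzero; have := riemann hK (D + B *+ g).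
    by rewrite div_degD div_deg_muln degB dD -ltz_nat; lia.
  rewrite LspaceE => Lh; exists (D + pdiv iota h).
    apply/mapP; exists (D + B *+ g + pdiv iota h); last by rewrite addrAC addrK.
    apply/mem_elist; split; last by rewrite !div_degD div_deg_muln degB (deg_pdiv hK) // dD addr0 add0r natz.
    move=> v; have := Lh v; rewrite vgeE // coeff0 !coeffD (coeff_pdiv hK) //; lia.
  have -> : D - (D + pdiv iota h) = - pdiv iota h by apply: divisor_eq => v; rewrite !(coeffB, coeffD, coeffN); ring.
  by apply: principalN; apply/principalP; exists h.
have ds D : D \in s -> div_deg D = 0.
  by move=> /mapP [E /mem_elist [_ dE] ->]; rewrite div_degB dE div_deg_muln degB natz subrr.
have [C [uC sC CP Cinj]] : exists C : seq divisor, [/\ uniq C, {subset C <= s},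
    forall D, D \in s -> exists2 E, E \in C & principal (D - E) &
    forall D E, D \in C -> E \in C -> principal (D - E) -> D = E].
  move: (s); elim=> [|D t [C [uC sC CP Cinj]]]; first by exists [::]; split.
  have [/hasP [E EC DE]|/hasPn nC] := boolP (has (fun E => principal (D - E)) C).
    exists C; split=> //; first by move=> E' /sC; rewrite inE orbC => ->.
    by move=> D'; rewrite inE => /orP [/eqP->|/CP //]; exists E.
  have pr0 := principal0.
  exists (D :: C); split=> /=.
  - rewrite uC andbT; apply/negP => DC; have := nC D DC.
    by rewrite subrr pr0.
  - by move=> E; rewrite !inE => /orP [->//|/sC->]; rewrite orbT.
  - move=> E; rewrite inE => /orP [/eqP->|/CP [E' E'C EE']].
      by exists D; rewrite ?mem_head // subrr.
    by exists E' => //; rewrite inE E'C orbT.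
  - move=> E E'; rewrite !inE => /orP [/eqP->|EC] /orP [/eqP->|E'C] pr.
    + by [].
    + by case/negP: (nC _ E'C); apply/asboolP.
    + by case/negP: (nC _ EC); rewrite -opprB; apply/principalN/asboolP.
    + by apply: Cinj => //; apply/asboolP.
exists C; split=> //; first by move=> D /sC/ds.
move=> D /sP [E /CP [E' E'C EE'] DE]; exists E' => //.
by rewrite -(subrK E D) -addrA; apply: principalD.
Qed.

(** Here h is the number of classes of degree 0; by Riemann-Roch each class of degree n contains
    (q^(n + 1 - g) - 1) / (q - 1) effective divisors. *)
Lemma Aeff_large : exists h : nat, forall n, (2 * g <= n.+1)%N ->
  ((q - 1) * Aeff n + h = h * q ^ (n + 1 - g))%N.
Proof.
have [C [uC dC CP Cinj]] := degree_classes.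
exists (size C) => n gn.
have dn D : D \in C -> div_deg (D + B *+ n) = n%:Z.
  by move=> /dC dD; rewrite div_degD div_deg_muln degB dD add0r natz.
have -> : Aeff n = (\sum_(D <- C) count (fun E => principal (E - (D + B *+ n))%R) (elist n))%N.
  have /boolp.choice [cl Hcl] : forall E, exists D, E \in elist n -> D \in C /\ principal (E - B *+ n - D).
    move=> E; case: (boolP (E \in elist n)) => [/mem_elist [_ dE]|]; last by exists 0.
    have [|D DC pD] := CP (E - B *+ n); last by exists D.
    by rewrite div_degB dE div_deg_muln degB natz subrr.
  rewrite /Aeff (size_partition uC (f := cl)) => [|E En]; last by have [] := Hcl E En.
  apply: eq_big_seq => D DC; apply: eq_in_count => E En; have [clC pcl] := Hcl E En.
  apply/eqP/idP => [<-|pr].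
    by congr principal: pcl; apply: divisor_eq => v; rewrite !(coeffB, coeffD); ring.
  apply: Cinj => //; have -> : cl E - D = (E - (D + B *+ n)) - (E - B *+ n - cl E).
    by apply: divisor_eq => v; rewrite !(coeffB, coeffD); ring.
  exact: principalB.
rewrite big_distrr /= -[in RHS]sum1_size big_distrl /= -[in LHS]sum1_size -big_split /=.
apply: eq_big_seq => D DC; rewrite (count_linear_system (dn D DC)) mul1n.
congr (_ ^ _)%N; apply/eqP; rewrite -eqz_nat.
by rewrite (riemann_roch_large hK) dn //; lia.
Qed.
End DegreeOne.
End Counting.

(** * Generators of residue fields *)

Section Generator.
Variables (Fq : finFieldType) (K : fieldType) (iota : {rmorphism Fq -> K}).
Hypothesis hK : function_field iota.
Notation cst := (constants iota).
Notation place := (place iota).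
Notation divisor := (divisor iota).
Notation ev := (ev iota).
Notation transc := (transc iota).
Notation fdeg := (fdeg iota).
Notation "'F(' f )" := (rational_in iota f) (at level 0, format "'F(' f )").
Notation L D := (riemann_roch_space D).
Notation g := (genus iota).
Implicit Types (v w : place) (S : seq place) (D E : divisor) (f h : K).

Let hF := subfield_constants iota.
Notation q := #|Fq|.

Lemma q_pow_gt1 n : (0 < n)%N -> (1 < q ^ n)%N.
Proof. by move=> n0; rewrite -(exp1n n) ltn_exp2r // card_gt1. Qed.

Lemma res_ev_eq0 (v : place) f (P : {poly Fq}) : vge v 0 f ->
  (forall i, (0 < i < place_deg v)%N -> res hK v f ^+ (q ^ i) != res hK v f) ->
  (size P <= place_deg v)%N -> vge v 1 (ev f P) -> P = 0.
Proof.
move=> Of Hf sP vP; apply/eqP; apply: contraLR sP => P0; rewrite -ltnNge.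
have E : (map_poly (res_iota hK v) P).[res hK v f] = 0.
  by rewrite -res_ev //; apply/eqP; rewrite res_eq0 // vge_ev.
exact: (conjugates_bound Hf P0 E).
Qed.

Lemma residue_relation (v : place) f : vge v 0 f ->
  exists2 P : {poly Fq}, P != 0 & (size P <= (place_deg v).+1)%N /\ vge v 1 (ev f P).
Proof.
move=> Of; apply: contrapT => H.
have : (#|'I_(place_deg v).+1| <= place_deg v)%N.
  apply: (has_dim_le_fin hF (subspace_vge v 1) (has_place_deg hK v)
    (c := fun i : 'I_(place_deg v).+1 => f ^+ i)) => [i|e ce We]; first exact: vge0X.
  have /boolp.choice [a Ha] : forall i, exists a, iota a = e i by move=> i; have [a _] := ce i; exists a.
  move=> i; rewrite -Ha; apply/eqP; rewrite fmorph_eq0; apply: contra_notT H => ai.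
  exists (\poly_(i < (place_deg v).+1) a (inord i)).
    apply/eqP => /(congr1 (fun p : {poly Fq} => p`_i)).
    by rewrite coef_poly ltn_ord inord_val coef0; apply/eqP.
  split; first exact: size_poly.
  rewrite (evE _ _ (size_poly _ _)); congr (vge v 1 _): We.
  by apply: eq_bigr => l _; rewrite coef_poly ltn_ord inord_val Ha.
by rewrite card_ord ltnn.
Qed.

(* f generates the residue field at v and pi(f) is a uniformizer, so F[f] maps
   onto O_v / m_v^n and the polynomials of degree < n deg v are a basis of it. *)
Lemma ev_free_mod_power (v : place) f (pi : {poly Fq}) : vge v 0 f -> size pi = (place_deg v).+1 ->
  v (ev f pi) = 1 -> (forall P : {poly Fq}, (size P <= place_deg v)%N -> vge v 1 (ev f P) -> P = 0) ->
  forall n (C : {poly Fq}), (size C <= n * place_deg v)%N -> vge v n%:Z (ev f C) -> C = 0.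
Proof.
move=> Of spi vpi H; elim=> [|n IH] C sC vC.
  by apply/eqP; rewrite -size_poly_leq0.
have pi0 : pi != 0 by rewrite -size_poly_eq0 spi.
have vP P : vge v 0 (ev f P) by apply: vge_ev.
have pif0 : ev f pi != 0 by apply: contra_eq_neq vpi => ->; rewrite val_at0.
have EC := divp_eq C pi.
have R0 : C %% pi = 0.
  apply: H; first by rewrite -ltnS -spi ltn_modp.
  have -> : C %% pi = C - C %/ pi * pi by rewrite {2}EC addrAC subrr add0r.
  rewrite evB evM; apply: vgeB; first by apply: vgeW vC; lia.
  by apply: vge0M => //; rewrite vgeE // vpi.
rewrite R0 addr0 in EC; rewrite EC.
suff -> : C %/ pi = 0 by rewrite mul0r.
apply: IH.
  rewrite size_divp // spi /=; apply: leq_trans (leq_sub2r _ sC) _.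
  by rewrite mulSn addKn.
have [->|c0] := eqVneq (ev f (C %/ pi)) 0; first exact: vge0.
have : vge v n.+1%:Z (ev f (C %/ pi) * ev f pi) by rewrite -evM -EC.
by rewrite !vgeE ?mulf_neq0 // val_atM // vpi; lia.
Qed.

(** Take f = f0^Q + t with f0 lifting a generator of the residue field, Q its cardinality and t a
    uniformizer. Then f^Q - f = (f0^Q - f0)^Q + t^Q - t has value 1. The minimal polynomial of the
    residue divides X^Q - X, so it also takes a value of order 1 at f. *)
Lemma local_generator (v : place) : exists2 f, vge v 0 f &
  forall n (C : {poly Fq}), (size C <= n * place_deg v)%N -> vge v n%:Z (ev f C) -> C = 0.
Proof.
have [th Hth] := resf_exists_generator hK v.
have [f0 Of0 f0th] := res_surj th.
have [t t0 vt] := place_uniformizer v.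
set k := place_deg v; set Q := (q ^ k)%N.
have Q1 : (1 < Q)%N by rewrite -(exp1n k) ltn_exp2r ?(place_deg_gt0 hK) ?card_gt1.
pose y := f0 ^+ Q; have Oy : vge v 0 y by apply: vge0X.
have Ot : vge v 1 t by rewrite vgeE // vt.
pose f := y + t; have Of : vge v 0 f by apply: vgeD => //; apply: vgeW Ot.
have rf : res hK v f = th.
  rewrite -f0th; apply/eqP; rewrite resP //.
  have -> : f - f0 = (f0 ^+ Q - f0) + t by rewrite /f /y; ring.
  by apply: vgeD => //; apply: vge_fermat.
have Hf i : (0 < i < k)%N -> res hK v f ^+ (q ^ i) != res hK v f by rewrite rf; apply: Hth.
have vPhi : vge v 0 (ev f ('X^Q - 'X)) /\ v (ev f ('X^Q - 'X)) = 1 /\ ev f ('X^Q - 'X) != 0.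
  split; first exact: vge_ev.
  have -> : ev f ('X^Q - 'X) = - t + ((f0 ^+ Q - f0) ^+ Q + t ^+ Q).
    rewrite evB evXn evX /f (exprD_card iota) (exprB_card iota) /y; ring.
  have tN0 : - t != 0 by rewrite oppr_eq0.
  have vs : vge v (v (- t) + 1) ((f0 ^+ Q - f0) ^+ Q + t ^+ Q).
    rewrite placeN vt; apply: vgeD.
      have := vgeX Q (vge_fermat hK Of0); apply: vgeW; lia.
    by have := vgeX Q Ot; apply: vgeW; lia.
  by have [a b] := place_addl tN0 vs; rewrite b placeN vt.
have [pi pi0 [spi vpi]] := residue_relation Of.
have spiE : size pi = k.+1.
  apply/eqP; rewrite eqn_leq spi ltnNge; apply: contra pi0 => sk.
  by apply/eqP/(res_ev_eq0 Of Hf sk).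
have [vP0 [vP1 Phi0]] := vPhi.
have EP := divp_eq ('X^Q - 'X) pi.
have R0 : ('X^Q - 'X) %% pi = 0.
  apply: (res_ev_eq0 Of Hf); first by rewrite -ltnS -/k -spiE ltn_modp.
  have -> : ('X^Q - 'X) %% pi = ('X^Q - 'X) - ('X^Q - 'X) %/ pi * pi by rewrite {2}EP addrAC subrr add0r.
  rewrite evB evM; apply: vgeB; first by rewrite vgeE // vP1.
  by apply: vge0M => //; apply: vge_ev.
rewrite R0 addr0 in EP; move: vP1 Phi0; rewrite EP evM mulf_eq0 negb_or => vP1 /andP [A0 pif0].
rewrite val_atM // in vP1; rewrite vgeE // in vpi.
have := vge_ev (('X^Q - 'X) %/ pi) Of; rewrite vgeE // => vA.
exists f => //; apply: (ev_free_mod_power Of spiE).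
  move: vP1 vpi vA; move: (v (ev f pi)) (v (ev f (('X^Q - 'X) %/ pi))) => a b; clear; lia.
by move=> P; apply: res_ev_eq0.
Qed.

Lemma distinct_valuations (v : place) (I : finType) (y : I -> K) :
  (forall i j, i != j -> y i != 0 -> y j != 0 -> v (y i) != v (y j)) ->
  \sum_i y i = 0 -> forall i, y i = 0.
Proof.
move=> Hy y0 i; apply/eqP; apply: contraT => yi.
pose P i := y i != 0.
have [m Pm mmin] := @arg_minP _ int I i P (fun i => v (y i)) yi.
have /eqP := y0; rewrite (bigD1 m) //=.
suff vs : vge v (v (y m) + 1) (\sum_(i0 | i0 != m) y i0).
  by have [/negPf-> _] := place_addl Pm vs.
apply: vge_sum => j jm; have [->|yj] := eqVneq (y j) 0; first exact: vge0.
rewrite vgeE // lezD1 lt_neqAle mmin // andbT; apply: Hy => //.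
by rewrite eq_sym.
Qed.

Section Frobenius.
Variable p : nat.
Hypotheses (p_pr : prime p) (pF : p \in [pchar Fq]).

Lemma pcharK : p \in [pchar K]. Proof. exact: rmorph_pchar iota _ pF. Qed.

Lemma pow_pnat m : [pchar K].-nat (p ^ m)%N.
Proof. by rewrite pnatX pnatE // pcharK. Qed.

Lemma exprD_p x y m : (x + y) ^+ (p ^ m) = x ^+ (p ^ m) + y ^+ (p ^ m) :> K.
Proof. exact/exprDn_pchar/pow_pnat. Qed.

Lemma expr_sum_p m (I : Type) (r : seq I) (P : pred I) (G : I -> K) :
  (\sum_(i <- r | P i) G i) ^+ (p ^ m) = \sum_(i <- r | P i) G i ^+ (p ^ m).
Proof.
apply: (big_morph (fun x => x ^+ (p ^ m))) => [x y|]; first exact: exprD_p.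
by rewrite expr0n expn_eq0 (gtn_eqF (prime_gt0 p_pr)).
Qed.

Lemma expr_sum_p1 (I : Type) (r : seq I) (P : pred I) (G : I -> K) :
  (\sum_(i <- r | P i) G i) ^+ p = \sum_(i <- r | P i) G i ^+ p.
Proof. by have := expr_sum_p 1 r P G; rewrite expn1. Qed.

Lemma frobenius_root m (a : Fq) : exists b, b ^+ (p ^ m) = a.
Proof.
have inj : injective (fun x : Fq => x ^+ (p ^ m)).
  move=> x y /= E; apply/eqP; rewrite -subr_eq0.
  have pn : [pchar Fq].-nat (p ^ m)%N by rewrite pnatX pnatE // pF.
  have : (x - y) ^+ (p ^ m) == 0 by rewrite exprDn_pchar // exprNn_pchar // E subrr.
  by rewrite expf_eq0 => /andP [_].
have [f _ fK] := injF_bij inj; by exists (f a); apply: fK.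
Qed.

(** Exponents are sorted modulo p, and the coefficients have p-th roots because Fq is perfect. *)
Lemma poly_p_split (P : {poly Fq}) : exists B : 'I_p -> {poly Fq},
  (forall j, size (B j) <= size P)%N /\
  forall z, ev z P = \sum_(j < p) z ^+ j * ev z (B j) ^+ p.
Proof.
have p0 := prime_gt0 p_pr.
have /boolp.choice [rt Hrt] := frobenius_root 1; rewrite expn1 in Hrt.
exists (fun j => \poly_(i < size P) rt P`_(i * p + j)); split=> [j|z]; first exact: size_poly.
have E j : ev z (\poly_(i < size P) rt P`_(i * p + j)) ^+ p =
    \sum_(i < size P) iota P`_(i * p + j) * z ^+ (i * p).
  rewrite (evE _ _ (size_poly _ _)) -[p in LHS]expn1 expr_sum_p expn1.
  apply: eq_bigr => i _; rewrite coef_poly ltn_ord exprMn -rmorphXn Hrt.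
  by rewrite exprM.
under eq_bigr => j _ do rewrite E mulr_sumr.
have sP : (size P <= size P * p)%N by rewrite leq_pmulr.
rewrite (evE _ _ sP) exchange_big /=.
rewrite -(big_mkord xpredT (fun i => iota P`_i * z ^+ i)) big_nat_mul big_mkord.
apply: eq_bigr => i _; rewrite -{1}[(i * p)%N]add0n big_addn mulSn addnK big_mkord.
by apply: eq_bigr => j _; rewrite [(j + _)%N]addnC exprD mulrA mulrC.
Qed.

(** Splitting the coefficients by [poly_p_split] turns a relation between the y_l^p into one of the
    form sum_j z^j h_j^p = 0, in which every h_j is a polynomial combination of the y_l. *)
Lemma frobenius_free z n (y : 'I_n -> K) : transc z ->
  (forall h : 'I_p -> K, \sum_(j < p) z ^+ j * h j ^+ p = 0 -> forall j, h j = 0) ->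
  free_mod F(z) [set 0] y -> free_mod F(z) [set 0] (fun l => y l ^+ p).
Proof.
move=> tz Hz fy; apply: free_poly_rational => // P HP l.
have /boolp.choice [B HB] := fun l => poly_p_split (P l).
have H j : \sum_l ev z (B l j) * y l = 0.
  apply: (Hz (fun j => \sum_l ev z (B l j) * y l)); rewrite -[RHS]HP.
  rewrite (eq_bigr (fun i => \sum_l z ^+ (i : 'I_p) * (ev z (B l i) * y l) ^+ p)); last first.
    by move=> i _; rewrite expr_sum_p1 mulr_sumr.
  rewrite exchange_big /=; apply: eq_bigr => i _; rewrite (HB i).2 mulr_suml.
  by apply: eq_bigr => i' _; rewrite exprMn mulrA.
apply: (tz); rewrite (HB l).2 big1 // => j _.
by rewrite (free_rational_poly tz fy (H j)) ev0 expr0n (gtn_eqF (prime_gt0 p_pr)) mulr0.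
Qed.

(** The values of the nonzero terms z^j h_j^p are pairwise different already modulo p. *)
Lemma place_frobenius_free (v : place) z : z != 0 -> ~~ (p%:Z %| v z)%Z ->
  forall h : 'I_p -> K, \sum_(j < p) z ^+ j * h j ^+ p = 0 -> forall j, h j = 0.
Proof.
move=> z0 pv h H j.
have := @distinct_valuations v _ (fun j : 'I_p => z ^+ j * h j ^+ p) _ H j.
have p0 := prime_gt0 p_pr.
move=> H1; have /eqP : z ^+ j * h j ^+ p = 0.
  apply: H1 => i l il; rewrite !mulf_eq0 !negb_or !expf_eq0 p0 /= => /andP [zi hi] /andP [zl hl].
  rewrite !val_atM ?expf_neq0 // !placeX //; apply/eqP => E.
  move/negP: pv; apply.
  have : (p%:Z %| v z * (i%:Z - l%:Z))%Z.
    apply/dvdzP; exists (v (h l) - v (h i)); rewrite mulrBr mulrBl; lia.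
  rewrite Gauss_dvdzl //; rewrite /coprimez /gcdz /=.
  have -> : `|i%:Z - l%:Z|%N = (maxn i l - minn i l)%N by lia.
  have : (0 < maxn i l - minn i l < p)%N.
    have := ltn_ord i; have := ltn_ord l; have : i != l :> nat by []; lia.
  move: (maxn i l - minn i l)%N => m /andP [m0 mp]; change (coprime p m); rewrite prime_coprime //.
  by rewrite gtnNdvd.
by rewrite mulf_eq0 !expf_eq0 p0 (negPf z0) /= andbF => /eqP.
Qed.
End Frobenius.

Definition integral_off (w : place) y := forall v, v != w -> vge v 0 y.

Lemma L_point w n y : L (<< n *g w >>) y <-> integral_off w y /\ vge w (- n) y.
Proof.
rewrite LspaceE; split=> [H|[H1 H2] v].
  split=> [v vw|]; first by have := H v; rewrite coeffU eq_sym (negPf vw) mulr0 oppr0.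
  by have := H w; rewrite coeffU eqxx mulr1.
rewrite coeffU; case: eqVneq => [<-|vw]; first by rewrite mulr1.
by rewrite mulr0 oppr0; apply: H1; rewrite eq_sym.
Qed.

Lemma clear_poles w z y : transc z -> integral_off w z ->
  exists2 c, c != 0 & integral_off w (ev z c * y).
Proof.
move=> tz Oz.
have [[a _ ay]|/(nonconstant_transc hK) ty] := pselect (cst y).
  exists 1; rewrite ?oner_eq0 // ev1 mul1r => v _; rewrite -ay; exact: vge_iota.
have [S [uS HS]] := zeros_enum hK (transcV hK ty).
have P0 (v : place) : 'X^(q ^ place_deg v) - 'X != 0 :> {poly Fq}.
  rewrite -size_poly_eq0 size_polyDl ?size_polyXn // size_polyN size_polyX ltnS.
  exact: q_pow_gt1 (place_deg_gt0 hK v).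
exists (\prod_(v <- S) ('X^(q ^ place_deg v) - 'X) ^+ `|v y|%N).
  by rewrite prodf_seq_neq0; apply/allP => v _; apply: expf_neq0.
move=> v vw; rewrite ev_prod.
have Ov (u : place) : vge v 0 (ev z (('X^(q ^ place_deg u) - 'X) ^+ `|u y|%N)) by apply: vge_ev; apply: Oz.
have [vS|nvS] := boolP (v \in S); last first.
  apply: vge0M; first by apply: vge_prod.
  rewrite vgeE ?(transc_neq0 ty) // leNgt; apply: contra nvS => vy.
  by apply/HS; rewrite placeV ?(transc_neq0 ty) //; lia.
rewrite (big_rem v) //= mulrAC; apply: vgeM0; last exact: vge_prod.
rewrite evXn evB evXn evX.
have H1 := vgeX `|v y|%N (vge_fermat hK (Oz v vw)).
have -> : 0 = 1 * `|v y|%:Z + v y by move/HS: vS; rewrite placeV ?(transc_neq0 ty) //; lia.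
by apply: vgeM => //; rewrite vgeE ?(transc_neq0 ty).
Qed.

(** The order n = 2gp + 1 is prime to p and large enough for Riemann-Roch to provide a pole of exact
    order n at w. The powers of a local generator at w are independent modulo m_w^n = z^-1 O_w,
    hence over F(z); a polynomial in z then makes it regular away from w without losing
    independence. *)
Lemma stepanov_setup (w : place) p : prime p ->
  exists z x n, [/\ (0 < n)%N, ~~ (p %| n)%N & w z = - n%:Z] /\
  [/\ transc z, integral_off w z, integral_off w x, fdeg z = (n * place_deg w)%N &
    free_mod F(z) [set 0] (fun l : 'I_(n * place_deg w) => x ^+ l)].
Proof.
move=> p_pr; pose n := (2 * g * p).+1; have k0 := place_deg_gt0 hK w.
have [z [Lz nLz]] : exists z, L (<< n%:Z *g w >>) z /\ ~ L (<< n.-1%:Z *g w >>) z.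
  apply: contrapT => H.
  have E : L (<< n%:Z *g w >>) = L (<< n.-1%:Z *g w >>).
    apply/seteqP; split=> y Ly; first by apply: contrapT => nLy; apply: H; exists y.
    by apply: L_sub Ly => v; rewrite !coeffU; case: (_ == _); lia.
  have E1 : ell (<< n%:Z *g w >> : divisor) = ell (<< n.-1%:Z *g w >> : divisor).
    by rewrite /ell E.
  have p2 := prime_gt1 p_pr.
  have R1 := @riemann_roch_large _ _ _ hK (<< n%:Z *g w >>).
  have R2 := @riemann_roch_large _ _ _ hK (<< n.-1%:Z *g w >>).
  rewrite !div_degU in R1 R2; move: R1 R2; rewrite E1 /n /=; nia.
have z0 : z != 0 by apply: contra_notN nLz => /eqP->; apply: (ss0 (subspace_L _)).
have [Oz vz] : integral_off w z /\ w z = - n%:Z.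
  move/L_point: Lz => [Oz wz]; split=> //; apply/eqP; rewrite eq_le; apply/andP; split.
    rewrite leNgt; apply/negP => H; apply: nLz; apply/L_point; split=> //.
    by rewrite vgeE //; lia.
  by rewrite -vgeE.
have tz : transc z by apply: (@uniformizer_transc _ _ _ hK w); rewrite vz /n; lia.
have dz : fdeg z = (n * place_deg w)%N.
  have [D HD dD] := zdiv_deg hK (transcV hK tz).
  rewrite fdegV in dD; apply/eqP; rewrite -eqz_nat -dD.
  have -> : D = << n%:Z *g w >>.
    apply: divisor_eq => v; rewrite HD coeffU placeV //; case: (eqVneq w v) => [<-|vw].
      by rewrite vz /=; lia.
    by have := Oz v; rewrite eq_sym => /(_ vw); rewrite vgeE //=; lia.
  by rewrite div_degU // PoszM.
have [f Of Hf] := local_generator w.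
have ff : free_mod F(z) [set 0] (fun l : 'I_(n * place_deg w) => f ^+ l).
  rewrite -rationalV; apply: (free_lift (transcV hK tz) (subspace_vge w 0)) => /=.
  - by move=> y Oy; apply: vge0M => //; rewrite vgeE ?invr_eq0 // placeV // vz; lia.
  - by move=> l; apply: vge0X.
  move=> e ce [y Oy Ey] l.
  have /boolp.choice [a Ha] : forall i, exists a, iota a = e i by move=> i; have [a _] := ce i; exists a.
  pose C : {poly Fq} := \poly_(i < n * place_deg w) oapp a 0 (insub i).
  have C0 : C = 0.
    apply: (Hf n); first exact: size_poly.
    have -> : ev f C = z^-1 * y.
      rewrite -Ey (evE _ _ (size_poly _ _)); apply: eq_bigr => i _.
      by rewrite coef_poly ltn_ord valK /= Ha.
    by rewrite -[n%:Z]addr0; apply: vgeM => //; rewrite vgeE ?invr_eq0 // placeV // vz opprK.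
  have := congr1 (fun p : {poly Fq} => p`_l) C0.
  by rewrite coef_poly ltn_ord valK coef0 /= => al; rewrite -Ha al rmorph0.
have [c c0 Oc] := clear_poles f tz Oz.
exists z, (ev z c * f), n; split; first split=> //.
  by rewrite /n -addn1 dvdn_addr ?dvdn_mull // dvdn1 (gtn_eqF (prime_gt1 p_pr)).
split=> // e ke; have cz0 := ev_neq0 tz c0.
move=> He l; have := ff (fun l => e l * ev z c ^+ l) _ _ l => H.
have /eqP : e l * ev z c ^+ l = 0.
  apply: H => [i|].
    by apply: (sfM (subfield_rational iota z)) => //; apply: (sfX _ (subfield_rational iota z)); apply: rational_ev.
  by rewrite /= -[RHS]He; apply: eq_bigr => i _; rewrite exprMn mulrA.
by rewrite mulf_eq0 (negPf (expf_neq0 _ cz0)) orbF => /eqP.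
Qed.
End Generator.

(** * Irreducibility over K and independence over p-th powers *)

Section Norm.
Variables (Fq : finFieldType) (K : fieldType) (iota : {rmorphism Fq -> K}).
Hypothesis hK : function_field iota.
Notation cst := (constants iota).
Notation place := (place iota).
Notation divisor := (divisor iota).
Notation ev := (ev iota).
Notation transc := (transc iota).
Notation fdeg := (fdeg iota).
Notation "'F(' f )" := (rational_in iota f) (at level 0, format "'F(' f )").
Notation L D := (riemann_roch_space D).
Notation g := (genus iota).
Implicit Types (v w : place) (S : seq place) (D E : divisor) (f h : K).

Let hF := subfield_constants iota.
Notation q := #|Fq|.

Lemma coef_unit_index (v : place) (D : {poly K}) : (forall i, vge v 0 D`_i) ->
  (exists i, ~~ vge v 1 D`_i) ->
  exists i, [/\ D`_i != 0, v D`_i = 0 & forall k, (k < i)%N -> vge v 1 D`_k].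
Proof.
move=> OD exD; have [i ni mini] := ex_minnP exD.
have d0 : D`_i != 0 by apply: contraNneq ni => ->; apply: vge0.
exists i; split=> //.
  by have := OD i; rewrite vgeE // in ni; rewrite vgeE //; move: ni; rewrite -ltNge; lia.
by move=> k ki; apply: contraLR ki => /mini; rewrite -leqNgt.
Qed.

(** The first unit coefficients of the two factors meet in a coefficient of the product whose other
    terms all vanish at v. *)
Lemma gauss_content (v : place) (D E : {poly K}) :
  (forall i, vge v 0 D`_i) -> (exists i, ~~ vge v 1 D`_i) ->
  (forall i, vge v 0 E`_i) -> (exists i, ~~ vge v 1 E`_i) ->
  exists i, ~~ vge v 1 (D * E)`_i.
Proof.
move=> OD /(coef_unit_index OD) [i [di vdi Hi]] OE /(coef_unit_index OE) [j [ej vej Hj]].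
exists (i + j)%N; rewrite coefM.
have ij : (i < (i + j).+1)%N by rewrite ltnS leq_addr.
rewrite (bigD1 (Ordinal ij)) //= addKn.
have de0 : D`_i * E`_j != 0 by rewrite mulf_neq0.
have vde : v (D`_i * E`_j) = 0 by rewrite val_atM // vdi vej.
suff vs : vge v (v (D`_i * E`_j) + 1) (\sum_(l < (i + j).+1 | l != Ordinal ij) D`_l * E`_(i + j - l)).
  by have [a b] := place_addl de0 vs; rewrite vgeE // b vde.
rewrite vde add0r; apply: vge_sum => l; rewrite -val_eqE /= => li.
have [lt|gt] := ltnP l i; first by apply: vgeM0 => //; apply: Hi.
apply: vge0M => //; apply: Hj; rewrite ltn_subLR; last by rewrite -ltnS ltn_ord.
by rewrite ltn_add2r ltn_neqAle eq_sym li.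
Qed.

Lemma monic_scale (v : place) (D : {poly K}) : D \is monic ->
  exists t (a : nat), [/\ t != 0, v t = a%:Z, forall i, vge v 0 (t *: D)`_i,
    exists i, ~~ vge v 1 (t *: D)`_i & a = 0%N -> forall i, vge v 0 D`_i].
Proof.
move=> mD; have [s s0 vs] := place_uniformizer v.
have lD : D`_(size D).-1 = 1 by apply/eqP.
have ex : exists a : nat, [forall i : 'I_(size D), vge v (- a%:Z) D`_i].
  have [a Ha] := @vge_exists_seq _ _ _ [:: v] _ (enum 'I_(size D)) (fun i : 'I_(size D) => D`_i).
  exists a; apply/forallP => i; apply: Ha; rewrite ?inE //.
  have := mem_enum 'I_(size D) i; elim: (enum _) => //= x l IH.
  by rewrite !inE => /orP [/eqP->|/IH]; [left|right].
have [a /forallP Ha mina] := ex_minnP ex.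
have Hai i : vge v (- a%:Z) D`_i.
  have [lt|ge] := ltnP i (size D); first exact: (Ha (Ordinal lt)).
  by rewrite nth_default // vge0.
exists (s ^+ a), a; split.
- by rewrite expf_neq0.
- by rewrite placeX // vs mul1r.
- move=> i; rewrite coefZ -(addrN a%:Z); apply: vgeM => //.
  by rewrite vgeE ?expf_neq0 // placeX // vs mul1r.
- case: a Ha mina Hai => [|a] Ha mina Hai.
    by exists (size D).-1; rewrite expr0 scale1r lD vgeE ?oner_eq0 // place1.
  have [/forallP H|/forallPn [i ni]] := boolP [forall i : 'I_(size D), vge v (- a%:Z) D`_i].
    by have : (a.+1 <= a)%N by [apply: mina; apply/forallP|]; rewrite ltnn.
  exists i; rewrite coefZ; apply: contra ni.
  have [->|d0] := eqVneq D`_i 0; first by rewrite vge0.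
  by rewrite !vgeE ?mulf_neq0 ?expf_neq0 // val_atM ?expf_neq0 // placeX // vs; lia.
- by move=> a0 i; have := Hai i; rewrite a0.
Qed.

(** Scaled to be primitive at v, both factors have a primitive product by Gauss's lemma. As D E is
    integral, the total scaling exponent a + b cannot be positive. *)
Lemma monic_factor_integral (v : place) (D E : {poly K}) : D \is monic -> E \is monic ->
  (forall i, vge v 0 (D * E)`_i) -> forall i, vge v 0 D`_i.
Proof.
move=> mD mE ODE.
have [s [a [s0 vs Os us a0]]] := monic_scale v mD.
have [t [b [t0 vt Ot ut b0]]] := monic_scale v mE.
have [i] := gauss_content Os us Ot ut.
rewrite -scalerAl -scalerAr scalerA coefZ => H; apply: a0; apply/eqP; apply: contraNT H => a0.
apply: vgeM0 => //; rewrite vgeE ?mulf_neq0 // val_atM // vs vt; lia.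
Qed.

Lemma constant_poly_descent (D : {poly K}) : (forall i, cst D`_i) ->
  exists D0 : {poly Fq}, D = map_poly iota D0.
Proof.
move=> cD; have /boolp.choice [a Ha] : forall i, exists a, iota a = D`_i by move=> i; have [a _] := cD i; exists a.
exists (\poly_(i < size D) a i); apply/polyP => i; rewrite coef_map coef_poly.
case: ltnP => [_|le]; first exact: esym (Ha i).
by rewrite nth_default // raddf0.
Qed.

(** By the previous lemma the coefficients of a monic factor have no pole at all, hence are
    constants, and the factorization takes place over Fq. *)
Lemma irreducible_over_K (P : {poly Fq}) : irreducible_poly P -> irreducible_poly (map_poly iota P).
Proof.
move=> [sP irr]; split; first by rewrite size_map_poly.
move=> D sD /dvdpP [E PE].
have P0 : P != 0 by rewrite -size_poly_gt0; apply: leq_trans sP.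
have PK0 : map_poly iota P != 0 by rewrite map_poly_eq0.
have /andP [E0 D0] : (E != 0) && (D != 0) by rewrite -negb_or -mulf_eq0 -PE.
have lD : lead_coef D != 0 by rewrite lead_coef_eq0.
have lE : lead_coef E != 0 by rewrite lead_coef_eq0.
pose D1 := (lead_coef D)^-1 *: D; pose E1 := (lead_coef E)^-1 *: E.
have mD : D1 \is monic by rewrite monicE lead_coefZ mulVf.
have mE : E1 \is monic by rewrite monicE lead_coefZ mulVf.
have DE : D1 * E1 = map_poly iota ((lead_coef P)^-1 *: P).
  rewrite /D1 /E1 -scalerAl -scalerAr scalerA -[in RHS]mul_polyC rmorphM /= map_polyC /= mul_polyC PE [D * E]mulrC.
  by congr (_ *: _); rewrite fmorphV -(lead_coef_map iota) PE lead_coefM invfM mulrC.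
have [D2 ED2] : exists D2 : {poly Fq}, D1 = map_poly iota D2.
  apply: constant_poly_descent => i; apply: (constant_no_pole hK) => v.
  apply: (monic_factor_integral mD mE) => l; rewrite DE coef_map; exact: vge_iota.
have sD2 : size D2 = size D by rewrite -(size_map_poly iota) -ED2 size_scale // invr_eq0.
have DD1 : D %= map_poly iota D2 by rewrite -ED2 eqp_sym eqp_scale // invr_eq0.
rewrite (eqp_trans DD1) // eqp_map; apply: irr; first by rewrite sD2.
rewrite -(dvdp_map iota) -(eqp_dvdl _ DD1).
by rewrite PE dvdp_mulIr.
Qed.

Lemma residue_relation_irreducible (v : place) (y : K) (P : {poly Fq}) : vge v 0 y ->
  (forall i, (0 < i < place_deg v)%N -> res hK v y ^+ (q ^ i) != res hK v y) ->
  P != 0 -> (size P <= (place_deg v).+1)%N -> vge v 1 (ev y P) ->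
  size P = (place_deg v).+1 /\ irreducible_poly P.
Proof.
move=> Oy Hy P0 sP vP; have r0 := place_deg_gt0 hK v.
have sPE : size P = (place_deg v).+1.
  by apply/eqP; rewrite eqn_leq sP ltnNge; apply: contra P0 => sk; apply/eqP/(res_ev_eq0 Oy Hy sk).
split=> //; split; first by rewrite sPE ltnS.
move=> D sD DP; have /dvdpP [E PE] := DP.
have /andP [E0 D0] : (E != 0) && (D != 0) by rewrite -negb_or -mulf_eq0 -PE.
have sDE : (size D + size E = (place_deg v).+2)%N.
  have := size_mul E0 D0; rewrite -PE sPE => /(congr1 succn); rewrite prednK.
    by rewrite addnC => ->.
  by rewrite ltn_addr // size_poly_gt0.
rewrite -dvdp_size_eqp // sPE; apply/eqP.
have sE0 : (0 < size E)%N by rewrite size_poly_gt0.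
have sD0 : (0 < size D)%N by rewrite size_poly_gt0.
have [sDr|sDr] := leqP (size D) (place_deg v); last first.
  by move: sDE sE0 sDr; clear; move: (size D) (size E) (place_deg v); lia.
have sEr : (size E <= place_deg v)%N.
  by move: sDE sD sD0; clear; move: (size D) (size E) (place_deg v); lia.
have : vge v 1 (ev y D) || vge v 1 (ev y E).
  apply: contraT; rewrite negb_or -!(res_eq0 hK) ?vge_ev // => /andP [a1 b1].
  have : res hK v (ev y P) == 0 by rewrite res_eq0 // vge_ev.
  by rewrite PE evM resM ?vge_ev // mulf_eq0 (negPf a1) (negPf b1).
by case/orP => [/(res_ev_eq0 Oy Hy sDr) D1|/(res_ev_eq0 Oy Hy sEr) E1]; move: E0 D0; rewrite ?D1 ?E1 eqxx.
Qed.

Lemma res_frobenius_power (v : place) (p m i : nat) (y : K) : prime p -> p \in [pchar Fq] ->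
  vge v 0 y -> res hK v y ^+ i != res hK v y ->
  res hK v (y ^+ (p ^ m)) ^+ i != res hK v (y ^+ (p ^ m)).
Proof.
move=> p_pr pF Oy; apply: contra; rewrite (resX hK _ Oy); move: (res hK v y) => th.
rewrite -exprM mulnC exprM => /eqP E.
have pk : [pchar (resf hK v)].-nat (p ^ m)%N.
  by rewrite pnatX pnatE // (rmorph_pchar (res_iota hK v)).
rewrite -subr_eq0; have : (th ^+ i - th) ^+ (p ^ m) == 0.
  by rewrite exprDn_pchar // exprNn_pchar // E subrr.
by rewrite expf_eq0 => /andP [].
Qed.

Variables (p : nat) (p_pr : prime p) (pF : p \in [pchar Fq]).

(* If the f_i became dependent over K^Pi, a norm from the residue field at u would
   be a nonzero function with a zero of order Pi at u and too few poles. *)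
Lemma frobenius_independence (w u : place) a m s (f : 'I_s -> K) (G : 'I_s -> K) : u != w ->
  (forall i, L (<< a%:Z *g w >>) (f i)) -> free_mod cst [set 0] f ->
  (a * place_deg w < p ^ m)%N -> \sum_i f i * G i ^+ (p ^ m) = 0 -> forall i, G i = 0.
Proof.
move=> uw Lf ff am; set Pi := (p ^ m)%N => FG.
have Pi0 : (0 < Pi)%N by rewrite expn_gt0 prime_gt0.
apply: contrapT => /existsNP [i1 /eqP Gi1].
have [i0 Gi0 min0] := @arg_minP _ int _ i1 (fun i => G i != 0) (fun i => u (G i)) Gi1.
pose G' i := G i / G i0.
have OG' i : vge u 0 (G' i).
  have [E|Gi] := eqVneq (G i) 0; first by rewrite /G' E mul0r vge0.
  by rewrite vgeE ?mulf_neq0 ?invr_eq0 // place_div // subr_ge0 min0.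
have {FG} FG' : \sum_i f i * G' i ^+ Pi = 0.
  apply: (mulIf (expf_neq0 Pi Gi0)); rewrite mul0r -[RHS]FG mulr_suml.
  by apply: eq_bigr => i _; rewrite -mulrA -exprMn divfK.
set r := place_deg u; have r0 : (0 < r)%N := place_deg_gt0 hK u.
have [th Hth] := resf_exists_generator hK u.
have [y0 Oy0 y0th] := res_surj th.
pose Y0 := y0 ^+ Pi; have OY0 : vge u 0 Y0 by apply: vge0X.
have HY0 i : (0 < i < r)%N -> res hK u Y0 ^+ (q ^ i) != res hK u Y0.
  by move=> ir; apply: res_frobenius_power => //; rewrite y0th; apply: Hth.
have [P P0 [sP vP]] := residue_relation hK OY0.
have [sPE irrP] := residue_relation_irreducible OY0 HY0 P0 sP vP.
(* T is a power of q^r, so that y = y0^T keeps the residue of y0; and T >= Pi, so that P(Y) =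
   P(Y0)^T vanishes at u to order at least Pi. *)
pose T := (q ^ (r * m))%N.
have T_ge : (Pi <= T)%N.
  have [p' [e [p'pr p'F Eq e0]]] := card_finField_pow Fq.
  have pp : p' = p by apply/eqP; move: (pF); rewrite (pcharf_eq p'F) inE eq_sym.
  by rewrite /Pi /T Eq pp -expnM leq_exp2l ?prime_gt1 // mulnA leq_pmull // muln_gt0 e0.
pose y := y0 ^+ T; have Oy : vge u 0 y by apply: vge0X.
pose Y := Y0 ^+ T; have OY : vge u 0 Y by apply: vge0X.
have YyPi : Y = y ^+ Pi by rewrite /Y /y /Y0 -!exprM mulnC.
have vPY : vge u Pi%:Z (ev Y P).
  rewrite /Y /T /Submission.ev horner_card; have := vgeX T vP; rewrite mul1r; exact: vgeW.
have ry : res hK u y = th.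
  rewrite -y0th; apply/eqP; rewrite resP //; apply: (vge_fermat_dvdn hK) => //.
  exact: dvdn_mulr.
have span_y z : vge u 0 z -> exists h : {poly Fq}, (size h <= r)%N /\ vge u 1 (z - ev y h).
  move=> Oz; have [c [cc Wc]] : exists c : 'I_r -> K, (forall i, cst (c i)) /\ vge u 1 (z - \sum_i c i * y ^+ i).
    apply: (has_dim_free_basis hF (subspace_vge u 1) (subspace_vge u 0) (has_place_deg hK u)
      (b := fun i : 'I_r => y ^+ i)) => //= [i|c cc Wc]; first exact: vge0X.
    have /boolp.choice [e He] : forall i, exists a, iota a = c i by move=> i; have [e _] := cc i; exists e.
    pose C : {poly Fq} := \poly_(i < r) oapp e 0 (insub i).
    have C0 : C = 0.
      apply: (res_ev_eq0 Oy _ (size_poly _ _)); first by rewrite ry.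
      congr (vge u 1 _): Wc; rewrite (evE _ _ (size_poly _ _)); apply: eq_bigr => i _.
      by rewrite coef_poly ltn_ord valK /= He.
    move=> i; have := congr1 (fun p : {poly Fq} => p`_i) C0.
    by rewrite coef_poly ltn_ord valK coef0 /= => ai; rewrite -He ai rmorph0.
  have /boolp.choice [e He] : forall i, exists a, iota a = c i by move=> i; have [e _] := cc i; exists e.
  exists (\poly_(i < r) oapp e 0 (insub i)); split; first exact: size_poly.
  congr (vge u 1 (z - _)): Wc; rewrite (evE _ _ (size_poly _ _)); apply: eq_bigr => i _.
  by rewrite coef_poly ltn_ord valK /= He.
have /boolp.choice [h Hh] := fun i => span_y (G' i) (OG' i).
(* Replacing each G' i by its polynomial approximation in y and taking Pi-th powers turns the
   relation into sum_l H_l Y^l = 0 modulo m_u^Pi, with every H_l in L(a w). *)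
pose H (l : 'I_r) : K := \sum_i f i * iota ((h i)`_l ^+ Pi).
have LH l : L (<< a%:Z *g w >>) (H l).
  apply: (ss_sum (subspace_L _)) => i _; rewrite mulrC; apply: (ssZ (subspace_L _)) => //.
  exact: constant_iota.
have OH l : vge u 0 (H l) by have /L_point [H1 _] := LH l; apply: H1.
have HY : vge u Pi%:Z (\sum_l H l * Y ^+ l).
  have -> : \sum_l H l * Y ^+ l = \sum_i f i * (ev y (h i) ^+ Pi - G' i ^+ Pi).
    under [RHS]eq_bigr => i _ do rewrite mulrBr.
    rewrite sumrB FG' subr0 (eq_bigr (fun l : 'I_r => \sum_i f i * (iota ((h i)`_l ^+ Pi) * Y ^+ l))); last first.
      by move=> l _; rewrite mulr_suml; apply: eq_bigr => i _; rewrite mulrA.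
    rewrite exchange_big /=; apply: eq_bigr => i _; rewrite -mulr_sumr; congr (_ * _).
    rewrite (evE _ _ (Hh i).1) (expr_sum_p iota p_pr pF); apply: eq_bigr => l _.
    by rewrite -/Pi exprMn -rmorphXn YyPi -!exprM [(Pi * l)%N]mulnC.
  apply: vge_sum => i _; have /L_point [Of _] := Lf i; apply: vge0M; first exact: Of.
  have -> : ev y (h i) ^+ Pi - G' i ^+ Pi = - ((G' i - ev y (h i)) ^+ Pi).
    have := exprD_p iota p_pr pF (G' i - ev y (h i)) (ev y (h i)) m; rewrite subrK -/Pi => ->.
    by ring.
  by rewrite vgeN; have := vgeX Pi (Hh i).2; rewrite mul1r.
have [l0 Hl0] : exists l0, H l0 != 0.
  have h0 : h i0 != 0.
    apply/eqP => h0; have := (Hh i0).2; rewrite h0 ev0 subr0 /G' divff //.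
    by rewrite vgeE ?oner_eq0 // place1.
  pose l0 := (size (h i0)).-1; have l0r : (l0 < r)%N.
    by rewrite /l0 (@prednK (size (h i0))) ?size_poly_gt0 //; exact: (Hh i0).1.
  exists (Ordinal l0r); apply/eqP => H0.
  have := ff (fun i => iota ((h i)`_l0 ^+ Pi)) (fun i => constant_iota iota _) _ i0.
  move=> E; have /eqP : iota ((h i0)`_l0 ^+ Pi) = 0.
    by apply: E; rewrite /= -[RHS]H0; apply: eq_bigr => i _; rewrite mulrC.
  by rewrite fmorph_eq0 expf_eq0 Pi0 /= -/(lead_coef (h i0)) lead_coef_eq0 (negPf h0).
(* The matrix of multiplication by sum_l H_l X^l on K[X] / (P). Its determinant is the norm, nonzero
   because P stays irreducible over K. *)
pose R : 'M[K]_r := \matrix_(l, k) \sum_(j < r) H j * iota (('X^(l + j) %% P)`_k).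
have LR l k : L (<< a%:Z *g w >>) (R l k).
  rewrite mxE; apply: (ss_sum (subspace_L _)) => i _; rewrite mulrC; apply: (ssZ (subspace_L _)) => //.
  exact: constant_iota.
have P_neq0 : P != 0 by [].
have sR i : (size ('X^i %% P)%R <= r)%N by rewrite -ltnS -sPE ltn_modp.
have PK0 : map_poly iota P != 0 by rewrite map_poly_eq0.
have detR : \det R != 0.
  apply/det0P => -[c c0 cR].
  pose Cp : {poly K} := \poly_(l < r) oapp (fun l' => c ord0 l') 0 (insub l).
  pose Hp : {poly K} := \poly_(j < r) oapp H 0 (insub j).
  have CpE : Cp = \sum_(l < r) c ord0 l *: 'X^l.
    by rewrite /Cp poly_def; apply: eq_bigr => l _; rewrite valK.
  have HpE : Hp = \sum_(j < r) H j *: 'X^j.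
    by rewrite /Hp poly_def; apply: eq_bigr => l _; rewrite valK.
  have Hp0 : Hp != 0.
    apply/eqP => /(congr1 (fun p : {poly K} => p`_l0)).
    by rewrite coef_poly ltn_ord valK coef0 /=; apply/eqP.
  have Cp0 : Cp != 0.
    apply: contra_neq c0 => E; apply/rowP => l; rewrite mxE.
    by have := congr1 (fun p : {poly K} => p`_l) E; rewrite coef_poly ltn_ord valK coef0.
  have dvd : map_poly iota P %| Cp * Hp.
    have -> : Cp * Hp = \sum_(l < r) \sum_(j < r) (c ord0 l * H j) *: map_poly iota 'X^(l + j).
      rewrite CpE HpE mulr_suml; apply: eq_bigr => l _; rewrite mulr_sumr; apply: eq_bigr => j _.
      by rewrite map_polyXn -scalerAl -scalerAr scalerA exprD.
    have -> : \sum_(l < r) \sum_(j < r) (c ord0 l * H j) *: map_poly iota 'X^(l + j) =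
       \sum_(l < r) \sum_(j < r) (c ord0 l * H j) *: map_poly iota (('X^(l + j) %/ P) * P).
      apply/eqP; rewrite -subr_eq0 -sumrB; apply/eqP.
      transitivity (\sum_(l < r) \sum_(j < r) (c ord0 l * H j) *: map_poly iota ('X^(l + j) %% P)).
        apply: eq_bigr => l _; rewrite -sumrB; apply: eq_bigr => j _.
        by rewrite -scalerBr -rmorphB /= {1}(divp_eq 'X^(l + j) P) addrAC subrr add0r.
      apply/polyP => k; rewrite coef0 coef_sum.
      have [kr|rk] := ltnP k r.
        have := congr1 (fun M : 'M[K]_(1, r) => M ord0 (Ordinal kr)) cR; rewrite !mxE => E.
        rewrite -[RHS]E; apply: eq_bigr => l _; rewrite mxE coef_sum mulr_sumr.
        by apply: eq_bigr => j _; rewrite coefZ coef_map mulrA.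
      rewrite big1 // => l _; rewrite coef_sum big1 // => j _.
      by rewrite coefZ nth_default ?mulr0 // size_map_poly; exact: leq_trans (sR _) rk.
    apply: (big_ind (fun x => map_poly iota P %| x)) => [|x x' Hx Hx'|l _]; [exact: dvdp0|exact: dvdp_add|].
    apply: (big_ind (fun x => map_poly iota P %| x)) => [|x x' Hx Hx'|j _]; [exact: dvdp0|exact: dvdp_add|].
    by rewrite rmorphM /= scalerAl; apply: dvdp_mulIr.
  have irrPK := irreducible_over_K irrP.
  have sPK : size (map_poly iota P) = r.+1 by rewrite size_map_poly.
  have cop : coprimep (map_poly iota P) Hp.
    rewrite coprimep_def; apply: contraT => sg.
    have := irrPK.2 _ sg (dvdp_gcdl _ _) => E.
    have : map_poly iota P %| Hp by rewrite -(eqp_dvdl _ E) dvdp_gcdr.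
    by move/(dvdp_leq Hp0); rewrite sPK leqNgt ltnS size_poly.
  move: dvd; rewrite (Gauss_dvdpl _ cop) => /(dvdp_leq Cp0).
  by rewrite sPK leqNgt ltnS size_poly.
have vR l : vge u Pi%:Z (\sum_k R l k * Y ^+ k).
  have -> : \sum_k R l k * Y ^+ k =
     Y ^+ l * \sum_j H j * Y ^+ j - \sum_(j < r) H j * (ev Y ('X^(l + j) %/ P) * ev Y P).
    transitivity (\sum_(j < r) H j * ev Y ('X^(l + j) %% P)).
      rewrite (eq_bigr (fun k : 'I_r => \sum_(j < r) H j * (iota ('X^(l + j) %% P)`_k * Y ^+ k))).
        by rewrite exchange_big /=; apply: eq_bigr => j _; rewrite -mulr_sumr (evE _ _ (sR _)).
      by move=> k _; rewrite mxE mulr_suml; apply: eq_bigr => j _; rewrite mulrA.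
    rewrite mulr_sumr -sumrB; apply: eq_bigr => j _.
    rewrite mulrCA -exprD -evM -mulrBr; congr (_ * _).
    by rewrite -{2}(evX iota Y) -evXn -evB {2}(divp_eq 'X^(l + j) P) addrAC subrr add0r.
  apply: vgeB; first by apply: vge0M => //; apply: vge0X.
  apply: vge_sum => j _; apply: vge0M => //; apply: vge0M => //; exact: vge_ev.
(* The first entry of the vector of powers of Y is 1, so the adjugate expresses the determinant
   through the sums estimated in [vR]. *)
have vdet : vge u Pi%:Z (\det R).
  pose Yv : 'cV[K]_r := \col_k Y ^+ k.
  have E : \adj R *m (R *m Yv) = \det R *: Yv by rewrite mulmxA mul_adj_mx mul_scalar_mx.
  have := congr1 (fun M : 'cV[K]_r => M (Ordinal r0) ord0) E; rewrite !mxE /= expr0 mulr1 => <-.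
  apply: vge_sum => l _; apply: vge0M; last first.
    by rewrite mxE; under eq_bigr => k _ do rewrite [Yv _ _]mxE; exact: vR.
  rewrite !mxE; apply: vge0M; first by apply: vge0X; rewrite vgeN vge1.
  apply: vge_sum => sg _; apply: vge0M; first by apply: vge0X; rewrite vgeN vge1.
  apply: vge_prod => i _; rewrite !mxE.
  apply: vge_sum => j _; apply: vge0M => //; exact: vge_iota.
have Ldet : L (<< (r * a)%N%:Z *g w >>) (\det R).
  have Lprod (t : 'I_r -> 'I_r) : L (<< (r * a)%N%:Z *g w >>) (\prod_i R i (t i)).
    apply/L_point; split=> [v vw|].
      by apply: vge_prod => i _; have /L_point [H1 _] := LR i (t i); apply: H1.
    have -> : - (r * a)%N%:Z = \sum_(i < r) - a%:Z by rewrite sumr_const card_ord -mulr_natr natz PoszM mulNr mulrC.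
    elim/big_ind2: _ => [|x n1 x' n2 Hx Hx'|i _]; [exact: vge1|exact: vgeM|].
    by have /L_point [_ H2] := LR i (t i).
  apply: (ss_sum (subspace_L _)) => sg _; move: (Lprod (perm.fun_of_perm sg)).
  case: (perm.odd_perm sg); rewrite ?expr0 ?expr1 ?mul1r // mulN1r => H1.
  exact: (ssN hF (subspace_L _)).
have : dle (<< Pi%:Z *g u >> - << (r * a)%N%:Z *g w >>) (pdiv iota (\det R)).
  move=> v; rewrite (coeff_pdiv hK) // coeffB !coeffU.
  move: Ldet; rewrite LspaceE => /(_ v); rewrite vgeE // coeffU.
  case: (eqVneq u v) => [uv|_]; last by rewrite mulr0 sub0r.
  move: vdet; rewrite uv vgeE // => vd _.
  by rewrite -uv [w == u]eq_sym (negPf uw) mulr0 mulr1 subr0 uv.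
move/dle_deg; rewrite (deg_pdiv hK) // div_degB !div_degU // -/r.
have ar : ((r * a)%N%:Z * (place_deg w)%:Z < Pi%:Z * r%:Z).
  by rewrite -!PoszM ltz_nat -mulnA [(Pi * r)%N]mulnC ltn_pmul2l.
by rewrite subr_le0 leNgt ar.
Qed.
End Norm.

Lemma sum_supported_multiples (V : nmodType) (h : nat -> V) p d : (0 < p)%N ->
  (forall i, ~~ (p %| i)%N -> h i = 0) -> \sum_(i < d * p) h i = \sum_(l < d) h (l * p)%N.
Proof.
move=> p0 hp; rewrite -(big_mkord xpredT h) big_nat_mul big_mkord.
apply: eq_bigr => l _; rewrite big_ltn; last by rewrite ltn_pmul2r.
rewrite [X in _ X = _]big_nat_cond big1 /= ?addr0 // => i /andP [/andP [i1 i2] _].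
by apply: hp; apply/negP => /dvdnP [k ik]; move: i1 i2; rewrite ik !ltn_pmul2r //; lia.
Qed.

(** * Functions whose only pole is at w *)

Section LocalSurjection.
Variables (Fq : finFieldType) (K : fieldType) (iota : {rmorphism Fq -> K}).
Hypothesis hK : function_field iota.
Notation cst := (constants iota).
Notation place := (place iota).
Notation divisor := (divisor iota).
Notation ev := (ev iota).
Notation transc := (transc iota).
Notation fdeg := (fdeg iota).
Notation "'F(' f )" := (rational_in iota f) (at level 0, format "'F(' f )").
Notation L D := (riemann_roch_space D).
Notation g := (genus iota).
Implicit Types (v w : place) (S : seq place) (D E : divisor) (f h : K).

Let hF := subfield_constants iota.
Notation q := #|Fq|.

(** By Riemann-Roch L(D) / L(D - v) has dimension deg v, the same as the graded piece of the local
    filtration at v into which it embeds. *)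
Lemma local_surjective (v : place) D y : 2 * g%:Z - 1 <= div_deg D - (place_deg v)%:Z ->
  vge v (- coeff v D) y -> exists2 y', L D y' & vge v (- coeff v D + 1) (y - y').
Proof.
move=> dD Oy; pose D' : divisor := D - << 1 *g v >>.
have cD' (u : place) : coeff u D' = coeff u D - (v == u)%:Z.
  by rewrite coeffB coeffU; case: (v == u); rewrite /= ?mulr1 ?mulr0.
have D'D : dle D' D by move=> u; rewrite cD'; case: (v == u) => /=; lia.
have dD' : div_deg D' = div_deg D - (place_deg v)%:Z by rewrite div_degB div_degU mul1r.
have [m Hm Em] := has_dim_LL hK D'D.
have mE : m = place_deg v.
  have R1 := riemann_roch_large hK (D := D); have R2 := riemann_roch_large hK (D := D').
  move: R1 R2; rewrite Em dD'; move: dD; move: (div_deg D) (ell D') (place_deg v) => a b c.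
  by clear; lia.
rewrite {m}mE in Hm Em; have [b [Lb _ fb]] := Hm.
have LD' x : L D x -> vge v (- coeff v D + 1) x -> L D' x.
  rewrite !LspaceE /= => Hx Hv u; rewrite cD'; case: (eqVneq v u) => [<-|_] /=.
    by apply: vgeW Hv; lia.
  by rewrite subr0.
have sp : span_mod cst [set x | vge v (- coeff v D + 1) x] [set x | vge v (- coeff v D) x] b.
  apply: (has_dim_free_basis hF (subspace_vge v _) (subspace_vge v _) (has_dim_local hK v _)).
    by move=> i; have := Lb i; rewrite LspaceE => /(_ v).
  move=> c cc Wc; apply: fb => //; apply: LD' => //.
  by apply: (ss_sum (subspace_L _)) => i _; apply: (ssZ (subspace_L _)).
have [c [cc Wc]] := sp y Oy; exists (\sum_i c i * b i) => //.
by apply: (ss_sum (subspace_L _)) => i _; apply: (ssZ (subspace_L _)).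
Qed.

Lemma deg_point_ge (w : place) (N : nat) : N%:Z <= div_deg (<< N%:Z *g w >> : divisor).
Proof. by rewrite div_degU -PoszM lez_nat leq_pmulr // place_deg_gt0. Qed.

Lemma strong_approximation (w v : place) y : v != w -> vge v 0 y ->
  exists2 y', integral_off w y' & vge v 1 (y - y').
Proof.
move=> vw Oy; pose N := (2 * g + place_deg v)%N.
have [||y' /L_point [Iy' _] vy'] := @local_surjective v (<< N%:Z *g w >>) y.
- by have := deg_point_ge w N; rewrite /N; lia.
- by rewrite coeffU eq_sym (negPf vw) mulr0.
by exists y' => //; move: vy'; rewrite coeffU eq_sym (negPf vw) mulr0.
Qed.

Lemma integral_uniformizer (w v : place) : v != w ->
  exists y, [/\ integral_off w y, y != 0 & v y = 1].
Proof.
move=> vw; have [t t0 vt] := place_uniformizer v.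
pose N := (2 * g + 2 * place_deg v)%N; pose D : divisor := << N%:Z *g w >> - << 1 *g v >>.
have cD : coeff v D = -1.
  by rewrite coeffB !coeffU eqxx eq_sym (negPf vw) mulr0 mulr1 sub0r.
have [||y' Ly vy'] := @local_surjective v D t.
- rewrite div_degB; have := deg_point_ge w N; have := div_degU 1 v; rewrite mul1r => ->.
  by rewrite /N; lia.
- by rewrite cD opprK vgeE // vt.
have := @place_addl _ _ _ v t (y' - t) t0; rewrite subrKC vt => -[|y0 vy].
  by rewrite -vgeN opprB; rewrite cD in vy'.
exists y'; split=> // u uw; move: Ly; rewrite LspaceE => /(_ u); rewrite coeffB !coeffU.
by rewrite eq_sym (negPf uw) mulr0 sub0r opprK; apply: vgeW; case: (v == u).
Qed.

Variables (w : place) (z x : K) (n : nat).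
Hypotheses (n0 : (0 < n)%N) (wz : w z = - n%:Z) (tz : transc z) (Iz : integral_off w z).
Notation kap := (place_deg w).
Notation d := (n * kap)%N.
Hypotheses (fz : fdeg z = d) (fx : free_mod F(z) [set 0] (fun l : 'I_d => x ^+ l)).

Lemma power_basis y : exists c : 'I_d -> K, (forall i, F(z) (c i)) /\ y = \sum_i c i * x ^+ i.
Proof.
have [] := @has_dim_free_basis _ _ (subfield_rational iota z) [set 0] setT d (fun l : 'I_d => x ^+ l)
  (subspace0 _) (subspaceT _) _ _ fx y => //; first by rewrite -fz; apply: has_fdeg.
by move=> c [cc /eqP]; rewrite subr_eq0 => /eqP E; exists c.
Qed.

(* The poles at w of an integral element can be removed one order at a time by z. *)
Lemma integral_finitely_generated : exists2 B : {poly Fq}, B != 0 & forall y, integral_off w y ->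
  exists P : 'I_d -> {poly Fq}, ev z B * y = \sum_l ev z (P l) * x ^+ l.
Proof.
pose N1 := (2 * g + kap + n)%N.
have [b [Lb sb _]] := has_ell hK (<< N1%:Z *g w >> : divisor).
have /boolp.choice [c Hc] := fun j => power_basis (b j).
have [B [P [B0 HP]]] := @common_denominator _ _ iota z _
  (fun t : 'I_(ell (<< N1%:Z *g w >> : divisor)) * 'I_d => c t.1 t.2) (fun t => (Hc t.1).1 t.2).
exists B; first by apply: contra_neq B0 => ->; rewrite ev0.
pose good y := exists P : 'I_d -> {poly Fq}, ev z B * y = \sum_l ev z (P l) * x ^+ l.
have goodD y y' : good y -> good y' -> good (y + y').
  move=> [A HA] [A' HA']; exists (fun l => A l + A' l); rewrite mulrDr HA HA' -big_split /=.
  by apply: eq_bigr => l _; rewrite evD mulrDl.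
have goodM y (A : {poly Fq}) : good y -> good (ev z A * y).
  move=> [A' HA]; exists (fun l => A * A' l); rewrite mulrCA HA mulr_sumr.
  by apply: eq_bigr => l _; rewrite evM mulrA.
have base y : L (<< N1%:Z *g w >>) y -> good y.
  move=> Ly; have [e [ce /eqP]] := sb y Ly; rewrite subr_eq0 => /eqP ->.
  have gb j : good (b j).
    exists (fun l => P (j, l)); rewrite (Hc j).2 mulr_sumr; apply: eq_bigr => l _.
    by rewrite -(HP (j, l)) mulrA.
  apply: big_ind => [|//|j _]; first by exists (fun _ => 0); rewrite mulr0 big1 // => l _; rewrite ev0 mul0r.
  by have [a _ <-] := ce j; rewrite -(evC iota z); apply: goodM.
suff H (N : nat) y : L (<< N%:Z *g w >>) y -> good y.
  move=> y Iy; have [N HN] := vge_exists w y; apply: (H N); exact/L_point.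
elim/ltn_ind: N y => N IH y Ly.
have [le|gt] := leqP N N1.
  by apply: base; apply: L_sub Ly => v; rewrite !coeffU; case: (_ == _); lia.
move/L_point: Ly => [Iy wy].
have z0 := transc_neq0 tz.
have nN : (n <= N)%N by rewrite /N1 in gt; lia.
have [||y' Ly' vy'] := @local_surjective w (<< (N - n)%N%:Z *g w >>) (y / z).
- have := deg_point_ge w (N - n); rewrite /N1 in gt; lia.
- rewrite coeffU eqxx mulr1.
  have -> : - (N - n)%N%:Z = - N%:Z + n%:Z by lia.
  by apply: vgeM => //; rewrite vgeE ?invr_eq0 // placeV // wz opprK.
have -> : y = (y - z * y') + ev z 'X * y' by rewrite evX subrK.
apply: goodD; last by apply: goodM; apply: (IH (N - n)%N) => //; lia.
apply: (IH N.-1); first by lia.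
apply/L_point; split=> [v vw|].
  apply: vgeB; first exact: Iy.
  by apply: vge0M; [apply: Iz|have /L_point [H _] := Ly'; apply: H].
have -> : y - z * y' = z * (y / z - y') by rewrite mulrBr mulrCA divff // mulr1.
have -> : - N.-1%:Z = - n%:Z + (- (N - n)%N%:Z + 1) by lia.
apply: vgeM; first by rewrite vgeE // wz.
by move: vy'; rewrite coeffU eqxx mulr1.
Qed.

Variable (p : nat).
Hypotheses (p_pr : prime p) (pF : p \in [pchar Fq]) (pn : ~~ (p %| n)%N).

(* The different of x is nonzero because the powers of x ^ p are still free. *)
Lemma separable_relation : exists m : 'I_d.+1 -> {poly Fq}, [/\ m ord_max != 0,
  \sum_i ev z (m i) * x ^+ i = 0 & \sum_i ev z (m i) * (x ^+ i.-1 *+ i) != 0].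
Proof.
have [c [cc cE]] := power_basis (x ^+ d).
have [D [P [D0 HP]]] := @common_denominator _ _ iota z _ c cc.
pose m (i : 'I_d.+1) : {poly Fq} := oapp (fun j => - P j) D (insub (i : nat)).
have mw (j : 'I_d) : m (widen_ord (leqnSn d) j) = - P j by rewrite /m /= valK.
have mm : m ord_max = D by rewrite /m insubN //= ltnn.
have mD0 : D != 0 by apply: contra_neq D0 => ->; rewrite ev0.
have p1 := prime_gt1 p_pr.
exists m; split; first by rewrite mm.
  rewrite big_ord_recr /= mm cE mulr_sumr -big_split /= big1 // => j _.
  by rewrite mw evN mulNr mulrA HP addNr.
apply/eqP => E.
have pK : p \in [pchar K] by apply: (pcharK iota pF).
(* The derivative is a relation of degree less than d in x over F(z), so all i * m_i vanish. *)
have m_eq0 (i : 'I_d.+1) : ~~ (p %| i)%N -> m i = 0.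
  move=> pi; have i0 : (0 < i)%N by rewrite lt0n; apply: contra pi => /eqP->; rewrite dvdn0.
  have id : (i.-1 < d)%N by rewrite prednK // -ltnS ltn_ord.
  have := free_rational_poly tz (I := 'I_d) (b := fun l => x ^+ l) _
    (P := fun l => m (fintype.lift ord0 l) *+ l.+1) _ (Ordinal id).
  rewrite /= => H.
  have : m (fintype.lift ord0 (Ordinal id)) *+ i.-1.+1 = 0.
    apply: H => [e ee e0 l|]; first by apply: (fx ee).
    move: E; rewrite big_ord_recl /= mulr0n mulr0 add0r => E; rewrite -[RHS]E.
    apply: eq_bigr => l _; rewrite -[m _ *+ _]mulr_natl -polyC_natr evM evC rmorph_nat.
    by rewrite /bump /= add1n -[x ^+ _ *+ _]mulr_natl mulrCA mulrA.
  rewrite prednK // => /eqP; rewrite -mulr_natl mulf_eq0 => /orP [].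
    by rewrite -polyC_natr polyC_eq0 -(dvdn_pcharf pF) (negPf pi).
  have -> : fintype.lift ord0 (Ordinal id) = i by apply: val_inj; rewrite /= /bump /= add1n prednK.
  by move/eqP.
have fxp : free_mod F(z) [set 0] (fun l : 'I_d => (x ^+ l) ^+ p).
  apply: (frobenius_free p_pr pF tz) => //; apply: (place_frobenius_free (v := w) p_pr pF).
    exact: transc_neq0 tz.
  by rewrite wz dvdzE abszN.
have d0 : (0 < d)%N by rewrite muln_gt0 n0 place_deg_gt0.
pose mp (l : 'I_d) : {poly Fq} := oapp m 0 (insub (p * l)%N).
have mp0 : forall l, mp l = 0.
  apply: (free_rational_poly tz (b := fun l : 'I_d => (x ^+ l) ^+ p)) => [e ee e0 l|]; first exact: (fxp e ee).
  pose h (i : nat) := (if (p %| i)%N then ev z (oapp m 0 (insub i)) * x ^+ i else 0).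
  have : \sum_(i < d.+1) h i = 0.
    rewrite -[RHS](_ : \sum_i ev z (m i) * x ^+ i = 0); last first.
      rewrite big_ord_recr /= mm cE mulr_sumr -big_split /= big1 // => j _.
      by rewrite mw evN mulNr mulrA HP addNr.
    apply: eq_bigr => i _; rewrite /h valK /=; case: ifPn => // pi.
    by rewrite m_eq0 // ev0 mul0r.
  have -> : \sum_(i < d.+1) h i = \sum_(i < p * d) h i.
    rewrite -(big_mkord xpredT h) -[RHS](big_mkord xpredT h).
    rewrite [RHS](big_cat_nat (n := d.+1)) //=; last by nia.
    rewrite [X in _ = _ + X]big_nat_cond [X in _ = _ + X]big1 ?addr0 // => i; rewrite andbT => /andP [di _].
    by rewrite /h insubN ?ev0 ?mul0r ?if_same // -leqNgt.
  move=> E2; rewrite -[RHS]E2 [(p * d)%N]mulnC sum_supported_multiples ?prime_gt0 // => [|i /negPf ip].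
    by apply: eq_bigr => l _; rewrite /h dvdn_mull // /mp [(p * l)%N]mulnC exprM.
  by rewrite /h ip.
(* The leading coefficient is nonzero, so p divides d; it then belongs to the power (x^(d/p))^p, and
   [mp0] makes it vanish after all. *)
have pd : (p %| d)%N.
  apply: contraT => pd; have := m_eq0 ord_max pd; rewrite mm => D00; by rewrite D00 eqxx in mD0.
have ldp : (d %/ p < d)%N by rewrite ltn_Pdiv.
have := mp0 (Ordinal ldp); rewrite /mp /=.
have -> : (p * (d %/ p))%N = @ord_max d :> nat by rewrite mulnC divnK.
by rewrite valK /= mm => D00; rewrite D00 eqxx in mD0.
Qed.
End LocalSurjection.

(** * The upper bound of Stepanov and Bombieri *)

Section Stepanov.
Variables (Fq : finFieldType) (K : fieldType) (iota : {rmorphism Fq -> K}).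
Hypothesis hK : function_field iota.
Notation cst := (constants iota).
Notation place := (place iota).
Notation divisor := (divisor iota).
Notation ev := (ev iota).
Notation transc := (transc iota).
Notation fdeg := (fdeg iota).
Notation "'F(' f )" := (rational_in iota f) (at level 0, format "'F(' f )").
Notation L D := (riemann_roch_space D).
Notation g := (genus iota).
Implicit Types (v w : place) (S : seq place) (D E : divisor) (f h : K).

Let hF := subfield_constants iota.
Notation q := #|Fq|.

(** Each of the N conditions takes values in a space of dimension e, hence amounts to e linear
    equations over the constants. *)
Lemma common_kernel (T : finType) N (V : set K) e (y : T -> 'I_N -> K) :
  has_dim cst [set 0] V e -> (forall t l, V (y t l)) -> (N * e < #|T|)%N ->
  exists c : T -> K, [/\ forall t, cst (c t), exists t, c t != 0 & forall l, \sum_t c t * y t l = 0].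
Proof.
move=> [b [_ sb _]] Vy lt.
have /boolp.choice [A HA] : forall tl : T * 'I_N, exists a : 'I_e -> K,
    (forall i, cst (a i)) /\ y tl.1 tl.2 = \sum_i a i * b i.
  move=> [t l] /=; have [a [ca /eqP]] := sb _ (Vy t l); rewrite subr_eq0 => /eqP E; by exists a.
have lt' : (#|{: 'I_N * 'I_e}| < #|T|)%N by rewrite card_prod !card_ord.
have [c [cc [i ci] c0]] := @homog_system _ _ hF _ _
  (fun i j => A (enum_val i, (enum_val j).1) (enum_val j).2) (fun i j => (HA _).1 _) lt'.
exists (fun t => c (enum_rank t)); split=> // [|l].
  by exists (enum_val i); rewrite enum_valK.
rewrite (eq_bigr (fun t => \sum_j c (enum_rank t) * A (t, l) j * b j)); last first.
  by move=> t _; rewrite (HA (t, l)).2 mulr_sumr; apply: eq_bigr => j _; rewrite mulrA.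
rewrite exchange_big big1 //= => j _; rewrite -mulr_suml.
suff -> : \sum_t c (enum_rank t) * A (t, l) j = 0 by rewrite mul0r.
rewrite -[RHS](c0 (enum_rank (l, j))) (big_enum_val (A := T) (fun t => c (enum_rank t) * A (t, l) j)).
by apply: eq_bigr => t _; rewrite enum_rankK enum_valK.
Qed.

Lemma vge_unit_cancel v N y b : ~~ vge v 1 b -> vge v 0 b -> vge v N (b * y) -> vge v N y.
Proof.
have [->|y0] := eqVneq y 0; first by rewrite vge0.
have [->|b0] := eqVneq b 0; first by rewrite vge0.
by rewrite !vgeE ?mulf_neq0 // val_atM //; lia.
Qed.

Lemma vge_expr_diff v N a b i : vge v 0 a -> vge v 0 b -> vge v N (a - b) -> vge v N (a ^+ i - b ^+ i).
Proof.
move=> Oa Ob ab; rewrite subrXX; apply: vgeM0 => //; apply: vge_sum => j _.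
by apply: vge0M; apply: vge0X.
Qed.

Lemma vge_ev_diff v N a b (P : {poly Fq}) : vge v 0 a -> vge v 0 b -> vge v N (a - b) ->
  vge v N (ev a P - ev b P).
Proof.
move=> Oa Ob ab; rewrite !(evE _ _ (leqnn _)) -sumrB; apply: vge_sum => i _.
by rewrite -mulrBr; apply: vge0M; [apply: vge_iota|apply: vge_expr_diff].
Qed.

Lemma vge_frobenius_iter v N y k i : 0 <= N -> (0 < i)%N -> vge v N (y ^+ (q ^ k) - y) ->
  vge v N (y ^+ (q ^ (k * i)) - y).
Proof.
move=> N0 i0 H; case: i i0 => // i _; elim: i => [|i IH]; first by rewrite muln1.
have -> : y ^+ (q ^ (k * i.+2)) - y = (y ^+ (q ^ (k * i.+1)) - y) ^+ (q ^ k) + (y ^+ (q ^ k) - y).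
  by rewrite (exprB_card iota) -exprM -expnD -mulnSr addrA subrK.
apply: vgeD => //; apply: vgeW (vgeX _ IH); rewrite ler_peMr // lez_nat expn_gt0.
by rewrite (ltnW (card_gt1 Fq)).
Qed.

Lemma expr_sum_card k (I : Type) (r : seq I) (P : pred I) (G : I -> K) :
  (\sum_(i <- r | P i) G i) ^+ (q ^ k) = \sum_(i <- r | P i) G i ^+ (q ^ k).
Proof.
apply: (big_morph (fun x => x ^+ (q ^ k))) => [y z|]; first exact: (exprD_card iota).
by rewrite expr0n expn_eq0 (gtn_eqF (ltnW (card_gt1 Fq))).
Qed.

(* The multiplicity of z ^ (q ^ k) - z at v is bounded because the minimal polynomial
   of the residue of z takes at z and at its conjugate values of different orders. *)
Lemma frobenius_multiplicity_bound v z : transc z -> vge v 0 z ->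
  exists e : nat, forall k, (0 < k)%N -> v (z ^+ (q ^ k) - z) <= e%:Z.
Proof.
move=> tz Oz; have [P P0 [_ vP]] := residue_relation hK Oz.
have eP0 : ev z P != 0 by apply: ev_neq0.
rewrite vgeE // in vP; exists `|v (ev z P)|%N => k k0; rewrite leNgt; apply/negP => H.
have Q1 := q_pow_gt1 Fq k0.
rewrite gez0_abs ?(le_trans _ vP) // in H.
have H1 : vge v (v (ev z P) + 1) (ev (z ^+ (q ^ k)) P - ev z P).
  have Z0 := transc_neq0 (transc_card_pow hK tz Q1).
  by apply: vge_ev_diff => //; [apply: vge0X|rewrite vgeE ?lezD1].
have H2 : vge v (v (ev z P) + 1) (ev (z ^+ (q ^ k)) P).
  by rewrite /Submission.ev horner_card vgeE ?expf_neq0 // placeX //; move: vP Q1; rewrite -/(ev z P); nia.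
have : vge v (v (ev z P) + 1) (ev z P).
  by have := vgeB H2 H1; rewrite opprB addrCA subrr addr0.
by rewrite vgeE //; lia.
Qed.

Variables (w : place) (z x : K) (n : nat).
Hypotheses (n0 : (0 < n)%N) (wz : w z = - n%:Z) (tz : transc z) (Iz : integral_off w z) (Ix : integral_off w x).
Notation kap := (place_deg w).
Notation d := (n * kap)%N.
Hypotheses (fx : free_mod F(z) [set 0] (fun l : 'I_d => x ^+ l)).
Variables (B : {poly Fq}) (m : 'I_d.+1 -> {poly Fq}).
Hypotheses (HB : forall y, integral_off w y ->
  exists P : 'I_d -> {poly Fq}, ev z B * y = \sum_l ev z (P l) * x ^+ l)
  (Mx : \sum_i ev z (m i) * x ^+ i = 0).

Let Mf (Y : K) := \sum_i ev z (m i) * Y ^+ i.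
(** The coefficient of Y^l in (M(Y) - M(x)) / (Y - x), where M(Y) = sum_i m_i(z) Y^i. The quotient
    itself is [rel_quot], whose value at x is the derivative M'(x). *)
Definition rel_coef (l : nat) : K := \sum_(i < d.+1 | (l < i)%N) ev z (m i) * x ^+ (i.-1 - l).
Definition rel_quot (Y : K) : K := \sum_(l < d) rel_coef l * Y ^+ l.

Lemma rel_quotE Y : Mf Y = (Y - x) * rel_quot Y.
Proof.
rewrite -[Mf Y]subr0 -Mx /Mf -sumrB /rel_quot mulr_sumr.
rewrite (eq_bigr (fun i : 'I_d.+1 => \sum_(l < d | (l < i)%N) (Y - x) * (ev z (m i) * x ^+ (i.-1 - l) * Y ^+ l))).
  rewrite (exchange_big_dep xpredT) //=; apply: eq_bigr => l _.
  by rewrite /rel_coef -mulr_sumr -mulr_suml.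
move=> i _; have id : (i <= d)%N by rewrite -ltnS ltn_ord.
rewrite -mulrBr -opprB subrXX -mulNr opprB mulrCA -mulr_sumr; congr (_ * _).
rewrite (big_ord_widen d (fun l => x ^+ (i.-1 - l) * Y ^+ l) id) mulr_sumr.
by apply: eq_bigr => l _; rewrite mulrA.
Qed.

Lemma rel_quot_root : rel_quot x = \sum_i ev z (m i) * (x ^+ i.-1 *+ i).
Proof.
rewrite /rel_quot (eq_bigr (fun l : 'I_d => \sum_(i < d.+1 | (l < i)%N) ev z (m i) * x ^+ i.-1)).
  rewrite (exchange_big_dep xpredT) //=; apply: eq_bigr => i _.
  have id : (i <= d)%N by rewrite -ltnS ltn_ord.
  by rewrite -(big_ord_widen d (fun=> ev z (m i) * x ^+ i.-1) id) sumr_const card_ord mulrnAr.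
move=> l _; rewrite /rel_coef mulr_suml; apply: eq_bigr => i li.
by rewrite -mulrA -exprD subnK // -ltnS prednK // (leq_trans _ li).
Qed.

Lemma rel_coef_top : rel_coef d.-1 = ev z (m ord_max).
Proof.
have d0 : (0 < d)%N by rewrite muln_gt0 n0 place_deg_gt0.
rewrite /rel_coef (big_pred1 ord_max) ?subnn ?mulr1 //.
move=> i; have id : (i <= d)%N by rewrite -ltnS ltn_ord.
apply/idP/eqP => [lt|->]; last by rewrite /= prednK.
by apply/val_inj/eqP; rewrite eqn_leq id /=; move: lt; rewrite prednK.
Qed.

Lemma integral_rel_coef l : integral_off w (rel_coef l).
Proof.
move=> v vw; apply: vge_sum => i _.
by apply: vge0M; [apply: vge_ev; apply: Iz|apply: vge0X; apply: Ix].
Qed.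

(** Finitely many places are excluded: those where B cannot be inverted, where M drops in degree, or
    where x is not a simple root of M. *)
Definition unramified v := [/\ v != w, ~~ vge v 1 (ev z B), ~~ vge v 1 (ev z (m ord_max)) &
  ~~ vge v 1 (rel_quot x)].

(** [ev z B * y] is a polynomial in z and x, which inherits the congruence from z and x; and
    [ev z B] is a unit at v. *)
Lemma unramified_frobenius v N k : 0 <= N -> unramified v -> vge v N (z ^+ (q ^ k) - z) ->
  vge v N (x ^+ (q ^ k) - x) -> forall y, integral_off w y -> vge v N (y ^+ (q ^ k) - y).
Proof.
move=> N0 [vw vB _ _] Hz Hx y Iy; have [P HP] := HB Iy.
have [Oz Ox Oy] := And3 (Iz vw) (Ix vw) (Iy v vw).
have frob (A : {poly Fq}) : vge v N (ev z A ^+ (q ^ k) - ev z A).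
  by rewrite -horner_card; apply: vge_ev_diff => //; apply: vge0X.
have OB : vge v 0 (ev z B) by apply: vge_ev.
apply: (vge_unit_cancel vB OB).
have -> : ev z B * (y ^+ (q ^ k) - y) =
  ((ev z B * y) ^+ (q ^ k) - ev z B * y) - (ev z B ^+ (q ^ k) - ev z B) * y ^+ (q ^ k).
  by rewrite exprMn; ring.
apply: vgeB; last by apply: vgeM0 => //; apply: vge0X.
rewrite HP expr_sum_card -sumrB; apply: vge_sum => l _.
rewrite exprMn -[(x ^+ l) ^+ _]exprM mulnC exprM.
have -> : ev z (P l) ^+ (q ^ k) * x ^+ (q ^ k) ^+ l - ev z (P l) * x ^+ l =
  ev z (P l) ^+ (q ^ k) * (x ^+ (q ^ k) ^+ l - x ^+ l) + (ev z (P l) ^+ (q ^ k) - ev z (P l)) * x ^+ l by ring.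
apply: vgeD; first by apply: vge0M; [apply/vge0X/vge_ev|apply: vge_expr_diff => //; apply: vge0X].
by apply: vgeM0 => //; apply: vge0X.
Qed.

(** By strong approximation the functions integral off w fill the residue field at v, so its k-th
    Frobenius power is trivial. *)
Lemma unramified_place_deg v k : (0 < k)%N -> unramified v -> vge v 1 (z ^+ (q ^ k) - z) ->
  vge v 1 (x ^+ (q ^ k) - x) -> (place_deg v %| k)%N.
Proof.
move=> k0 uv Hz Hx; have [vw _ _ _] := uv.
apply: (place_deg_dvdn hK k0) => y Oy; have [y' Iy' yy'] := strong_approximation hK vw Oy.
have -> : y ^+ (q ^ k) - y = (y - y') ^+ (q ^ k) - (y - y') + (y' ^+ (q ^ k) - y').
  by rewrite (exprB_card iota); ring.
apply: vgeD; last exact: unramified_frobenius.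
apply: vgeB => //; apply: vgeW (vgeX _ yy'); rewrite mul1r lez_nat.
exact: ltnW (q_pow_gt1 Fq k0).
Qed.

(** Raising M(x) = 0 to the power Q = q^k gives a relation for x^Q with coefficients m_i(z^Q);
    replacing z^Q by z changes it only by terms of value at least N. *)
Lemma rel_frobenius v N k : v != w -> vge v N (z ^+ (q ^ k) - z) ->
  vge v N ((x ^+ (q ^ k) - x) * rel_quot (x ^+ (q ^ k))).
Proof.
move=> vw Hz; have [Oz Ox] := conj (Iz vw) (Ix vw).
have Q0 : (0 < q ^ k)%N by rewrite expn_gt0 (ltnW (card_gt1 Fq)).
have E0 : (Mf x) ^+ (q ^ k) = 0 by rewrite /Mf Mx expr0n (gtn_eqF Q0).
rewrite -rel_quotE -[Mf _]subr0 -E0 /Mf expr_sum_card -sumrB; apply: vge_sum => i _.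
rewrite exprMn -exprM -[in X in _ - X]exprM [(i * _)%N]mulnC -mulrBl.
apply: vgeM0; last exact: vge0X.
by rewrite -horner_card -vgeN opprB; apply: vge_ev_diff => //; apply: vge0X.
Qed.

Lemma vge_rel_quot_diff v Y : v != w -> vge v 0 Y -> vge v 1 (Y - x) ->
  vge v 1 (rel_quot Y - rel_quot x).
Proof.
move=> vw OY Yx; rewrite /rel_quot -sumrB; apply: vge_sum => l _; rewrite -mulrBr.
by apply: vge0M; [apply: integral_rel_coef|apply: vge_expr_diff => //; apply: Ix].
Qed.

(** At a double zero, passing from k to k * deg v makes x^Q = x modulo m_v and then, [rel_quot]
    being a unit at x^Q, modulo m_v^2. The same congruence follows for every function integral off
    w, which is absurd for one that is a uniformizer at v. *)
Lemma unramified_simple v k : (0 < k)%N -> unramified v -> ~~ vge v 2 (z ^+ (q ^ k) - z).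
Proof.
move=> k0 uv; have [vw _ _ vM] := uv; apply/negP => H.
have [Oz Ox] := conj (Iz vw) (Ix vw).
have r0 := place_deg_gt0 hK v; pose k' := (k * place_deg v)%N.
have k'0 : (0 < k')%N by rewrite muln_gt0 k0.
have Hz : vge v 2 (z ^+ (q ^ k') - z) by apply: vge_frobenius_iter.
have Hx1 : vge v 1 (x ^+ (q ^ k') - x) by apply: (vge_fermat_dvdn hK); rewrite ?dvdn_mull.
have OxQ : vge v 0 (x ^+ (q ^ k')) by apply: vge0X.
have OM Y : vge v 0 Y -> vge v 0 (rel_quot Y).
  by move=> OY; apply: vge_sum => l _; apply: vge0M; [apply: integral_rel_coef|apply: vge0X].
have Hx : vge v 2 (x ^+ (q ^ k') - x).
  apply: (@vge_unit_cancel _ _ _ (rel_quot (x ^+ (q ^ k')))).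
  - apply: contra vM => H1; have := vgeB H1 (vge_rel_quot_diff vw OxQ Hx1).
    by rewrite opprB addrC subrK.
  - exact: OM.
  - by rewrite mulrC; apply: rel_frobenius.
have [y [Iy y0 vy]] := integral_uniformizer hK vw.
have H2 : vge v 2 (y ^+ (q ^ k') - y) by apply: unramified_frobenius.
have H3 : vge v 2 (y ^+ (q ^ k')).
  by rewrite vgeE ?expf_neq0 // placeX // vy mul1r lez_nat q_pow_gt1.
by have := vgeB H3 H2; rewrite opprB addrC subrK vgeE // vy.
Qed.

Variables (p : nat) (p_pr : prime p) (pF : p \in [pchar Fq]).
Variable (u : place) (uw : u != w).
Variables (c1 c2 : nat).
Hypotheses (wx : vge w (- c1%:Z) x) (wm : vge w (- c2%:Z) (ev z (m ord_max)))
  (wc : forall l : 'I_d, vge w (- c2%:Z) (rel_coef l)).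

(** Bombieri's construction. Let Psi = sum_i f_i h_i^(p^m2), with h_i a combination of the x^l z^j.
    Where z^Q = z, its p^m1-th power is the value at Y = x^Q of a polynomial in Y with coefficients
    built from f_i^(p^m1) z^j. Linear conditions make this polynomial proportional to [rel_quot],
    which vanishes at x^Q when z^Q = z and x^Q differs from x. Psi is nonzero by
    [frobenius_independence]. *)
Lemma auxiliary_function k m1 m2 a b : (q ^ k = p ^ (m1 + m2))%N -> (a * kap < p ^ m2)%N ->
  (d.-1 * ell (<< (c2 + p ^ m1 * a + n * b)%N%:Z *g w >> : divisor) <
   ell (<< a%:Z *g w >> : divisor) * (d * b.+1))%N ->
  exists Psi, [/\ Psi != 0, L (<< (a + p ^ m2 * (n * b + c1 * d))%N%:Z *g w >>) Psi &
    forall v, unramified v -> vge v 1 (z ^+ (q ^ k) - z) -> ~~ vge v 1 (x ^+ (q ^ k) - x) ->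
      vge v 1 Psi].
Proof.
move=> Qk am lt; set P1 := (p ^ m1)%N; set P2 := (p ^ m2)%N; set E := (c2 + _ + _)%N in lt.
have d0 : (0 < d)%N by rewrite muln_gt0 n0 place_deg_gt0.
have P0 i : (0 < p ^ i)%N by rewrite expn_gt0 prime_gt0.
have [f [Lf _ ff]] := has_ell hK (<< a%:Z *g w >> : divisor).
set s := ell (<< a%:Z *g w >> : divisor) in lt f Lf ff.
pose T := ('I_s * ('I_d * 'I_b.+1))%type.
pose Ft (t : T) := f t.1 ^+ P1 * z ^+ t.2.2.
(* Proportionality to [rel_quot] is written with cross products against the leading coefficients.
   The condition for l = d - 1 holds by itself, which leaves d - 1 of them. *)
pose yl (t : T) (l : nat) : K :=
  (t.2.1 == l :> nat)%:R * ev z (m ord_max) - (t.2.1 == d.-1 :> nat)%:R * rel_coef l.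
have If i : integral_off w (f i) /\ vge w (- a%:Z) (f i) by exact/L_point.
have IFt t : integral_off w (Ft t).
  by move=> v vw; apply: vge0M; apply: vge0X; [apply: (If _).1|apply: Iz].
have zpow (j : nat) : (j <= b)%N -> vge w (- (n * b)%N%:Z) (z ^+ j).
  move=> jb; rewrite vgeE ?expf_neq0 ?(transc_neq0 tz) // placeX ?(transc_neq0 tz) // wz.
  by rewrite mulNr lerN2 -PoszM lez_nat leq_mul2l jb orbT.
have vbool v N (e : bool) y : vge v N y -> vge v N (e%:R * y).
  by case: e; rewrite ?mul1r // mul0r vge0.
have LV t (l : 'I_d.-1) : L (<< E%:Z *g w >>) (Ft t * yl t l).
  have ld : (l < d)%N by apply: leq_trans (leq_pred _).
  apply/L_point; split=> [v vw|].
    apply: vge0M; first exact: IFt.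
    apply: vgeB; apply: vbool; first by apply: vge_ev; apply: Iz.
    exact: integral_rel_coef.
  have -> : - E%:Z = - (a%:Z * P1%:Z) + - (n * b)%N%:Z + - c2%:Z.
    by rewrite /E !PoszD !PoszM; ring.
  apply: vgeM; first apply: vgeM.
  - by rewrite -mulNr; apply: vgeX; apply: (If _).2.
  - by apply: zpow; rewrite -ltnS.
  - by apply: vgeB; apply: vbool => //; apply: (wc (Ordinal ld)).
have cT : (d.-1 * ell (<< E%:Z *g w >> : divisor) < #|T : finType|)%N by rewrite !card_prod !card_ord.
have [c [cc [t0 ct0] ck]] := common_kernel (has_ell hK _) LV cT.
have ck' (l : 'I_d) : \sum_t c t * (Ft t * yl t l) = 0.
  have [lt1|] := ltnP l d.-1; first exact: (ck (Ordinal lt1)).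
  move=> ge1; have -> : (l : nat) = d.-1.
    by apply/eqP; rewrite eqn_leq ge1 -ltnS prednK // ltn_ord.
  by rewrite big1 // => t _; rewrite /yl rel_coef_top subrr !mulr0.
pose G0 := \sum_t c t * Ft t * (t.2.1 == d.-1 :> nat)%:R.
have GE Y : ev z (m ord_max) * \sum_t c t * Ft t * Y ^+ t.2.1 = G0 * rel_quot Y.
  apply/eqP; rewrite -subr_eq0 /G0 mulr_suml mulr_sumr -sumrB; apply/eqP.
  transitivity (\sum_(l < d) (\sum_t c t * (Ft t * yl t l)) * Y ^+ l); last first.
    by rewrite big1 // => l _; rewrite ck' mul0r.
  rewrite (eq_bigr _ (fun l _ => mulr_suml _ _ _ _)) exchange_big /=; apply: eq_bigr => t _.
  rewrite (eq_bigr (fun l : 'I_d => c t * Ft t * ((t.2.1 == l)%:R * (ev z (m ord_max) * Y ^+ l)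
     - (t.2.1 == d.-1 :> nat)%:R * (rel_coef l * Y ^+ l)))).
    rewrite -mulr_sumr sumrB -mulr_sumr -/(rel_quot Y) mulrBr; congr (_ - _); last by rewrite !mulrA.
    rewrite (bigD1 t.2.1) //= eqxx mul1r big1 ?addr0 => [|l /negPf lt1]; first by rewrite mulrCA.
    by rewrite eq_sym lt1 mul0r.
  by move=> l _; rewrite /yl -val_eqE; ring.
pose h (i : 'I_s) := \sum_(t : 'I_d * 'I_b.+1) c (i, t) * (x ^+ t.1 * z ^+ t.2).
pose Psi := \sum_i f i * h i ^+ P2.
exists Psi; split.
- apply/eqP => /(frobenius_independence hK p_pr pF uw Lf ff am) h0.
  have := free_powers tz (b := fun l : 'I_d => x ^+ l) (m := b.+1) _ (e := fun t => c (t0.1, t)) _ (h0 t0.1) t0.2.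
  rewrite -surjective_pairing => ct; move/eqP: ct0; apply; apply: ct => [e ee e0 i|t]; [exact: (fx ee)|exact: cc].
- apply: (ss_sum (subspace_L _)) => i _; apply/L_point; split=> [v vw|].
    apply: vge0M; first exact: (If _).1.
    apply: vge0X; apply: vge_sum => t _; apply: vge_cst => //.
    by apply: vge0M; apply: vge0X; [apply: Ix|apply: Iz].
  have -> : - (a + P2 * (n * b + c1 * d))%N%:Z = - a%:Z + - (c1 * d + n * b)%N%:Z * P2%:Z.
    by rewrite !PoszD !PoszM !PoszD; ring.
  apply: vgeM; first exact: (If _).2.
  apply: vgeX; apply: vge_sum => t _; apply: vge_cst => //.
  rewrite PoszD opprD; apply: vgeM; last by apply: zpow; rewrite -ltnS.
  apply: vgeW (vgeX _ wx); rewrite mulNr lerN2 -PoszM lez_nat leq_mul2l.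
  by rewrite (ltnW (ltn_ord _)) orbT.
move=> v uv Hz Hx; have [vw vB vD _] := uv; have [Oz Ox] := conj (Iz vw) (Ix vw).
have OPsi : vge v 0 Psi.
  apply: vge_sum => i _; apply: vge0M; first exact: (If i).1.
  by apply: vge0X; apply: vge_sum => t _; apply: vge_cst => //; apply: vge0M; apply: vge0X.
have HM : vge v 1 (rel_quot (x ^+ (q ^ k))).
  have := rel_frobenius vw Hz; apply: vge_unit_cancel => //.
  by apply: vgeB => //; apply: vge0X.
have S1 : vge v 1 (\sum_t c t * Ft t * (x ^+ (q ^ k)) ^+ t.2.1).
  apply: (vge_unit_cancel vD); first exact: vge_ev.
  rewrite GE; apply: vge0M => //; apply: vge_sum => t _; rewrite mulrC; apply: vbool.
  by apply: vge_cst => //; apply: IFt.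
have PsiE : Psi ^+ P1 = \sum_t c t * (f t.1 ^+ P1 * ((z ^+ (q ^ k)) ^+ t.2.2)) * (x ^+ (q ^ k)) ^+ t.2.1.
  transitivity (\sum_(i < s) \sum_(t : 'I_d * 'I_b.+1)
      c (i, t) * (f i ^+ P1 * ((z ^+ (q ^ k)) ^+ t.2)) * (x ^+ (q ^ k)) ^+ t.1); last first.
    by rewrite pair_bigA; apply: eq_bigr => -[i t].
  rewrite (expr_sum_p iota p_pr pF).
  apply: eq_bigr => i _; rewrite exprMn -exprM mulnC -expnD -Qk expr_sum_card mulr_sumr.
  apply: eq_bigr => t _; have [e _ eE] := cc (i, t).
  rewrite !exprMn -eE expr_card_iota -[x ^+ _ ^+ (q ^ k)]exprM -[z ^+ _ ^+ (q ^ k)]exprM.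
  by rewrite ![(_ * q ^ k)%N]mulnC !exprM; ring.
have : vge v 1 (Psi ^+ P1).
  have := vgeD S1 (_ : vge v 1 (Psi ^+ P1 - \sum_t c t * Ft t * (x ^+ (q ^ k)) ^+ t.2.1)).
  rewrite addrCA subrr addr0; apply; rewrite PsiE -sumrB; apply: vge_sum => t _.
  rewrite -mulrBl; apply: vgeM0; last by do 2![apply: vge0X].
  rewrite -mulrBr; apply: vge_cst => //; rewrite /Ft -mulrBr.
  apply: vge0M; first by apply: vge0X; apply: (If _).1.
  by apply: vge_expr_diff => //; apply: vge0X.
have [->|Psi0] := eqVneq Psi 0; first by rewrite vge0.
move: OPsi; rewrite !vgeE ?expf_neq0 // placeX // => O1 H1.
by rewrite -gtz0_ge1 lt_neqAle O1 andbT; apply: contraTneq H1 => <-; rewrite mul0r.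
Qed.
End Stepanov.

(** Equations against unknowns for [auxiliary_function]. The main terms D P1 P2 cancel. The margin t
    is twice G D + 1 because P2 > 2G only guarantees P2 - G >= P2 / 2. *)
Lemma auxiliary_count_int (D G k2 t y ak P1 P2 s e : int) :
  0 <= D -> 0 <= G -> 0 <= P1 -> 0 <= y -> 0 <= k2 ->
  ak + 1 <= P2 -> P2 + D + 2 <= s + G ->
  e <= k2 + P1 * ak + y - D -> D * P1 + t <= y ->
  P1 <= P2 -> t = 2 * (G * D + 1) -> 2 * G + D * k2 < P2 ->
  D * e < s * y.
Proof.
move=> D0 G0 P10 y0 k0 H1 H3 H4 H5 H6 tE H8.
have Dk : 0 <= D * k2 by apply: mulr_ge0.
have GD : 0 <= G * D by apply: mulr_ge0.
have h1 : D * P1 * (ak + 1) <= D * P1 * P2 by apply: ler_wpM2l => //; apply: mulr_ge0.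
have h2 : D * e <= D * (k2 + P1 * ak + y - D) by apply: ler_wpM2l.
have h3 : (P2 + D + 2) * y <= (s + G) * y by apply: ler_wpM2r.
have h4 : (P2 - G) * (D * P1 + t) <= (P2 - G) * y by apply: ler_wpM2l => //; lia.
have h5 : P2 * (G * D + 1) <= (2 * (P2 - G)) * (G * D + 1) by apply: ler_wpM2r; lia.
have h6 : (G * D) * P1 <= (G * D) * P2 by apply: ler_wpM2l.
have DD : 0 <= D * D by apply: mulr_ge0.
have DP : 0 <= D * P1 by apply: mulr_ge0.
subst t; lra.
Qed.

Lemma auxiliary_count (d1 kap g c2 t ak P1 P2 s e bd : nat) :
  (ak < P2)%N -> (P2 <= ak + kap)%N -> (ak.+1 <= s + g)%N ->
  (e <= c2 * kap + P1 * ak + bd + 1)%N -> (d1 * P1 + t < bd + d1.+1)%N ->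
  (P1 <= P2)%N -> t = (2 * ((kap + g + d1.+1) * d1 + 1))%N ->
  (2 * (kap + g + d1.+1) + d1 * (c2 * kap) < P2)%N ->
  (d1 * e < s * (bd + d1.+1))%N.
Proof.
move=> H1 H2 H3 H4 H5 H6 H7 H8.
have := @auxiliary_count_int d1 (kap + g + d1.+1)%N (c2 * kap)%N t (bd + d1.+1)%N ak P1 P2 s e.
rewrite -!PoszM ltz_nat; apply; lia.
Qed.

Lemma sum3_le0 (i j k : int) : 0 <= i -> 0 <= j -> 0 <= k -> i + j + k <= 0 ->
  [/\ i < 1, j < 1 & k < 1].
Proof. by split; lia. Qed.

Lemma absz_bound (x N A : nat) (E : int) : x%:Z <= N%:Z + E + A%:Z -> (x <= N + `|E| + A)%N.
Proof. lia. Qed.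

Lemma final_count (d1 P1 P2 Q N E A t c c0 x : nat) : x = (d1 * P1 * P2 + Q)%N ->
  (x <= N + E + A)%N -> (A <= P2 + P2 * (d1 * P1 + t) + P2 * c)%N -> (E <= E * P2)%N ->
  (Q <= N + (c0 + (E + 1 + t + c)) * P2)%N.
Proof.
move=> ->; rewrite !mulnDl !mulnDr mul1n [(P2 * (d1 * P1))%N]mulnC [(P2 * t)%N]mulnC [(P2 * c)%N]mulnC.
by move: (d1 * P1 * P2)%N (t * P2)%N (c * P2)%N (E * P2)%N (c0 * P2)%N; clear; lia.
Qed.

Section StepanovBound.
Variables (Fq : finFieldType) (K : fieldType) (iota : {rmorphism Fq -> K}).
Hypothesis hK : function_field iota.
Notation cst := (constants iota).
Notation place := (place iota).
Notation divisor := (divisor iota).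
Notation ev := (ev iota).
Notation transc := (transc iota).
Notation fdeg := (fdeg iota).
Notation "'F(' f )" := (rational_in iota f) (at level 0, format "'F(' f )").
Notation L D := (riemann_roch_space D).
Notation g := (genus iota).
Implicit Types (v w : place) (S : seq place) (D E : divisor) (f h : K).

Let hF := subfield_constants iota.
Notation q := #|Fq|.

Lemma two_places : exists w u : place, u != w.
Proof.
have [[y [/(not_algebraic_transc) ty _]] _] := hK.
have [w wy] := place_exists hK ty; have [u uy] := place_exists hK (transcV hK ty).
exists w, u; apply: contraTneq uy => ->; rewrite placeV ?(transc_neq0 ty) //; lia.
Qed.

Lemma zeros_finite f : f != 0 -> exists S, uniq S /\ forall v, 0 < v f -> v \in S.
Proof.
move=> f0; have [[a _ <-]|/(nonconstant_transc hK) tf] := pselect (cst f).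
  by exists [::]; split=> // v; rewrite place_iota.
by have [S [uS HS]] := zeros_enum hK tf; exists S; split=> // v; rewrite HS.
Qed.

Lemma deg_rational_places k : (0 < k)%N ->
  div_deg (divf [seq v <- plist hK k | (place_deg v %| k)%N] (fun=> 1)) = (Npt hK k)%:Z.
Proof.
move=> k0; rewrite div_deg_divf ?filter_uniq ?plist_uniq // big_filter /Npt.
by rewrite (big_morph Posz PoszD (erefl _)); apply: eq_bigr => v _; rewrite mul1r.
Qed.

(** A lower bound for the number of rational points. The function z^Q - z has d Q zeros. Outside a
    fixed finite set they are simple and either lie at rational points or are zeros of Psi, which
    has about (d - 1) Q of them up to O(P2). The excluded places contribute a bounded amount by
    [frobenius_multiplicity_bound]. *)
Lemma stepanov_bound p : prime p -> p \in [pchar Fq] -> exists C, forall k m1 m2, (0 < k)%N ->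
  (q ^ k = p ^ (m1 + m2))%N -> (m1 <= m2)%N -> (q ^ k <= Npt hK k + C * p ^ m2)%N.
Proof.
move=> p_pr pF; have [w [u uw]] := two_places.
have [z [x [n [[n0 pn wz] [tz Iz Ix fz fx]]]]] := stepanov_setup hK w p_pr.
have [B B0 HB] := integral_finitely_generated hK n0 wz tz Iz fz fx.
have [m [m0 Mx Mx']] := separable_relation hK n0 wz tz fz fx p_pr pF pn.
rewrite -rel_quot_root in Mx'.
set kap := place_deg w in fx fz m Mx Mx' m0 HB *; set d := (n * kap)%N in fx fz m Mx Mx' m0 HB *.
have kap0 : (0 < kap)%N := place_deg_gt0 hK w.
have d0 : (0 < d)%N by rewrite muln_gt0 n0.
have [c1 wx] := vge_exists w x.
have [c2 [wm wc]] : exists c2 : nat, vge w (- c2%:Z) (ev z (m ord_max)) /\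
    forall l : 'I_d, vge w (- c2%:Z) (rel_coef (iota := iota) z x m l).
  have [c wm] := vge_exists w (ev z (m ord_max)).
  have /boolp.choice [e He] := fun l : 'I_d => vge_exists w (rel_coef (iota := iota) z x m l).
  exists (maxn c (\max_l e l)); split=> [|l].
    by apply: vgeW wm; rewrite lerN2 lez_nat leq_maxl.
  by apply: vgeW (He l); rewrite lerN2 lez_nat leq_max leq_bigmax orbT.
pose De := ev z B * ev z (m ord_max) * rel_quot (iota := iota) z x m x.
have zB0 : ev z B != 0 by apply: ev_neq0.
have zm0 : ev z (m ord_max) != 0 by apply: ev_neq0.
have [S [uS HS]] : exists S, uniq S /\ forall v, 0 < v De -> v \in S.
  by apply: zeros_finite; rewrite !mulf_neq0.
have unr v : v != w -> v \notin S -> unramified (iota := iota) (w := w) z x B m v.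
  move=> vw vS; have := contra (HS v) vS; rewrite !val_atM ?mulf_neq0 // -leNgt => H.
  have H1 : vge v 0 (ev z B) by apply/vge_ev/Iz.
  have H2 : vge v 0 (ev z (m ord_max)) by apply/vge_ev/Iz.
  have H3 : vge v 0 (rel_quot (iota := iota) z x m x).
    apply: vge_sum => l _; apply: vge0M; last exact/vge0X/Ix.
    exact: (integral_rel_coef Iz Ix).
  move: H1 H2 H3; rewrite /unramified !vgeE // => H1 H2 H3.
  have [a1 a2 a3] := sum3_le0 H1 H2 H3 H; by split; rewrite // -ltNge.
have /boolp.choice [e He] : forall v : place, exists e : nat, v != w ->
    forall k, (0 < k)%N -> v (z ^+ (q ^ k) - z) <= e%:Z.
  move=> v; have [->|vw] := eqVneq v w; first by exists 0%N.
  by have [e He] := frobenius_multiplicity_bound hK tz (Iz v vw); exists e.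
pose Eb := divf S (fun v => (e v)%:Z).
pose t := (2 * ((kap + g + d.-1.+1) * d.-1 + 1))%N.
(* The size of P2 from which [auxiliary_count] applies; below it the claim is trivial since Q = P1
   P2 <= c0 P2. *)
pose c0 := (2 * (kap + g + d.-1.+1) + d.-1 * (c2 * kap)).+1.
exists (c0 + (`|div_deg Eb| + 1 + t + c1 * d * kap))%N => k m1 m2 k0 Qk m12.
set P2 := (p ^ m2)%N; set P1 := (p ^ m1)%N; set Q := (q ^ k)%N.
have QP : Q = (P1 * P2)%N by rewrite /Q Qk expnD.
have P12 : (P1 <= P2)%N by rewrite leq_exp2l ?prime_gt1.
have [small|large] := ltnP P2 c0.
  apply: (@leq_trans (c0 * P2)); last by rewrite mulnDl addnCA leq_addr.
  by rewrite QP leq_mul2r (leq_trans P12 (ltnW small)) orbT.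
have P20 : (0 < P2)%N by rewrite expn_gt0 prime_gt0.
pose a := (P2.-1 %/ kap)%N; pose b := ((d.-1 * P1 + t) %/ d)%N.
have ak : (a * kap < P2)%N by rewrite -(prednK P20) ltnS leq_trunc_div.
have bd : (b * d <= d.-1 * P1 + t)%N by apply: leq_trunc_div.
have [Psi [Psi0 LPsi vPsi]] : exists Psi, [/\ Psi != 0,
    L (<< (a + P2 * (n * b + c1 * d))%N%:Z *g w >>) Psi &
    forall v, unramified (iota := iota) (w := w) z x B m v -> vge v 1 (z ^+ Q - z) -> ~~ vge v 1 (x ^+ Q - x) ->
      vge v 1 Psi].
  apply: (auxiliary_function hK n0 wz tz Iz Ix fx B Mx p_pr pF uw wx wm wc Qk ak).
  have -> : (d * b.+1 = b * d + d.-1.+1)%N by rewrite prednK // mulnC mulSn addnC.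
  apply: (@auxiliary_count d.-1 kap g c2 t (a * kap) P1 P2) => //.
  - have := ltn_pmod P2.-1 kap0; have := divn_eq P2.-1 kap; rewrite -/a; clear - P20; lia.
  - have := riemann hK (<< a%:Z *g w >> : divisor); rewrite div_degU -PoszM -/kap; move: (ell _); clear; lia.
  - have := @ell_eff _ _ _ hK (<< (c2 + P1 * a + n * b)%N%:Z *g w >> : divisor).
    rewrite div_degU -PoszM -/kap => /(_ _) H.
    have : (ell (<< (c2 + P1 * a + n * b)%N%:Z *g w >> : divisor) <= (c2 + P1 * a + n * b) * kap + 1)%N.
      by rewrite -lez_nat PoszD; apply: H => v; rewrite coeff0 coeffU; case: (_ == _).
    by rewrite !mulnDl -[(P1 * a * kap)%N]mulnA [(n * b * kap)%N]mulnAC -/d [(d * b)%N]mulnC.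
  - have := ltn_pmod (d.-1 * P1 + t) d0; have := divn_eq (d.-1 * P1 + t) d; rewrite -/b (prednK d0); clear; lia.
have Q1 : (1 < Q)%N := q_pow_gt1 Fq k0.
have tZ : transc (z ^+ Q - z) by apply: transc_card_pow.
set Z := z ^+ Q - z in tZ vPsi; have Z0 := transc_neq0 tZ.
have z0 := transc_neq0 tz.
have wZ : w Z = - (n * Q)%N%:Z.
  have := @place_addl _ _ _ w (z ^+ Q) (- z); rewrite expf_neq0 // vgeN vgeE // placeX // wz.
  rewrite mulNr PoszM => -[] //; rewrite -PoszM; move: Q1 n0; clear; nia.
pose F : divisor := pdiv iota Z + << (n * Q)%N%:Z *g w >>.
pose R : divisor := divf [seq v <- plist hK k | (place_deg v %| k)%N] (fun=> 1).
pose G : divisor := pdiv iota Psi + << (a + P2 * (n * b + c1 * d))%N%:Z *g w >>.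
have G0 v : 0 <= coeff v G.
  rewrite coeffD (coeff_pdiv hK) //; move: LPsi; rewrite LspaceE => /(_ v).
  by rewrite vgeE // -lerBlDr sub0r.
(* Place by place: a zero of z^Q - z is paid for by Eb if it is exceptional, by R if its degree
   divides k, and by the zeros of Psi in G otherwise. *)
have FRG : dle F (R + Eb + G).
  move=> v; have R0 : 0 <= coeff v R by rewrite coeff_divf ?filter_uniq ?plist_uniq //; case: ifP.
  have Eb0 : 0 <= coeff v Eb by rewrite coeff_divf //; case: ifP.
  rewrite coeffD [coeff v (R + _)]coeffD; rewrite [coeff v F]coeffD (coeff_pdiv hK) // coeffU.
  have [wv|wv] := eqVneq w v; first by rewrite -wv wZ mulr1 addNr; rewrite !addr_ge0 // wv.
  have vw : v != w by rewrite eq_sym.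
  rewrite mulr0 addr0; have := G0 v => Gv.
  have [le0|gt0] := lerP (v Z) 0; first by apply: le_trans le0 _; rewrite !addr_ge0.
  have [vS|vS] := boolP (v \in S).
    have := He v vw k k0; rewrite -/Q -/Z => H; apply: le_trans H _.
    by rewrite [coeff v Eb]coeff_divf // vS; clear - R0 Gv; lia.
  have uv := unr v vw vS.
  have Z1 : v Z = 1.
    by have := unramified_simple hK Iz Ix HB Mx k0 uv; rewrite -/Q -/Z vgeE // -ltNge; clear - gt0; lia.
  have [dk|dk] := boolP (place_deg v %| k)%N.
    rewrite Z1; have -> : coeff v R = 1.
      by rewrite coeff_divf ?filter_uniq ?plist_uniq // mem_filter dk mem_plist dvdn_leq.
    by clear - Eb0 Gv; lia.
  have : vge v 1 Psi.
    apply: vPsi => //; first by rewrite vgeE // Z1.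
    apply: contra dk => Hx; apply: (unramified_place_deg hK Iz Ix HB k0 uv) => //.
    by rewrite -/Q -/Z vgeE // Z1.
  rewrite vgeE // => P1v; have : 1 <= coeff v G.
    by rewrite coeffD (coeff_pdiv hK) // coeffU (negPf wv) mulr0 addr0.
  by rewrite Z1; clear - R0 Eb0; lia.
have := dle_deg FRG; rewrite !div_degD !(deg_pdiv hK) // !div_degU !add0r -/kap -!PoszM.
rewrite deg_rational_places // => H.
have e1 : (n * Q * kap = d.-1 * P1 * P2 + Q)%N.
  by rewrite mulnAC -/d -{1}(prednK d0) mulSn QP mulnA addnC.
have e2 : ((a + P2 * (n * b + c1 * d)) * kap <= P2 + P2 * (d.-1 * P1 + t) + P2 * (c1 * d * kap))%N.
  rewrite mulnDl mulnDr mulnDl -mulnA [X in (_ + (P2 * X + _) <= _)%N]mulnAC -/d addnA -mulnA.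
  by rewrite !leq_add ?(ltnW ak) // leq_mul2l [(d * b)%N]mulnC bd orbT.
have e3 : (`|div_deg Eb| <= `|div_deg Eb| * P2)%N by rewrite leq_pmulr.
have FC := final_count c0 e1 (absz_bound H) e2 e3.
exact: FC.
Qed.
End StepanovBound.

(** * The zeta function *)

Section NewtonSums.
Variable F : closedFieldType.
Implicit Types (P D : {poly F}) (s : seq F).

Lemma dvdXnP M P : reflect (forall i, (i < M)%N -> P`_i = 0) ('X^M %| P).
Proof.
apply: (iffP idP) => [/dvdpP [r ->] i iM|H]; first by rewrite coefMXn iM.
rewrite -(poly_take_drop M P); have -> : take_poly M P = 0.
  by apply/polyP => i; rewrite coef_take_poly coef0; case: ifP => // /H.
by rewrite add0r dvdp_mull.
Qed.

Lemma dvdXn_deriv M P : 'X^M %| P -> 'X^M %| 'X * P^`().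
Proof.
move/dvdXnP => H; apply/dvdXnP => -[|i] iM; first by rewrite coefXM.
by rewrite coefXM /= coef_deriv H // mul0rn.
Qed.

(** The series c X / (1 - c X) cut off after degree M. Power series are replaced throughout by
    polynomials modulo X^(M + 1). *)
Definition geo M (c : F) : {poly F} := \poly_(i < M.+1) (if i == 0%N then 0 else c ^+ i).

Lemma geoP M c : 'X^(M.+1) %| (1 - c *: 'X) * geo M c - c *: 'X.
Proof.
apply/dvdXnP => i iM; rewrite mulrBl mul1r -scalerAl !coefB !coefZ coefXM coefX !coef_poly iM.
case: i iM => [|i] iM /=; first by rewrite !mulr0 !subr0.
rewrite (ltnW iM); case: i iM => [|i] iM /=; first by rewrite mulr1 mulr0; ring.
by rewrite mulr0 subr0 -exprS subrr.
Qed.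

(** Newton's identities as a logarithmic derivative: X P' / P = - sum_z z X / (1 - z X). *)
Lemma newton_prod M s : let P := \prod_(z <- s) (1 - z *: 'X) in
  'X^(M.+1) %| 'X * P^`() + (\sum_(z <- s) geo M z) * P.
Proof.
elim: s => [|z s IH] /=; first by rewrite !big_nil derivC mulr0 mul0r addr0 dvdp0.
rewrite !big_cons derivM derivB derivZ derivX derivC sub0r.
move: IH (geoP M z); move: (\prod_(_ <- s) _) (\sum_(_ <- s) _) (geo M z) => P G g IH Hg.
have -> : 'X * (- (z *: 1) * P + (1 - z *: 'X) * P^`()) + (g + G) * ((1 - z *: 'X) * P) =
  ((1 - z *: 'X) * g - z *: 'X) * P + (1 - z *: 'X) * ('X * P^`() + G * P).
  by rewrite -![z *: _]mul_polyC; ring.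
by apply: dvdp_add; [apply: dvdp_mulr|apply: dvdp_mull].
Qed.

Lemma split_constant1 P : P`_0 = 1 -> exists s, (size s < size P)%N /\ P = \prod_(z <- s) (1 - z *: 'X).
Proof.
move=> P01; have [r Er] := closed_field_poly_normal P.
have P0 : P != 0 by apply: contra_eq_neq P01 => ->; rewrite coef0 eq_sym oner_eq0.
have l0 : lead_coef P != 0 by rewrite lead_coef_eq0.
have P1 : P.[0] = 1 by rewrite horner_coef0.
have r0 : forall z, z \in r -> z != 0.
  move=> z zr; apply/eqP => z0; have : root P 0.
    by rewrite Er rootZ // root_prod_XsubC -z0.
  by rewrite rootE P1 oner_eq0.
exists [seq z^-1 | z <- r]; split.
  by rewrite size_map Er size_scale // size_prod_XsubC.
have E z : z \in r -> 'X - z%:P = (- z) *: (1 - z^-1 *: 'X).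
  move=> zr; rewrite scalerBr scalerA mulNr divff ?r0 // scaleN1r opprK addrC scaleNr alg_polyC.
  by rewrite addrC.
have EP : P = (lead_coef P * \prod_(z <- r) (- z)) *: \prod_(z <- r) (1 - z^-1 *: 'X).
  rewrite {1}Er -scalerA; congr (_ *: _); rewrite (eq_big_seq _ E) scaler_prod.
  by [].
have c1 : lead_coef P * \prod_(z <- r) (- z) = 1.
  have := congr1 (fun Q => Q.[0]) EP; rewrite P1 hornerZ horner_prod [X in _ = _ * X]big1_seq ?mulr1 // => z _.
  by rewrite hornerD hornerN hornerZ hornerX hornerC mulr0 subr0.
by rewrite big_map {1}EP c1 scale1r.
Qed.

Variables (A N : nat -> F) (q : F) (g : nat).
Hypotheses (g0 : (0 < g)%N) (A0 : A 0 = 1)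
  (AN : forall n, n%:R * A n = \sum_(1 <= j < n.+1) N j * A (n - j)%N)
  (Avan : forall n, (2 * g < n)%N -> A n - (q + 1) * A n.-1 + q * A n.-2 = 0).

(** The hypothesis on large n says that P = (1 - X) (1 - q X) sum_n A_n X^n is a polynomial. Its
    logarithmic derivative is read off once from its factors and once from the recursion [AN], and
    the two are compared modulo X^(n + 1). *)
Lemma zeta_roots : exists s : seq F, (size s <= 2 * g)%N /\
  forall n, (0 < n)%N -> \sum_(z <- s) z ^+ n = q ^+ n + 1 - N n.
Proof.
pose a n := A n - (q + 1) * (if n is n'.+1 then A n' else 0) + q * (if n is n'.+2 then A n' else 0).
pose P := \poly_(i < (2 * g).+1) a i.
have [s [ss Ps]] : exists s, (size s < size P)%N /\ P = \prod_(z <- s) (1 - z *: 'X).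
  by apply: split_constant1; rewrite coef_poly /= /a A0 !mulr0 subr0 addr0.
exists s; split; first by rewrite -ltnS (leq_trans ss) // size_poly.
move=> n n0; pose M := n.
pose AM := \poly_(i < M.+1) A i; pose NM := \poly_(i < M.+1) (if i == 0%N then 0 else N i).
pose D : {poly F} := (1 - 1 *: 'X) * (1 - q *: 'X).
have DE : D = 1 - (q + 1) *: 'X + q *: 'X^2.
  by rewrite /D expr2 scale1r scalerDl scale1r -![q *: _]mul_polyC; ring.
have e1 : 'X^(M.+1) %| P - D * AM.
  apply/dvdXnP => i iM; rewrite coefB DE mulrDl mulrBl mul1r -!scalerAl coefD coefB !coefZ.
  rewrite coefXM coefXnM !coef_poly iM.
  have -> : (if (i < (2 * g).+1)%N then a i else 0) = a i.
    case: ltnP => // gi; rewrite /a; case: i gi {iM} => [|[|i]] gi; [lia|lia|].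
    by have := Avan gi; rewrite /= => ->.
  rewrite /a; case: i iM => [|[|i]] iM /=; rewrite ?mulr0 ?subrr //.
  by rewrite (ltnW iM) subn2 /= (ltnW (ltnW iM)) subrr.
have e2 : 'X^(M.+1) %| 'X * AM^`() - NM * AM.
  apply/dvdXnP => i iM; rewrite coefB coefXM coef_deriv !coefM.
  have -> : (if i == 0%N then 0 else AM`_i.-1.+1 *+ i.-1.+1) = i%:R * A i.
    by case: i iM => [|i] iM /=; rewrite ?mul0r // coef_poly iM mulr_natl.
  rewrite AN big_add1 /= big_mkord big_ord_recl /= coef_poly /= mul0r add0r.
  apply/eqP; rewrite subr_eq0; apply/eqP; apply: eq_bigr => j _; rewrite !coef_poly /bump /= add1n.
  by rewrite ltnS (leq_trans (ltn_ord j)) // (leq_ltn_trans (leq_subr _ _) iM).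
have e3 := geoP M 1; have e4 := geoP M q.
have e5 : 'X^(M.+1) %| 'X * P^`() - (NM - geo M 1 - geo M q) * P.
  have -> : 'X * P^`() - (NM - geo M 1 - geo M q) * P =
    'X * (P - D * AM)^`() - (NM - geo M 1 - geo M q) * (P - D * AM) + D * ('X * AM^`() - NM * AM)
    + ((1 - q *: 'X) * ((1 - 1 *: 'X) * geo M 1 - 1 *: 'X)
       + (1 - 1 *: 'X) * ((1 - q *: 'X) * geo M q - q *: 'X)) * AM.
    rewrite derivB derivM; have -> : D^`() = - (q + 1)%:P + (2 * q)%:P * 'X.
      rewrite DE -!mul_polyC derivD derivB derivC !derivM !derivX !derivC.
      by rewrite !polyCM !polyCD; ring.
    by rewrite /D scale1r -!mul_polyC polyCM !polyCD; ring.
  apply: dvdp_add; first apply: dvdp_add; first apply: dvdp_sub.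
  - exact: dvdXn_deriv.
  - exact: dvdp_mull.
  - exact: dvdp_mull.
  - by apply: dvdp_mulr; apply: dvdp_add; apply: dvdp_mull.
have e6 : 'X^(M.+1) %| 'X * P^`() + (\sum_(z <- s) geo M z) * P by rewrite Ps; apply: newton_prod.
have : 'X^(M.+1) %| (NM - geo M 1 - geo M q + \sum_(z <- s) geo M z) * P.
  have -> : (NM - geo M 1 - geo M q + \sum_(z <- s) geo M z) * P =
    'X * P^`() + (\sum_(z <- s) geo M z) * P - ('X * P^`() - (NM - geo M 1 - geo M q) * P) by ring.
  exact: dvdp_sub.
rewrite Gauss_dvdpl; last first.
  rewrite coprimep_expl // coprimep_sym coprimepX rootE horner_coef0 coef_poly /=.
  by rewrite /a A0 !mulr0 subr0 addr0 oner_eq0.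
move/dvdXnP/(_ n (ltnSn _)); rewrite !coefD !coefN !coef_poly ltnSn coef_sum /= (gtn_eqF n0).
under eq_bigr => z _ do rewrite coef_poly ltnSn /= (gtn_eqF n0).
rewrite expr1n => E; apply/eqP; rewrite -subr_eq0 -[X in _ == X]E; apply/eqP; ring.
Qed.
End NewtonSums.

Section Pigeonhole.
Variable C : numClosedFieldType.
Implicit Types z w : C.

(** Three signs cut the plane into eight sectors of 45 degrees; within one sector the inner product
    is at least half the product of the absolute values. *)
Definition octant z := (0 <= 'Re z, 0 <= 'Im z, `|'Re z| <= `|'Im z|).

Lemma same_sign_mul (a b : C) : a \is Num.real -> b \is Num.real -> (0 <= a) = (0 <= b) ->
  a * b = `|a| * `|b|.
Proof.
move=> ra rb E; have [a0|a0] := real_ge0P ra; first by rewrite (ger0_norm (_ : 0 <= b)) // -E.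
by rewrite (ltr0_norm (_ : b < 0)) ?mulrNN // real_ltNge // -E -real_ltNge.
Qed.

Lemma octant_dot z w : octant z = octant w ->
  `|z| * `|w| <= ('Re z * 'Re w + 'Im z * 'Im w) *+ 2.
Proof.
move=> [E1 E2 E3]; rewrite (same_sign_mul (Creal_Re z) (Creal_Re w) E1) (same_sign_mul (Creal_Im z) (Creal_Im w) E2).
have le z' (a b : C) : 0 <= a -> 0 <= b -> `|z'| ^+ 2 = a ^+ 2 + b ^+ 2 -> b <= a -> `|z'| ^+ 2 <= a ^+ 2 *+ 2.
  by move=> a0 b0 -> ba; rewrite mulr2n lerD2l lerXn2r.
have nE z' : `|z'| ^+ 2 = `|'Re z'| ^+ 2 + `|'Im z'| ^+ 2.
  by rewrite normC2_Re_Im !real_normK ?Creal_Re ?Creal_Im.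
have fin (a b a' b' : C) : 0 <= a -> 0 <= b -> 0 <= a' -> 0 <= b' ->
    `|z| ^+ 2 <= a ^+ 2 *+ 2 -> `|w| ^+ 2 <= a' ^+ 2 *+ 2 -> `|z| * `|w| <= (a * a' + b * b') *+ 2.
  move=> a0 b0 a'0 b'0 H1 H2.
  have H : `|z| * `|w| <= (a * a') *+ 2.
    rewrite -(@ler_pXn2r _ 2) ?nnegrE ?mulrn_wge0 ?mulr_ge0 // exprMn.
    have -> : (a * a' *+ 2) ^+ 2 = (a ^+ 2 *+ 2) * (a' ^+ 2 *+ 2) by ring.
    by apply: ler_pM; rewrite ?exprn_ge0.
  by apply: le_trans H _; rewrite lerMn2r /= lerDl mulr_ge0.
have [le1|gt1] := boolP (`|'Re z| <= `|'Im z|).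
  rewrite addrC; apply: fin => //; first by apply: (le z _ `|'Re z|) => //; rewrite nE addrC.
  by apply: (le w _ `|'Re w|) => //; [rewrite nE addrC|rewrite -E3].
have ge1 : `|'Im z| <= `|'Re z| by rewrite ltW // real_ltNge ?normr_real.
have ge2 : `|'Im w| <= `|'Re w| by rewrite ltW // real_ltNge ?normr_real // -E3.
by apply: fin => //; [apply: (le z _ `|'Im z|)|apply: (le w _ `|'Im w|)].
Qed.

(* Two powers of all the roots lie in the same octants, and their quotient has real part
   at least half of its absolute value. *)
Lemma simultaneous_real_parts (m n0 : nat) (om : 'I_m -> C) : (0 < n0)%N ->
  (forall i, om i != 0) ->
  exists2 n, (n0 <= n)%N & forall i, `|om i| ^+ n <= 'Re (om i ^+ n) *+ 2.
Proof.
move=> n00 om0; pose T := {ffun 'I_m -> bool * bool * bool}.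
pose f (j : 'I_(#|{: T}|.+1)) : T := [ffun i => octant (om i ^+ (n0 * j))].
have /injectivePn [j [k jk fjk]] : ~~ injectiveb f.
  apply/negP => /injectiveP /leq_card; rewrite card_ord ltnn //.
wlog lt : j k jk fjk / (j < k)%N.
  move=> H; have := jk; rewrite -val_eqE neq_ltn => /orP [|]; first exact: H.
  by apply: H => //; rewrite eq_sym.
exists (n0 * (k - j))%N => [|i]; first by rewrite leq_pmulr // subn_gt0.
have E := congr1 (fun h : T => h i) fjk; rewrite !ffunE in E.
set z := om i ^+ (n0 * (k - j)); set w := om i ^+ (n0 * j) in E.
have zw : om i ^+ (n0 * k) = z * w by rewrite -exprD -mulnDr subnK // ltnW.
rewrite zw in E; have := octant_dot (esym E).
have -> : 'Re (z * w) * 'Re w + 'Im (z * w) * 'Im w = 'Re z * `|w| ^+ 2.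
  rewrite normC2_Re_Im ReM ImM; ring.
have w0 : 0 < `|w| ^+ 2 by rewrite exprn_gt0 // normr_gt0 expf_neq0.
by rewrite normrM -mulrA -expr2 -mulrnAl ler_pM2r // normrX.
Qed.
End Pigeonhole.

(** * The Hasse-Weil bound *)

Section HasseWeil.
Variables (Fq : finFieldType) (K : fieldType) (iota : {rmorphism Fq -> K}).
Hypothesis hK : function_field iota.
Notation cst := (constants iota).
Notation place := (place iota).
Notation divisor := (divisor iota).
Notation ev := (ev iota).
Notation transc := (transc iota).
Notation fdeg := (fdeg iota).
Notation "'F(' f )" := (rational_in iota f) (at level 0, format "'F(' f )").
Notation L D := (riemann_roch_space D).
Notation g := (genus iota).
Implicit Types (v w : place) (S : seq place) (D E : divisor) (f h : K).

Notation q := #|Fq|.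
Notation Npt := (Npt hK).

Lemma half_add_uphalf m : (m./2 + uphalf m = m)%N.
Proof. by rewrite uphalf_half addnCA addnn odd_double_half. Qed.

Lemma double_uphalf m : ((uphalf m).*2 <= m.+1)%N.
Proof. by have := odd_double_half m; rewrite uphalf_half; case: (odd m); lia. Qed.

Lemma Npt_lower p e : prime p -> p \in [pchar Fq] -> q = (p ^ e)%N ->
  exists C, forall k, (0 < k)%N -> (q ^ k <= Npt k + C * p ^ uphalf (e * k))%N.
Proof.
move=> p_pr pF qE; have [C HC] := stepanov_bound hK p_pr pF; exists C => k k0.
apply: (HC k (e * k)./2) => //; first by rewrite qE -expnM half_add_uphalf.
by rewrite uphalf_half leq_addl.
Qed.

Lemma Npt_gt0 : exists k0, forall k, (k0 <= k)%N -> (0 < Npt k)%N.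
Proof.
have [p [e [p_pr pF qE e0]]] := card_finField_pow Fq.
have [C HC] := Npt_lower p_pr pF qE; exists (C.+1).*2 => k kC.
have k0 : (0 < k)%N by apply: leq_trans kC; rewrite double_gt0.
rewrite lt0n; apply/negP => /eqP N0; have := HC k k0.
rewrite N0 add0n qE -expnM -{1}(half_add_uphalf (e * k)) expnD leq_pmul2r ?expn_gt0 ?prime_gt0 //.
rewrite leqNgt => /negP; apply; apply: (@leq_trans (e * k)./2).
  by apply: (@leq_trans k./2); [have := half_leq kC; rewrite doubleK|apply/half_leq; rewrite leq_pmull].
by rewrite ltnW // ltn_expl // prime_gt1.
Qed.

(** Since rational points exist over all large extensions, some place has degree dividing k and
    another one degree dividing k + 1; multiples of them have degrees k and k + 1. *)
Lemma degree_one : exists B : divisor, div_deg B = 1.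
Proof.
have [k Hk] := Npt_gt0.
have pl n : (k <= n)%N -> exists v : place, (place_deg v %| n)%N.
  move=> kn; apply: contrapT => H; have := Hk n kn; rewrite /Submission.Npt big1 // => v vn.
  by case: H; exists v.
have [v vk] := pl k (leqnn k); have [u uk] := pl k.+1 (leqnSn k).
exists (<< (k.+1 %/ place_deg u)%N%:Z *g u >> - << (k %/ place_deg v)%N%:Z *g v >>).
by rewrite div_degB !div_degU -!PoszM !divnK //; lia.
Qed.

Lemma expr_unbounded (x B : algC) : 1 < x -> 0 <= B ->
  exists n0, forall n, (n0 <= n)%N -> B < x ^+ n.
Proof.
move=> x1 B0; have y0 : 0 < x - 1 by rewrite subr_gt0.
exists (Num.bound (B / (x - 1))) => n Hn.
have bern : (x - 1) *+ n <= x ^+ n - 1.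
  elim: n {Hn} => [|n IH]; first by rewrite subrr mulr0n.
  have -> : x ^+ n.+1 - 1 = x * (x ^+ n - 1) + (x - 1) by rewrite exprS; ring.
  rewrite mulrSr lerD2r; apply: le_trans (IH) _; rewrite ler_peMl ?(ltW x1) //.
  by apply: le_trans IH; rewrite mulrn_wge0 // ltW.
apply: (@lt_le_trans _ _ ((x - 1) *+ n)); last by apply: le_trans bern _; rewrite gerBl.
rewrite -mulr_natl -ltr_pdivrMr //.
apply: lt_le_trans (archi_boundP _) _; first by rewrite divr_ge0 // ltW.
by rewrite ler_nat.
Qed.

(** The Stepanov estimate bounds the power sum of order n from above by D' q^(n/2). At the n given
    by [simultaneous_real_parts] no root contributes a negative real part, so a single root larger
    than q^(1/2) would violate this bound. *)
Theorem weil_roots : (0 < g)%N -> exists s : seq algC, [/\ (size s <= 2 * g)%N,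
  forall n, (0 < n)%N -> \sum_(z <- s) z ^+ n = q%:R ^+ n + 1 - (Npt n)%:R &
  forall z, z \in s -> `|z| <= sqrtC q%:R].
Proof.
move=> g0; have [B degB] := degree_one; have [h Hh] := Aeff_large hK degB.
have q1 : (q%:R - 1 : algC) != 0 by rewrite subr_eq0 -[1]/(1%:R) eqr_nat gtn_eqF // card_gt1.
have Hc n : (2 * g <= n.+1)%N -> (q%:R - 1) * (Aeff hK n)%:R = h%:R * q%:R ^+ (n + 1 - g) - h%:R :> algC.
  move=> ng; have := congr1 (fun k : nat => k%:R : algC) (Hh n ng).
  by rewrite natrD !natrM natrX natrB ?(ltnW (card_gt1 Fq)) // => E; rewrite -E addrK.
have AN n : n%:R * (Aeff hK n)%:R = \sum_(1 <= j < n.+1) (Npt j)%:R * (Aeff hK (n - j))%:R :> algC.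
  by rewrite -natrM Aeff_recursion natr_sum; apply: eq_bigr => j _; exact: natrM.
have Av n : (2 * g < n)%N ->
    (Aeff hK n)%:R - (q%:R + 1) * (Aeff hK n.-1)%:R + q%:R * (Aeff hK n.-2)%:R = 0 :> algC.
  case: n => [|[|n]] ng; [by []|by move: ng; clear - g0; lia|]; apply: (mulfI q1); rewrite mulr0 /=.
  have -> : (q%:R - 1) * ((Aeff hK n.+2)%:R - (q%:R + 1) * (Aeff hK n.+1)%:R + q%:R * (Aeff hK n)%:R) =
    (q%:R - 1) * (Aeff hK n.+2)%:R - (q%:R + 1) * ((q%:R - 1) * (Aeff hK n.+1)%:R)
     + q%:R * ((q%:R - 1) * (Aeff hK n)%:R) :> algC by ring.
  rewrite !Hc; try by move: ng; clear; lia.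
  have -> : (n.+2 + 1 - g = (n + 1 - g).+2)%N by move: ng g0; clear; lia.
  have -> : (n.+1 + 1 - g = (n + 1 - g).+1)%N by move: ng g0; clear; lia.
  by move: (n + 1 - g)%N => k; rewrite !exprS; move: (q%:R : algC) (h%:R : algC) => Q H; move: (Q ^+ k) => X; ring.
have A0 : (Aeff hK 0)%:R = 1 :> algC by rewrite Aeff0.
have [s0 [ss0 Hs0]] := zeta_roots g0 A0 AN Av.
pose s := [seq z <- s0 | z != 0].
have Hs n : (0 < n)%N -> \sum_(z <- s) z ^+ n = q%:R ^+ n + 1 - (Npt n)%:R.
  move=> n0; rewrite -Hs0 // big_filter [RHS](bigID (fun z => z != 0)) /=.
  by rewrite [X in _ = _ + X]big1 ?addr0 // => z; rewrite negbK => /eqP ->; rewrite expr0n gtn_eqF.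
exists s; split=> //; first by apply: leq_trans ss0; rewrite size_filter count_size.
set r := sqrtC q%:R.
have r0 : 0 < r by rewrite sqrtC_gt0 ltr0n (ltnW (card_gt1 Fq)).
have [p [e [p_pr pF qE e0]]] := card_finField_pow Fq.
have [D HD] := Npt_lower p_pr pF qE.
pose D' : algC := 1 + D%:R * p%:R.
have D'0 : 0 <= D' by rewrite addr_ge0 ?mulr_ge0 ?ler0n.
have r1 : 1 <= r by rewrite -[1]sqrtC1 ler_sqrtC ?nnegrE ?ler01 ?ler0n // ler1n (ltnW (card_gt1 Fq)).
have SD n : (0 < n)%N -> q%:R ^+ n + 1 - (Npt n)%:R <= D' * r ^+ n.
  move=> n0; rewrite /D' mulrDl mul1r lerBlDr addrAC [q%:R ^+ n + 1]addrC -addrA lerD ?exprn_ege1 //.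
  have H1 : (q%:R ^+ n <= (Npt n)%:R + D%:R * (p ^ uphalf (e * n))%:R :> algC).
    by rewrite -natrX -natrM -natrD ler_nat; apply: HD.
  apply: le_trans H1 _; rewrite lerD2l -mulrA ler_wpM2l ?ler0n //.
  rewrite -(@ler_pXn2r _ 2) ?nnegrE ?ler0n ?mulr_ge0 ?exprn_ge0 ?ler0n ?(ltW r0) //.
  rewrite exprMn -[(r ^+ n) ^+ 2]exprM [(n * 2)%N]mulnC exprM sqrtCK qE -!natrX -natrM ler_nat -!expnM -expnD.
  rewrite leq_exp2l ?prime_gt1 // mulnC mul2n.
  by apply: leq_trans (double_uphalf _) _; rewrite add2n.
move=> z zs; rewrite real_leNgt ?normr_real ?ger0_real ?(ltW r0) //; apply/negP => rz.
have zr1 : 1 < `|z| / r by rewrite ltr_pdivlMr // mul1r.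
have [n0 Hn0] := expr_unbounded zr1 (mulrn_wge0 2 D'0).
have [i iz] : exists i : 'I_(size s), tnth (in_tuple s) i = z by have /(@tnthP _ _ (in_tuple s)) [i] := zs; exists i.
have s_neq0 j : tnth (in_tuple s) j != 0.
  by have := mem_tnth j (in_tuple s); rewrite mem_filter => /andP [].
have [n nn0 Hn] := simultaneous_real_parts (ltn0Sn n0) s_neq0.
have np : (0 < n)%N by apply: leq_trans nn0.
suff H : (`|z| / r) ^+ n <= D' *+ 2 by have := le_lt_trans H (Hn0 n (ltnW nn0)); rewrite ltxx.
rewrite expr_div_n ler_pdivrMr ?exprn_gt0 // mulrnAl.
apply: le_trans (_ : (q%:R ^+ n + 1 - (Npt n)%:R) *+ 2 <= _); last by rewrite lerMn2r SD ?orbT.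
have Re : (q%:R ^+ n + 1 - (Npt n)%:R : algC) \is Num.real.
  by rewrite rpredB ?rpredD ?rpredX ?realn ?rpred1.
rewrite -(Creal_ReP _ Re) -Hs // raddf_sum /= big_tnth (bigD1 i) //= iz mulrnDl.
have := Hn i; rewrite iz => Hi; apply: le_trans Hi _; rewrite lerDl -sumrMnl sumr_ge0 // => j _.
by apply: le_trans (Hn j); rewrite exprn_ge0.
Qed.

(** The squared form keeps the statement within the integers although q^(n/2) may be irrational. *)
Corollary hasse_weil n : (0 < g)%N -> (0 < n)%N ->
  (q%:Z ^+ n + 1 - (Npt n)%:Z) ^+ 2 <= (4 * g ^ 2 * q ^ n)%N%:Z.
Proof.
move=> g0 n0; have [s [ss Hs zs]] := weil_roots g0.
have r0 : 0 <= sqrtC (q%:R : algC) by rewrite sqrtC_ge0 ler0n.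
have bound : `|q%:R ^+ n + 1 - (Npt n)%:R : algC| <= (2 * g)%:R * sqrtC q%:R ^+ n.
  rewrite -Hs //; apply: le_trans (ler_norm_sum _ _ _) _.
  apply: (@le_trans _ _ ((size s)%:R * sqrtC q%:R ^+ n)); last first.
    by rewrite ler_wpM2r ?exprn_ge0 // ler_nat.
  elim: s zs {ss Hs} => [|z s IH] zs; first by rewrite big_nil mul0r.
  rewrite big_cons /= -natr1 mulrDl mul1r [X in _ <= X]addrC lerD //.
    by rewrite normrX lerXn2r ?nnegrE // zs // mem_head.
  by apply: IH => y ys; apply: zs; rewrite inE ys orbT.
have E : (q%:Z ^+ n + 1 - (Npt n)%:Z)%:~R = q%:R ^+ n + 1 - (Npt n)%:R :> algC.
  by rewrite rmorphB rmorphD rmorphXn.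
rewrite -(ler_int algC) rmorphXn /= E -real_normK; last first.
  by rewrite rpredB ?rpredD ?rpredX ?realn ?rpred1.
apply: (@le_trans _ _ (((2 * g)%:R * sqrtC q%:R ^+ n) ^+ 2)).
  by rewrite lerXn2r ?nnegrE // mulr_ge0 ?exprn_ge0 ?ler0n.
rewrite exprMn -[(sqrtC _ ^+ n) ^+ 2]exprM [(n * 2)%N]mulnC exprM sqrtCK.
by rewrite -!natrX -natrM expnMn.
Qed.
End HasseWeil.

(** * Gonality and torsion in the class group *)

Lemma least_spec (P : set nat) n : P n -> P (least P) /\ forall j, P j -> (least P <= j)%N.
Proof.
move=> Pn; rewrite /least; apply: (@xgetPex _ 0%N [set n | P n /\ forall j, P j -> (n <= j)%N]).
have ex : exists n, `[< P n >] by exists n; apply/asboolP.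
have [m /asboolP Pm mm] := ex_minnP ex.
by exists m; split=> // j Pj; apply: mm; apply/asboolP.
Qed.

Section Gonality.
Variables (Fq : finFieldType) (K : fieldType) (iota : {rmorphism Fq -> K}).
Hypothesis hK : function_field iota.
Notation cst := (constants iota).
Notation place := (place iota).
Notation divisor := (divisor iota).
Notation ev := (ev iota).
Notation transc := (transc iota).
Notation fdeg := (fdeg iota).
Notation "'F(' f )" := (rational_in iota f) (at level 0, format "'F(' f )").
Notation L D := (riemann_roch_space D).
Notation g := (genus iota).
Implicit Types (v w : place) (S : seq place) (D E : divisor) (f h : K).

Let hF := subfield_constants iota.
Notation q := #|Fq|.
Notation gon := (gonality iota).
Notation cl := (@divisor_class Fq K iota).

Lemma gonality_le f : transc f -> (gon <= fdeg f)%N.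
Proof.
move=> tf; have H : exists h, ~ cst h /\ has_degree iota h (fdeg f).
  by exists f; split; [apply: transc_nonconstant|apply: has_fdeg].
exact: (least_spec (P := [set n | exists h, ~ cst h /\ has_degree iota h n]) H).2.
Qed.

Lemma gonality_attained : exists2 f, transc f & fdeg f = gon.
Proof.
have [[y [/(not_algebraic_transc) ty _]] _] := hK.
have H : exists h, ~ cst h /\ has_degree iota h (fdeg y).
  by exists y; split; [apply: transc_nonconstant|apply: has_fdeg].
have [[f [cf df]] _] := least_spec (P := [set n | exists h, ~ cst h /\ has_degree iota h n]) H.
by exists f; [apply: (nonconstant_transc hK)|apply: fdegE].
Qed.

Lemma fdeg_le_pole h D : transc h -> dle 0 D -> L D h -> (fdeg h)%:Z <= div_deg D.
Proof.
move=> th D0 Lh; have [E HE dE] := zdiv_deg hK (transcV hK th).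
rewrite -fdegV -dE; apply: dle_deg => v; rewrite HE placeV ?(transc_neq0 th) //.
move: Lh; rewrite LspaceE => /(_ v); rewrite vgeE ?(transc_neq0 th) // => Lh.
by rewrite ge_max (eff_ge0 v D0) -lerN2 opprK.
Qed.

(** A function in L(D) moves D to an equivalent effective E, and any nonconstant function of L(E)
    has degree at most deg E. *)
Lemma gonality_le_ell D : (1 < ell D)%N -> exists2 E : divisor, gon%:Z <= div_deg E & div_deg E = div_deg D.
Proof.
move=> l2; have [h h0 Lh] := L_nonzero (ltnW l2).
pose E := D + pdiv iota h; exists E; last by rewrite div_degD (deg_pdiv hK h0) addr0.
have E0 : dle 0 E.
  move=> v; rewrite coeff0 coeffD (coeff_pdiv hK) //; move: Lh; rewrite LspaceE => /(_ v).
  by rewrite vgeE // -lerBlDl sub0r.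
have lE : (1 < ell E)%N.
  by have := ell_pdiv hK E h0; rewrite /E addrK => <-.
have [y [Ly cy]] : exists y, L E y /\ ~ cst y.
  apply: contrapT => H; have [b [Lb _ fb]] := has_ell hK E.
  have cb i : cst (b i) by apply: contrapT => nb; apply: H; exists (b i).
  have h1 : has_dim cst [set 0] cst 1.
    exists (fun=> 1); split=> [_|y cy|c cc]; first exact: sf1 hF.
      by exists (fun=> y); split=> //; rewrite big_ord1 mulr1 subrr.
    by rewrite big_ord1 mulr1 => c0 i; rewrite ord1.
  have := has_dim_le hF (subspace0 _) h1 cb fb; move: lE; case: (ell E) => [|[]] //.
have ty := nonconstant_transc hK cy.
by apply: le_trans (fdeg_le_pole ty E0 Ly); rewrite lez_nat gonality_le.
Qed.

(** A divisor of degree g + 1 exists by [degree_one] and has ell >= 2 by Riemann's inequality. *)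
Lemma gonality_genus : (gon <= g.+1)%N.
Proof.
have [B dB] := degree_one hK.
have dD : div_deg (B *+ g.+1) = g.+1%:Z by rewrite div_deg_muln dB natz.
have [|E gE dE] := @gonality_le_ell (B *+ g.+1).
  by have := riemann hK (B *+ g.+1); rewrite dD -ltz_nat; lia.
by rewrite -lez_nat -dD -dE.
Qed.

Lemma principal_gonality D E s n : dle 0 D -> dle 0 E -> div_deg E = s%:Z -> D != E ->
  (0 < n)%N -> principal ((D - E) *+ n) -> (gon <= n * s)%N.
Proof.
move=> D0 E0 dE DE n0 /(principalP hK) [h h0 Eh].
have vh v : v h = (coeff v D - coeff v E) * n%:Z.
  by rewrite -(coeff_pdiv hK v h0) -Eh coeffMn coeffB -mulr_natr natz.
have th : transc h.
  apply: (nonconstant_transc hK) => -[a _ ah]; move/eqP: DE; apply; apply: divisor_eq => v.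
  have := vh v; rewrite -ah place_iota => /esym/eqP; rewrite mulf_eq0 subr_eq0.
  by case/orP => /eqP // n00; move: n0; rewrite -ltz_nat n00.
have LE : L (E *+ n) h.
  rewrite LspaceE => v; rewrite vgeE // vh coeffMn -mulr_natr natz.
  have := mulr_ge0 (eff_ge0 v D0) (ler0n int n); rewrite natz mulrBl; lia.
have nE0 : dle 0 (E *+ n).
  by move=> v; rewrite coeff0 coeffMn mulrn_wge0 // eff_ge0.
have := fdeg_le_pole th nE0 LE; rewrite div_deg_muln dE -mulr_natr natz mulrC -PoszM lez_nat.
exact: leq_trans (gonality_le th).
Qed.

Lemma classD D E : cl (D + E) = cl D + cl E.
Proof. exact: Quotient.pi_add. Qed.

Lemma class_eq D E : cl D = cl E <-> principal (D - E).
Proof.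
rewrite /divisor_class; split=> [/eqP|H]; last apply/eqP.
  by rewrite eqmodE /= Quotient.equivE.
by rewrite eqmodE /= Quotient.equivE.
Qed.

Lemma class_muln D n : cl (D *+ n) = cl D *+ n.
Proof.
elim: n => [|n IH]; last by rewrite !mulrS classD IH.
by rewrite !mulr0n; apply: (addrI (cl 0)); rewrite -classD !addr0.
Qed.

Lemma class_muln_eq0 D n : cl D *+ n = 0 <-> principal (D *+ n).
Proof.
have c0 : cl 0 = 0 by rewrite -[0 in LHS](mulr0n (0 : divisor)) class_muln mulr0n.
by rewrite -class_muln -c0 class_eq subr0.
Qed.

Lemma Pic0_torsion c : Pic0 iota c -> exists2 n, (0 < n)%N & c *+ n = 0.
Proof.
move=> [D dD ->]; have [B dB] := degree_one hK.
have [C [uC degC repC injC]] := degree_classes hK dB.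
have Hj (j : 'I_(size C).+1) : exists t : 'I_(size C), principal (D *+ j - tnth (in_tuple C) t).
  have [|E EC pE] := repC (D *+ j); first by rewrite div_deg_muln dD mul0rn.
  by have /(@tnthP _ _ (in_tuple C)) [t Et] := EC; exists t; rewrite -Et.
have /boolp.choice [t Ht] := Hj.
have /injectivePn [j [k jk tjk]] : ~~ injectiveb t.
  by apply/negP => /injectiveP /leq_card; rewrite !card_ord ltnn.
wlog lt : j k jk tjk / (j < k)%N.
  move=> H; have := jk; rewrite -val_eqE neq_ltn => /orP [|]; first exact: H.
  by apply: H => //; rewrite eq_sym.
exists (k - j)%N; first by rewrite subn_gt0.
apply/class_muln_eq0; have := principalB hK (Ht k) (Ht j).
by rewrite tjk opprB addrA subrK -mulrnBr // ltnW.
Qed.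

(** A product of orders of class representatives annihilates the group, so that [least] does not
    return its default value 0. *)
Lemma exponent_spec : (0 < exponent (Pic0 iota))%N /\
  forall c, Pic0 iota c -> c *+ exponent (Pic0 iota) = 0.
Proof.
have [B dB] := degree_one hK; have [C [uC degC repC injC]] := degree_classes hK dB.
have /boolp.choice [n Hn] : forall E : divisor, exists n, (0 < n)%N /\ (E \in C -> cl E *+ n = 0).
  move=> E; have [EC|_] := boolP (E \in C); last by exists 1%N.
  have [|n n0 cn] := @Pic0_torsion (cl E); first by exists E; rewrite ?degC.
  by exists n.
suff H : [set n | (0 < n)%N /\ forall c, Pic0 iota c -> c *+ n = 0] (\prod_(E <- C) n E)%N.
  exact: (least_spec H).1.
split=> [|c [D dD ->]]; first by rewrite prodn_cond_gt0 // => E _; case: (Hn E).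
have [E EC /class_eq ->] := repC D dD.
by rewrite (big_rem E) //= mulrnA (Hn E).2 // mul0rn.
Qed.

Lemma additive_order_ge c m : Pic0 iota c -> (forall n, (0 < n)%N -> c *+ n = 0 -> (m <= n)%N) ->
  (m <= additive_order c)%N.
Proof.
move=> /Pic0_torsion [n n0 cn] H.
have [[o0 co] _] := least_spec (P := [set n | (0 < n)%N /\ c *+ n = 0]) (conj n0 cn).
exact: H.
Qed.
End Gonality.

(** * The borderline case of the Weil bound *)

(** For u = a + i b and w = c + i d in the unit disc, a c - b d is the real part of u w. If it is
    close to 1, then w is close to the conjugate of u and c is close to a; l weights the two terms
    of the mean inequality. *)
Lemma root_inequality (R : realFieldType) (a b c d l : R) : a ^+ 2 + b ^+ 2 <= 1 ->
  c ^+ 2 + d ^+ 2 <= 1 -> 0 < l -> c - a <= l / 2 + (1 - (a * c - b * d)) / l.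
Proof.
move=> ab cd l0; rewrite -(ler_pM2r l0).
have -> : (l / 2 + (1 - (a * c - b * d)) / l) * l = l ^+ 2 / 2 + (1 - (a * c - b * d)).
  by field; rewrite gt_eqF.
have := sqr_ge0 (c - a - l); have := sqr_ge0 (d + b); lra.
Qed.

(** T1, T2 and Ts are the traces of the powers 1, 2j and 2j + 1 of the normalized roots. N1 >= 0
    gives T1 <= U, N2 <= 2j gives T2 >= c + U, while Ns <= 2j + 1 brings Ts so close to 2g that T2 -
    T1 < c. The choice of l makes both error terms at most c / 2. *)
Lemma borderline_arithmetic (R : realFieldType) (w X Y c U M l T1 T2 Ts Ns N1 N2 g q j : R) :
  0 < g -> 0 < c -> l = c / (2 * g) -> M <= 2 * g -> 1 <= j ->
  T2 - T1 <= M * (l / 2) + (M - Ts) / l ->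
  Ts * X = X ^+ 2 + 1 - Ns -> Ns <= 2 * j + 1 -> 2 * g < X ->
  T2 * Y = Y ^+ 2 + 1 - N2 -> N2 <= 2 * j -> 0 < Y ->
  T1 * w = q + 1 - N1 -> 0 <= N1 -> 0 < w -> w ^+ 2 = q -> (q + 1) ^+ 2 <= q * U ^+ 2 -> 0 <= U ->
  (c + U) * Y <= Y ^+ 2 + 1 - 2 * j -> 4 * j <= c ^+ 2 -> False.
Proof.
move=> g0 c0 lE Mg j1 h1 hs Ns1 X1 h2 N21 Y0 hT1 N10 w0 wq qU U0 hY cj.
have T1U : T1 <= U.
  rewrite -(ler_pM2r w0) hT1; apply: (@le_trans _ _ (q + 1)); first by rewrite gerBl.
  rewrite -(@ler_pXn2r _ 2) ?nnegrE ?mulr_ge0 ?(ltW w0) // ?exprMn ?wq 1?mulrC //.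
  by rewrite -wq addr_ge0 ?sqr_ge0 ?ler01.
have T2U : c + U <= T2 by rewrite -(ler_pM2r Y0) h2; lra.
have l0 : 0 < l by rewrite lE divr_gt0 // mulr_gt0.
have e1 : M * (l / 2) + (M - Ts) / l <= 2 * g * (l / 2) + (2 * g - Ts) / l.
  apply: lerD; first by rewrite ler_pM2r ?divr_gt0.
  by rewrite ler_pM2r ?invr_gt0 // lerD2r.
have e2 : 2 * g * (l / 2) = c / 2 by rewrite lE; field; rewrite gt_eqF.
have e3 : (2 * g - Ts) / l = (2 * g - Ts) * (2 * g) / c.
  by rewrite lE; field; rewrite !gt_eqF.
have e4 : (2 * g - Ts) * (2 * g) < 2 * j.
  have [neg|pos] := lerP (2 * g - Ts) 0.
    by apply: le_lt_trans (_ : 0 < 2 * j); [rewrite mulr_le0_ge0 // mulr_ge0 // ltW|lra].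
  apply: (@le_lt_trans _ _ ((2 * g - Ts) * X)); first by rewrite ler_pM2l // ltW.
  have : (X - 2 * g) * X > 0 by rewrite mulr_gt0 ?subr_gt0 //; lra.
  have -> : (2 * g - Ts) * X = 2 * g * X - Ts * X by ring.
  by rewrite hs; lra.
have e5 : (2 * g - Ts) * (2 * g) / c < c / 2.
  rewrite ltr_pdivrMr //; lra.
lra.
Qed.

Lemma borderline_parameters (q j g : nat) : (1 < q)%N -> (0 < j)%N -> (2 * j + 1 <= g)%N ->
  (4 * g ^ 2 < q ^ (2 * j + 1))%N -> (q ^ (2 * j + 1) < (2 * g + 1) ^ 2)%N ->
  j = 1%N /\ (5 <= q)%N \/ (1 < j)%N /\ (q + j + 3 <= q ^ j)%N /\ (2 * j <= q ^ j)%N.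
Proof.
move=> q1 j0 jg H1 H2; have [j1|j2] := leqP j 1.
  have jE : j = 1%N by apply/eqP; rewrite eqn_leq j1.
  left; split=> //; rewrite jE /= in H1 H2 jg; rewrite !expnS !expn0 !muln1 in H1 H2.
  have [g4|g3] := leqP 4 g.
    rewrite ltnNge; apply/negP => q4; have := leq_mul q4 (leq_mul q4 q4); have := leq_mul g4 g4.
    by move: H1; move: (g * g)%N (q * (q * q))%N; lia.
  have gE : g = 3 by apply/eqP; rewrite eqn_leq -ltnS g3.
  by move: H1 H2 q1; rewrite gE; case: (q) => [|[|[|[|[|q']]]]].
right; split=> //; have [q3|q2] := leqP 3 q.
  have p3 k : (k.+2 < 3 ^ k.+1)%N.
    by elim: k => [|k IH] //; rewrite expnS; lia.
  have le : (3 ^ j.-1 <= q ^ j.-1)%N by rewrite leq_exp2r //; lia.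
  have qj : (q ^ j = q * q ^ j.-1)%N by rewrite -expnS prednK.
  have := p3 j.-2; rewrite !prednK //; last by lia.
  move=> j3; have : (j.+1 <= q ^ j.-1)%N by move: j3 le; lia.
  rewrite qj => Hq; have := leq_mul (leqnn q) Hq; move: (q * q ^ j.-1)%N => X; nia.
have qE : q = 2%N by apply/eqP; rewrite eqn_leq q1 -ltnS q2.
rewrite qE in H1 *; have j3 : (2 < j)%N.
  rewrite ltn_neqAle j2 andbT; apply: contraTneq H1 => jE; rewrite -jE -leqNgt.
  by rewrite -jE in jg; rewrite !expnS expn0; nia.
have H k : (2 * k + 8 <= 2 ^ (k + 3))%N by elim: k => [|k IH] //; rewrite (addSn k 3) expnS; lia.
by have := H (j - 3)%N; rewrite subnK //; lia.
Qed.

Lemma sum_affine (R : fieldType) (T : Type) (s : seq T) (f : T -> R) a l :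
  \sum_(z <- s) (a + (1 - f z) / l) = (size s)%:R * a + ((size s)%:R - \sum_(z <- s) f z) / l.
Proof.
elim: s => [|z s IH]; first by rewrite !big_nil subr0 !mul0r addr0.
by rewrite !big_cons IH /= -natr1; ring.
Qed.

Section Borderline.
Variables (Fq : finFieldType) (K : fieldType) (iota : {rmorphism Fq -> K}).
Hypothesis hK : function_field iota.
Notation cst := (constants iota).
Notation place := (place iota).
Notation divisor := (divisor iota).
Notation ev := (ev iota).
Notation transc := (transc iota).
Notation fdeg := (fdeg iota).
Notation "'F(' f )" := (rational_in iota f) (at level 0, format "'F(' f )").
Notation L D := (riemann_roch_space D).
Notation g := (genus iota).
Implicit Types (v w : place) (S : seq place) (D E : divisor) (f h : K).

Notation q := #|Fq|.
Notation Npt := (Npt hK).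

Lemma Npt_le_Aeff n : (Npt n <= n * Aeff hK n)%N.
Proof.
case: n => [|n].
  rewrite /Submission.Npt big1_seq // => v /andP [_]; rewrite mem_plist leqn0 => /eqP E.
  by have := place_deg_gt0 hK v; rewrite E.
rewrite Aeff_recursion big_nat_recr //= subnn Aeff0 muln1; exact: leq_addl.
Qed.

(** With s = 2j + 1, the hypotheses say that q^(s/2) - 2g lies strictly between 0 and 1. If each
    degree up to s had at most one effective divisor, then N_i <= i there, and the three traces
    become contradictory. *)
Lemma borderline j : (0 < j)%N -> (2 * j + 1 <= g)%N ->
  (4 * g ^ 2 < q ^ (2 * j + 1))%N -> (q ^ (2 * j + 1) < (2 * g + 1) ^ 2)%N ->
  exists2 i, (0 < i <= 2 * j + 1)%N & (1 < Aeff hK i)%N.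
Proof.
move=> j0 jg H1 H2; apply: contrapT => HA; have g0 : (0 < g)%N by lia.
have q1 := card_gt1 Fq.
have Ni i : (0 < i <= 2 * j + 1)%N -> (Npt i <= i)%N.
  move=> ii; have A1 : (Aeff hK i <= 1)%N by rewrite leqNgt; apply/negP => A1; apply: HA; exists i.
  by apply: leq_trans (Npt_le_Aeff i) _; rewrite -[X in (_ <= X)%N]muln1 leq_mul.
have [s [ss Hs zs]] := weil_roots hK g0.
pose w : algR := Num.sqrt q%:R.
have w0 : 0 < w by rewrite sqrtr_gt0 ltr0n ltnW.
have w2 : w ^+ 2 = q%:R by rewrite sqr_sqrtr // ler0n.
have wC : algRval w = sqrtC q%:R.
  have W0 : 0 <= algRval w by have := ltW w0.
  rewrite -(sqrCK W0); congr sqrtC; have := congr1 algRval w2.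
  by rewrite rmorphXn /= rmorph_nat.
pose re n (z : algC) : algR := in_algR (Creal_Re ((z / algRval w) ^+ n)).
pose im n (z : algC) : algR := in_algR (Creal_Im ((z / algRval w) ^+ n)).
have unit n z : z \in s -> re n z ^+ 2 + im n z ^+ 2 <= 1.
  move=> /zs zw; have : algRval (re n z ^+ 2 + im n z ^+ 2) <= algRval 1.
    rewrite rmorphD !rmorphXn /= -normC2_Re_Im exprn_ile1 //.
    rewrite normrX exprn_ile1 // normf_div ler_pdivrMr ?mul1r.
      by rewrite [X in _ <= X]ger0_norm ?wC // sqrtC_ge0 ler0n.
    by rewrite wC normr_gt0 sqrtC_eq0 pnatr_eq0 -lt0n ltnW.
  by [].
have T n : (0 < n)%N -> (\sum_(z <- s) re n z) * w ^+ n = q%:R ^+ n + 1 - (Npt n)%:R.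
  move=> n0; suff E : algRval ((\sum_(z <- s) re n z) * w ^+ n) = algRval (q%:R ^+ n + 1 - (Npt n)%:R).
    exact: val_inj E.
  have -> : algRval (q%:R ^+ n + 1 - (Npt n)%:R) = q%:R ^+ n + 1 - (Npt n)%:R :> algC.
    by rewrite rmorphB rmorphD rmorphXn ?rmorph1 !rmorph_nat.
  have -> : algRval ((\sum_(z <- s) re n z) * w ^+ n) = (\sum_(z <- s) 'Re ((z / algRval w) ^+ n)) * algRval w ^+ n.
    by rewrite rmorphM rmorphXn raddf_sum.
  rewrite -Hs //.
  have wn0 : algRval w ^+ n != 0 by rewrite expf_neq0 // wC sqrtC_eq0 pnatr_eq0 -lt0n ltnW.
  rewrite -raddf_sum -[RHS](divfK wn0) /=; congr (_ * _).
  have -> : \sum_(z <- s) (z / algRval w) ^+ n = (\sum_(z <- s) z ^+ n) / algRval w ^+ n.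
    by rewrite mulr_suml; apply: eq_bigr => z _; rewrite expr_div_n.
  apply/Creal_ReP; rewrite Hs // rpredM ?rpredV ?rpredX ?algRvalP //.
  by rewrite rpredB ?rpredD ?rpredX ?realn ?rpred1.
have wY : w ^+ (2 * j) = (q ^ j)%:R by rewrite exprM w2 natrX.
have X2 : (w ^+ (2 * j + 1)) ^+ 2 = (q ^ (2 * j + 1))%:R.
  by rewrite -exprM mulnC exprM w2 natrX.
pose Y : algR := (q ^ j)%:R.
have Y0 : 0 < Y by rewrite ltr0n expn_gt0 ltnW.
have gR : 0 < g%:R :> algR by rewrite ltr0n.
have jR : 1 <= j%:R :> algR by rewrite ler1n.
have arith (c U : algR) : 0 < c -> 0 <= U -> (q%:R + 1) ^+ 2 <= q%:R * U ^+ 2 ->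
    (c + U) * Y <= Y ^+ 2 + 1 - 2 * j%:R -> 4 * j%:R <= c ^+ 2 -> False.
  move=> c0 U0 qU hY cj; pose l := c / (2 * g%:R); have l0 : 0 < l by rewrite divr_gt0 ?mulr_gt0.
  apply: (@borderline_arithmetic _ w (w ^+ (2 * j + 1)) Y c U (size s)%:R l
    (\sum_(z <- s) re 1%N z) (\sum_(z <- s) re (2 * j)%N z) (\sum_(z <- s) re (2 * j + 1)%N z)
    (Npt (2 * j + 1))%:R (Npt 1)%:R (Npt (2 * j))%:R g%:R q%:R j%:R) => //.
  - by rewrite -natrM ler_nat.
  - rewrite -sumrB; have -> : (size s)%:R * (l / 2) + ((size s)%:R - \sum_(z <- s) re (2 * j + 1)%N z) / l =
       \sum_(z <- s) (l / 2 + (1 - re (2 * j + 1)%N z) / l).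
      exact: esym (sum_affine _ _ _ _).
    rewrite !big_seq; apply: ler_sum => z zin.
    have -> : re (2 * j + 1)%N z = re 1%N z * re (2 * j)%N z - im 1%N z * im (2 * j)%N z.
      suff E : algRval (re (2 * j + 1)%N z) =
          algRval (re 1%N z * re (2 * j)%N z - im 1%N z * im (2 * j)%N z) by exact: val_inj E.
      rewrite rmorphB !rmorphM.
      change ('Re ((z / algRval w) ^+ (2 * j + 1)) = 'Re ((z / algRval w) ^+ 1) * 'Re ((z / algRval w) ^+ (2 * j))
         - 'Im ((z / algRval w) ^+ 1) * 'Im ((z / algRval w) ^+ (2 * j))).
      by rewrite addnC exprD ReM.
    by apply: root_inequality; rewrite ?unit.
  - by rewrite X2 natrX; apply: T; rewrite addn1.
  - by rewrite -[1]/(1%:R) -natrM -natrD ler_nat Ni // leqnn addn1.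
  - rewrite -(@ltr_pXn2r _ 2) ?nnegrE ?mulr_ge0 ?ler0n ?exprn_ge0 ?(ltW w0) // X2.
    by rewrite -natrM -natrX ltr_nat expnMn.
  - by rewrite -[Y in _ * Y]wY T ?muln_gt0 // /Y -!natrX -!expnM [(2 * j)%N]mulnC.
  - by rewrite -natrM ler_nat; apply: Ni; rewrite leq_addr muln_gt0 j0.
  - by have := T 1%N isT; rewrite !expr1.
have qR : 2 <= q%:R :> algR by rewrite ler_nat.
have [[jE q5]|[j2 [qj qj2]]] := borderline_parameters q1 j0 jg H1 H2.
  have q5R : 5 <= q%:R :> algR by rewrite ler_nat.
  have qn0 : q%:R != 0 :> algR by rewrite gt_eqF // ltr0n ltnW.
  have qV : q%:R^-1 <= 1 :> algR by rewrite invf_le1 ?ler1n ?ltr0n ltnW.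
  (* For j = 1, c = 2 is the least value with 4j <= c^2, and U takes all the room left by (c + U) Y
     <= Y^2 + 1 - 2j with Y = q. *)
  apply: (arith 2 (q%:R - 2 - q%:R^-1)) => //.
  - lra.
  - have -> : q%:R * (q%:R - 2 - q%:R^-1) ^+ 2 = (q%:R ^+ 2 - 2 * q%:R - 1) ^+ 2 / q%:R :> algR by field.
    rewrite ler_pdivlMr ?ltr0n 1?ltnW //; move: q5R; move: (q%:R : algR) => x x5.
    nra.
  - rewrite /Y jE expn1; have -> : (2 + (q%:R - 2 - q%:R^-1)) * q%:R = q%:R ^+ 2 - 1 :> algR by field.
    lra.
  - by rewrite jE; lra.
have qjR : q%:R + j%:R + 3 <= Y by rewrite -!natrD ler_nat.
have qj2R : 2 * j%:R <= Y by rewrite -natrM ler_nat.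
apply: (arith (j%:R + 1) (q%:R + 1 / 2)).
- lra.
- lra.
- move: qR; move: (q%:R : algR) => x x2; nra.
- have : Y * (q%:R + j%:R + 3) <= Y * Y by rewrite ler_pM2l.
  lra.
- have := sqr_ge0 (j%:R - 1 : algR); lra.
Qed.
End Borderline.

(** * Points in the fibers of a map of minimal degree *)

Lemma castelnuovo_arithmetic (d e J g : nat) : (0 < d)%N -> (0 < e)%N ->
  (e * J.+1)%N%:Z <= (d * e.-1 + e * J)%N%:Z + 1 - g%:Z -> (g <= d.-1 * e.-1)%N.
Proof.
case: d e => [|d] [|e] //= _ _; rewrite [(e.+1 * J.+1)%N]mulnS [(d.+1 * e)%N]mulSn.
by move: (d * e)%N (e.+1 * J)%N; clear; lia.
Qed.

Section PrimeDegree.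
Variables (Fq : finFieldType) (K : fieldType) (iota : {rmorphism Fq -> K}).
Hypothesis hK : function_field iota.
Notation cst := (constants iota).
Notation place := (place iota).
Notation divisor := (divisor iota).
Notation ev := (ev iota).
Notation transc := (transc iota).
Notation fdeg := (fdeg iota).
Notation "'F(' f )" := (rational_in iota f) (at level 0, format "'F(' f )").
Notation L D := (riemann_roch_space D).
Notation g := (genus iota).
Implicit Types (v w : place) (S : seq place) (D E : divisor) (f h : K).

Let hF := subfield_constants iota.
Notation q := #|Fq|.
Notation Npt := (Npt hK).

Lemma zeros_weight h D (T : seq place) (m : place -> int) : h != 0 -> L D h -> dle 0 D -> uniq T ->
  (forall v, v \in T -> m v <= v h) -> \sum_(v <- T) m v * (place_deg v)%:Z <= div_deg D.
Proof.
move=> h0 Lh D0 uT mT; rewrite -div_deg_divf // -[div_deg D]add0r -(deg_pdiv hK h0) -div_degD.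
apply: dle_deg => v; rewrite coeff_divf // coeffD (coeff_pdiv hK) //.
move: Lh; rewrite LspaceE => /(_ v); rewrite vgeE // => Lh.
case: ifP => [/mT H|_]; last by rewrite -lerBlDr sub0r.
by apply: le_trans H _; rewrite lerDl (eff_ge0 v D0).
Qed.

Lemma pole_divisor f : transc f -> exists P : divisor,
  [/\ dle 0 P, div_deg P = (fdeg f)%:Z & forall v, coeff v P = Num.max 0 (- v f)].
Proof.
move=> tf; have [P HP dP] := zdiv_deg hK (transcV hK tf); exists P.
have HP' v : coeff v P = Num.max 0 (- v f) by rewrite HP placeV ?(transc_neq0 tf).
by split=> // [v|]; rewrite ?coeff0 ?HP' ?le_max ?lexx // dP fdegV.
Qed.

Lemma L_muln f (P : divisor) n i : (forall v, coeff v P = Num.max 0 (- v f)) -> f != 0 ->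
  (i <= n)%N -> L (P *+ n) (f ^+ i).
Proof.
move=> HP f0 iin; rewrite LspaceE => v; rewrite vgeE ?expf_neq0 // placeX // coeffMn HP.
rewrite -mulr_natr natz; have : (i%:Z <= n%:Z) by rewrite lez_nat.
case: (lerP 0 (- v f)) => H; move: H; clear; nia.
Qed.

Lemma L_mul (D E : divisor) x y : L D x -> L E y -> L (D + E) (x * y).
Proof.
rewrite !LspaceE => Lx Ly v; rewrite coeffD opprD; apply: vgeM; [exact: Lx|exact: Ly].
Qed.

(** With d and e the degrees of f and h, the products f^i h^j with i < e and j <= J are independent
    and lie in L(D) for D of degree d (e - 1) + e J. For large J Riemann's equality computes this
    space, and the terms e J cancel. *)
Lemma castelnuovo f h : transc f -> transc h ->
  free_mod F(h) [set 0] (fun l : 'I_(fdeg h) => f ^+ l) ->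
  (g <= (fdeg f).-1 * (fdeg h).-1)%N.
Proof.
move=> tf th ff; have [Pf [Pf0 dPf HPf]] := pole_divisor tf; have [Ph [Ph0 dPh HPh]] := pole_divisor th.
have [c Hc] := riemann_large hK; pose J := `|c|%N.
have f0 := transc_neq0 tf; have h0 := transc_neq0 th.
have df0 := fdeg_gt0 hK tf; have dh0 := fdeg_gt0 hK th.
set d := fdeg f in dPf df0 *; set e := fdeg h in dPh dh0 ff *.
pose D : divisor := Pf *+ e.-1 + Ph *+ J.
have dD : div_deg D = (d * e.-1 + e * J)%N%:Z.
  by rewrite div_degD !div_deg_muln dPf dPh -[X in X + _]mulr_natr -[X in _ + X]mulr_natr !natz PoszD !PoszM.
have cD : c <= div_deg D.
  have : (J <= d * e.-1 + e * J)%N by apply: leq_trans (leq_addl _ _); rewrite leq_pmull.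
  by rewrite dD -lez_nat /J; move: (d * e.-1 + e * J)%N; clear; lia.
have LT (t : 'I_e * 'I_J.+1) : L D (f ^+ t.1 * h ^+ t.2).
  apply: L_mul; apply: L_muln => //; last by rewrite -ltnS.
  by rewrite -ltnS prednK.
have := free_le_ell hK LT (fun e ce e0 => free_powers th (fun c cc c0 => ff c cc c0) ce e0).
rewrite card_prod !card_ord -lez_nat Hc // dD => H.
exact: castelnuovo_arithmetic H.
Qed.

Lemma fdeg_zeros h v n : v h = n%:Z -> (0 < n)%N -> (forall u, u != v -> u h <= 0) ->
  transc h /\ fdeg h = (n * place_deg v)%N.
Proof.
move=> vh n0 uh; have th : transc h by apply: (@uniformizer_transc _ _ _ hK v); rewrite vh eqz_nat -lt0n.
split=> //; have [D HD dD] := zdiv_deg hK th; apply/eqP; rewrite -eqz_nat -dD PoszM.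
have -> : D = << n%:Z *g v >>; last by rewrite div_degU.
apply: divisor_eq => u; rewrite HD coeffU; have [<-|uv] := eqVneq v u; first by rewrite vh mulr1 max_r.
by rewrite mulr0 max_l // uh // eq_sym.
Qed.

(* A relation n (v - v') ~ 0 gives h of degree n deg v over which the powers of f are independent. *)
Lemma point_difference f v v' n : transc f -> vge v 0 f -> v != v' -> (0 < n)%N ->
  (forall C : {poly Fq}, (size C <= n * place_deg v)%N -> vge v n%:Z (ev f C) -> C = 0) ->
  principal ((<< 1 *g v >> - << 1 *g v' >> : divisor) *+ n) ->
  (g <= (fdeg f).-1 * (n * place_deg v).-1)%N.
Proof.
move=> tf Of vv n0 Hf /(principalP hK) [h h0 Eh].
have uh (u : place) : u h = ((v == u)%:Z - (v' == u)%:Z) * n%:Z.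
  rewrite -(coeff_pdiv hK u h0) -Eh coeffMn coeffB !coeffU -[LHS]mulr_natr; congr (_ * _); last exact: natz.
  by case: (v == u); case: (v' == u); rewrite /= ?mulr1 ?mulr0.
have vh : v h = n%:Z by rewrite uh eqxx eq_sym (negPf vv) subr0 mul1r.
have uh0 (u : place) : u != v -> u h <= 0.
  by move=> uv; rewrite uh eq_sym (negPf uv) sub0r; case: (v' == u) => /=; clear; lia.
have [th dh] := fdeg_zeros vh n0 uh0.
rewrite -dh; apply: castelnuovo => //.
apply: (free_lift th (subspace_vge v 0)) => /= [y Oy|l|c cc [y Oy Ey]]; first by apply: vge0M; rewrite // vgeE // vh.
  exact: vge0X.
have /boolp.choice [a Ha] : forall i, exists a, iota a = c i by move=> i; have [a _] := cc i; exists a.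
pose C : {poly Fq} := \poly_(i < fdeg h) oapp a 0 (insub i).
have EC : ev f C = \sum_i c i * f ^+ i.
  rewrite (evE _ _ (size_poly _ _)); apply: eq_bigr => i _.
  by rewrite coef_poly ltn_ord valK /= Ha.
have C0 : C = 0.
  apply: Hf; first by rewrite -dh size_poly.
  by rewrite EC Ey -[n%:Z]addr0; apply: vgeM => //; rewrite vgeE // vh.
move=> i; have := congr1 (fun p : {poly Fq} => p`_i) C0.
by rewrite coef_poly ltn_ord valK coef0 /= => ai; rewrite -Ha ai rmorph0.
Qed.

Lemma fdeg_shift f a : transc f -> transc (f - iota a) /\ fdeg (f - iota a) = fdeg f.
Proof.
move=> tf; have tfa : transc (f - iota a).
  apply: (nonconstant_transc hK) => ca; apply: (transc_nonconstant tf).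
  by rewrite -(subrK (iota a) f); apply: (sfD hF ca); apply: constant_iota.
split=> //; have [P [_ dP HP]] := pole_divisor tf; have [P' [_ dP' HP']] := pole_divisor tfa.
apply/eqP; rewrite -eqz_nat -dP -dP'; apply/eqP; congr div_deg; apply: divisor_eq => v.
rewrite HP HP'; have f0 := transc_neq0 tf; have fa0 := transc_neq0 tfa.
have [vf|vf] := lerP 0 (v f).
  rewrite !max_l // oppr_le0 //.
  have : vge v 0 (f - iota a) by apply: vgeB; [rewrite vgeE|exact: vge_iota].
  by rewrite vgeE.
have [||_ ->] := @place_addl _ _ _ v f (- iota a) => //.
by rewrite vgeN; apply: vgeW (vge_iota v a); rewrite lezD1.
Qed.

Section Fiber.
Variables (f : K) (k : nat).
Hypotheses (tf : transc f) (k_pr : prime k).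

(** The value of f at v, as a point of P^1, is defined over Fq; a pole counts as the value
    infinity. *)
Definition rational_value v := ~~ vge v 0 f || [exists a, vge v 1 (f - iota a)].

(** As k is prime, the value of f at v generates the whole residue field unless it lies in Fq. *)
Lemma generic_value_free v : place_deg v = k -> ~~ rational_value v ->
  forall C : {poly Fq}, (size C <= k)%N -> vge v 1 (ev f C) -> C = 0.
Proof.
move=> vk; rewrite negb_or negbK => /andP [Of /existsPn na] C sC.
apply: (res_ev_eq0 (hK := hK) Of); rewrite ?vk // => i /andP [i0 ik]; apply/negP => /eqP E.
set x := res hK v f in E.
have xk j : x ^+ (q ^ (k * j)) = x.
  elim: j => [|j IH]; first by rewrite muln0 expn0 expr1.
  rewrite mulnS expnD exprM; have -> : x ^+ (q ^ k) = x; last by [].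
  rewrite /x -(resX hK _ Of); apply/eqP; rewrite resP ?vge0X // -vk; exact: vge_fermat.
have xi j : x ^+ (q ^ (i * j)) = x.
  elim: j => [|j IH]; first by rewrite muln0 expn0 expr1.
  by rewrite mulnS expnD exprM E.
have x1 : x ^+ q = x.
  have := frobenius_gcd xk xi (prime_gt0 k_pr).
  have -> : gcdn k i = 1%N by apply/eqP; rewrite -/(coprime k i) prime_coprime // gtnNdvd.
  by rewrite expn1.
have xa a : x != res_iota hK v a.
  by apply: contra (na a) => /eqP E1; rewrite -(resP hK) ?vge_iota //; apply/eqP.
pose s := x :: [seq res_iota hK v a | a <- enum Fq].
have us : uniq s.
  rewrite /= map_inj_uniq ?enum_uniq ?andbT; last exact: fmorph_inj.
  by apply/negP => /mapP [a _ E1]; have := xa a; rewrite E1 eqxx.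
have P0 : 'X^q - 'X != 0 :> {poly resf hK v}.
  rewrite -size_poly_eq0 size_polyDl ?size_polyXn // size_polyN size_polyX ltnS card_gt1 //.
have rs : all (root ('X^q - 'X)) s.
  apply/allP => y; rewrite inE rootE hornerD hornerN hornerXn hornerX => /orP [/eqP ->|/mapP [a _ ->]].
    by rewrite x1 subrr.
  by rewrite -rmorphXn expf_card subrr.
have := max_poly_roots P0 rs us; rewrite /= size_map -cardE.
by rewrite size_polyDl ?size_polyXn ?ltnn // size_polyN size_polyX ltnS card_gt1.
Qed.

Lemma degree_one_rational v : place_deg v = 1%N -> rational_value v.
Proof.
move=> v1; rewrite /rational_value; case: (boolP (vge v 0 f)) => //= Of.
have [|||c [cc Wc]] := @has_dim_free_basis _ _ hF [set x | vge v 1 x] [set x | vge v 0 x] 1 (fun=> 1)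
  (subspace_vge v 1) (subspace_vge v 0) _ _ _ f Of.
- by rewrite -v1; apply: has_place_deg.
- by move=> _; apply: vge1.
- move=> c cc; rewrite big_ord1 mulr1 => Wc i; rewrite ord1; have [a _ aE] := cc ord0.
  by apply/eqP; apply: contraTT Wc; rewrite -aE => a0 /=; rewrite vgeE // place_iota.
by have [a _ aE] := cc ord0; apply/existsP; exists a; move: Wc; rewrite big_ord1 mulr1 aE.
Qed.

Definition fiber_places : seq place :=
  [seq v <- plist hK k | (place_deg v == k) && ~~ rational_value v].

(** A place of degree dividing the prime k has degree k or 1, and in degree 1 its value is rational.
    The places over each of the q + 1 rational values weigh at most the degree of f together. *)
Lemma fiber_count : (Npt k <= k * size fiber_places + fdeg f * (q + 1))%N.
Proof.
pose R := [seq v <- plist hK k | rational_value v].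
have k0 := prime_gt0 k_pr.
have H1 : (Npt k <= k * size fiber_places + \sum_(v <- R) place_deg v)%N.
  rewrite /Submission.Npt /fiber_places /R big_filter big_mkcond [X in (_ <= _ + X)%N]big_mkcond /=.
  elim: (plist hK k) => [|v s IH]; first by rewrite !big_nil muln0.
  rewrite !big_cons /=; have [dk|_] := boolP (place_deg v %| k)%N; last first.
    apply: (leq_trans IH); case: ifP => _ /=; rewrite ?mulnS; move: (k * size _)%N (\sum_(_ <- s) _)%N; clear; lia.
  have [rv|nv] := boolP (rational_value v); first by rewrite andbF /=; move: IH; move: (k * size _)%N (\sum_(_ <- s) _)%N (\sum_(_ <- s) _)%N; clear; lia.
  have -> : place_deg v = k.
    have /primeP [_ H] := k_pr; have /orP [/eqP v1|/eqP //] := H _ dk.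
    by rewrite degree_one_rational in nv.
  by rewrite eqxx /= mulnS; move: IH; move: (k * size _)%N (\sum_(_ <- s) _)%N (\sum_(_ <- s) _)%N; clear; lia.
apply: leq_trans H1 _; rewrite leq_add2l -lez_nat.
have [P [P0 dP HP]] := pole_divisor tf.
have /boolp.choice [Z HZ] : forall a, exists Z : divisor, (forall v, coeff v Z = Num.max 0 (v (f - iota a))) /\ div_deg Z = (fdeg f)%:Z.
  move=> a; have [ta da] := fdeg_shift a tf; have [Z HZ dZ] := zdiv_deg hK ta.
  by exists Z; rewrite dZ da.
pose E : divisor := P + \sum_a Z a.
have dE : div_deg E = (fdeg f * (q + 1))%N%:Z.
  rewrite div_degD dP (big_morph (fun D : divisor => div_deg D) (@div_degD _ _ _) (div_deg0 iota)) (eq_bigr _ (fun a _ => (HZ a).2)).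
  by rewrite sumr_const -mulr_natr natz -PoszM -PoszD mulnDr muln1 addnC.
have uR : uniq R by rewrite filter_uniq // plist_uniq.
rewrite -dE (big_morph Posz PoszD (erefl _)).
rewrite (eq_bigr (fun v => 1 * (place_deg v)%:Z)); last by move=> v _; rewrite mul1r.
rewrite -(div_deg_divf (fun=> 1) uR); apply: dle_deg => v; rewrite coeff_divf //.
have Zge a : 0 <= coeff v (Z a) by rewrite (HZ a).1 le_max lexx.
rewrite coeffD raddf_sum /=; case: ifP => [|_]; last first.
  by rewrite addr_ge0 ?(eff_ge0 v P0) // sumr_ge0.
rewrite mem_filter => /andP [/orP [nO|/existsP [a va]] _].
  apply: ler_wpDr; first by rewrite sumr_ge0.
  by rewrite HP le_max; move: nO; rewrite vgeE ?(transc_neq0 tf) // -ltNge; clear; lia.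
apply: ler_wpDl; first exact: (eff_ge0 v P0).
rewrite (bigD1 a) //=; apply: ler_wpDr; first by rewrite sumr_ge0.
by rewrite (HZ a).1 le_max -vgeE ?va ?orbT // (transc_neq0 (fdeg_shift a tf).1).
Qed.
End Fiber.
End PrimeDegree.

(** * Separability, ramification and generators of K *)

Section Unramified.
Variables (Fq : finFieldType) (K : fieldType) (iota : {rmorphism Fq -> K}).
Hypothesis hK : function_field iota.
Notation cst := (constants iota).
Notation place := (place iota).
Notation divisor := (divisor iota).
Notation ev := (ev iota).
Notation transc := (transc iota).
Notation fdeg := (fdeg iota).
Notation "'F(' f )" := (rational_in iota f) (at level 0, format "'F(' f )").
Notation L D := (riemann_roch_space D).
Notation g := (genus iota).
Implicit Types (v w : place) (S : seq place) (D E : divisor) (f h : K).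

Let hF := subfield_constants iota.
Notation q := #|Fq|.
Notation Npt := (Npt hK).

(** A relation makes the Frobenius twist of G vanish at f. The twisted gcd of G and X^p - f divides
    (X - f)^p, hence is (X - f)^m with 0 < m < p, and its coefficient - m f shows that f is a p-th
    power. *)
Lemma p_independent p f : prime p -> p \in [pchar Fq] -> (forall h, f != h ^+ p) ->
  forall h : 'I_p -> K, \sum_(j < p) f ^+ j * h j ^+ p = 0 -> forall j, h j = 0.
Proof.
move=> p_pr pF nf h Hh; have p0 := prime_gt0 p_pr.
have pK : p \in [pchar K] by apply: (pcharK iota pF).
pose phi : {rmorphism K -> K} := pFrobenius_aut pK.
have phiE x : phi x = x ^+ p by [].
pose G : {poly K} := \poly_(j < p) oapp h 0 (insub j).
suff G0 : G = 0.
  by move=> j; have := congr1 (fun P : {poly K} => P`_j) G0; rewrite coef_poly ltn_ord valK coef0.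
apply/eqP; apply: contraT => G0.
have Gf : (map_poly phi G).[f] = 0.
  rewrite -[RHS]Hh (horner_coef_wide _ (_ : (size (map_poly phi G) <= p)%N)).
    by apply: eq_bigr => j _; rewrite coef_map coef_poly ltn_ord valK /= pFrobenius_autE mulrC.
  by apply: leq_trans (size_poly _ _) _; apply: size_poly.
pose A : {poly K} := 'X^p - f%:P.
have mA : map_poly phi A = ('X - f%:P) ^+ p.
  rewrite rmorphB /= map_polyXn map_polyC /= pFrobenius_autE.
  have pX : p \in [pchar {poly K}] by rewrite pchar_poly.
  by rewrite -[RHS](pFrobenius_autE pX) rmorphB /= !pFrobenius_autE polyC_exp.
pose H := gcdp G A; have [[u v] /= E] := Bezoutp G A.
have Hf : root (map_poly phi H) f.
  have E2 : map_poly phi (u * G + v * A) %= map_poly phi H by rewrite eqp_map.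
  rewrite -(eqp_root E2) rmorphD !rmorphM /= rootE hornerD !hornerM Gf mA.
  by rewrite horner_exp hornerXsubC subrr expr0n (gtn_eqF p0) !mulr0 addr0.
have H0 : H != 0 by rewrite gcdp_eq0 negb_and G0.
have sH : (size H <= p)%N by apply: leq_trans (leq_gcdpl _ G0) _; apply: size_poly.
have : map_poly phi H %| ('X - f%:P) ^+ p by rewrite -mA dvdp_map dvdp_gcdr.
case/dvdp_exp_XsubCP => m [_ Em].
have sm : size H = m.+1.
  by have := eqp_size Em; rewrite size_map_poly size_exp_XsubC.
have m0 : (0 < m)%N.
  rewrite lt0n; apply: contraL Hf => /eqP m0; rewrite (eqp_root Em) m0 expr0.
  by rewrite root1.
pose H1 := (lead_coef H)^-1 *: H.
have lH : lead_coef H != 0 by rewrite lead_coef_eq0.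
have mH1 : H1 \is monic by rewrite monicE lead_coefZ mulVf.
have EH : map_poly phi H1 = ('X - f%:P) ^+ m.
  apply/eqP; rewrite -eqp_monic ?monic_map ?monic_exp ?monicXsubC //.
  apply: eqp_trans Em; rewrite eqp_map; apply: eqp_scale; by rewrite invr_eq0.
have := congr1 (fun P : {poly K} => P`_m.-1) EH; rewrite coef_map /=.
have -> : ('X - f%:P) ^+ m = \prod_(z <- nseq m f) ('X - z%:P) :> {poly K}.
  by rewrite big_nseq -Monoid.iteropE.
have := @coefPn_prod_XsubC _ (nseq m f); rewrite size_nseq -lt0n m0 => /(_ isT) ->.
rewrite big_nseq iter_addr_0 pFrobenius_autE => E3.
have mK : m%:R != 0 :> K.
  rewrite -(dvdn_pcharf pK) gtnNdvd //; by rewrite -sm.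
have := nf (- H1`_m.-1 / m%:R); have -> : (- H1`_m.-1 / m%:R) ^+ p = f; last by rewrite eqxx.
rewrite -(pFrobenius_autE pK) rmorphM fmorphV rmorphN rmorph_nat /= pFrobenius_autE E3 opprK.
by rewrite -[f *+ m]mulr_natr mulfK.
Qed.

(** A p-th root of f would have a degree p times smaller. *)
Lemma power_not_minimal f p : transc f -> fdeg f = gonality iota -> (1 < p)%N -> forall h, f != h ^+ p.
Proof.
move=> tf df p1 h; apply/eqP => E; have f0 := transc_neq0 tf.
have h0 : h != 0 by apply: contraNneq f0; rewrite E => ->; rewrite expr0n (gtn_eqF (ltnW p1)).
have th : transc h.
  apply: (nonconstant_transc hK) => -[a _ aE]; apply: (transc_nonconstant tf).
  by rewrite E -aE -rmorphXn; apply: constant_iota.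
have [P [_ dP HP]] := pole_divisor hK tf; have [P' [_ dP' HP']] := pole_divisor hK th.
have EP : P = P' *+ p.
  apply: divisor_eq => v; rewrite coeffMn HP HP' E placeX // -mulr_natr natz.
  by case: (lerP 0 (- v h)) => H; move: H p1; clear; nia.
have := dP; rewrite EP div_deg_muln dP' -mulr_natr natz -PoszM df => /eqP; rewrite eqz_nat => /eqP E2.
have := gonality_le hK th; rewrite -E2; have := fdeg_gt0 hK th; move: p1; clear; nia.
Qed.

Section Local.
Variables (f : K) (k : nat) (v : place).
Hypotheses (tf : transc f) (vk : place_deg v = k) (Of : vge v 0 f)
  (Hf : forall C : {poly Fq}, (size C <= k)%N -> vge v 1 (ev f C) -> C = 0).

Lemma residue_lift x : vge v 0 x -> exists c : {poly Fq}, vge v 1 (x - ev f c).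
Proof.
move=> Ox; have [|||c [cc Wc]] := @has_dim_free_basis _ _ hF [set x | vge v 1 x] [set x | vge v 0 x] k
  (fun i : 'I_k => f ^+ i) (subspace_vge v 1) (subspace_vge v 0) _ _ _ x Ox.
- by rewrite -vk; apply: has_place_deg.
- by move=> i; apply: vge0X.
- move=> c cc Wc; have /boolp.choice [a Ha] : forall i, exists a, iota a = c i by move=> i; have [a _] := cc i; exists a.
  pose C : {poly Fq} := \poly_(i < k) oapp a 0 (insub i).
  have C0 : C = 0.
    apply: Hf; first exact: size_poly.
    congr (vge v 1 _): Wc; rewrite (evE _ _ (size_poly _ _)); apply: eq_bigr => i _.
    by rewrite coef_poly ltn_ord valK /= Ha.
  move=> i; have := congr1 (fun p : {poly Fq} => p`_i) C0.
  by rewrite coef_poly ltn_ord valK coef0 /= => ai; rewrite -Ha ai rmorph0.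
have /boolp.choice [a Ha] : forall i, exists a, iota a = c i by move=> i; have [a _] := cc i; exists a.
exists (\poly_(i < k) oapp a 0 (insub i)).
congr (vge v 1 (x - _)): Wc; rewrite (evE _ _ (size_poly _ _)); apply: eq_bigr => i _.
by rewrite coef_poly ltn_ord valK /= Ha.
Qed.

(** Here pi is the minimal polynomial of the residue of f and e is the ramification index; repeated
    division by pi shows that values of polynomials in f are multiples of e. *)
Lemma ramification : exists (pi : {poly Fq}) (e : nat), [/\ size pi = k.+1, v (ev f pi) = e%:Z, (0 < e)%N &
  forall P : {poly Fq}, P != 0 -> exists a : nat, v (ev f P) = (e * a)%N%:Z].
Proof.
have [pi pi0 [spi vpi]] := residue_relation hK Of; rewrite vk in spi.
have epi0 : ev f pi != 0 by apply: ev_neq0.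
rewrite vgeE // in vpi; exists pi, `|v (ev f pi)|%N.
have vE : v (ev f pi) = `|v (ev f pi)|%N%:Z by move: vpi; clear; lia.
have e0 : (0 < `|v (ev f pi)|)%N by move: vpi; clear; lia.
have spiE : size pi = k.+1.
  apply/eqP; rewrite eqn_leq spi ltnNge; apply: contra pi0 => sk; apply/eqP/(Hf sk).
  by rewrite vgeE.
split=> // P; have [n] := ubnP (size P); elim: n P => // n IH P sP P0.
have PE := divp_eq P pi; have eP0 : ev f P != 0 by apply: ev_neq0.
have [r0|r0] := eqVneq (P %% pi) 0.
  have Q0 : P %/ pi != 0 by apply: contra_neq P0 => Q0; rewrite PE Q0 r0 mul0r addr0.
  have [|a Ha] := IH (P %/ pi) _ Q0.
    rewrite size_divp // spiE /= -ltnS; apply: leq_trans sP; rewrite ltnS ltn_subrL size_poly_gt0 P0 andbT.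
    by rewrite -vk place_deg_gt0.
  exists a.+1; rewrite {1}PE r0 addr0 evM val_atM ?ev_neq0 // Ha vE mulnS PoszD addrC.
  by rewrite -vE.
exists 0%N; rewrite muln0.
have nr : ~~ vge v 1 (ev f (P %% pi)).
  apply: contra r0 => H; apply/eqP; apply: Hf H; rewrite -ltnS -spiE ltn_modp //.
have nP : ~~ vge v 1 (ev f P).
  apply: contra nr => HP; have -> : ev f (P %% pi) = ev f P - ev f (P %/ pi) * ev f pi.
    by rewrite {2}PE evD evM addrAC subrr add0r.
  by apply: vgeB => //; apply: vge0M; [apply: vge_ev|rewrite vgeE].
have := vge_ev P Of; move: nP; rewrite !vgeE //; move: (v (ev f P)) => z; clear; lia.
Qed.

Variables (pi : {poly Fq}) (e c : nat) (y : K).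
Hypotheses (vpi : v (ev f pi) = e%:Z) (ty : transc y) (vy : v y = - (e * c).+1%:Z)
  (dy : fdeg y = ((e * c).+1 * k)%N) (e0 : (0 < e)%N).
Notation n := (e * c).+1.

(* As v (y pi(f)^c) = -1, the elements f^i (y pi(f)^c)^-j, i < k, j < n, form a basis of K over F(y). *)
Lemma fraction_generators (Rg : K -> Prop) : (forall a, Rg (iota a)) -> Rg f -> Rg y ->
  (forall x x', Rg x -> Rg x' -> Rg (x + x')) -> (forall x x', Rg x -> Rg x' -> Rg (x * x')) ->
  forall x, exists A B, [/\ Rg A, Rg B, B != 0 & x * B = A].
Proof.
move=> Rc Rf Ry RD RM.
have RX x i : Rg x -> Rg (x ^+ i).
  by move=> Rx; elim: i => [|i IH]; rewrite ?expr0 ?exprS; [rewrite -(rmorph1 iota)|apply: RM].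
have Rsum (I : Type) (r : seq I) (G : I -> K) : (forall i, Rg (G i)) -> Rg (\sum_(i <- r) G i).
  by move=> RG; apply: big_ind => //; rewrite -(rmorph0 iota).
have Rev z P : Rg z -> Rg (ev z P).
  by move=> Rz; rewrite (evE _ _ (leqnn _)); apply: Rsum => i; apply: RM => //; apply: RX.
have k0 : (0 < k)%N by rewrite -vk place_deg_gt0.
have epi0 : ev f pi != 0.
  by apply/eqP => E; move: vpi; rewrite E val_at0 => /eqP; rewrite eqz_nat eq_sym (gtn_eqF e0).
have y0 := transc_neq0 ty.
pose t := y * ev f pi ^+ c; have t0 : t != 0 by rewrite mulf_neq0 ?expf_neq0.
have vt : v t = -1 by rewrite val_atM ?expf_neq0 // placeX // vpi vy -PoszM; move: (e * c)%N; clear; lia.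
pose u := t^-1; have u0 : u != 0 by rewrite invr_eq0.
have vu : v u = 1 by rewrite placeV // vt opprK.
have Ou : vge v 0 u by rewrite vgeE // vu.
pose b (i : nat) := f ^+ (i %% k) * u ^+ (i %/ k).
have fb : free_mod F(y) [set 0] (fun i : 'I_(n * k) => b i).
  rewrite -rationalV; apply: (free_lift (transcV hK ty) (subspace_vge v 0)) => /= [z Oz|i|a ca [z Oz Ez]].
  - by apply: vge0M => //; rewrite vgeE ?invr_eq0 // placeV // vy opprK.
  - by apply: vge0M; apply: vge0X.
  have /boolp.choice [a0 Ha0] : forall i, exists a0, iota a0 = a i by move=> i; have [a0 _] := ca i; exists a0.
  pose a1 (i : nat) : Fq := oapp a0 0 (insub i).
  pose C (j : nat) : {poly Fq} := \poly_(i < k) a1 (j * k + i)%N.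
  have EC : \sum_i a i * b i = \sum_(j < n) ev f (C j) * u ^+ j.
    rewrite (eq_bigr (fun i : 'I_(n * k) => iota (a1 i) * b i)); last first.
      by move=> i _; rewrite /a1 valK /= Ha0.
    rewrite -(big_mkord xpredT (fun i => iota (a1 i) * b i)) big_nat_mul big_mkord.
    apply: eq_bigr => j _; rewrite -{1}[(j * k)%N]add0n big_addn mulSn addnK big_mkord.
    rewrite (evE _ _ (size_poly _ _)) mulr_suml; apply: eq_bigr => i _.
    rewrite coef_poly ltn_ord /b [(i + j * k)%N]addnC modnMDl modn_small // divnMDl // divn_small // addn0.
    by rewrite mulrA.
  pose fam (o : option 'I_n) := if o is Some j then ev f (C j) * u ^+ j else - (y^-1 * z).
  have vC j : C j != 0 -> v (ev f (C j)) = 0.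
    move=> Cj; have eC0 : ev f (C j) != 0 by apply: ev_neq0.
    have := vge_ev (C j) Of; have : ~~ vge v 1 (ev f (C j)).
      by apply: contra Cj => H; apply/eqP; apply: Hf H; apply: size_poly.
    by rewrite !vgeE //; move: (v (ev f (C j))) => w; clear; lia.
  have vfam (j : 'I_n) : fam (Some j) != 0 -> v (fam (Some j)) = j%:Z.
    rewrite /= mulf_eq0 negb_or => /andP [eC _]; rewrite val_atM ?expf_neq0 // placeX // vu mul1r vC ?add0r //.
    by apply: contraNneq eC => ->; rewrite ev0.
  have vN : fam None != 0 -> n%:Z <= v (fam None).
    rewrite /= oppr_eq0 mulf_eq0 negb_or => /andP [_ z0]; rewrite placeN val_atM ?invr_eq0 // placeV // vy opprK.
    by rewrite lerDl -vgeE.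
  have sfam : \sum_o fam o = 0.
    rewrite (bigD1 None) //= (reindex_omap Some id) /=; last by case.
    rewrite (eq_bigl xpredT) => [|j]; last by rewrite eqxx.
    by rewrite -EC Ez addNr.
  have distinct : forall o o', o != o' -> fam o != 0 -> fam o' != 0 -> v (fam o) != v (fam o').
    move=> [j|] [j'|] // jj nj nj'.
    - by rewrite !vfam // eqz_nat.
    - by rewrite vfam //; have := vN nj'; have := ltn_ord j; move: (v (fam None)) => w; rewrite -ltz_nat; clear; lia.
    - by rewrite [v (fam (Some j'))]vfam //; have := vN nj; have := ltn_ord j'; move: (v (fam None)) => w; rewrite -ltz_nat; clear; lia.
  have F0 := distinct_valuations distinct sfam.
  move=> i; have ik : (i %/ k < n)%N by rewrite ltn_divLR.
  have := F0 (Some (Ordinal ik)); rewrite /= => /eqP; rewrite mulf_eq0 expf_eq0 (negPf u0) andbF orbF => /eqP eC.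
  have := congr1 (fun P : {poly Fq} => P`_(i %% k)) (tf eC).
  by rewrite coef_poly ltn_pmod // -divn_eq coef0 /a1 valK /= => ai; rewrite -Ha0 ai rmorph0.
move=> x; have [] := @has_dim_free_basis _ _ (subfield_rational iota y) [set 0] setT (n * k)
  (fun i : 'I_(n * k) => b i) (subspace0 _) (subspaceT _) _ _ fb x => //; first by rewrite -dy; apply: has_fdeg.
move=> a [ca /eqP]; rewrite subr_eq0 => /eqP Ex.
have [D [P [D0 HP]]] := common_denominator ca.
exists (\sum_(i < n * k) ev y (P i) * (f ^+ (i %% k) * t ^+ (n - i %/ k))), (ev y D * t ^+ n).
have Rt : Rg t by apply: RM => //; apply: RX; apply: Rev.
split.
- by apply: Rsum => i; apply: (RM); [exact: Rev|apply: (RM); apply: (RX)].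
- by apply: (RM); [exact: Rev|apply: (RX)].
- by rewrite mulf_neq0 ?expf_neq0.
rewrite Ex mulr_suml; apply: eq_bigr => i _; rewrite -HP /b.
have ik : (i %/ k <= n)%N by rewrite ltnW // ltn_divLR.
have -> : t ^+ n = t ^+ (i %/ k) * t ^+ (n - i %/ k) by rewrite -exprD subnKC.
have tu : u ^+ (i %/ k) * t ^+ (i %/ k) = 1 by rewrite -exprMn mulVf // expr1n.
rewrite -[RHS]mulr1 -tu; ring.
Qed.
End Local.
End Unramified.

(** * A point where the minimal map is unramified *)

Section GoodPoint.
Variables (Fq : finFieldType) (K : fieldType) (iota : {rmorphism Fq -> K}).
Hypothesis hK : function_field iota.
Notation cst := (constants iota).
Notation place := (place iota).
Notation divisor := (divisor iota).
Notation ev := (ev iota).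
Notation transc := (transc iota).
Notation fdeg := (fdeg iota).
Notation "'F(' f )" := (rational_in iota f) (at level 0, format "'F(' f )").
Notation L D := (riemann_roch_space D).
Notation g := (genus iota).
Implicit Types (v w : place) (S : seq place) (D E : divisor) (f h : K).

Let hF := subfield_constants iota.
Notation q := #|Fq|.
Notation Npt := (Npt hK).

(** The bound I on the sizes of the coefficients controls the poles of the relation and of its
    derivative with respect to y. *)
Definition relation_of f y I J (m : 'I_J -> {poly Fq}) :=
  (forall j, (size (m j) <= I)%N) /\ \sum_j ev f (m j) * y ^+ j = 0.

(** With d and D0 the two degrees, 4 d D0 monomials f^i y^j lie in a space of dimension at most 4 d
    D0 - d - D0 + 1. *)
Lemma relation_exists f y : transc f -> transc y -> (1 < fdeg f + fdeg y)%N ->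
  exists m : 'I_(2 * fdeg f) -> {poly Fq}, relation_of f y (2 * fdeg y) m /\ exists j, m j != 0.
Proof.
move=> tf ty d1; set d := fdeg f in d1 *; set D0 := fdeg y in d1 *.
have [Pf [Pf0 dPf HPf]] := pole_divisor hK tf; have [Py [Py0 dPy HPy]] := pole_divisor hK ty.
pose D : divisor := Pf *+ (2 * D0).-1 + Py *+ (2 * d).-1.
pose T := ('I_(2 * D0) * 'I_(2 * d))%type.
have d0 : (0 < d)%N := fdeg_gt0 hK tf; have D00 : (0 < D0)%N := fdeg_gt0 hK ty.
have LT (t : T) : L D (f ^+ t.1 * y ^+ t.2).
  apply: L_mul; apply: L_muln; rewrite ?(transc_neq0 tf) ?(transc_neq0 ty) //.
    by rewrite -ltnS prednK ?muln_gt0.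
  by rewrite -ltnS prednK ?muln_gt0.
have nf : ~ (forall e : T -> K, (forall i, cst (e i)) ->
    \sum_i e i * (f ^+ i.1 * y ^+ i.2) = 0 -> forall i, e i = 0).
  move=> /(free_le_ell hK LT); apply/negP; rewrite -ltnNge card_prod !card_ord.
  have Dge0 : dle 0 D.
    by move=> v; rewrite coeff0 coeffD !coeffMn addr_ge0 // mulrn_wge0 // eff_ge0.
  rewrite -ltz_nat; apply: le_lt_trans (ell_eff hK Dge0) _.
  rewrite div_degD !div_deg_muln dPf dPy -/d -/D0 -[d%:Z *+ _]mulr_natr -[D0%:Z *+ _]mulr_natr !natz.
  rewrite -!PoszM -!PoszD ltz_nat.
  by move: d1 d0 D00; clear; case: d D0 => [|d] [|D0] //=; nia.
have [e [ce [e0 [t et]]]] : exists e : T -> K, (forall i, cst (e i)) /\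
    (\sum_i e i * (f ^+ i.1 * y ^+ i.2) = 0 /\ exists i, e i != 0).
  apply: contrapT => H; apply: nf => e ce e0 i; apply/eqP; apply: contraT => ei.
  by case: H; exists e; split=> //; split=> //; exists i.
have /boolp.choice [a Ha] : forall i, exists a, iota a = e i by move=> i; have [a _] := ce i; exists a.
pose m (j : 'I_(2 * d)) : {poly Fq} := \poly_(i < 2 * D0) oapp (fun i => a (i, j)) 0 (insub i).
exists m; split; last first.
  exists t.2; apply/eqP => /(congr1 (fun P : {poly Fq} => P`_t.1)).
  rewrite coef_poly ltn_ord valK coef0 /= -surjective_pairing => at0; move/eqP: et; apply.
  by rewrite -Ha at0 rmorph0.
split=> [j|]; first exact: size_poly.
transitivity (\sum_(i < 2 * D0) \sum_(j < 2 * d) e (i, j) * (f ^+ i * y ^+ j)).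
  rewrite exchange_big; apply: eq_bigr => j _; rewrite (evE _ _ (size_poly _ _)) mulr_suml.
  by apply: eq_bigr => i _; rewrite coef_poly ltn_ord valK /= Ha mulrA.
by rewrite pair_bigA -[RHS]e0; apply: eq_bigr => -[i j].
Qed.

(* A relation of least degree in y is separable: otherwise its p-th root, taken coefficientwise
   along the powers of f, would be a smaller one. *)
Lemma separable_relation_exists p f y : prime p -> p \in [pchar Fq] -> transc f -> transc y ->
  (1 < fdeg f + fdeg y)%N -> (forall h, f != h ^+ p) ->
  exists J (m : 'I_J -> {poly Fq}), [/\ (J <= 2 * fdeg f)%N, relation_of f y (2 * fdeg y) m &
    \sum_j ev f (m j) * (y ^+ j.-1 *+ j) != 0].
Proof.
move=> p_pr pF tf ty d1 nf; set I := (2 * fdeg y)%N; have p1 := prime_gt1 p_pr.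
pose rel J := `[< exists m : 'I_J -> {poly Fq}, relation_of f y I m /\ exists j, m j != 0 >].
have exJ : exists J, rel J by exists (2 * fdeg f)%N; apply/asboolP; apply: relation_exists.
have [J /asboolP [m [[sm Em] [j0 mj0]]] minJ] := ex_minnP exJ.
have Jd : (J <= 2 * fdeg f)%N by apply: minJ; apply/asboolP; apply: relation_exists.
exists J, m; split=> //; apply/eqP => W0.
have min J' (m' : 'I_J' -> {poly Fq}) : (J' < J)%N -> relation_of f y I m' -> forall j, m' j = 0.
  move=> JJ Rm j; apply/eqP; apply: contraT => mj; move: JJ; rewrite ltnNge minJ //.
  by apply/asboolP; exists m'; split=> //; exists j.
case: J m sm Em j0 mj0 minJ Jd W0 min => [|J] m sm Em j0 mj0 minJ Jd W0 min; first by case: j0 mj0.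
have m_eq0 (i : 'I_J.+1) : ~~ (p %| i)%N -> m i = 0.
  move=> pi; have i0 : (0 < i)%N by rewrite lt0n; apply: contra pi => /eqP->; rewrite dvdn0.
  have iJ : (i.-1 < J)%N by rewrite -ltnS prednK // ltn_ord.
  have := min J (fun l => m (fintype.lift ord0 l) *+ l.+1) (ltnSn J) _ (Ordinal iJ).
  rewrite /= prednK // => H; have : m (fintype.lift ord0 (Ordinal iJ)) *+ i = 0.
    apply: H; split=> [l|].
      rewrite -[_ *+ _]mulr_natl -polyC_natr mul_polyC; apply: leq_trans (size_scale_leq _ _) (sm _).
    move: W0; rewrite big_ord_recl /= mulr0n mulr0 add0r => E; rewrite -[RHS]E.
    apply: eq_bigr => l _; rewrite -[m _ *+ _]mulr_natl -polyC_natr evM evC rmorph_nat.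
    by rewrite /bump /= add1n -[y ^+ _ *+ _]mulr_natl mulrCA mulrA.
  have -> : fintype.lift ord0 (Ordinal iJ) = i by apply: val_inj; rewrite /= /bump /= add1n prednK.
  move/eqP; rewrite -mulr_natl mulf_eq0 => /orP [|/eqP //].
  by rewrite -polyC_natr polyC_eq0 -(dvdn_pcharf pF) (negPf pi).
have J0 : (0 < J)%N.
  rewrite lt0n; apply: contra mj0 => /eqP JE; subst J; apply/eqP/tf.
  by have := Em; rewrite big_ord1 expr0 mulr1 [j0]ord1.
have /boolp.choice [B HB] := fun i : 'I_J.+1 => poly_p_split iota p_pr pF (m i).
pose B' (i : nat) (l : 'I_p) : {poly Fq} := oapp (fun i => B i l) 0 (insub i).
have HB' l : \sum_(i < J.+1) (if (p %| i)%N then ev f (B' i l) * y ^+ (i %/ p) else 0) = 0.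
  pose hh l := \sum_(i < J.+1) (if (p %| i)%N then ev f (B' i l) * y ^+ (i %/ p) else 0).
  rewrite -/(hh l); move: l; apply: (p_independent iota p_pr pF nf); rewrite /hh.
  rewrite -[RHS]Em.
  under eq_bigr => j _ do rewrite (expr_sum_p1 iota p_pr pF) mulr_sumr.
  rewrite exchange_big /=; apply: eq_bigr => i _; have [pi|pi] := boolP (p %| i)%N; last first.
    rewrite m_eq0 // ev0 mul0r big1 // => j _.
    by rewrite expr0n (gtn_eqF (ltnW p1)) mulr0.
  rewrite (HB i).2 mulr_suml; apply: eq_bigr => j _.
  by rewrite /B' valK /= exprMn -exprM divnK // mulrA.
have B0 (i : 'I_J.+1) l : (p %| i)%N -> B i l = 0.
  move=> pi; have iJ : (i %/ p < J)%N.
    case: (posnP i) => [->|i0]; first by rewrite div0n.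
    by apply: leq_trans (ltn_Pdiv p1 i0) _; rewrite -ltnS ltn_ord.
  have := min J (fun j => B' (j * p)%N l) (ltnSn J) _ (Ordinal iJ).
  rewrite /= divnK // /B' valK /=; apply; split=> [j|].
    by case: insubP => [i' _ _|_] /=; rewrite ?size_poly0 //; apply: leq_trans ((HB i').1 l) (sm i').
  pose h (i : nat) : K := if (p %| i)%N then ev f (B' i l) * y ^+ (i %/ p) else 0.
  rewrite -[RHS](HB' l) -/(h _); have JJ : (J.+1 <= J * p)%N by move: J0 p1; clear; nia.
  transitivity (\sum_(i < J * p) h i).
    rewrite sum_supported_multiples ?(ltnW p1) // => [|i' /negPf ip]; last by rewrite /h ip.
    by apply: eq_bigr => j _; rewrite /h dvdn_mull // mulnK // ltnW.
  rewrite -(big_mkord xpredT h) -[RHS](big_mkord xpredT h) (big_cat_nat (n := J.+1)) //=.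
  rewrite [X in _ + X]big_nat_cond [X in _ + X]big1 ?addr0 // => i' /andP [/andP [Ji _] _].
  by rewrite /h /B' insubN ?ev0 ?mul0r ?if_same // -leqNgt.
move/eqP: mj0; apply; have [pj|pj] := boolP (p %| j0)%N; last exact: m_eq0.
apply: (tf); rewrite (HB j0).2 big1 // => l _.
by rewrite B0 // ev0 expr0n (gtn_eqF (ltnW p1)) mulr0.
Qed.

(* Newton iteration: y is a limit of polynomials in f at every point where the
   derivative of the relation is a unit. *)
Lemma hensel_approximation f y J (m : 'I_J -> {poly Fq}) I (v : place) : vge v 0 f -> vge v 0 y ->
  relation_of f y I m -> (forall C : {poly Fq}, (size C <= place_deg v)%N -> vge v 1 (ev f C) -> C = 0) ->
  ~~ vge v 1 (\sum_j ev f (m j) * (y ^+ j.-1 *+ j)) ->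
  forall N : nat, exists c : {poly Fq}, vge v N%:Z (y - ev f c).
Proof.
move=> Of Oy [_ Em] Hf nW; set W := \sum_j _ in nW.
have OW : vge v 0 W.
  apply: vge_sum => j _; apply: vge0M; first exact: vge_ev.
  by rewrite -mulr_natl -(rmorph_nat iota); apply: vge0M; [apply: vge_iota|apply: vge0X].
have W0 : W != 0 by apply: contraNneq nW => ->; apply: vge0.
have vW : v W = 0.
  by move: OW nW; rewrite !vgeE //; move: (v W) => z; clear; lia.
pose H Y := \sum_j ev f (m j) * \sum_(l < j) Y ^+ (j.-1 - l) * y ^+ l.
pose Mc (c : {poly Fq}) : {poly Fq} := \sum_j m j * c ^+ j.
have MH c : ev f (Mc c) = (ev f c - y) * H (ev f c).
  rewrite /Mc ev_sum -[LHS]subr0 -[X in _ - X]Em -sumrB mulr_sumr; apply: eq_bigr => j _.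
  by rewrite evM evXn -mulrBr subrXX mulrCA.
have Hy : H y = W.
  apply: eq_bigr => j _; congr (_ * _); rewrite (eq_bigr (fun=> y ^+ j.-1)).
    by rewrite sumr_const card_ord.
  by move=> l _; rewrite -exprD subnK // -ltnS prednK // (leq_trans _ (ltn_ord l)).
have HH Y : vge v 0 Y -> vge v 1 (Y - y) -> vge v 1 (H Y - W).
  move=> OY Yy; rewrite -Hy /H -sumrB; apply: vge_sum => j _; rewrite -mulrBr.
  apply: vge0M; first exact: vge_ev.
  rewrite -sumrB; apply: vge_sum => l _; rewrite -mulrBl; apply: vgeM0; last exact: vge0X.
  exact: vge_expr_diff.
have [b Hb] : exists b : {poly Fq}, vge v 1 (W^-1 - ev f b).
  by apply: (residue_lift hK (k := place_deg v)) => //; rewrite vgeE ?invr_eq0 // placeV // vW.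
have Hb1 : vge v 1 (1 - ev f b * W).
  have -> : 1 - ev f b * W = (W^-1 - ev f b) * W by rewrite mulrBl mulVf.
  exact: vgeM0.
elim=> [|N [c Hc]]; first by exists 0; rewrite ev0 subr0.
case: N Hc => [|N] Hc; first by apply: (residue_lift hK (k := place_deg v)).
exists (c - b * Mc c); rewrite evB evM MH.
have Oc : vge v 0 (ev f c) by apply: vge_ev.
have c1 : vge v 1 (ev f c - y) by rewrite -vgeN opprB; apply: vgeW Hc.
have -> : y - (ev f c - ev f b * ((ev f c - y) * H (ev f c))) =
  (y - ev f c) * (1 - ev f b * W - ev f b * (H (ev f c) - W)) by ring.
rewrite -[N.+2]addn1 PoszD; apply: vgeM => //; apply: vgeB => //; apply: vge0M; first exact: vge_ev.
exact: HH.
Qed.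
End GoodPoint.

(** The pole order e c + 1 is 1 modulo e, which lets y pi(f)^c have value -1. The number c is just
    large enough for Riemann-Roch, and e k <= 2 k (d - 1) < 2g keeps the degree of y below 2g + 2g +
    g. *)
Lemma pole_order_bound (d e k g c : nat) : (1 < d)%N -> (0 < e)%N -> (0 < k)%N -> (e <= d)%N ->
  (k * (d - 1) < g)%N -> c = (2 * g %/ (e * k)).+1 ->
  (2 * g <= e * c * k)%N /\ ((e * c).+1 * k <= 5 * g)%N.
Proof.
move=> d1 e0 k0 ed kd cE; have ek : (0 < e * k)%N by rewrite muln_gt0 e0.
have := divn_eq (2 * g) (e * k); have := ltn_pmod (2 * g) ek.
have -> : (e * c * k = (2 * g %/ (e * k)) * (e * k) + e * k)%N by rewrite cE mulnAC mulnS addnC mulnC.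
have edk : (e * k <= d * k)%N by rewrite leq_mul2r ed orbT.
have dk : (d * k = k * (d - 1) + k)%N by rewrite -{1}(subnK (ltnW d1)) mulnDl mul1n mulnC.
have kk : (k <= k * (d - 1))%N by rewrite leq_pmulr // subn_gt0.
rewrite [((e * c).+1 * k)%N]mulSn; have -> : (e * c * k = (2 * g %/ (e * k)) * (e * k) + e * k)%N by rewrite cE mulnAC mulnS addnC mulnC.
move: edk dk kk kd; move: (2 * g %/ (e * k) * (e * k))%N (2 * g %% (e * k))%N (e * k)%N (d * k)%N (k * (d - 1))%N.
by clear; lia.
Qed.

Lemma fiber_arithmetic (R : realFieldType) (x N g d k q : R) : 1 <= g -> 7 * g + 1 <= x ->
  (x ^+ 2 + 1 - N) ^+ 2 <= (2 * g * x) ^+ 2 -> N <= 20 * d * g + k + d * (q + 1) ->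
  2 * d <= g + 1 -> k <= g -> q <= x -> 0 <= d -> 0 <= q -> False.
Proof.
move=> g1 xg H1 H2 dg kg qx d0 q0.
have N1 : x ^+ 2 + 1 - N <= 2 * g * x.
  have gx0 : 0 <= 2 * g * x by rewrite !mulr_ge0 //; lra.
  have [neg|pos] := lerP (x ^+ 2 + 1 - N) 0; first exact: le_trans neg gx0.
  by rewrite -(@ler_pXn2r _ 2) ?nnegrE // ltW.
have e1 : d * (q + 1) <= d * (x + 1) by rewrite ler_wpM2l // lerD2r.
have e2 : (2 * d) * (x + 1) <= (g + 1) * (x + 1) by rewrite ler_wpM2r //; lra.
have e3 : (2 * d) * g <= (g + 1) * g by rewrite ler_wpM2r //; lra.
have e4 : (x - (7 * g + 1)) * (x + 4 * g) >= 0 by rewrite mulr_ge0 //; lra.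
have e5 : (g - 1) * g >= 0 by rewrite mulr_ge0 //; lra.
have e6 : (x - (7 * g + 1)) * g >= 0 by rewrite mulr_ge0 //; lra.
lra.
Qed.

Section PointDifferences.
Variables (Fq : finFieldType) (K : fieldType) (iota : {rmorphism Fq -> K}).
Hypothesis hK : function_field iota.
Notation cst := (constants iota).
Notation place := (place iota).
Notation divisor := (divisor iota).
Notation ev := (ev iota).
Notation transc := (transc iota).
Notation fdeg := (fdeg iota).
Notation "'F(' f )" := (rational_in iota f) (at level 0, format "'F(' f )").
Notation L D := (riemann_roch_space D).
Notation g := (genus iota).
Implicit Types (v w : place) (S : seq place) (D E : divisor) (f h : K).

Let hF := subfield_constants iota.
Notation q := #|Fq|.
Notation Npt := (Npt hK).

Lemma exact_pole v n : (2 * g <= n * place_deg v)%N ->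
  exists y, [/\ y != 0, integral_off v y & v y = - n.+1%:Z].
Proof.
move=> gn; have [t t0 vt] := place_uniformizer v.
pose s := t^-1 ^+ n.+1; have s0 : s != 0 by rewrite expf_neq0 ?invr_eq0.
have vs : v s = - n.+1%:Z by rewrite placeX ?invr_eq0 // placeV // vt mulN1r.
have [||y Ly vy] := @local_surjective _ _ _ hK v (<< n.+1%:Z *g v >>) s.
- by rewrite div_degU -PoszM mulSn; move: gn; move: (n * place_deg v)%N; clear; lia.
- by rewrite coeffU eqxx mulr1 vgeE // vs.
rewrite coeffU eqxx mulr1 in vy.
have := @place_addl _ _ _ v s (y - s) s0; rewrite subrKC vs => -[|y0 vyE].
  by rewrite -vgeN opprB.
by exists y; split=> //; have /L_point [] := Ly.
Qed.

Lemma L_ev f (P : divisor) (C : {poly Fq}) n : transc f -> (forall v, coeff v P = Num.max 0 (- v f)) ->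
  (size C <= n.+1)%N -> L (P *+ n) (ev f C).
Proof.
move=> tf HP sC; rewrite (evE _ _ sC); apply: (ss_sum (subspace_L _)) => i _.
apply: (ssZ (subspace_L _)); first exact: constant_iota.
by apply: L_muln; rewrite ?(transc_neq0 tf) // -ltnS.
Qed.

Lemma fiber_placesP f k v : v \in fiber_places hK f k ->
  [/\ place_deg v = k, vge v 0 f & ~~ rational_value f v].
Proof.
rewrite mem_filter => /andP [/andP [/eqP vk nr] _]; split=> //.
by move: nr; rewrite negb_or negbK => /andP [].
Qed.

(** Let y have its only pole at a point v1 of the fiber. The derivative W of a separable equation of
    y over F(f) is a unit at some other point v0 of the fiber, by the count of zeros. At v0 all
    elements of the ring generated by f and y are limits of polynomials in f, so their values are
    multiples of the ramification index there. By [fraction_generators] K is the field of fractions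
    of this ring, whence the index is 1. *)
Lemma good_point f k : transc f -> fdeg f = gonality iota -> (1 < fdeg f)%N -> prime k ->
  (k * (fdeg f - 1) < g)%N -> (20 * fdeg f * g + k < k * size (fiber_places hK f k))%N ->
  exists2 v, v \in fiber_places hK f k &
    forall n (C : {poly Fq}), (size C <= n * k)%N -> vge v n%:Z (ev f C) -> C = 0.
Proof.
move=> tf df d1 k_pr kd cnt; set S := fiber_places hK f k in cnt *; have k0 := prime_gt0 k_pr.
have [v1 v1S] : exists v, v \in S.
  by case: S cnt => [|v S] H; [rewrite muln0 in H|exists v; rewrite mem_head].
have [v1k Of1 nr1] := fiber_placesP v1S.
have Hf1 := generic_value_free hK k_pr v1k nr1.
have [pi [e [spi vpi e0 _]]] := ramification hK tf v1k Of1 Hf1.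
have [Pf [Pf0 dPf HPf]] := pole_divisor hK tf.
have epi0 : ev f pi != 0 by apply: ev_neq0; rewrite // -size_poly_gt0 spi.
have ed : (e <= fdeg f)%N.
  have := @zeros_weight _ _ _ hK (ev f pi) (Pf *+ k) [:: v1] (fun=> e%:Z) epi0.
  rewrite big_seq1 v1k div_deg_muln dPf -[(fdeg f)%:Z *+ k]mulr_natr natz -!PoszM lez_nat leq_pmul2r //; apply=> //.
  - by apply: L_ev => //; rewrite spi.
  - by move=> v; rewrite coeff0 coeffMn mulrn_wge0 // eff_ge0.
  - by move=> v; rewrite inE => /eqP ->; rewrite vpi.
pose c := (2 * g %/ (e * k)).+1.
have [nc nk] := pole_order_bound d1 e0 k0 ed kd (erefl c).
have [y [y0 Iy vy]] : exists y, [/\ y != 0, integral_off v1 y & v1 y = - (e * c).+1%:Z].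
  by apply: exact_pole; rewrite v1k.
have ty : transc y by apply: (@uniformizer_transc _ _ _ hK v1); rewrite vy.
have dy : fdeg y = ((e * c).+1 * k)%N.
  have vyV : v1 y^-1 = (e * c).+1%:Z by rewrite placeV // vy opprK.
  have uy (u : place) : u != v1 -> u y^-1 <= 0.
    by move=> uv; rewrite placeV // oppr_le0; have := Iy u uv; rewrite vgeE.
  by have [_] := fdeg_zeros hK vyV (ltn0Sn _) uy; rewrite fdegV v1k.
have [p [_ [p_pr pF _ _]]] := card_finField_pow Fq.
have [Py [Py0 dPy HPy]] := pole_divisor hK ty.
have [|J [m [Jd Rm W0]]] := separable_relation_exists hK p_pr pF tf ty _ (power_not_minimal hK tf df (prime_gt1 p_pr)).
  by apply: leq_trans d1 (leq_addr _ _).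
set W := \sum_j _ in W0.
pose D : divisor := Pf *+ (2 * fdeg y) + Py *+ J.
have LW : L D W.
  apply: (ss_sum (subspace_L _)) => j _; apply: L_mul.
    by apply: L_ev => //; apply: leq_trans (Rm.1 j) _.
  rewrite -mulr_natl -(rmorph_nat iota); apply: (ssZ (subspace_L _)); first exact: constant_iota.
  by apply: L_muln => //; apply: leq_trans (leq_pred _) (ltnW (ltn_ord j)).
have D0 : dle 0 D by move=> v; rewrite coeff0 coeffD !coeffMn addr_ge0 // mulrn_wge0 // eff_ge0.
(* The degree of y is at most 5g and J <= 2 d, so each of the two parts of D has degree at most 10 d
   g. *)
have dD : div_deg D <= (20 * fdeg f * g)%N%:Z.
  rewrite div_degD !div_deg_muln dPf dPy -[(fdeg f)%:Z *+ _]mulr_natr -[(fdeg y)%:Z *+ _]mulr_natr !natz.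
  rewrite -!PoszM -PoszD lez_nat -dy in nk *.
  have a1 : (fdeg f * (2 * fdeg y) <= fdeg f * (2 * (5 * g)))%N by rewrite !leq_mul2l nk !orbT.
  have a2 : (fdeg y * J <= 5 * g * (2 * fdeg f))%N by apply: leq_mul.
  apply: leq_trans (leq_add a1 a2) _; clear; nia.
pose T := [seq v <- S | (v != v1) && (0 < v W)].
have uS : uniq S by rewrite filter_uniq // plist_uniq.
have kT : (k * size T <= 20 * fdeg f * g)%N.
  rewrite -lez_nat; apply: le_trans dD; have uT : uniq T by rewrite filter_uniq.
  have := @zeros_weight _ _ _ hK W D T (fun=> 1) W0 LW D0 uT.
  rewrite (eq_big_seq (fun=> k%:Z)) => [|v].
    rewrite big_const_seq count_predT iter_addr addr0 -mulr_natr natz PoszM; apply=> v.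
    by rewrite mem_filter => /andP [/andP [_ H] _]; rewrite -gtz0_ge1.
  by rewrite mem_filter => /andP [_ /fiber_placesP [-> _ _]]; rewrite mul1r.
have [v0 v0S [v01 v0W]] : exists2 v, v \in S & v != v1 /\ v W <= 0.
  apply: contrapT => H; have : (size S <= (size T).+1)%N.
    have -> : (size T).+1 = size (v1 :: T) by [].
    apply: uniq_leq_size => // v vS; rewrite inE mem_filter vS andbT.
    have [//|vv1] := eqVneq v v1; rewrite /= ltNge; apply/negP => vW.
    by apply: H; exists v.
  move=> sS; have := leq_mul (leqnn k) sS; rewrite mulnS.
  by move: cnt kT; move: (k * size S)%N (k * size T)%N (20 * _ * _)%N; clear; lia.
have [v0k Of0 nr0] := fiber_placesP v0S.
have Hf0 := generic_value_free hK k_pr v0k nr0.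
have Oy0 : vge v0 0 y by apply: Iy.
have nW : ~~ vge v0 1 W by rewrite vgeE // -ltNge; apply: le_lt_trans v0W _.
have Hf0' : forall C : {poly Fq}, (size C <= place_deg v0)%N -> vge v0 1 (ev f C) -> C = 0 by rewrite v0k.
have app := hensel_approximation hK Of0 Oy0 Rm Hf0' nW.
have [pi0 [e1 [spi0 vpi0 e10 Hm]]] := ramification hK tf v0k Of0 Hf0.
(* The elements of K in the closure of F[f] at v0. *)
pose Rg x := forall N : nat, exists C : {poly Fq}, vge v0 N%:Z (x - ev f C).
have ROx x : Rg x -> vge v0 0 x.
  by move=> Rx; have [C HC] := Rx 0%N; rewrite -(subrK (ev f C) x); apply: vgeD => //; apply: vge_ev.
have [t t0 vt] := place_uniformizer v0.
have [A [B [RA RB B0 tB]]] : exists A B, [/\ Rg A, Rg B, B != 0 & t * B = A].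
  apply: (fraction_generators hK tf v1k Of1 Hf1 vpi ty vy dy e0).
  - by move=> a N; exists a%:P; rewrite evC subrr vge0.
  - by move=> N; exists 'X; rewrite evX subrr vge0.
  - exact: app.
  - move=> x x' Rx Rx' N; have [C HC] := Rx N; have [C' HC'] := Rx' N; exists (C + C').
    by rewrite evD opprD addrACA; apply: vgeD.
  move=> x x' Rx Rx' N; have [C HC] := Rx N; have [C' HC'] := Rx' N; exists (C * C').
  have -> : x * x' - ev f (C * C') = x * (x' - ev f C') + (x - ev f C) * ev f C' by rewrite evM; ring.
  by apply: vgeD; [apply: vge0M => //; apply: ROx|apply: vgeM0 => //; apply: vge_ev].
have mult x : Rg x -> x != 0 -> exists a : nat, v0 x = (e1 * a)%N%:Z.
  move=> Rx x0; have [C HC] := Rx `|(v0 x + 1)%R|%N.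
  have [|eC vC] := @place_addl _ _ _ v0 x (ev f C - x) x0.
    rewrite -vgeN opprB; apply: vgeW HC; move: (v0 x) => z; clear; lia.
  rewrite subrKC in eC vC; rewrite -vC; apply: Hm; apply: contra_neq eC => ->; exact: ev0.
have A0 : A != 0 by rewrite -tB mulf_neq0.
have [a aE] := mult A RA A0; have [b bE] := mult B RB B0.
have e1E : e1 = 1%N.
  have : (1 + (e1 * b)%N%:Z = (e1 * a)%N%:Z) by rewrite -aE -tB val_atM // vt bE.
  rewrite -PoszD => /eqP; rewrite eqz_nat => /eqP E.
  have : (e1 %| 1)%N by rewrite -(dvdn_addl _ (dvdn_mulr b (dvdnn e1))) E dvdn_mulr.
  by rewrite dvdn1 => /eqP.
exists v0 => //; rewrite -v0k; apply: (@ev_free_mod_power _ _ _ v0 f pi0 Of0 _ _ Hf0').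
  by rewrite v0k.
by rewrite vpi0 e1E.
Qed.

(** Separating the classes uses only n = 1, where a generating residue of f is enough. A relation n
    (v - v0) ~ 0 may be read at v0 instead of v, so one unramified point serves for all orders. *)
Lemma fiber_points k : (0 < g)%N -> (1 < gonality iota)%N -> prime k ->
  (k * (gonality iota - 1) < g)%N -> ((7 * g + 1) ^ 2 <= q ^ k)%N ->
  exists S v0, [/\ uniq S, v0 \in S, forall v, v \in S -> place_deg v = k,
    (Npt k <= k * size S + gonality iota * (q + 1))%N &
    (forall v v', v \in S -> v' \in S -> v != v' -> principal (<< 1 *g v >> - << 1 *g v' >> : divisor) ->
      (g <= (gonality iota).-1 * k.-1)%N) /\
    (forall v n, v \in S -> v != v0 -> (0 < n)%N ->
      principal ((<< 1 *g v >> - << 1 *g v0 >> : divisor) *+ n) ->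
      (g <= (gonality iota).-1 * (n * k).-1)%N)].
Proof.
move=> g0 d1 k_pr kd xg; have [f tf df] := gonality_attained hK.
rewrite -df in d1 kd *; have cnt := fiber_count hK tf k_pr.
have k0 := prime_gt0 k_pr; have k1 := prime_gt1 k_pr.
have big : (20 * fdeg f * g + k < k * size (fiber_places hK f k))%N.
  rewrite ltnNge; apply/negP => H.
  have HW := hasse_weil hK g0 k0.
  pose x : algR := Num.sqrt (q ^ k)%:R.
  have x2 : x ^+ 2 = (q ^ k)%:R by rewrite sqr_sqrtr // ler0n.
  have x0 : 0 <= x by apply: sqrtr_ge0.
  have le_x (n : nat) : (n ^ 2 <= q ^ k)%N -> n%:R <= x.
    move=> H1; rewrite -(@ler_pXn2r _ 2) ?nnegrE ?ler0n // x2 -natrX ler_nat //.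
  have kk : (k <= k * (fdeg f - 1))%N by rewrite leq_pmulr // subn_gt0.
  apply: (@fiber_arithmetic _ x (Npt k)%:R g%:R (fdeg f)%:R k%:R q%:R); rewrite ?ler0n ?ler1n //.
  - by have := le_x _ xg; rewrite natrD natrM.
  - have := HW; rewrite -(ler_int algR) rmorphXn rmorphB rmorphD rmorphXn /= -natrX -x2 => H1.
    apply: le_trans H1 _; rewrite exprMn x2 pmulrn exprMn -!natrX -!natrM ler_nat //.
  - have H2 := leq_trans cnt (leq_add H (leqnn _)).
    by rewrite -[1]/(1%:R) -!natrM -!natrD -!natrM -!natrD ler_nat.
  - rewrite -[1]/(1%:R) -natrM -natrD ler_nat.
    have : (2 * (fdeg f - 1) <= k * (fdeg f - 1))%N by rewrite leq_mul2r k1 orbT.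
    by move: kd d1; move: (k * _)%N; clear; lia.
  - by rewrite ler_nat; apply: leq_trans kk (ltnW kd).
  - by apply: le_x; rewrite leq_exp2l // card_gt1.
have [v0 v0S Hv0] := good_point tf df d1 k_pr kd big.
exists (fiber_places hK f k), v0; split=> //.
- by rewrite filter_uniq // plist_uniq.
- by move=> v /fiber_placesP [].
split=> [v v' vS v'S vv pr|v n vS vv0 n0 pr].
  have [vk Of nr] := fiber_placesP vS.
  have := @point_difference _ _ _ hK f v v' 1 tf Of vv isT; rewrite vk !mul1n; apply=> //.
  exact: generic_value_free.
have [vk Of nr] := fiber_placesP v0S.
have := @point_difference _ _ _ hK f v0 v n tf Of _ n0; rewrite vk eq_sym; apply=> //; first exact: Hv0.
by have := principalN hK pr; rewrite -mulNrn opprB.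
Qed.
End PointDifferences.

(** * Families of classes of large order *)

Lemma effective_count_bound (R : realFieldType) (x g s A N : R) : 0 <= s -> s <= g -> 1 <= x - 2 * g ->
  x ^+ 2 + 1 - 2 * g * x <= N -> N <= s * A -> x - 2 * g <= A - 1.
Proof.
move=> s0 sg y1 xN NA; have : s * (x - 2 * g) <= s * (A - 1) -> 0 < s -> x - 2 * g <= A - 1.
  by move=> H s1; rewrite -(ler_pM2l s1).
have [s1 H|s1 _] := ltP 0 s; last first.
  have s00 : s = 0 by apply/eqP; rewrite eq_le s1 s0.
  rewrite s00 mul0r in NA; exfalso; nra.
apply: H => //; nra.
Qed.

Lemma fiber_count_bound (R : realFieldType) (x g k d q t N : R) : 0 <= t -> 0 <= d -> 1 <= k -> k <= g ->
  q <= x -> 2 * d <= g + 1 -> 7 * g + 1 <= x ->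
  x ^+ 2 + 1 - 2 * g * x <= N -> N <= k * (t + 1) + d * (q + 1) -> x - 7 * g <= t.
Proof.
move=> t0 d0 k1 kg qx dg x7 xN Nt.
have h1 : 2 * (d * (q + 1)) <= (g + 1) * (x + 1) by nra.
rewrite leNgt; apply/negP => tx.
have h2 : k * (t + 1) <= g * (x - 7 * g + 1) by apply: ler_pM; lra.
nra.
Qed.

Lemma double_le_exp q c : (1 < q)%N -> (0 < c)%N -> (2 * c <= q ^ c)%N.
Proof.
move=> q1 c0; apply: leq_trans (_ : 2 ^ c <= _)%N; last by case: c c0 => // c _; rewrite leq_exp2r.
by case: c c0 => // c _; elim: c => [|c IH] //; rewrite expnS; move: IH; move: (2 ^ c.+1)%N; lia.
Qed.

Section Families.
Variables (Fq : finFieldType) (K : fieldType) (iota : {rmorphism Fq -> K}).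
Hypothesis hK : function_field iota.
Notation place := (place iota).
Notation divisor := (divisor iota).
Notation g := (genus iota).
Notation gon := (gonality iota).
Notation q := #|Fq|.
Notation cl := (@divisor_class Fq K iota).
Notation Npt := (Npt hK).
Implicit Types (D E : divisor) (m n k i : nat).
Hypothesis gon1 : (1 < gon)%N.

Lemma genus_gt0 : (0 < g)%N.
Proof. by rewrite -ltnS; apply: leq_trans gon1 (gonality_genus hK). Qed.

Definition has_order_ge m c := Pic0 iota c /\ (m <= additive_order c)%N.

Lemma order_le_exponent c : Pic0 iota c -> (additive_order c <= exponent (Pic0 iota))%N.
Proof.
move=> Pc; have [e0 He] := exponent_spec hK.
have ce := conj e0 (He c Pc).
exact: (least_spec (P := [set n | (0 < n)%N /\ c *+ n = 0]) ce).2 _ ce.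
Qed.

(** Classes are differences with one fixed divisor D0. An order below m is at most m - 1, hence the
    factor m - 1 in the hypothesis; with m one more than the exponent it leaves room for a
    contradiction. *)
Lemma effective_family m i : (i < gon)%N -> (m.-1 * i < gon)%N ->
  exists s, [/\ uniq s, forall c, c \in s -> has_order_ge m c & size s = (Aeff hK i).-1].
Proof.
move=> ig mi; have u := elist_uniq hK i; rewrite /Aeff; have mem := mem_elist hK.
case E : (elist hK i) u => [|D0 T] /=; first by move=> _; exists [::].
move=> /andP [D0T uT]; exists [seq cl (D - D0) | D <- T].
have inT D : D \in D0 :: T -> dle 0 D /\ div_deg D = i%:Z by rewrite -E => /mem.
have [D00 dD0] := inT D0 (mem_head _ _).
split; last by rewrite size_map.
  rewrite map_inj_in_uniq // => D D' DT D'T /class_eq; rewrite opprB addrA subrK => pr.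
  apply/eqP; apply: contraT => ne.
  have [H1 _] := inT D (mem_behead (s := D0 :: T) DT); have [H2 d2] := inT D' (mem_behead (s := D0 :: T) D'T).
  by have := principal_gonality hK H1 H2 d2 ne (ltn0Sn 0) pr; rewrite mul1n leqNgt ig.
move=> c /mapP [D DT ->]; have [H1 d1] := inT D (mem_behead (s := D0 :: T) DT).
have P0 : Pic0 iota (cl (D - D0)) by exists (D - D0); rewrite // div_degB // d1 dD0 subrr.
split=> //; apply: (additive_order_ge hK) => // n n0 /class_muln_eq0 pr.
have ne : D != D0 by apply: contraNneq D0T => <-.
have := principal_gonality hK H1 D00 dD0 ne n0 pr; case: (leqP m n) => // nm H.
have : (n * i <= m.-1 * i)%N by rewrite leq_mul2r; apply/orP; right; lia.
by move=> H2; have := leq_ltn_trans (leq_trans H H2) mi; rewrite ltnn.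
Qed.

Lemma hasse_weil_real (R : realFieldType) (x : R) n : 0 <= x -> x ^+ 2 = (q ^ n)%:R -> (0 < n)%N ->
  x ^+ 2 + 1 - 2 * g%:R * x <= (Npt n)%:R.
Proof.
move=> x0 x2 n0; have := hasse_weil hK genus_gt0 n0; rewrite -(ler_int R) rmorphXn rmorphB rmorphD rmorphXn /=.
rewrite -!pmulrn -natrX -x2 => H.
have {}H : (x ^+ 2 + 1 - (Npt n)%:R) ^+ 2 <= (2 * g%:R * x) ^+ 2.
  by apply: le_trans H _; rewrite !natrM -x2; clear; rewrite le_eqVlt; apply/orP; left; apply/eqP; ring.
have g0 : 0 <= g%:R :> R by apply: ler0n.
have : `|x ^+ 2 + 1 - (Npt n)%:R| <= 2 * g%:R * x.
  by rewrite -(@ler_pXn2r _ 2) ?nnegrE ?mulr_ge0 // real_normK ?num_real.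
by rewrite ler_norml => /andP [_]; lra.
Qed.

(** A bound strictly between 0 and 1 still demands one class, that is, two divisors. For even s it
    cannot occur since x is an integer, and for s = 1 the inequality N_1 <= A_1 is enough. For the
    other odd s [borderline] provides them, possibly in a smaller degree i. *)
Lemma effective_count (R : realFieldType) (x : R) s : 0 <= x -> x ^+ 2 = (q ^ s)%:R -> (0 < s <= g)%N ->
  0 < x - 2 * g%:R ->
  x - 2 * g%:R <= (Aeff hK s).-1%:R \/
    exists2 i, (0 < i <= s)%N & (1 < Aeff hK i)%N /\ x - 2 * g%:R < 1.
Proof.
move=> x0 x2 /andP [s0 sg] y0; have N0 := hasse_weil_real x0 x2 s0.
have g0 : 0 <= g%:R :> R by apply: ler0n.
have q1 : (1 < q)%N := card_gt1 Fq.
have NA := Npt_le_Aeff hK s.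
have [y1|y1] := leP 1 (x - 2 * g%:R).
  left; have H : x - 2 * g%:R <= (Aeff hK s)%:R - 1.
    apply: (effective_count_bound (s := s%:R) (N := (Npt s)%:R)) => //; rewrite ?ler0n ?ler_nat // -natrM ler_nat //.
  have A0 : (0 < Aeff hK s)%N by rewrite lt0n; apply: contraTneq H => ->; rewrite -ltNge; lra.
  by apply: le_trans H _; rewrite -{1}(prednK A0) -natr1 addrK.
right; have [s_odd|s_even] := boolP (odd s); last first.
  have xE : x = (q ^ s./2)%:R.
    have sE : (s./2 * 2 = s)%N by rewrite muln2 -[RHS]odd_double_half (negPf s_even).
    by apply/eqP; rewrite -(@eqrXn2 _ 2) ?ler0n // x2 -natrX -expnM sE.
  move: y0 y1; rewrite xE subr_gt0 ltrBlDl -natrM.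
  by rewrite -[1]/(1%:R) -natrD !ltr_nat addn1 ltnS => h1 h2; have := leq_trans h1 h2; rewrite ltnn.
have [j sE] : exists j, s = (2 * j + 1)%N.
  by exists s./2; rewrite -[LHS]odd_double_half s_odd mul2n addnC.
case: (posnP j) => [j0|j0].
  have s1 : s = 1 by rewrite sE j0.
  exists 1; rewrite ?s0 //; split=> //; rewrite -s1; move: NA; rewrite {2}s1 mul1n; apply: leq_trans.
  by rewrite -(ltr_nat R); apply: lt_le_trans N0; nra.
have H1 : (4 * g ^ 2 < q ^ (2 * j + 1))%N.
  by rewrite -sE -(ltr_nat R) -x2 natrM natrX; nra.
have H2 : (q ^ (2 * j + 1) < (2 * g + 1) ^ 2)%N.
  by rewrite -sE -(ltr_nat R) -x2 natrX natrD natrM; nra.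
rewrite sE in sg *; have [i Hi Ai] := borderline hK j0 sg H1 H2.
by exists i.
Qed.

Lemma effective_large_order (R : realFieldType) (x : R) m s : 0 <= x -> x ^+ 2 = (q ^ s)%:R -> (0 < s)%N ->
  (0 < m)%N -> (m * s < gon)%N -> 0 < x - 2 * g%:R ->
  exists t, [/\ uniq t, forall c, c \in t -> has_order_ge m c & x - 2 * g%:R <= (size t)%:R].
Proof.
move=> x0 x2 s0 m0 ms y0.
have ss : (s <= m * s)%N by rewrite leq_pmull.
have sg : (0 < s <= g)%N by rewrite s0 -ltnS; apply: leq_trans (leq_ltn_trans ss ms) (gonality_genus hK).
have fam i : (i <= s)%N -> (i < gon)%N /\ (m.-1 * i < gon)%N.
  move=> si; split; first by apply: leq_ltn_trans si (leq_ltn_trans ss ms).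
  by apply: leq_ltn_trans ms; apply: leq_mul => //; apply: leq_pred.
have [H|[i /andP [i0 si] [Ai y1]]] := effective_count x0 x2 sg y0.
  have [h1 h2] := fam s (leqnn s).
  by have [t [ut Ht st]] := effective_family h1 h2; exists t; rewrite st.
have [h1 h2] := fam i si; have [t [ut Ht st]] := effective_family h1 h2; exists t; split=> //.
by rewrite st; apply: le_trans (ltW y1) _; rewrite ler1n -ltnS prednK // ltnW.
Qed.

Lemma point_large_order (R : realFieldType) (x : R) m k : 0 <= x -> x ^+ 2 = (q ^ k)%:R -> prime k ->
  (k * (gon - 1) < g)%N -> (m.-1 * k * (gon - 1) < g)%N -> 7 * g%:R + 1 <= x ->
  exists t, [/\ uniq t, forall c, c \in t -> has_order_ge m c & x - 7 * g%:R <= (size t)%:R].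
Proof.
move=> x0 x2 k_pr kg mkg x7; have k1 := prime_gt1 k_pr; have k0 := prime_gt0 k_pr.
have big : ((7 * g + 1) ^ 2 <= q ^ k)%N.
  by rewrite -(ler_nat R) -x2 natrX natrD natrM ler_pXn2r ?nnegrE // addr_ge0 ?mulr_ge0 ?ler0n.
have [S [v0 [uS v0S dS NS [H1 H2]]]] := fiber_points hK genus_gt0 gon1 k_pr kg big.
exists [seq cl (<< 1 *g v >> - << 1 *g v0 >>) | v <- rem v0 S]; split.
- rewrite map_inj_in_uniq ?rem_uniq // => v v'; rewrite !mem_rem_uniq // !inE => /andP [_ vS] /andP [_ v'S].
  move=> /class_eq; rewrite opprB addrA subrK => pr; apply/eqP; apply: contraT => ne.
  have := H1 v v' vS v'S ne pr; move: kg; clear - gon1 k0 => kg H.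
  have : (gon.-1 * k.-1 <= k * (gon - 1))%N by rewrite mulnC subn1 leq_mul2r leq_pred orbT.
  by move=> H'; have := leq_ltn_trans (leq_trans H H') kg; rewrite ltnn.
- move=> c /mapP [v]; rewrite mem_rem_uniq // inE => /andP [ne vS] ->.
  have P0 : Pic0 iota (cl (<< 1 *g v >> - << 1 *g v0 >>)).
    by exists (<< 1 *g v >> - << 1 *g v0 >>); rewrite // div_degB // !div_degU // !dS // subrr.
  split=> //; apply: (additive_order_ge hK) => // n n0 /class_muln_eq0 pr.
  have H := H2 v n vS ne n0 pr; case: (leqP m n) => // nm.
  have nm1 : (n <= m.-1)%N by lia.
  have : (gon.-1 * (n * k).-1 <= m.-1 * k * (gon - 1))%N.
    rewrite mulnC subn1 leq_mul2r; apply/orP; right.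
    by apply: leq_trans (leq_pred _) _; rewrite leq_mul2r nm1 orbT.
  by move=> H'; have := leq_ltn_trans (leq_trans H H') mkg; rewrite ltnn.
have S0 : (0 < size S)%N by case: (S) v0S.
rewrite size_map size_rem //.
apply: (@fiber_count_bound _ x g%:R k%:R gon%:R q%:R _ (Npt k)%:R); rewrite ?ler0n ?ler1n //.
- by rewrite ler_nat; apply: leq_trans (ltnW kg); rewrite leq_pmulr // subn_gt0.
- rewrite -(@ler_pXn2r _ 2) ?nnegrE ?ler0n // x2 -natrX ler_nat leq_exp2l //; exact: card_gt1.
- rewrite -[1]/(1%:R) -natrM -natrD ler_nat.
  have : (2 * (gon - 1) <= k * (gon - 1))%N by rewrite leq_mul2r k1 orbT.
  by move: kg gon1; move: (k * _)%N; clear; lia.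
- exact: hasse_weil_real.
by rewrite natr1 prednK // -[1]/(1%:R) -natrD -!natrM -natrD ler_nat.
Qed.

Lemma exponent_lt_family e : e = exponent (Pic0 iota) -> (exists t, [/\ uniq t, forall c, c \in t -> has_order_ge e.+1 c & (0 < size t)%N]) -> False.
Proof.
move=> -> [[|c t] [_ Ht] //= _]; have [Pc oc] := Ht c (mem_head _ _).
by have := leq_trans oc (order_le_exponent Pc); rewrite ltnn.
Qed.

(** In degree 2c the root q^(2c/2) = q^c is at least 2g + 1, which forces N_(2c) > 2c and a second
    effective divisor. Its class would have order above the exponent e if 2 c e < gon. *)
Lemma exponent_gonality c : (0 < c)%N -> (2 * g + 1 <= q ^ c)%N -> (gon <= exponent (Pic0 iota) * (2 * c))%N.
Proof.
move=> c0 qc; have q1 : (1 < q)%N := card_gt1 Fq; set e := exponent _; rewrite leqNgt; apply/negP => lt.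
have e0 : (0 < e)%N by have [] := exponent_spec hK.
have c20 : (0 < 2 * c)%N by rewrite muln_gt0.
have lt' : (2 * c < gon)%N by apply: leq_ltn_trans lt; rewrite leq_pmull.
have [t [ut Ht st]] := @effective_family e.+1 (2 * c) lt' lt.
apply: (exponent_lt_family (erefl e)); exists t; split=> //; rewrite st -ltnS.
have x2 : ((q ^ c)%:R : rat) ^+ 2 = (q ^ (2 * c))%:R by rewrite -natrX -expnM mulnC.
have HW := hasse_weil_real (ler0n _ _) x2 c20.
have N2c : (2 * c < Npt (2 * c))%N.
  rewrite -(ltr_nat rat); apply: lt_le_trans HW.
  have h1 : (2 * c)%:R <= (q ^ c)%:R :> rat by rewrite ler_nat double_le_exp.
  have h2 : 2 * g%:R + 1 <= (q ^ c)%:R :> rat by rewrite -[1]/(1%:R) -natrM -natrD ler_nat.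
  by move: h1 h2; move: ((q ^ c)%:R) ((2 * c)%:R) => a b h1 h2; have := ler0n rat g; nra.
have := leq_trans N2c (Npt_le_Aeff hK (2 * c)); rewrite -{1}[(2 * c)%N]muln1 ltn_pmul2l //.
by case: (Aeff hK (2 * c)) => [|[|]].
Qed.

(** Bertrand's postulate gives a prime k between 2c and 4c: k > 2c yields q^(k/2) >= 7g + 1, and k <
    4c is the origin of the factor 4. *)
Lemma exponent_genus c : (0 < c)%N -> (7 * g + 1 <= q ^ c)%N ->
  (g <= exponent (Pic0 iota) * (4 * (gon - 1) * c))%N.
Proof.
move=> c0 qc; have q1 : (1 < q)%N := card_gt1 Fq; set e := exponent _; rewrite leqNgt; apply/negP => lt.
have e0 : (0 < e)%N by have [] := exponent_spec hK.
have [|k k_pr /andP [ck kc]] := @bertrand (2 * c); first by clear - c0; lia.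
have k4 : (k <= 4 * c)%N by clear - kc; lia.
have ek : (e * k * (gon - 1) < g)%N.
  apply: leq_ltn_trans lt; rewrite -mulnA leq_mul2l; apply/orP; right.
  by rewrite mulnAC leq_mul2r k4 orbT.
have k1 : (k * (gon - 1) < g)%N by apply: leq_ltn_trans ek; rewrite -mulnA leq_pmull.
pose x : algR := Num.sqrt (q ^ k)%:R.
have x2 : x ^+ 2 = (q ^ k)%:R by rewrite sqr_sqrtr // ler0n.
have x0 : 0 <= x by apply: sqrtr_ge0.
have x7 : 7 * g%:R + 1 <= x.
  rewrite -[1]/(1%:R) -natrM -natrD -(@ler_pXn2r _ 2) ?nnegrE ?ler0n // x2 -natrX ler_nat.
  apply: leq_trans (_ : (q ^ c) ^ 2 <= _)%N; first by rewrite leq_exp2r.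
  by rewrite -expnM leq_exp2l // mulnC ltnW.
have [t [ut Ht st]] := point_large_order (m := e.+1) x0 x2 k_pr k1 ek x7.
apply: (exponent_lt_family (erefl e)); exists t; split=> //.
by rewrite -(ltr_nat algR); apply: lt_le_trans st; rewrite subr_gt0; lra.
Qed.

End Families.

(** * Real powers, ceilings and floors *)

Lemma at_least0 (R : realType) (T : eqType) (x : R) (A : set T) : x <= 0 -> at_least x A.
Proof. by move=> x0; exists [::]. Qed.

Lemma powR_half_sqr (R : realType) (a : R) n : 0 <= a -> (a `^ (n%:R / 2)) ^+ 2 = a ^+ n.
Proof.
by move=> a0; rewrite -powR_mulrn ?powR_ge0 // -powRrM divfK ?pnatr_eq0 // powR_mulrn.
Qed.

Lemma ceil_log (R : realType) (a y : nat) : (1 < a)%N -> (1 < y)%N ->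
  exists c, [/\ Num.ceil (log (a%:R : R) y%:R) = c%:Z, (0 < c)%N & (y <= a ^ c)%N].
Proof.
move=> a1 y1; have la : 0 < ln (a%:R : R) by apply: ln_gt0; rewrite ltr1n.
have ly : 0 < ln (y%:R : R) by apply: ln_gt0; rewrite ltr1n.
have c0 : 0 < Num.ceil (log (a%:R : R) y%:R) by rewrite ceil_gt0 divr_gt0.
have := ceil_ge (log (a%:R : R) y%:R); case: (Num.ceil _) c0 => // c c0.
rewrite /log ler_pdivrMr // -pmulrn mulr_natl => H; exists c; split=> //.
have a0 : 0 < (a%:R : R) by rewrite ltr0n ltnW.
have y0 : 0 < (y%:R : R) by rewrite ltr0n ltnW.
rewrite -(ler_nat R) natrX -ler_ln ?posrE ?exprn_gt0 //.
by rewrite lnXn.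
Qed.

(* If T > 5g + 1 then either q^(1/2), q^(s/2) or, by Bertrand's postulate, q^(k/2) exceeds T. *)
Lemma order_count_bound (R : realType) (a g d m k : nat) (s : int) :
  let q : R := a%:R in let G : R := g%:R in let M : R := m%:R in let D : R := d%:R in
  (1 < a)%N -> (0 < g)%N -> (0 < d)%N -> (0 < m)%N ->
  s = Num.ceil ((D + 1) / M) - 1 -> largest_prime_below (G / (M * D)) k ->
  q `^ (Num.sqrt G / (4 * M)) - 7 * G <=
    Num.max (q `^ (s%:~R / 2) - 2 * G) (Num.floor (q `^ (k%:R / 2) - 7 * G))%:~R.
Proof.
move=> q G M D a1 g0 d0 m0 sE [k_pr kX kmax].
have q2 : 2 <= q by rewrite ler_nat.
have q1 : 1 <= q by lra.
have G1 : 1 <= G by rewrite ler1n.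
have M1 : 1 <= M by rewrite ler1n.
have D1 : 1 <= D by rewrite ler1n.
have M0 : 0 < M by lra.
have D0 : 0 < D by lra.
set r := Num.sqrt G; set T := q `^ _; rewrite le_max.
have r0 : 0 < r by rewrite sqrtr_gt0; lra.
have r2 : r ^+ 2 = G by rewrite sqr_sqrtr //; lra.
have s0 : 0 <= s by rewrite sE subr_ge0 -gtz0_ge1 ceil_gt0 divr_gt0 //; lra.
have sD : D + 1 <= (s%:~R + 1) * M.
  by rewrite -ler_pdivrMr // -[1]/(1%:~R) -intrD sE subrK ceil_ge.
have k2 : 2 <= k%:R :> R by rewrite ler_nat prime_gt1.
(* As s >= 0, the first entry is at least 1 - 2G, which settles all T up to 5G + 1. *)
have [Ts|Tb] := leP T (5 * G + 1).
  apply/orP; left; have : 1 <= q `^ (s%:~R / 2).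
    rewrite -[X in X <= _](powRr0 q); apply: ler_powR => //.
    by rewrite divr_ge0 ?ler0z.
  lra.
have floor_ge (y : R) (z : int) : z%:~R <= y -> z%:~R <= (Num.floor y)%:~R :> R.
  by move=> zy; rewrite ler_int floor_ge_int.
(* For a root of g up to 2m both sides compare with the integer q - 7g: T <= q, and k >= 2 gives
   q^(k/2) >= q. *)
have [mr|mr] := leP r (2 * M).
  apply/orP; right; have -> : T - 7 * G <= (Num.floor (q `^ (k%:R / 2) - 7 * G))%:~R => //.
  apply: (@le_trans _ _ ((a%:Z - (7 * g)%N%:Z)%:~R)).
    rewrite rmorphB /= -!pmulrn natrM lerD2r; apply: le_trans (_ : q `^ 1 <= _); last by rewrite powRr1 //; lra.
    apply: ler_powR => //; rewrite ler_pdivrMr; lra.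
  apply: floor_ge; rewrite rmorphB /= -!pmulrn natrM lerD2r -[a%:R]/q -{1}(@powRr1 _ q); last by lra.
  by apply: ler_powR => //; lra.
(* Here s > r / M - 1 >= r / (2 M), so that the first entry wins. *)
have [dr|dr] := leP r D.
  apply/orP; left; suff : T <= q `^ (s%:~R / 2) by lra.
  apply: ler_powR => //; rewrite ler_pdivrMr; last by lra.
  by move: sD mr dr; lra.
have MD0 : 0 < M * D by apply: mulr_gt0.
have X1 : r / M <= G / (M * D).
  rewrite ler_pdivlMr // mulrA divfK; last by rewrite gt_eqF.
  by rewrite -r2; nra.
(* The next prime p is below 2k and, by maximality of k, not below G / (M D) >= r / M. So 2k >= r /
   M + 1, which gains a factor q^(1/4). It is at least 7/6, as (7/6)^4 < 2, and with T > 6 this pays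
   for the floor. *)
have [p p_pr /andP [kp pk]] := bertrand (prime_gt1 k_pr).
have Xp : G / (M * D) <= p%:R by rewrite leNgt; apply/negP => /(kmax p p_pr); rewrite leqNgt kp.
have kk : r / M + 1 <= 2 * k%:R.
  have : p%:R + 1 <= 2 * k%:R :> R by rewrite -[1]/(1%:R) -natrM -natrD ler_nat addn1 mul2n.
  by move: X1 Xp; move: (r / M) (G / (M * D)); move=> u v; lra.
pose w := q `^ (4^-1).
have w0 : 0 <= w by apply: powR_ge0.
have w4 : w ^+ 4 = q by rewrite -powR_mulrn // -powRrM mulVf ?pnatr_eq0 // powRr1 //; lra.
have w7 : 7 / 6 <= w.
  rewrite leNgt; apply/negP => w7; have : w ^+ 4 <= (7 / 6) ^+ 4 by apply: lerXn2r; rewrite ?nnegrE //; lra.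
  by rewrite w4; lra.
have Tw : T * w <= q `^ (k%:R / 2).
  rewrite -powRD; last by rewrite implybE orbC gt_eqF //; lra.
  apply: ler_powR => //; have -> : r / (4 * M) = r / M / 4 by field; rewrite gt_eqF.
  lra.
apply/orP; right; have := floorD1_gt (q `^ (k%:R / 2) - 7 * G); rewrite intrD.
have : 7 / 6 * T <= T * w by rewrite mulrC ler_pM2l //; lra.
by move: Tw; move: (q `^ _) => y; lra.
Qed.

Theorem theorem4p3 (R : realType) (Fq : finFieldType) (K : fieldType)
    (iota : {rmorphism Fq -> K})
    (hK : function_field iota) (hgon : (1 < gonality iota)%N) :
  let q : R := #|Fq|%:R in
  let g : R := (genus iota)%:R in
  let gon : R := (gonality iota)%:R in
  let e : R := (exponent (Pic0 iota))%:R in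
  Num.max (gon / (2 * (Num.ceil (log q (2 * g + 1)))%:~R))
          (g / (4 * (gon - 1) * (Num.ceil (log q (7 * g + 1)))%:~R)) <= e
  /\
  forall m : int, m != 0 ->
    let s : int := Num.ceil (gon / m%:~R) - 1 in
    let large_order : set (Pic iota) :=
      [set c | Pic0 iota c /\ m <= (additive_order c)%:Z] in
    at_least (q `^ (s%:~R / 2) - 2 * g) large_order
    /\
    forall k : nat, largest_prime_below (g / (m%:~R * (gon - 1))) k ->
      let N : R :=
        Num.max (q `^ (s%:~R / 2) - 2 * g)
                (Num.floor (q `^ (k%:R / 2) - 7 * g))%:~R in
      at_least N large_order
      /\ q `^ (Num.sqrt g / (4 * m%:~R)) - 7 * g <= N.
Proof.
move=> q g gon e; have q1 : (1 < #|Fq|)%N := card_gt1 Fq.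
have g0 := genus_gt0 hK hgon.
have gon2 : 1 < gon by rewrite ltr1n.
have qR1 : 1 <= q by rewrite ler1n ltnW.
have q0 : 0 <= q by lra.
have gR1 : 1 <= g by rewrite ler1n.
split.
  rewrite ge_max; apply/andP; split.
    have -> : 2 * g + 1 = (2 * genus iota + 1)%N%:R by rewrite natrD natrM.
    have [|c [-> c0 qc]] := @ceil_log R #|Fq| (2 * genus iota + 1) q1; first by clear - g0; lia.
    rewrite ler_pdivrMr; last by rewrite mulr_gt0 // ltr0z.
    by rewrite -pmulrn -!natrM ler_nat (exponent_gonality hK hgon).
  have -> : 7 * g + 1 = (7 * genus iota + 1)%N%:R by rewrite natrD natrM.
  have [|c [-> c0 qc]] := @ceil_log R #|Fq| (7 * genus iota + 1) q1; first by clear - g0; lia.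
  rewrite ler_pdivrMr; last by rewrite !mulr_gt0 ?ltr0z // subr_gt0.
  have -> : gon - 1 = (gonality iota - 1)%N%:R by rewrite natrB // ltnW.
  by rewrite -pmulrn -!natrM ler_nat (exponent_genus hK hgon).
move=> m m0 s large.
have A : at_least (q `^ (s%:~R / 2) - 2 * g) large.
  have [s0|s0] := leP s 0.
    apply: at_least0; have : q `^ (s%:~R / 2) <= 1.
      by rewrite -[X in _ <= X](powRr0 q); apply: ler_powR => //; rewrite pmulr_lle0 ?invr_gt0 ?lerz0.
    lra.
  have [y0|y0] := leP (q `^ (s%:~R / 2) - 2 * g) 0; first exact: at_least0.
  (* For negative m the ceiling is at most 0 and s is negative, against [s0]. *)
  have Hm : 0 < m.
    rewrite lt_neqAle eq_sym m0 leNgt; apply/negP => mneg.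
    move: s0; rewrite /s subr_gt0 => s1; have : 0 < Num.ceil (gon / m%:~R) by apply: lt_trans s1.
    rewrite ceil_gt0 ltNge => /negP; apply.
    by apply: mulr_ge0_le0; [lra|rewrite invr_le0 lerz0 ltW].
  case: m m0 Hm @s @large s0 y0 => // m _ m_gt0 s large s0 y0.
  have Em : m%:~R = m%:R :> R by [].
  have mR0 : 0 < m%:R :> R by rewrite ltr0n.
  have [n nE] : exists n : nat, s = n%:Z by exists `|s|%N; rewrite gez0_abs // ltW.
  rewrite nE -pmulrn in s0 y0 *.
  have x0 : 0 <= q `^ (n%:R / 2) by apply: powR_ge0.
  have x2 : (q `^ (n%:R / 2)) ^+ 2 = (#|Fq| ^ n)%:R by rewrite powR_half_sqr // natrX.
  have mn : (m * n < gonality iota)%N.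
    rewrite -(ltr_nat R) natrM mulrC -ltr_pdivlMr // -[n%:R]/(n%:Z%:~R) -nE.
    by have := ceilB1_lt (gon / m%:R).
  by have [t [ut Ht st]] := effective_large_order hK hgon x0 x2 s0 m_gt0 mn y0; exists t.
split=> // k Hk N.
have [k_pr kX kmax] := Hk.
(* A prime below g / (m (gon - 1)) exists, so this bound is positive. *)
have Hm : 0 < m.
  rewrite lt_neqAle eq_sym m0 leNgt; apply/negP => mneg; move: kX; rewrite ltNge => /negP; apply.
  apply: (@le_trans _ _ 0) => //; apply: mulr_ge0_le0; first lra.
  by rewrite invr_le0 nmulr_rle0 ?ltrz0 // subr_ge0 ltW.
case: m m0 Hm @s @large @N A Hk kX kmax => // m _ m_gt0 s large N A Hk kX kmax.
have mR0 : 0 < m%:R :> R by rewrite ltr0n.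
have gd : gon - 1 = (gonality iota).-1%:R by rewrite -subn1 natrB // ltnW.
have d0 : (0 < (gonality iota).-1)%N by rewrite -ltnS prednK // ltnW.
have dR0 : 0 < (gonality iota).-1%:R :> R by rewrite ltr0n.
have kmg : (k * (m * (gonality iota).-1) < genus iota)%N.
  rewrite -(ltr_nat R) !natrM -ltr_pdivlMr ?mulr_gt0 //.
  by move: kX; rewrite gd.
split.
  rewrite /N /Num.max; case: ifP => // _.
  (* A positive floor means y >= 7g + 1, exactly what [point_large_order] demands; otherwise nothing
     is to be shown. *)
  set y := q `^ _; have [F0|F0] := leP (Num.floor (y - 7 * g)) 0.
    by apply: at_least0; rewrite lerz0.
  have y7 : 7 * g + 1 <= y.
    have : 1%:~R <= (Num.floor (y - 7 * g))%:~R :> R by rewrite ler_int.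
    by have := floor_le (y - 7 * g); lra.
  have x2 : y ^+ 2 = (#|Fq| ^ k)%:R by rewrite powR_half_sqr // natrX.
  have h1 : (k * (gonality iota - 1) < genus iota)%N.
    by apply: leq_ltn_trans kmg; rewrite leq_mul2l subn1 leq_pmull ?orbT.
  have h2 : (m.-1 * k * (gonality iota - 1) < genus iota)%N.
    apply: leq_ltn_trans kmg; rewrite subn1 mulnCA mulnA leq_mul2r leq_mul2r leq_pred !orbT //.
  have [t [ut Ht st]] := point_large_order hK hgon (powR_ge0 _ _ : 0 <= y) x2 k_pr h1 h2 y7.
  by exists t; split=> //; apply: le_trans st; apply: floor_le.
apply: (@order_count_bound R _ _ (gonality iota).-1 m k s q1 g0 d0 m_gt0); last by rewrite -gd.
by rewrite -gd subrK.
Qed.
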